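(* Let $z\in\mathbb{C}$, $z\neq0$, $|\arg z|<\pi$, and let $\nu>0$ be real with $\nu\notin\mathbb{Z}$. Then $$\begin{aligned}\int_z^\infty\frac{Y_\nu^2(t)}{t}\,dt={}&\frac1{2\pi^2\nu}\Biggl[\left(\frac z2\right)^{-2\nu}\Gamma^2(\nu)\,{}_2F_3\left(\left.\begin{array}{c}-\nu,\ \frac12-\nu\\ 1-\nu,\ 1-\nu,\ 1-2\nu\end{array}\right|-z^2\right)\\&\qquad-\left(\frac z2\right)^{2\nu}\Gamma^2(-\nu)\cos^2(\pi\nu)\,{}_2F_3\left(\left.\begin{array}{c}\nu,\ \nu+\frac12\\ \nu+1,\ \nu+1,\ 2\nu+1\end{array}\right|-z^2\right)\Biggr]\\&-\frac{1+2\cot^2(\pi\nu)}{2\nu}-\frac{2\cot(\pi\nu)}{\pi\nu}\left[\frac{z^2}{4(1-\nu^2)}\,{}_3F_4\left(\left.\begin{array}{c}1,\ 1,\ \frac32\\ 2,\ 2,\ 2-\nu,\ 2+\nu\end{array}\right|-z^2\right)+\log\left(\frac2z\right)+\frac1{2\nu}+\psi(\nu)\right].\end{aligned}$$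
   Context: Powers and logarithms take their principal values. With $J_\nu(z)=(z/2)^\nu\sum_{k\ge0}\frac{(-1)^k(z/2)^{2k}}{k!\,\Gamma(\nu+k+1)}$ the Bessel function of the first kind, the Bessel function of the second kind is, for $\nu\notin\mathbb{Z}$, $Y_\nu(z)=\frac{J_\nu(z)\cos\pi\nu-J_{-\nu}(z)}{\sin\pi\nu}$. $\Gamma$ is the gamma function and $\psi=\Gamma'/\Gamma$ is the digamma function. The generalized hypergeometric function is ${}_pF_q\left(\left.\begin{array}{c}a_1,\dots,a_p\\ b_1,\dots,b_q\end{array}\right|x\right)=\sum_{k\ge0}\frac{(a_1)_k\cdots(a_p)_k}{(b_1)_k\cdots(b_q)_k}\frac{x^k}{k!}$ with $(\alpha)_k=\Gamma(\alpha+k)/\Gamma(\alpha)$. The integral $\int_z^\infty$ is along a path in $\mathbb{C}\setminus(-\infty,0]$ from $z$ ending at $+\infty$ along the positive real axis.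
   Formalization: When ν is a half-integer, the first ₂F₃ has lower parameter 1−2ν and upper parameter 1/2−ν both nonpositive integers, so its terms are undefined (0/0); there it is read as the limit of the function as the parameter tends to ν. *)

(* Defs.v *)
From Stdlib Require Import Reals List ZArith ClassicalEpsilon.
From Coquelicot Require Import Coquelicot.
Import ListNotations.
Open Scope R_scope.

(* Every function below is total; outside the domain indicated for it, it takes
   an irrelevant default value. *)

(** Principal logarithm and powers *)

(* Principal argument, in (-PI, PI], for z <> 0. *)
Definition Carg (z : C) : R :=
  if Rle_dec 0 (Im z) then acos (Re z / Cmod z) else - acos (Re z / Cmod z).

Definition Clog (z : C) : C := (ln (Cmod z), Carg z).

Definition Cexp (z : C) : C :=
  (exp (Re z) * cos (Im z), exp (Re z) * sin (Im z)).

Definition Cpower (z : C) (a : R) : C := Cexp (RtoC a * Clog z)%C.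

(** Gamma and digamma functions on R \ {0, -1, -2, ...} *)

Definition Gamma_pos (x : R) : R :=
  RInt_gen (V := R_CompleteNormedModule)
    (fun t => Rpower t (x - 1) * exp (- t))
    (at_right 0) (Rbar_locally p_infty).

(* Gamma x = Gamma (x + n) / (x (x + 1) ... (x + n - 1)) *)
Fixpoint Gamma_shift (n : nat) (x : R) : R :=
  match n with
  | O => Gamma_pos x
  | S m => Gamma_shift m (x + 1) / x
  end.

(* [Z.to_nat (up (- x))] is 0 if x > 0, and otherwise is the least n with
   x + n > 0. *)
Definition Gamma (x : R) : R := Gamma_shift (Z.to_nat (up (- x))) x.

Definition digamma (x : R) : R := Derive Gamma x / Gamma x.

(** Complex series, generalized hypergeometric and Bessel functions *)

Definition CSeries (u : nat -> C) : C :=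
  (Series (fun k => Re (u k)), Series (fun k => Im (u k))).

Definition poch (a : R) (k : nat) : R := Gamma (a + INR k) / Gamma a.

Definition Rprod (l : list R) : R := fold_right Rmult 1 l.

Definition pFq (a b : list R) (x : C) : C :=
  CSeries (fun k =>
    (RtoC (Rprod (map (fun c => poch c k) a) /
           Rprod (map (fun c => poch c k) b))
     * (x ^ k / RtoC (INR (fact k))))%C).

Definition has_pole (b : list R) : Prop :=
  exists c, In c b /\ exists n : nat, c = - INR n.

(* The series with parameters a(mu), b(mu) at mu = nu.  When some lower
   parameter is a nonpositive integer at mu = nu, its terms are undefined, and
   the function is understood by continuity, as the limit mu -> nu.  For
   2F3(-nu, 1/2-nu; 1-nu, 1-nu, 1-2nu | x) with nu a half-integer this limit is
   NOT the polynomial obtained by stopping at the vanishing factor of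
   (1/2-nu)_k: the factors tending to 0 in (1/2-mu)_k / (1-2mu)_k cancel. *)
Definition pFq_ext (a b : R -> list R) (nu : R) (x : C) : C :=
  if excluded_middle_informative (has_pole (b nu)) then
    (real (Lim (fun mu => Re (pFq (a mu) (b mu) x)) nu),
     real (Lim (fun mu => Im (pFq (a mu) (b mu) x)) nu))
  else pFq (a nu) (b nu) x.

Definition BesselJ (nu : R) (z : C) : C :=
  (Cpower (z / 2) nu *
   CSeries (fun k =>
     (RtoC ((-1) ^ k / (INR (fact k) * Gamma (nu + INR k + 1)))
      * (z / 2) ^ (2 * k))%C))%C.

(* For nu not an integer. *)
Definition BesselY (nu : R) (z : C) : C :=
  ((BesselJ nu z * RtoC (cos (PI * nu)) - BesselJ (- nu) z)
   / RtoC (sin (PI * nu)))%C.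

Definition cot (x : R) : R := cos x / sin x.

(** Paths in the cut plane *)

(* g : [0, +oo) -> C is continuous and piecewise C^1 with finitely many break
   points; g' is its derivative away from them (the values of g' at the break
   points are arbitrary). *)
Definition piecewise_C1 (g g' : R -> C) : Prop :=
  filterlim g (at_right 0) (locally (g 0)) /\
  (forall t, 0 < t -> continuous g t) /\
  (exists l : list R, forall t, 0 < t -> ~ In t l ->
     is_derive (V := C_R_NormedModule) g t (g' t) /\ continuous g' t) /\
  (forall t, 0 <= t -> exists d : C, filterlim g' (at_right t) (locally d)) /\
  (forall t, 0 < t -> exists d : C, filterlim g' (at_left t) (locally d)).

Definition cut_plane (w : C) : Prop := ~ (Im w = 0 /\ Re w <= 0).

Definition path_to_infty (z : C) (g g' : R -> C) : Prop :=
  g 0 = z /\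
  piecewise_C1 g g' /\
  (forall t, 0 <= t -> cut_plane (g t)) /\
  (exists T, forall t, T <= t -> Im (g t) = 0 /\ 0 < Re (g t)) /\
  filterlim (fun t => Re (g t)) (Rbar_locally p_infty) (Rbar_locally p_infty).

(* The integral of f from z to +oo exists along every admissible path and
   equals I. *)
Definition is_CInt_to_infty (f : C -> C) (z I : C) : Prop :=
  forall g g' : R -> C, path_to_infty z g g' ->
    is_RInt_gen (V := C_R_NormedModule) (fun t => (f (g t) * g' t)%C)
      (at_point 0) (Rbar_locally p_infty) I.

(* Main.v *)
Require Import Defs.
From Stdlib Require Import Reals List ZArith.
From Stdlib Require Import Lra Lia Psatz Factorial ClassicalEpsilon.
From Coquelicot Require Import Coquelicot.
Import ListNotations.
Open Scope R_scope.

(* Expanding [Y_nu^2] and multiplying the series of Bessel functions (the product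
   coefficients are closed by Vandermonde's identity) gives an explicit
   primitive of [Y_nu(t)^2 / t] on the cut plane, built from
     G_al(t) = integral of J_al(t)^2 / t  for al = nu and al = - nu,  and
     K_nu(t) = integral of J_nu(t) J_{-nu}(t) / t, with its logarithm.
   The hypergeometric part of the theorem is this primitive up to sign, so that
   everything reduces to its limit at +oo along the real axis.

   For mu <> +-la, a primitive of J_mu J_la / t is the Wronskian
   t (J_mu' J_la - J_mu J_la') divided by mu^2 - la^2.  An energy estimate bounds
   sqrt(t) J_mu(t) locally uniformly in mu, so it is within |mu^2 - la^2| O(1/t) of
   its limit (2/pi) sin((mu - la) pi/2), and the limits of G_al and K_nu follow by
   letting la -> mu, and mu -> nu with la = - nu; the latter also shows that
   Gamma is differentiable at nu and makes digamma(nu) appear.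

   The limit of the Wronskian comes from the Laplace transform of J_mu(t) / t at
   p = sinh s, which is exp(- mu s) / mu.  On the imaginary axis this evaluates
   the integrals over (0, +oo) of cos(t sin th) J_mu(t) / t and
   sin(t sin th) J_mu(t) / t; averaging over th gives those of J_0 J_mu / t and
   J_1 J_mu / t, hence the limits of the Wronskians of mu with 0 and 1.  A
   Pluecker relation and shifts of the orders then give all other pairs.  The
   pair (nu, - nu) yields the reflection formula for Gamma. *)

(** * Dominated improper integrals *)

(** The regularity of [Gamma] and the behaviour of Bessel functions at infinity are outputs of this
    development, not inputs. The normalization [Jh mu] keeps [Gamma] out of all series and
    differential equations; it enters through one constant, the leading coefficient of a Laplace
    transform for large p, which is an Euler integral. The obstacle at infinity is that the
    primitives are power series in x, whose limits cannot be read off. For unequal orders they are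
    Wronskians, bilinear in the vectors ([Jh], [Kh]). Such a vector times sqrt(x) stays bounded and
    nearly rotates, so its direction is fixed by its determinant and scalar product with the vector
    of order 0; these two pairings are what the angular averages deliver, since order 1 is, up to
    O(1/x), order 0 turned by a right angle. The confluent cases exchange two limits: the factor
    mu^2 - la^2 of the tail estimate is exactly the one divided out, so the error C/x no longer
    depends on mu. The complex side needs only a primitive that is differentiable along real paths,
    because every admissible path ends on the real axis. *)

Ltac eqR := match goal with |- @eq _ ?a ?b => change (@eq R a b) end.

Ltac subst_Derive := repeat match goal with
  | D : is_derive _ ?x ?l |- context [Derive ?g ?x] =>
      replace (Derive g x) with l by (symmetry; exact (is_derive_unique g x l D))
  end.

Definition II (f : R -> R) (l : R) : Prop :=
  is_RInt_gen (V := R_NormedModule) f (at_right 0) (Rbar_locally p_infty) l.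

Lemma at_right_0_inv (P : R -> Prop) :
  at_right 0 P -> exists d, 0 < d /\ forall x, 0 < x < d -> P x.
Proof.
intros [d Hd]; exists d; split; [apply cond_pos|].
intros x Hx; apply Hd; [|lra].
unfold ball; simpl; unfold AbsRing_ball, abs, minus, plus, opp; simpl.
rewrite Rabs_pos_eq; lra.
Qed.

Lemma at_right_0_intro (P : R -> Prop) (d : R) :
  0 < d -> (forall x, 0 < x < d -> P x) -> at_right 0 P.
Proof.
intros Hd H; exists (mkposreal d Hd); intros x Hx Hx0; apply H.
unfold ball in Hx; simpl in Hx; unfold AbsRing_ball, abs, minus, plus, opp in Hx;
  simpl in Hx.
apply Rabs_def2 in Hx; lra.
Qed.

Lemma locally_Rabs (l e : R) : 0 < e -> locally l (fun u => Rabs (u - l) < e).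
Proof. intros He; exists (mkposreal e He); intros u Hu; exact Hu. Qed.

Lemma II_unique f l l' : II f l -> II f l' -> l = l'.
Proof.
intros H1 H2.
rewrite <- (is_RInt_gen_unique (V := R_CompleteNormedModule) f l H1).
apply (is_RInt_gen_unique (V := R_CompleteNormedModule)); exact H2.
Qed.

Lemma half_line_prod (P : R -> R -> Prop) :
  (forall x y, 0 < x -> x < y -> P x y) ->
  filter_prod (at_right 0) (Rbar_locally p_infty) (fun ab => P (fst ab) (snd ab)).
Proof.
intros H; apply Filter_prod with (fun x => 0 < x < 1) (fun y => 1 < y).
- apply at_right_0_intro with 1; [lra|auto].
- exists 1; auto.
- simpl; intros x y Hx Hy; apply H; lra.
Qed.

Lemma II_ext f g l : (forall t, 0 < t -> f t = g t) -> II f l -> II g l.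
Proof.
intros E; refine (is_RInt_gen_ext (V := R_NormedModule) f g l _).
apply (half_line_prod (fun a b => forall x, Rmin a b < x < Rmax a b -> f x = g x)).
intros x y Hx Hy t Ht; apply E.
rewrite Rmin_left in Ht; lra.
Qed.

Lemma II_plus f g lf lg : II f lf -> II g lg -> II (fun t => f t + g t) (lf + lg).
Proof. exact (is_RInt_gen_plus (V := R_NormedModule) f g lf lg). Qed.

Lemma II_scal f k lf : II f lf -> II (fun t => k * f t) (k * lf).
Proof. exact (is_RInt_gen_scal (V := R_NormedModule) f k lf). Qed.

Lemma II_le f g lf lg : (forall t, 0 < t -> Rabs (f t) <= g t) ->
  II f lf -> II g lg -> Rabs lf <= lg.
Proof.
intros H Hf Hg.
refine (RInt_gen_norm (V := R_CompleteNormedModule) f g lf lg _ _ Hf Hg).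
- apply (half_line_prod (fun a b => a <= b)); intros; lra.
- apply (half_line_prod (fun a b => forall x, a <= x <= b -> norm (f x) <= g x)).
  intros x y Hx Hy t Ht; apply H; lra.
Qed.

Lemma II_ge0 f l : (forall t, 0 < t -> 0 <= f t) -> II f l -> 0 <= l.
Proof.
intros H Hf; apply Rle_trans with (Rabs l); [apply Rabs_pos|].
refine (II_le f f l l _ Hf Hf).
intros t Ht; rewrite Rabs_pos_eq by auto; apply Rle_refl.
Qed.

Lemma II_derive F f A B :
  (forall t, 0 < t -> is_derive F t (f t)) ->
  (forall t, 0 < t -> continuous f t) ->
  filterlim F (at_right 0) (locally A) ->
  filterlim F (Rbar_locally p_infty) (locally B) ->
  II f (B - A).
Proof.
intros HF Hf HA HB.
assert (E : forall t, 0 < t -> Derive F t = f t)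
  by (intros; apply is_derive_unique; auto).
apply II_ext with (Derive F); [exact E|].
refine (is_RInt_gen_Derive F A B _ _ HA HB).
- apply (half_line_prod (fun a b => forall x, Rmin a b <= x <= Rmax a b -> ex_derive F x)).
  intros x y Hx Hy t Ht; rewrite Rmin_left in Ht by lra.
  exists (f t); apply HF; lra.
- apply (half_line_prod (fun a b => forall x, Rmin a b <= x <= Rmax a b -> continuous (Derive F) x)).
  intros x y Hx Hy t Ht; rewrite Rmin_left in Ht by lra.
  assert (Ht0 : 0 < t) by lra.
  apply continuous_ext_loc with f; [|apply Hf, Ht0].
  exists (mkposreal t Ht0); intros u Hu; symmetry; apply E.
  unfold ball in Hu; simpl in Hu; unfold AbsRing_ball, abs, minus, plus, opp in Hu; simpl in Hu.
  apply Rabs_def2 in Hu; lra.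
Qed.

Lemma ex_RInt_half_line (f : R -> R) x y :
  (forall t, 0 < t -> continuous f t) -> 0 < x -> 0 < y -> ex_RInt f x y.
Proof.
intros Hf Hx Hy; apply (ex_RInt_continuous (V := R_CompleteNormedModule)).
intros t Ht; apply Hf.
destruct Ht as [Ht _]; revert Ht; unfold Rmin; destruct (Rle_dec x y); lra.
Qed.

Lemma II_limits f l : II f l -> (forall t, 0 < t -> continuous f t) ->
  forall eps, 0 < eps -> exists d T, 0 < d /\ 0 < T /\
    forall x y, 0 < x < d -> T < y -> Rabs (RInt f x y - l) < eps.
Proof.
intros H Hf eps He.
assert (HP : locally l (fun z => Rabs (z - l) < eps)).
{ apply locally_Rabs, He. }
destruct (H _ HP) as [P Q HPp HQ HPQ].
destruct (at_right_0_inv _ HPp) as [d [Hd Hd']].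
destruct HQ as [T HT].
exists d, (Rmax T 1); split; [|split]; auto.
- pose proof (Rmax_r T 1); lra.
- intros x y Hx Hy.
  pose proof (Rmax_l T 1).
  destruct (HPQ x y (Hd' x Hx) (HT y ltac:(lra))) as [z [Hz Hz']].
  simpl in Hz; rewrite (is_RInt_unique _ _ _ _ Hz); exact Hz'.
Qed.

(* The dominating function is, up to a constant, the derivative of
   [t ^ a / (1 + t ^ a)], which behaves like [t ^ (a - 1)] at 0 and like
   [t ^ (- a - 1)] at infinity. *)
Definition hker (a t : R) : R := a * Rpower t (a - 1) / (1 + Rpower t a) ^ 2.

Definition Hker (a t : R) : R := Rpower t a / (1 + Rpower t a).

Lemma Rpower_pos x y : 0 < Rpower x y.
Proof. apply exp_pos. Qed.

Lemma is_derive_Rpower a t : 0 < t ->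
  is_derive (fun t => Rpower t a) t (a * Rpower t (a - 1)).
Proof.
intros Ht; apply is_derive_Reals, derivable_pt_lim_power, Ht.
Qed.

Lemma continuous_Rpower a t : 0 < t -> continuous (fun t => Rpower t a) t.
Proof.
intros Ht; apply (ex_derive_continuous (fun t => Rpower t a)).
eexists; apply is_derive_Rpower, Ht.
Qed.

Lemma is_derive_Hker a t : 0 < t -> is_derive (Hker a) t (hker a t).
Proof.
intros Ht; unfold Hker, hker.
pose proof (Rpower_pos t a).
replace (a * Rpower t (a - 1) / (1 + Rpower t a) ^ 2) with
  ((a * Rpower t (a - 1) * (1 + Rpower t a) - Rpower t a * (a * Rpower t (a - 1)))
   / (1 + Rpower t a) ^ 2) by (f_equal; ring).
apply (is_derive_div (fun t => Rpower t a) (fun t => 1 + Rpower t a)).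
- apply is_derive_Rpower, Ht.
- replace (a * Rpower t (a - 1)) with (0 + a * Rpower t (a - 1)) by ring.
  apply (is_derive_plus (K := R_AbsRing) (fun _ => 1) (fun t => Rpower t a));
    [apply (is_derive_const (K := R_AbsRing) (V := R_NormedModule))
    |apply is_derive_Rpower, Ht].
- lra.
Qed.

Lemma continuous_hker a t : 0 < t -> continuous (hker a) t.
Proof.
intros Ht; unfold hker, Rdiv.
apply (continuous_mult (fun t => a * Rpower t (a - 1)) (fun t => / (1 + Rpower t a) ^ 2)).
- apply (continuous_mult (fun _ => a)); [apply continuous_const|apply continuous_Rpower, Ht].
- apply continuous_comp with (g := Rinv).
  + apply (ex_derive_continuous (fun t => (1 + Rpower t a) ^ 2)).
    apply (ex_derive_comp (fun u => (1 + u) ^ 2) (fun t => Rpower t a)).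
    * auto_derive; auto.
    * eexists; apply is_derive_Rpower, Ht.
  + apply continuity_pt_filterlim, continuity_pt_inv; [apply continuity_pt_id|].
    pose proof (Rpower_pos t a); nra.
Qed.

Lemma filterlim_at_right_0 (F : R -> R) l :
  (forall eps, 0 < eps -> exists d, 0 < d /\ forall x, 0 < x < d -> Rabs (F x - l) < eps) ->
  filterlim F (at_right 0) (locally l).
Proof.
intros H P [e He].
destruct (H e (cond_pos e)) as [d [Hd Hd']].
apply at_right_0_intro with d; auto.
intros x Hx; apply He, (Hd' x Hx).
Qed.

Lemma filterlim_p_infty_R (F : R -> R) l :
  (forall eps, 0 < eps -> exists T, forall x, T < x -> Rabs (F x - l) < eps) ->
  filterlim F (Rbar_locally p_infty) (locally l).
Proof.
intros H P [e He].
destruct (H e (cond_pos e)) as [T HT].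
exists T; intros x Hx; apply He, (HT x Hx).
Qed.

Lemma Rpower_small a eps : 0 < a -> 0 < eps ->
  exists d, 0 < d /\ forall x, 0 < x < d -> Rpower x a < eps.
Proof.
intros Ha He; exists (Rpower eps (/ a)); split; [apply Rpower_pos|].
intros x Hx; apply Rlt_le_trans with (Rpower (Rpower eps (/ a)) a).
- apply Rlt_Rpower_l; lra.
- rewrite Rpower_mult, Rinv_l, Rpower_1; lra.
Qed.

Lemma Rpower_large a M : 0 < a -> 0 < M ->
  exists T, 0 < T /\ forall x, T < x -> M < Rpower x a.
Proof.
intros Ha HM; exists (Rpower M (/ a)); split; [apply Rpower_pos|].
pose proof (Rpower_pos M (/ a)).
intros x Hx; apply Rle_lt_trans with (Rpower (Rpower M (/ a)) a).
- rewrite Rpower_mult, Rinv_l, Rpower_1; lra.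
- apply Rlt_Rpower_l; lra.
Qed.

Lemma Hker_0 a : 0 < a -> filterlim (Hker a) (at_right 0) (locally 0).
Proof.
intros Ha; apply filterlim_at_right_0; intros eps He.
destruct (Rpower_small a eps Ha He) as [d [Hd Hd']].
exists d; split; auto; intros x Hx; unfold Hker.
pose proof (Rpower_pos x a); pose proof (Hd' x Hx).
rewrite Rminus_0_r, Rabs_pos_eq.
- apply Rle_lt_trans with (Rpower x a); auto.
  apply Rmult_le_reg_r with (1 + Rpower x a); [lra|].
  unfold Rdiv; rewrite Rmult_assoc, Rinv_l; nra.
- apply Rlt_le, Rdiv_lt_0_compat; lra.
Qed.

Lemma Hker_infty a : 0 < a -> filterlim (Hker a) (Rbar_locally p_infty) (locally 1).
Proof.
intros Ha; apply filterlim_p_infty_R; intros eps He.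
destruct (Rpower_large a (/ eps) Ha (Rinv_0_lt_compat _ He)) as [T [HT HT']].
exists T; intros x Hx; unfold Hker.
pose proof (Rpower_pos x a) as Hp; pose proof (HT' x Hx) as Hl.
replace (Rpower x a / (1 + Rpower x a) - 1) with (- / (1 + Rpower x a)) by (field; lra).
rewrite Rabs_Ropp, Rabs_pos_eq by (apply Rlt_le, Rinv_0_lt_compat; lra).
rewrite <- (Rinv_inv eps); apply Rinv_lt_contravar; [|lra].
apply Rmult_lt_0_compat; [apply Rinv_0_lt_compat; lra|lra].
Qed.

Lemma RInt_hker a x y : 0 < x -> 0 < y -> RInt (hker a) x y = Hker a y - Hker a x.
Proof.
intros Hx Hy; apply is_RInt_unique, (is_RInt_derive (Hker a)); intros t Ht;
  [apply is_derive_Hker|apply continuous_hker];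
  destruct Ht as [Ht _]; revert Ht; unfold Rmin; destruct (Rle_dec x y); lra.
Qed.

(* Up to a constant factor, the bounds say [Rabs (f t) <= C * hker a t]. *)
Definition dom (f : R -> R) (a C : R) : Prop :=
  (forall t, 0 < t -> continuous f t) /\
  (forall t, 0 < t <= 1 -> Rabs (f t) <= C * Rpower t (a - 1)) /\
  (forall t, 1 <= t -> Rabs (f t) <= C * Rpower t (- a - 1)).

Lemma Rpower_le_1 t a : 0 < t <= 1 -> 0 <= a -> Rpower t a <= 1.
Proof.
intros Ht Ha; destruct (Req_dec a 0) as [->|].
- rewrite Rpower_O; lra.
- apply Rle_trans with (Rpower 1 a).
  + apply Rle_Rpower_l; lra.
  + unfold Rpower; rewrite ln_1, Rmult_0_r, exp_0; lra.
Qed.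

Lemma Rpower_ge_1 t a : 1 <= t -> 0 <= a -> 1 <= Rpower t a.
Proof.
intros Ht Ha; rewrite <- (Rpower_O t) by lra; apply Rle_Rpower; lra.
Qed.

(** For t at most 1 one has (1 + t^a)^2 <= 4, and for t at least 1 one has (1 + t^a)^2 <= 4 t^(2a);
    this is the origin of the constant 4. *)
Lemma dom_hker f a C t : 0 < a -> 0 <= C -> dom f a C -> 0 < t ->
  Rabs (f t) <= 4 * C / a * hker a t.
Proof.
intros Ha HC [_ [H1 H2]] Ht; unfold hker.
pose proof (Rpower_pos t a) as Hp; pose proof (Rpower_pos t (a - 1)) as Hq.
replace (4 * C / a * (a * Rpower t (a - 1) / (1 + Rpower t a) ^ 2)) with
  (C * (4 * Rpower t (a - 1) / (1 + Rpower t a) ^ 2)) by (field; lra).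
destruct (Rle_dec t 1) as [H|H].
- apply Rle_trans with (1 := H1 t (conj Ht H)).
  apply Rmult_le_compat_l; auto.
  pose proof (Rpower_le_1 t a (conj Ht H) ltac:(lra)).
  apply Rmult_le_reg_r with ((1 + Rpower t a) ^ 2); [nra|].
  unfold Rdiv; rewrite Rmult_assoc, Rinv_l by nra.
  assert ((1 + Rpower t a) ^ 2 <= 4) by nra. nra.
- assert (H' : 1 <= t) by lra.
  apply Rle_trans with (1 := H2 t H').
  apply Rmult_le_compat_l; auto.
  pose proof (Rpower_ge_1 t a H' ltac:(lra)).
  replace (a - 1) with ((- a - 1) + a + a) by ring.
  rewrite !Rpower_plus.
  pose proof (Rpower_pos t (- a)); pose proof (Rpower_pos t (- 1)).
  replace (Rpower t (- a - 1)) with (Rpower t (- a + - 1)) by (f_equal; ring).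
  rewrite Rpower_plus.
  set (p := Rpower t a) in *; set (q := Rpower t (- a) * Rpower t (- 1)).
  assert (0 < q) by (apply Rmult_lt_0_compat; auto).
  apply Rmult_le_reg_r with ((1 + p) ^ 2); [nra|].
  unfold Rdiv; rewrite Rmult_assoc, Rinv_l by nra.
  replace (Rpower t (- a - 1)) with q
    by (unfold q; rewrite <- Rpower_plus; f_equal; ring).
  assert ((1 + p) ^ 2 <= 4 * p * p) by nra. nra.
Qed.

Lemma dom_RInt f a C x y : 0 < a -> 0 <= C -> dom f a C -> 0 < x <= y ->
  Rabs (RInt f x y) <= 4 * C / a * (Hker a y - Hker a x).
Proof.
intros Ha HC Hd Hxy.
rewrite <- RInt_hker by lra.
assert (Hex : ex_RInt (hker a) x y)
  by (apply ex_RInt_half_line; [apply continuous_hker|lra|lra]).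
assert (E : RInt (fun t => 4 * C / a * hker a t) x y = 4 * C / a * RInt (hker a) x y)
  by exact (RInt_scal (V := R_CompleteNormedModule) (hker a) x y (4 * C / a) Hex).
rewrite <- E.
apply (norm_RInt_le (V := R_NormedModule) f (fun t => 4 * C / a * hker a t) x y); [lra| | |].
- intros t Ht; apply dom_hker; auto; lra.
- apply (RInt_correct (V := R_CompleteNormedModule)), ex_RInt_half_line; [apply Hd|lra|lra].
- apply (RInt_correct (V := R_CompleteNormedModule)).
  apply (ex_RInt_scal (V := R_NormedModule)), ex_RInt_half_line; [apply continuous_hker|lra|lra].
Qed.

Lemma Hker_incr a x y : 0 < a -> 0 < x <= y -> Hker a x <= Hker a y.
Proof.
intros Ha H; unfold Hker.
assert (Rpower x a <= Rpower y a) by (apply Rle_Rpower_l; lra).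
pose proof (Rpower_pos x a); pose proof (Rpower_pos y a).
apply Rmult_le_reg_r with ((1 + Rpower x a) * (1 + Rpower y a)); [nra|].
replace (Rpower x a / (1 + Rpower x a) * ((1 + Rpower x a) * (1 + Rpower y a)))
  with (Rpower x a * (1 + Rpower y a)) by (field; lra).
replace (Rpower y a / (1 + Rpower y a) * ((1 + Rpower x a) * (1 + Rpower y a)))
  with (Rpower y a * (1 + Rpower x a)) by (field; lra).
nra.
Qed.

Lemma dom_RInt_abs f a C x y : 0 < a -> 0 <= C -> dom f a C -> 0 < x -> 0 < y ->
  Rabs (RInt f x y) <= 4 * C / a * Rabs (Hker a y - Hker a x).
Proof.
intros Ha HC Hd Hx Hy.
destruct (Rle_dec x y).
- rewrite (Rabs_pos_eq (Hker a y - Hker a x)).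
  + apply dom_RInt; auto.
  + pose proof (Hker_incr a x y Ha ltac:(lra)); lra.
- rewrite <- (opp_RInt_swap (V := R_CompleteNormedModule))
    by (apply ex_RInt_half_line; [apply Hd|lra|lra]).
  change (opp (RInt f y x)) with (- RInt f y x).
  rewrite Rabs_Ropp, Rabs_minus_sym, (Rabs_pos_eq (Hker a x - Hker a y)).
  + apply dom_RInt; auto; lra.
  + pose proof (Hker_incr a y x Ha ltac:(lra)); lra.
Qed.

(** Differences of integrals over [x, y] are bounded by increments of [Hker a], which has finite
    limits at 0 and at infinity; the Cauchy criterion then applies on the product filter. *)
Lemma dom_II f a C : 0 < a -> 0 <= C -> dom f a C -> exists l, II f l.
Proof.
intros Ha HC Hd.
(* The summand 1 keeps D positive when C = 0. Four values of [Hker], each within eps / (5 D) of its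
   limit, give a total error of 4 eps / 5. *)
set (D := 4 * C / a + 1).
assert (HD : 0 < D).
{ unfold D; apply Rplus_le_lt_0_compat; [|lra].
  apply Rmult_le_pos; [lra|apply Rlt_le, Rinv_0_lt_compat; lra]. }
assert (HCau : exists l : R, filterlim (fun ab : R * R => RInt f (fst ab) (snd ab))
   (filter_prod (at_right 0) (Rbar_locally p_infty)) (locally l)).
{ apply (filterlim_locally_cauchy (U := R_CompleteSpace)
    (F := filter_prod (at_right 0) (Rbar_locally p_infty))).
  intros eps.
  assert (He : 0 < eps / (5 * D)) by (apply Rdiv_lt_0_compat; [apply cond_pos|lra]).
  assert (L0 := Hker_0 a Ha (fun u => Rabs (u - 0) < eps / (5 * D))
    (locally_Rabs _ _ He)).
  assert (L1 := Hker_infty a Ha (fun u => Rabs (u - 1) < eps / (5 * D))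
    (locally_Rabs _ _ He)).
  destruct (at_right_0_inv _ L0) as [d [Hd0 Hd']].
  destruct L1 as [T HT].
  exists (fun ab => 0 < fst ab < d /\ Rmax T 0 < snd ab); split.
  - apply Filter_prod with (fun x => 0 < x < d) (fun y => Rmax T 0 < y).
    + apply at_right_0_intro with d; auto.
    + exists (Rmax T 0); auto.
    + auto.
  - intros [x1 y1] [x2 y2] [Hx1 Hy1] [Hx2 Hy2]; simpl in *.
    pose proof (Rmax_l T 0); pose proof (Rmax_r T 0).
    assert (Hex : forall u v, 0 < u -> 0 < v -> ex_RInt f u v)
      by (intros; apply ex_RInt_half_line; [apply Hd|auto|auto]).
    change (Rabs (RInt f x2 y2 - RInt f x1 y1) < eps).
    rewrite <- (RInt_Chasles f x2 x1 y2) by (apply Hex; lra).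
    rewrite <- (RInt_Chasles f x1 y1 y2) by (apply Hex; lra).
    unfold plus; simpl.
    replace (RInt f x2 x1 + (RInt f x1 y1 + RInt f y1 y2) - RInt f x1 y1)
      with (RInt f x2 x1 + RInt f y1 y2) by ring.
    apply Rle_lt_trans with (1 := Rabs_triang _ _).
    pose proof (dom_RInt_abs f a C x2 x1 Ha HC Hd ltac:(lra) ltac:(lra)) as B1.
    pose proof (dom_RInt_abs f a C y1 y2 Ha HC Hd ltac:(lra) ltac:(lra)) as B2.
    pose proof (Hd' x1 ltac:(lra)) as E1; pose proof (Hd' x2 ltac:(lra)) as E2.
    pose proof (HT y1 ltac:(lra)) as E3; pose proof (HT y2 ltac:(lra)) as E4.
    simpl in E1, E2, E3, E4.
    assert (F1 : Rabs (Hker a x1 - Hker a x2) <= 2 * (eps / (5 * D))).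
    { replace (Hker a x1 - Hker a x2) with ((Hker a x1 - 0) - (Hker a x2 - 0)) by ring.
      apply Rle_trans with (1 := Rabs_triang _ _); rewrite Rabs_Ropp; lra. }
    assert (F2 : Rabs (Hker a y2 - Hker a y1) <= 2 * (eps / (5 * D))).
    { replace (Hker a y2 - Hker a y1) with ((Hker a y2 - 1) - (Hker a y1 - 1)) by ring.
      apply Rle_trans with (1 := Rabs_triang _ _); rewrite Rabs_Ropp; lra. }
    pose proof (Rabs_pos (Hker a x1 - Hker a x2)); pose proof (Rabs_pos (Hker a y2 - Hker a y1)).
    assert (0 <= 4 * C / a).
    { apply Rmult_le_pos; [lra|apply Rlt_le, Rinv_0_lt_compat; lra]. }
    assert (4 * C / a <= D) by (unfold D; lra).
    assert (D * (eps / (5 * D)) = eps / 5) by (field; lra).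
    pose proof (cond_pos eps).
    nra. }
destruct HCau as [l Hl]; exists l.
intros P HP; specialize (Hl P HP).
destruct Hl as [Q1 Q2 HQ1 HQ2 HQ].
unfold filtermapi.
apply Filter_prod with (fun x => Q1 x /\ 0 < x) (fun y => Q2 y /\ 0 < y).
- apply filter_and; auto; apply at_right_0_intro with 1; [lra|intros; lra].
- apply filter_and; auto; exists 0; auto.
- intros x y [Hx Hx0] [Hy Hy0]; exists (RInt f x y); split; [|apply HQ; auto].
  apply (RInt_correct (V := R_CompleteNormedModule)), ex_RInt_half_line; auto; apply Hd.
Qed.

(** * The gamma function *)

(** With an integer n above b and 1, exp(s t) = exp(s t / n)^n >= (s t / n)^n, which beats t^b up to
    the constant (n / s)^n. *)
Lemma Rpower_exp_bound b s : 0 < s ->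
  exists C, 0 <= C /\ forall t, 1 <= t -> Rpower t b * exp (- (s * t)) <= C.
Proof.
intros Hs.
destruct (INR_unbounded (Rmax b 1)) as [n Hn].
pose proof (Rmax_l b 1); pose proof (Rmax_r b 1).
assert (Hn0 : 0 < INR n) by lra.
exists ((INR n / s) ^ n); split.
- apply pow_le, Rlt_le, Rdiv_lt_0_compat; lra.
- intros t Ht.
  assert (H1 : Rpower t b <= t ^ n).
  { rewrite <- Rpower_pow by lra; apply Rle_Rpower; lra. }
  set (y := exp (s * t / INR n)).
  assert (Hy : s * t / INR n <= y).
  { unfold y; pose proof (exp_ineq1_le (s * t / INR n)); lra. }
  assert (E : exp (- (s * t)) = / y ^ n).
  { unfold y; rewrite <- (Rpower_pow n) by apply exp_pos.
    unfold Rpower; rewrite ln_exp, <- exp_Ropp; f_equal; field; lra. }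
  rewrite E.
  assert (Hyp : 0 < y) by apply exp_pos.
  assert (Hy2 : t <= INR n / s * y).
  { apply Rmult_le_reg_r with (s / INR n); [apply Rdiv_lt_0_compat; lra|].
    replace (INR n / s * y * (s / INR n)) with y by (field; lra).
    replace (t * (s / INR n)) with (s * t / INR n) by (field; lra); auto. }
  apply Rmult_le_reg_r with (y ^ n); [apply pow_lt, Hyp|].
  rewrite Rmult_assoc, Rinv_l, Rmult_1_r by (apply pow_nonzero; lra).
  apply Rle_trans with (t ^ n); auto.
  rewrite <- Rpow_mult_distr; apply pow_incr; lra.
Qed.

Lemma dom_Gamma x : 0 < x ->
  exists C, 0 <= C /\ dom (fun t => Rpower t (x - 1) * exp (- t)) x C.
Proof.
intros Hx.
(* The exponent x - 1 of the integrand is increased by x + 1, the decay that [dom] demands at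
   infinity. *)
destruct (Rpower_exp_bound (x - 1 + (x + 1)) 1 Rlt_0_1) as [C [HC HB]].
exists (Rmax C 1).
pose proof (Rmax_l C 1); pose proof (Rmax_r C 1).
split; [lra|split; [|split]].
- intros t Ht; apply (continuous_mult (fun t => Rpower t (x - 1)) (fun t => exp (- t))).
  + apply continuous_Rpower, Ht.
  + apply (ex_derive_continuous (fun t => exp (- t))); auto_derive; auto.
- intros t Ht; pose proof (Rpower_pos t (x - 1)).
  rewrite Rabs_pos_eq by (apply Rlt_le, Rmult_lt_0_compat; [auto|apply exp_pos]).
  rewrite Rmult_comm; apply Rmult_le_compat_r; [lra|].
  apply Rle_trans with 1; auto.
  rewrite <- exp_0; destruct Ht; left; apply exp_increasing; lra.
- intros t Ht; pose proof (Rpower_pos t (x - 1)).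
  rewrite Rabs_pos_eq by (apply Rlt_le, Rmult_lt_0_compat; [auto|apply exp_pos]).
  pose proof (HB t Ht) as HB'; rewrite Rpower_plus, Rmult_1_l in HB'.
  replace (- x - 1) with (- (x + 1)) by ring; rewrite Rpower_Ropp.
  pose proof (Rpower_pos t (x + 1)).
  apply Rmult_le_reg_r with (Rpower t (x + 1)); auto.
  replace (Rmax C 1 * / Rpower t (x + 1) * Rpower t (x + 1)) with (Rmax C 1)
    by (field; lra).
  lra.
Qed.

Lemma Gamma_pos_II x : 0 < x ->
  II (fun t => Rpower t (x - 1) * exp (- t)) (Gamma_pos x).
Proof.
intros Hx; destruct (dom_Gamma x Hx) as [C [HC Hd]].
destruct (dom_II _ x C Hx HC Hd) as [l Hl].
assert (E : Gamma_pos x = l) by exact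
  (is_RInt_gen_unique (V := R_CompleteNormedModule) (fun t => Rpower t (x - 1) * exp (- t)) l Hl).
rewrite E; exact Hl.
Qed.

(** The integrand is positive, so every integral over a larger interval is at least the positive
    integral over [1, 2], and so is the limit. *)
Lemma Gamma_pos_gt0 x : 0 < x -> 0 < Gamma_pos x.
Proof.
intros Hx.
set (f := fun t => Rpower t (x - 1) * exp (- t)).
destruct (dom_Gamma x Hx) as [C [HC Hd]].
assert (Hc : forall t, 0 < t -> continuous f t) by apply Hd.
assert (Hp : forall t, 0 < f t) by (intros; apply Rmult_lt_0_compat; apply exp_pos).
assert (H12 : 0 < RInt f 1 2).
{ apply RInt_gt_0; [lra|auto|intros; apply Hc; lra]. }
destruct (II_limits f _ (Gamma_pos_II x Hx) Hc (RInt f 1 2) H12) as [d [T [Hd0 [HT H]]]].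
assert (Hm : 0 < Rmin d 1) by (apply Rmin_glb_lt; lra).
pose proof (Rmin_l d 1); pose proof (Rmin_r d 1); pose proof (Rmax_l T 2); pose proof (Rmax_r T 2).
specialize (H (Rmin d 1 / 2) (Rmax T 2 + 1) ltac:(lra) ltac:(lra)).
assert (Hge : RInt f 1 2 <= RInt f (Rmin d 1 / 2) (Rmax T 2 + 1)).
{ rewrite <- (RInt_Chasles f (Rmin d 1 / 2) 1 (Rmax T 2 + 1))
    by (apply ex_RInt_half_line; auto; lra).
  rewrite <- (RInt_Chasles f 1 2 (Rmax T 2 + 1))
    by (apply ex_RInt_half_line; auto; lra).
  unfold plus; simpl.
  assert (0 <= RInt f (Rmin d 1 / 2) 1).
  { apply RInt_ge_0; [lra|apply ex_RInt_half_line; auto; lra|intros; left; auto]. }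
  assert (0 <= RInt f 2 (Rmax T 2 + 1)).
  { apply RInt_ge_0; [lra|apply ex_RInt_half_line; auto; lra|intros; left; auto]. }
  lra. }
apply Rabs_def2 in H; lra.
Qed.

(** Integration by parts: the difference of the two integrands is the derivative of t^x exp(- t),
    which vanishes at both ends. *)
Lemma Gamma_pos_succ x : 0 < x -> Gamma_pos (x + 1) = x * Gamma_pos x.
Proof.
intros Hx.
set (F := fun t => Rpower t x * exp (- t)).
assert (H : II (fun t => x * (Rpower t (x - 1) * exp (- t)) + -1 * (Rpower t (x + 1 - 1) * exp (- t)))
              (x * Gamma_pos x + -1 * Gamma_pos (x + 1))).
{ apply (II_plus (fun t => x * (Rpower t (x - 1) * exp (- t)))
    (fun t => -1 * (Rpower t (x + 1 - 1) * exp (- t)))).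
  - apply II_scal, Gamma_pos_II, Hx.
  - apply (II_scal (fun t => Rpower t (x + 1 - 1) * exp (- t))), Gamma_pos_II; lra. }
assert (H0 : II (fun t => x * (Rpower t (x - 1) * exp (- t)) + -1 * (Rpower t (x + 1 - 1) * exp (- t))) (0 - 0)).
{ apply II_derive with F.
  - intros t Ht; unfold F.
    replace (x + 1 - 1) with x by ring.
    replace (x * (Rpower t (x - 1) * exp (- t)) + -1 * (Rpower t x * exp (- t)))
      with (plus (mult (x * Rpower t (x - 1)) (exp (- t))) (mult (Rpower t x) (- exp (- t))))
      by (unfold plus, mult; simpl; ring).
    apply (is_derive_mult (fun t => Rpower t x) (fun t => exp (- t))).
    + apply is_derive_Rpower, Ht.
    + auto_derive; auto; ring.
    + intros; apply Rmult_comm.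
  - intros t Ht.
    destruct (dom_Gamma x Hx) as [C [_ [Hc _]]].
    destruct (dom_Gamma (x + 1) ltac:(lra)) as [C' [_ [Hc' _]]].
    apply (continuous_plus (fun t => x * (Rpower t (x - 1) * exp (- t)))
      (fun t => -1 * (Rpower t (x + 1 - 1) * exp (- t)))).
    + apply (continuous_mult (fun _ => x) (fun t => Rpower t (x - 1) * exp (- t)));
        [apply continuous_const|auto].
    + apply (continuous_mult (fun _ => -1) (fun t => Rpower t (x + 1 - 1) * exp (- t)));
        [apply continuous_const|auto].
  - apply filterlim_at_right_0; intros eps He.
    destruct (Rpower_small x eps Hx He) as [d [Hd Hd']].
    exists d; split; auto; intros t Ht; unfold F.
    pose proof (Hd' t Ht); pose proof (Rpower_pos t x); pose proof (exp_pos (- t)).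
    assert (exp (- t) <= 1) by (rewrite <- exp_0; left; apply exp_increasing; lra).
    rewrite Rminus_0_r, Rabs_pos_eq by nra; nra.
  - apply filterlim_p_infty_R; intros eps He.
    destruct (Rpower_exp_bound (x + 1) 1 Rlt_0_1) as [C [HC HB]].
    exists (Rmax 1 (C / eps)); intros t Ht; unfold F.
    pose proof (Rmax_l 1 (C / eps)); pose proof (Rmax_r 1 (C / eps)).
    pose proof (HB t ltac:(lra)) as HB'; rewrite Rpower_plus, Rpower_1, Rmult_1_l in HB' by lra.
    pose proof (Rpower_pos t x); pose proof (exp_pos (- t)).
    rewrite Rminus_0_r, Rabs_pos_eq by nra.
    assert (C < eps * t).
    { apply Rmult_lt_reg_r with (/ eps); [apply Rinv_0_lt_compat; lra|].
      replace (eps * t * / eps) with t by (field; lra). unfold Rdiv in *; lra. }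
    apply Rmult_lt_reg_r with t; [lra|].
    replace (Rpower t x * exp (- t) * t) with (Rpower t x * t * exp (- t)) by ring; lra. }
pose proof (II_unique _ _ _ H H0); lra.
Qed.

Definition nonpole (x : R) : Prop := forall n : nat, x <> - INR n.

Lemma nonpole_succ x : nonpole x -> nonpole (x + 1).
Proof. intros H n E; apply (H (S n)); rewrite S_INR; lra. Qed.

Lemma nonpole_neq0 x : nonpole x -> x <> 0.
Proof. intros H E; apply (H 0%nat); simpl; lra. Qed.

Lemma nonpole_pos x : 0 < x -> nonpole x.
Proof. intros H n; pose proof (pos_INR n); lra. Qed.

Lemma Gamma_pos_eq x : 0 < x -> Gamma x = Gamma_pos x.
Proof.
intros Hx; unfold Gamma.
replace (Z.to_nat (up (- x))) with 0%nat; [reflexivity|].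
assert (H : (up (- x) <= 0)%Z); [|destruct (up (- x)); simpl; lia].
apply Z.lt_succ_r; apply lt_IZR; simpl.
pose proof (archimed (- x)); lra.
Qed.

Lemma Gamma_shift_pos n x : 0 < x -> Gamma_shift n x = Gamma_pos x.
Proof.
revert x; induction n as [|n IH]; intros x Hx; simpl; auto.
rewrite IH by lra; rewrite Gamma_pos_succ by lra; field; lra.
Qed.

(** [Gamma] fixes one number of shifts at each point; the functional equation compares neighbouring
    points and needs the freedom to use n + 1 shifts at x and n at x + 1. *)
Lemma Gamma_shift_stable m n x : - INR m < x -> - INR n < x -> nonpole x ->
  Gamma_shift m x = Gamma_shift n x.
Proof.
revert n x; induction m as [|m IH]; intros n x Hm Hn Hx.
- simpl in Hm; rewrite !Gamma_shift_pos; lra.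
- destruct n as [|n].
  + simpl in Hn; rewrite !Gamma_shift_pos; lra.
  + rewrite S_INR in Hm, Hn; simpl.
    rewrite (IH n); auto; try lra; apply nonpole_succ, Hx.
Qed.

Lemma up_bound x : - INR (Z.to_nat (up (- x))) < x.
Proof.
pose proof (archimed (- x)) as [H _].
destruct (Z_le_gt_dec 0 (up (- x))) as [H0|H0].
- rewrite INR_IZR_INZ, Z2Nat.id by auto; lra.
- assert (IZR (up (- x)) <= 0) by (apply IZR_le; lia).
  pose proof (pos_INR (Z.to_nat (up (- x)))); lra.
Qed.

Lemma Gamma_succ x : nonpole x -> Gamma (x + 1) = x * Gamma x.
Proof.
intros Hx; unfold Gamma.
set (n := Z.to_nat (up (- x))).
pose proof (up_bound x) as H; fold n in H.
rewrite (Gamma_shift_stable n (S n) x) by (rewrite ?S_INR; auto; lra).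
rewrite (Gamma_shift_stable _ n (x + 1)).
- simpl; field; apply nonpole_neq0, Hx.
- apply up_bound.
- lra.
- apply nonpole_succ, Hx.
Qed.

Lemma Gamma_gt0 x : 0 < x -> 0 < Gamma x.
Proof. intros Hx; rewrite Gamma_pos_eq by auto; apply Gamma_pos_gt0, Hx. Qed.

Lemma Gamma_neq0 x : nonpole x -> Gamma x <> 0.
Proof.
intros Hx.
assert (H : forall n y, nonpole y -> - INR n < y -> Gamma y <> 0).
{ induction n as [|n IH]; intros y Hy Hn.
  - simpl in Hn; pose proof (Gamma_gt0 y ltac:(lra)); lra.
  - rewrite S_INR in Hn; intros E.
    apply (IH (y + 1)); [apply nonpole_succ, Hy|lra|].
    rewrite Gamma_succ, E by auto; ring. }
apply (H _ _ Hx (up_bound x)).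
Qed.

(** The rising factorial as a product: unlike the quotient [poch], it is visibly continuous in [a],
    which is needed long before anything is known about the continuity of [Gamma]. *)
Fixpoint rf (a : R) (k : nat) : R :=
  match k with O => 1 | S k => rf a k * (a + INR k) end.

Lemma rf_neq0 a k : nonpole a -> rf a k <> 0.
Proof.
intros H; induction k; simpl; [lra|].
apply Rmult_integral_contrapositive; split; auto.
intros E; apply (H k); lra.
Qed.

Lemma nonpole_add a k : nonpole a -> nonpole (a + INR k).
Proof. intros H n E; apply (H (k + n)%nat); rewrite plus_INR; lra. Qed.

Lemma Gamma_add a k : nonpole a -> Gamma (a + INR k) = rf a k * Gamma a.
Proof.
intros H; induction k; simpl rf.
- rewrite Rplus_0_r; ring.
- rewrite S_INR, <- Rplus_assoc, Gamma_succ by (apply nonpole_add, H).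
  rewrite IHk; ring.
Qed.

Lemma poch_rf a k : nonpole a -> poch a k = rf a k.
Proof.
intros H; unfold poch; rewrite Gamma_add by auto; field; apply Gamma_neq0, H.
Qed.

Lemma rf_first a k : rf a (S k) = a * rf (a + 1) k.
Proof.
induction k; [simpl; ring|].
change (rf a (S (S k))) with (rf a (S k) * (a + INR (S k))); rewrite IHk.
simpl rf; rewrite S_INR; ring.
Qed.

(** * Dominated convergence for series *)

Lemma Series_le_abs (u M : nat -> R) : (forall k, Rabs (u k) <= M k) -> ex_series M ->
  ex_series u /\ Rabs (Series u) <= Series M.
Proof.
intros H HM.
assert (Ha : ex_series (fun k => Rabs (u k))).
{ apply (ex_series_le (V := R_CompleteNormedModule)) with M; auto.
  intros k; unfold norm; simpl; unfold abs; simpl; rewrite Rabs_Rabsolu; auto. }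
split; [apply ex_series_Rabs, Ha|].
apply Rle_trans with (1 := Series_Rabs _ Ha).
apply Series_le; auto; intros k; split; [apply Rabs_pos|auto].
Qed.

Lemma Series_tail (M : nat -> R) eps : ex_series M -> 0 < eps ->
  exists n, Rabs (Series (fun k => M (S n + k)%nat)) < eps.
Proof.
intros HM He.
assert (L := Series_correct _ HM).
destruct (L _ (locally_Rabs _ _ He)) as [n Hn].
exists n; specialize (Hn n (Nat.le_refl n)); simpl in Hn.
rewrite (Series_incr_n M (S n)) in Hn by (auto; lia).
rewrite sum_n_Reals in Hn; simpl pred in Hn.
rewrite Rabs_minus_sym in Hn.
replace (Series (fun k => M (S n + k)%nat)) with
  (sum_f_R0 M n + Series (fun k => M (S n + k)%nat) - sum_f_R0 M n) by ring.
exact Hn.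
Qed.

(* Tannery's theorem. *)
Lemma filterlim_Series {T} (F : (T -> Prop) -> Prop) {FF : Filter F}
  (u : T -> nat -> R) (u0 M : nat -> R) :
  ex_series M -> F (fun x => forall k, Rabs (u x k) <= M k) ->
  (forall k, Rabs (u0 k) <= M k) ->
  (forall k, filterlim (fun x => u x k) F (locally (u0 k))) ->
  filterlim (fun x => Series (u x)) F (locally (Series u0)).
Proof.
intros HM Hu Hu0 Hl P [eps HP].
assert (HL : forall k e, 0 < e -> F (fun x => Rabs (u x k - u0 k) < e))
  by (intros k e He; exact (Hl k _ (locally_Rabs _ _ He))).
destruct (Series_tail M (eps / 4) HM ltac:(pose proof (cond_pos eps); lra)) as [n Hn].
assert (Hf : F (fun x => forall k, (k <= n)%nat ->
  Rabs (u x k - u0 k) < eps / (4 * INR (S n)))).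
{ assert (He : 0 < eps / (4 * INR (S n))).
  { pose proof (cond_pos eps); pose proof (lt_0_INR (S n) ltac:(lia)).
    apply Rdiv_lt_0_compat; lra. }
  assert (Hm : forall m, F (fun x => forall k, (k <= m)%nat ->
    Rabs (u x k - u0 k) < eps / (4 * INR (S n)))).
  { induction m as [|m IH].
    - generalize (HL 0%nat _ He); apply filter_imp.
      intros x Hx k Hk; replace k with 0%nat by lia; exact Hx.
    - generalize (filter_and _ _ IH (HL (S m) _ He)); apply filter_imp.
      intros x [H1 H2] k Hk; destruct (Nat.eq_dec k (S m)) as [->|]; [exact H2|apply H1; lia]. }
  apply Hm. }
change (F (fun x => P (Series (u x)))).
generalize (filter_and _ _ Hu Hf); apply filter_imp; intros x [H1 H2].
apply HP; change (Rabs (Series (u x) - Series u0) < eps).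
destruct (Series_le_abs _ _ H1 HM) as [E1 _].
destruct (Series_le_abs _ _ Hu0 HM) as [E2 _].
rewrite (Series_incr_n (u x) (S n)), (Series_incr_n u0 (S n)) by (auto; lia).
simpl pred.
assert (HM' : ex_series (fun k => M (S n + k)%nat)) by (apply (ex_series_incr_n M (S n)), HM).
destruct (Series_le_abs (fun k => u x (S n + k)%nat) _ (fun k => H1 _) HM') as [_ B1].
destruct (Series_le_abs (fun k => u0 (S n + k)%nat) _ (fun k => Hu0 _) HM') as [_ B2].
pose proof (Rle_abs (Series (fun k => M (S n + k)%nat))).
assert (B3 : Rabs (sum_f_R0 (u x) n - sum_f_R0 u0 n) <= eps / 4).
{ rewrite <- minus_sum.
  apply Rle_trans with (1 := sum_f_R0_triangle _ _).
  apply Rle_trans with (sum_f_R0 (fun _ => eps / (4 * INR (S n))) n).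
  - apply sum_Rle; intros k Hk; left; apply H2, Hk.
  - rewrite sum_cte; right; field; apply not_0_INR; lia. }
set (s1 := sum_f_R0 (u x) n) in *; set (s2 := sum_f_R0 u0 n) in *.
set (t1 := Series (fun k => u x (S n + k)%nat)) in *.
set (t2 := Series (fun k => u0 (S n + k)%nat)) in *.
replace (s1 + t1 - (s2 + t2)) with ((s1 - s2) + (t1 - t2)) by ring.
apply Rle_lt_trans with (1 := Rabs_triang _ _).
assert (Rabs (t1 - t2) <= Rabs t1 + Rabs t2).
{ unfold Rminus; apply Rle_trans with (1 := Rabs_triang _ _); rewrite Rabs_Ropp; lra. }
pose proof (cond_pos eps); lra.
Qed.

(** * Entire power series of exponential type *)

(** The two constants are explicit so that the bound can be made uniform in the order of a Bessel
    function. The class is stable under sums, products, differentiation and multiplication of the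
    coefficients by k. *)
Definition exp_type (c : nat -> R) (A B : R) : Prop :=
  0 <= A /\ 0 <= B /\ forall k, Rabs (c k) <= A * B ^ k / INR (fact k).

Lemma INR_fact_pos k : 0 < INR (fact k).
Proof. apply INR_fact_lt_0. Qed.

Lemma is_series_exp A x : is_series (fun k => A * x ^ k / INR (fact k)) (A * exp x).
Proof.
apply (is_series_ext (fun k => scal A (scal (pow_n x k) (/ INR (fact k))))).
- intros k; rewrite pow_n_pow; unfold scal; simpl; unfold mult; simpl; field.
  apply INR_fact_neq_0.
- apply (is_series_scal (K := R_AbsRing) (V := R_NormedModule)), is_exp_Reals.
Qed.

Lemma exp_type_term c A B x r k : exp_type c A B -> Rabs x <= r ^ k -> 0 <= r ->
  Rabs (c k * x) <= A * (B * r) ^ k / INR (fact k).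
Proof.
intros [HA [HB H]] Hx Hr; rewrite Rabs_mult, Rpow_mult_distr.
replace (A * (B ^ k * r ^ k) / INR (fact k)) with (A * B ^ k / INR (fact k) * r ^ k)
  by (field; apply INR_fact_neq_0).
apply Rmult_le_compat; auto; apply Rabs_pos.
Qed.

(** The powers are replaced by any sequence dominated by r^k so as to cover also the real and
    imaginary parts of the powers of a complex number. *)
Lemma exp_type_Series c A B (t : nat -> R) r : exp_type c A B ->
  (forall k, Rabs (t k) <= r ^ k) -> 0 <= r ->
  ex_series (fun k => c k * t k) /\ Rabs (Series (fun k => c k * t k)) <= A * exp (B * r).
Proof.
intros Hc Ht Hr.
rewrite <- (is_series_unique _ _ (is_series_exp A (B * r))).
apply Series_le_abs.
- intros k; apply exp_type_term; auto.
- eexists; apply is_series_exp.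
Qed.

Lemma Rabs_pow_le x k : Rabs (x ^ k) <= Rabs x ^ k.
Proof. rewrite RPow_abs; lra. Qed.

Lemma exp_type_PSeries c A B x : exp_type c A B -> Rabs (PSeries c x) <= A * exp (B * Rabs x).
Proof.
intros Hc; apply (exp_type_Series c A B (fun k => x ^ k)); auto.
- intros; apply Rabs_pow_le.
- apply Rabs_pos.
Qed.

(** Each term at radius r is at most A (B r)^n / n!, a single term of the exponential series, hence
    bounded for every r. *)
Lemma exp_type_CV c A B : exp_type c A B -> CV_radius c = p_infty.
Proof.
intros Hc.
destruct (CV_radius_bounded c) as [H _].
assert (Hr : forall r, Rbar_le (Finite r) (CV_radius c)).
{ intros r; apply H; exists (A * exp (B * Rabs r)); intros n.
  apply Rle_trans with (1 := exp_type_term c A B (r ^ n) (Rabs r) n Hc (Rabs_pow_le r n) (Rabs_pos r)).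
  destruct Hc as [HA [HB _]].
  assert (0 <= B * Rabs r) by (apply Rmult_le_pos; auto; apply Rabs_pos).
  unfold Rdiv; rewrite Rmult_assoc; apply Rmult_le_compat_l; auto.
  apply Rle_trans with (2 := exp_ge_taylor _ n ltac:(eassumption)).
  destruct n as [|n]; [simpl; lra|].
  rewrite tech5; unfold Rdiv.
  assert (0 <= sum_f_R0 (fun k => (B * Rabs r) ^ k * / INR (fact k)) n); [|lra].
  apply cond_pos_sum; intros k; apply Rmult_le_pos; [apply pow_le; auto|].
  left; apply Rinv_0_lt_compat, INR_fact_pos. }
destruct (CV_radius c) as [r| |]; auto.
- specialize (Hr (r + 1)); simpl in Hr; lra.
- destruct (Hr 0).
Qed.

Lemma exp_type_lt c A B x : exp_type c A B -> Rbar_lt (Rabs x) (CV_radius c).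
Proof. intros Hc; rewrite (exp_type_CV c A B Hc); exact I. Qed.

Lemma exp_type_derive c A B : exp_type c A B -> exp_type (PS_derive c) (A * B) B.
Proof.
intros [HA [HB H]]; split; [apply Rmult_le_pos; auto|split; auto].
intros k; unfold PS_derive; rewrite Rabs_mult, Rabs_pos_eq by apply pos_INR.
apply Rle_trans with (INR (S k) * (A * B ^ S k / INR (fact (S k)))).
- apply Rmult_le_compat_l; [apply pos_INR|auto].
- rewrite fact_simpl, mult_INR; right; simpl pow; field.
  split; [apply INR_fact_neq_0|apply not_0_INR; lia].
Qed.

(** The binomial theorem sums B^j B'^(k-j) / (j! (k-j)!) to (B + B')^k / k!. *)
Lemma exp_type_mult a b A B A' B' : exp_type a A B -> exp_type b A' B' ->
  exp_type (PS_mult a b) (A * A') (B + B').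
Proof.
intros [HA [HB H]] [HA' [HB' H']]; split; [apply Rmult_le_pos; auto|split; [lra|]].
intros k; unfold PS_mult; rewrite binomial.
apply Rle_trans with (1 := sum_f_R0_triangle _ _).
replace (A * A' * sum_f_R0 (fun i => Binomial.C k i * B ^ i * B' ^ (k - i)) k / INR (fact k)) with
  (sum_f_R0 (fun i => Binomial.C k i * B ^ i * B' ^ (k - i) * (A * A' / INR (fact k))) k)
  by (rewrite <- scal_sum; unfold Rdiv; ring).
apply sum_Rle; intros j Hj; rewrite Rabs_mult.
apply Rle_trans with ((A * B ^ j / INR (fact j)) * (A' * B' ^ (k - j) / INR (fact (k - j)))).
- apply Rmult_le_compat; auto; apply Rabs_pos.
- unfold Binomial.C; right; field; repeat split; apply INR_fact_neq_0.
Qed.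

Lemma exp_type_le a b A B : exp_type b A B -> (forall k, Rabs (a k) <= Rabs (b k)) ->
  exp_type a A B.
Proof.
intros [HA [HB H]] Hab; repeat split; auto; intros k; apply Rle_trans with (1 := Hab k); auto.
Qed.

Lemma exp_type_scal a m A B : exp_type a A B -> exp_type (fun k => m * a k) (Rabs m * A) B.
Proof.
intros [HA [HB H]]; split; [apply Rmult_le_pos; auto; apply Rabs_pos|split; auto].
intros k; rewrite Rabs_mult; unfold Rdiv; rewrite !Rmult_assoc.
apply Rmult_le_compat_l; [apply Rabs_pos|].
rewrite <- Rmult_assoc; apply H.
Qed.

Lemma exp_type_bmul a m Mb A B : exp_type a A B -> (forall k, Rabs (m k) <= Mb) ->
  exp_type (fun k => m k * a k) (Mb * A) B.
Proof.
intros [HA [HB H]] Hm.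
assert (0 <= Mb) by (apply Rle_trans with (2 := Hm 0%nat), Rabs_pos).
split; [apply Rmult_le_pos; auto|split; auto].
intros k; rewrite Rabs_mult; unfold Rdiv; rewrite !Rmult_assoc, <- (Rmult_assoc A).
apply Rmult_le_compat; auto; try apply Rabs_pos; apply H.
Qed.

Lemma PSeries_mulk c A B y : exp_type c A B ->
  y * PSeries (PS_derive c) y = PSeries (fun k => INR k * c k) y.
Proof.
intros Hc; rewrite <- PSeries_incr_1; apply PSeries_ext.
intros [|k]; [change (0 = 0 * c 0%nat); ring|reflexivity].
Qed.

Lemma exp_type_mulk c A B : exp_type c A B -> exp_type (fun k => INR k * c k) (A * B) (B + 1).
Proof.
intros [HA [HB H]]; split; [apply Rmult_le_pos; auto|split; [lra|]].
intros [|k].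
- simpl; rewrite Rmult_0_l, Rabs_R0; unfold Rdiv; rewrite Rinv_1; nra.
- rewrite Rabs_mult, Rabs_pos_eq by apply pos_INR.
  apply Rle_trans with (INR (S k) * (A * B ^ S k / INR (fact (S k)))).
  + apply Rmult_le_compat_l; [apply pos_INR|auto].
  + replace (INR (S k) * (A * B ^ S k / INR (fact (S k)))) with
      (A * B * (INR (S k) * B ^ k) / INR (fact (S k)))
      by (simpl pow; field; apply INR_fact_neq_0).
    unfold Rdiv; apply Rmult_le_compat_r; [left; apply Rinv_0_lt_compat, INR_fact_pos|].
    apply Rmult_le_compat_l; [apply Rmult_le_pos; auto|].
    (* [(k + 1) B ^ k <= (B + 1) ^ (k + 1)] *)
    clear H HA; induction k as [|k IH]; [simpl; lra|].
    change (B ^ S k) with (B * B ^ k); rewrite S_INR.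
    change ((B + 1) ^ S (S k)) with ((B + 1) * (B + 1) ^ S k).
    assert (B ^ S k <= (B + 1) ^ S k) by (apply pow_incr; lra).
    change (B ^ S k) with (B * B ^ k) in H.
    nra.
Qed.

Lemma exp_type_plus a b A B A' B' : exp_type a A B -> exp_type b A' B' ->
  exp_type (fun k => a k + b k) (A + A') (B + B').
Proof.
intros [HA [HB H]] [HA' [HB' H']]; split; [lra|split; [lra|]].
intros k; apply Rle_trans with (1 := Rabs_triang _ _).
pose proof (INR_fact_pos k).
apply Rle_trans with (A * (B + B') ^ k / INR (fact k) + A' * (B + B') ^ k / INR (fact k)).
- assert (B ^ k <= (B + B') ^ k) by (apply pow_incr; lra).
  assert (B' ^ k <= (B + B') ^ k) by (apply pow_incr; lra).
  apply Rplus_le_compat; [apply Rle_trans with (1 := H k)|apply Rle_trans with (1 := H' k)];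
  unfold Rdiv; apply Rmult_le_compat_r; try (left; apply Rinv_0_lt_compat; auto);
  apply Rmult_le_compat_l; auto.
- right; field; lra.
Qed.

Lemma ex_pseries_exp_type c A B y : exp_type c A B -> ex_pseries c y.
Proof. intros H; apply CV_radius_inside, (exp_type_lt c A B), H. Qed.

Lemma PSeries_plus_exp_type a b A B A' B' y : exp_type a A B -> exp_type b A' B' ->
  PSeries (fun k => a k + b k) y = PSeries a y + PSeries b y.
Proof.
intros Ha Hb; exact (PSeries_plus a b y (ex_pseries_exp_type a A B y Ha)
  (ex_pseries_exp_type b A' B' y Hb)).
Qed.

Lemma PSeries_scal_fun a m y : PSeries (fun k => m * a k) y = m * PSeries a y.
Proof. exact (PSeries_scal m a y). Qed.

(** * The series of the Bessel functions *)

(* With [(mu + 1)_k] in place of [Gamma (mu + k + 1)], the function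
   [Jh mu] below is [Gamma (mu + 1)] times the Bessel function of order [mu]. *)
Definition bcoef (mu : R) (k : nat) : R := (-1) ^ k / (INR (fact k) * rf (mu + 1) k).

(** Factors a + i with i >= N are at least 1 in absolute value, and the N first ones are at least e
    <= 1 when a is within e of a0, so that e^N bounds every product from below. *)
Lemma rf_unif a0 : nonpole a0 -> exists eta m, 0 < eta /\ 0 < m /\
  forall a, Rabs (a - a0) < eta ->
    nonpole a /\ forall k, m <= Rabs (rf a k) /\ m <= Rabs (a + INR k).
Proof.
intros Ha0.
assert (HN : forall N, exists e, 0 < e <= 1 /\ forall i, (i < N)%nat -> 2 * e <= Rabs (a0 + INR i)).
{ induction N as [|N [e [He IH]]].
  - exists 1; split; [lra|intros; lia].
  - assert (0 < Rabs (a0 + INR N)).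
    { apply Rabs_pos_lt; intros E; apply (Ha0 N); lra. }
    exists (Rmin e (Rabs (a0 + INR N) / 2)).
    pose proof (Rmin_l e (Rabs (a0 + INR N) / 2)); pose proof (Rmin_r e (Rabs (a0 + INR N) / 2)).
    assert (0 < Rmin e (Rabs (a0 + INR N) / 2)) by (apply Rmin_glb_lt; lra).
    split; [lra|].
    intros i Hi; destruct (Nat.eq_dec i N) as [->|]; [lra|].
    pose proof (IH i ltac:(lia)); lra. }
destruct (INR_unbounded (Rabs a0 + 2)) as [N HN'].
destruct (HN N) as [e [He Hi]]; clear HN.
assert (Hlow : forall a, Rabs (a - a0) < e -> forall i, e <= Rabs (a + INR i) /\
  ((N <= i)%nat -> 1 <= Rabs (a + INR i))).
{ intros a Ha i.
  assert (H1 : (N <= i)%nat -> 1 <= Rabs (a + INR i)).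
  { intros H; apply le_INR in H; pose proof (Rle_abs (- a0)); rewrite Rabs_Ropp in *.
    apply Rabs_def2 in Ha.
    rewrite Rabs_pos_eq; lra. }
  split; auto.
  destruct (le_lt_dec N i) as [H|H]; [pose proof (H1 H); lra|].
  pose proof (Hi i H).
  replace (a0 + INR i) with ((a + INR i) - (a - a0)) in * by ring.
  pose proof (Rabs_triang (a + INR i) (- (a - a0))); rewrite Rabs_Ropp in *.
  unfold Rminus in *; lra. }
exists e, (e ^ N); split; [lra|split; [apply pow_lt; lra|]].
intros a Ha; specialize (Hlow a Ha); split.
- intros n E; destruct (Hlow n) as [H _]; rewrite E in H.
  replace (- INR n + INR n) with 0 in H by ring; rewrite Rabs_R0 in H; lra.
- assert (Hk : forall k, e ^ (Nat.min k N) <= Rabs (rf a k)).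
  { induction k as [|k IH]; simpl rf; [simpl; rewrite Rabs_R1; lra|].
    rewrite Rabs_mult.
    destruct (le_lt_dec N k) as [H|H].
    + rewrite Nat.min_r in * by lia.
      destruct (Hlow k) as [_ H1]; specialize (H1 H).
      pose proof (Rabs_pos (rf a k)); nra.
    + rewrite Nat.min_l in * by lia.
      destruct (Hlow k) as [H1 _]; simpl pow.
      rewrite Rmult_comm; apply Rmult_le_compat; auto; [apply pow_le|]; lra. }
  assert (Hp : forall m n, (m <= n)%nat -> e ^ n <= e ^ m).
  { intros m n Hmn; induction Hmn as [|n Hmn IH]; [lra|].
    simpl pow; pose proof (pow_le e n ltac:(lra)); nra. }
  assert (HN1 : (1 <= N)%nat).
  { apply INR_le; simpl; pose proof (Rabs_pos a0); lra. }
  intros k; split.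
  + apply Rle_trans with (2 := Hk k); apply Hp; lia.
  + apply Rle_trans with (e ^ 1); [apply Hp, HN1|].
    rewrite pow_1; apply Hlow.
Qed.

Lemma bcoef_unif mu0 : nonpole (mu0 + 1) -> exists eta M, 0 < eta /\
  forall mu, Rabs (mu - mu0) < eta -> nonpole (mu + 1) /\ exp_type (bcoef mu) M 1.
Proof.
intros H; destruct (rf_unif _ H) as [eta [m [He [Hm HH]]]].
exists eta, (/ m); split; auto; intros mu Hmu.
destruct (HH (mu + 1)) as [H1 H2]; [replace (mu + 1 - (mu0 + 1)) with (mu - mu0) by ring; auto|].
split; auto; split; [left; apply Rinv_0_lt_compat; auto|split; [lra|]].
intros k; unfold bcoef, Rdiv; rewrite Rabs_mult, pow_1_abs, pow1.
rewrite Rabs_inv, Rabs_mult, (Rabs_pos_eq (INR _)) by apply pos_INR.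
pose proof (INR_fact_pos k); destruct (H2 k) as [H2' _].
rewrite !Rmult_1_l, Rmult_1_r, <- Rinv_mult.
apply Rinv_le_contravar; nra.
Qed.

Lemma bcoef_exp_type mu : nonpole (mu + 1) -> exists M, exp_type (bcoef mu) M 1.
Proof.
intros H; destruct (bcoef_unif mu H) as [e [M [He HM]]]; exists M.
apply HM; rewrite Rminus_diag, Rabs_R0; auto.
Qed.

Lemma rf_ratio a k : nonpole a -> rf (a + 1) k * a = rf a k * (a + INR k).
Proof. intros H; rewrite Rmult_comm, <- rf_first; reflexivity. Qed.

(** Coefficient form of (x^(-mu) J_mu)' = - x^(-mu) J_(mu+1). *)
Lemma bcoef_derive mu k : nonpole (mu + 1) ->
  PS_derive (bcoef mu) k = - / (mu + 1) * bcoef (mu + 1) k.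
Proof.
intros H; unfold PS_derive, bcoef.
rewrite rf_first, fact_simpl, mult_INR; simpl pow; field.
repeat split; try apply INR_fact_neq_0; try (apply not_0_INR; lia).
- apply rf_neq0, nonpole_succ, H.
- apply nonpole_neq0, H.
Qed.

(** Coefficient form of (x^(mu+1) J_(mu+1))' = x^(mu+1) J_mu. *)
Lemma bcoef_shift mu k : nonpole (mu + 1) ->
  (mu + 1) * bcoef (mu + 1) k + INR k * bcoef (mu + 1) k = (mu + 1) * bcoef mu k.
Proof.
intros H; unfold bcoef.
pose proof (rf_ratio (mu + 1) k H) as E.
assert (N1 : rf (mu + 1 + 1) k <> 0) by (apply rf_neq0, nonpole_succ, H).
assert (N2 : rf (mu + 1) k <> 0) by (apply rf_neq0, H).
assert (N3 : INR (fact k) <> 0) by apply INR_fact_neq_0.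
apply Rmult_eq_reg_r with (rf (mu + 1 + 1) k * rf (mu + 1) k * INR (fact k));
  [|repeat apply Rmult_integral_contrapositive_currified; auto].
transitivity ((-1) ^ k * (rf (mu + 1) k * (mu + 1 + INR k))); [field; auto|].
rewrite <- E; field; auto.
Qed.

(** This is Bessel's differential equation read on the coefficients. *)
Lemma bcoef_rec mu j : nonpole (mu + 1) ->
  INR (S j) * (mu + INR (S j)) * bcoef mu (S j) = - bcoef mu j.
Proof.
intros H; unfold bcoef; simpl rf; rewrite fact_simpl, mult_INR, S_INR; simpl pow; field.
repeat split; first [apply INR_fact_neq_0 | apply rf_neq0, H
  | pose proof (pos_INR j); lra | intros E; apply (H j); lra].
Qed.

Definition bser (mu y : R) : R := PSeries (bcoef mu) y.

Lemma is_derive_bser mu y : nonpole (mu + 1) ->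
  is_derive (bser mu) y (- / (mu + 1) * bser (mu + 1) y).
Proof.
intros H; destruct (bcoef_exp_type mu H) as [M HM].
replace (- / (mu + 1) * bser (mu + 1) y) with (PSeries (PS_derive (bcoef mu)) y).
- apply is_derive_PSeries, (exp_type_lt _ M 1), HM.
- unfold bser; rewrite <- PSeries_scal_fun; apply PSeries_ext; intros; apply bcoef_derive, H.
Qed.

Lemma bser_shift mu y : nonpole (mu + 1) ->
  (mu + 1) * bser (mu + 1) y + y * PSeries (PS_derive (bcoef (mu + 1))) y = (mu + 1) * bser mu y.
Proof.
intros H; pose proof (nonpole_succ _ H) as H'.
destruct (bcoef_exp_type (mu + 1) H') as [M HM].
rewrite (PSeries_mulk _ M 1) by auto; unfold bser.
rewrite <- !PSeries_scal_fun.
rewrite <- (PSeries_plus_exp_type _ _ (Rabs (mu + 1) * M) 1 (M * 1) (1 + 1)).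
- apply PSeries_ext; intros; apply bcoef_shift, H.
- apply exp_type_scal, HM.
- apply exp_type_mulk, HM.
Qed.

Definition Jh (mu x : R) : R := Rpower (x / 2) mu * bser mu (x ^ 2 / 4).

(** [Gamma (mu + 1)] times the Bessel function of order mu + 1, hence on the same scale as [Jh mu].
    The pair satisfies a linear first-order system free of [Gamma], which is a rotation up to terms
    in 1/x. *)
Definition Kh (mu x : R) : R :=
  Rpower (x / 2) (mu + 1) * bser (mu + 1) (x ^ 2 / 4) / (mu + 1).

Lemma is_derive_Rpower_half a x : 0 < x ->
  is_derive (fun x => Rpower (x / 2) a) x (a / x * Rpower (x / 2) a).
Proof.
intros Hx; unfold Rpower, Rdiv; auto_derive; [lra|field; lra].
Qed.

Lemma is_derive_Jh mu x : 0 < x -> nonpole (mu + 1) ->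
  is_derive (Jh mu) x (mu / x * Jh mu x - Kh mu x).
Proof.
intros Hx H; unfold Jh.
assert (H1 := is_derive_Rpower_half mu x Hx).
assert (H2 : is_derive (fun x => bser mu (x ^ 2 / 4)) x
  (x / 2 * (- / (mu + 1) * bser (mu + 1) (x ^ 2 / 4)))).
{ apply (is_derive_comp (K := R_AbsRing) (V := R_NormedModule) (bser mu) (fun x => x ^ 2 / 4)).
  - apply is_derive_bser, H.
  - auto_derive; auto; field. }
evar_last; [apply (is_derive_mult (fun x => Rpower (x / 2) mu) (fun x => bser mu (x ^ 2 / 4)));
  [exact H1|exact H2|intros; apply Rmult_comm]|].
unfold Kh, plus, mult; simpl.
rewrite Rpower_plus, Rpower_1 by lra.
field; split; [apply nonpole_neq0, H|lra].
Qed.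

Lemma is_derive_Kh mu x : 0 < x -> nonpole (mu + 1) ->
  is_derive (Kh mu) x (Jh mu x - (mu + 1) / x * Kh mu x).
Proof.
intros Hx H; unfold Kh.
pose proof (nonpole_neq0 _ H) as H0.
assert (H1 := is_derive_Rpower_half (mu + 1) x Hx).
assert (H2 : is_derive (fun x => bser (mu + 1) (x ^ 2 / 4)) x
  (x / 2 * PSeries (PS_derive (bcoef (mu + 1))) (x ^ 2 / 4))).
{ apply (is_derive_comp (K := R_AbsRing) (V := R_NormedModule) (bser (mu + 1)) (fun x => x ^ 2 / 4)).
  - destruct (bcoef_exp_type (mu + 1) (nonpole_succ _ H)) as [M HM].
    apply is_derive_PSeries, (exp_type_lt _ M 1), HM.
  - auto_derive; auto; field. }
apply is_derive_ext with (fun x => / (mu + 1) * (Rpower (x / 2) (mu + 1) * bser (mu + 1) (x ^ 2 / 4))).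
{ intros t; eqR; unfold Rdiv; ring. }
evar_last; [apply is_derive_scal, (is_derive_mult (fun x => Rpower (x / 2) (mu + 1)) (fun x => bser (mu + 1) (x ^ 2 / 4)));
  [exact H1|exact H2|intros; apply Rmult_comm]|].
unfold Jh, plus, mult; simpl.
pose proof (bser_shift mu (x ^ 2 / 4) H) as E.
rewrite Rpower_plus, Rpower_1 by lra.
set (P := PSeries _ _) in *.
assert (EP : P = 4 / x ^ 2 * ((mu + 1) * bser mu (x ^ 2 / 4) - (mu + 1) * bser (mu + 1) (x ^ 2 / 4))).
{ rewrite <- E; field; lra. }
rewrite EP.
replace (x * (x * 1) / 4) with (x ^ 2 / 4) by (simpl; reflexivity).
field; split; lra.
Qed.

Lemma Kh_Jh mu x : Kh mu x = Jh (mu + 1) x / (mu + 1).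
Proof. reflexivity. Qed.

(** The three-term recurrence, obtained by comparing the derivative of [Jh (mu + 1)] given by
    [is_derive_Jh] at mu + 1 with the one given by [is_derive_Kh] at mu. *)
Lemma Kh_succ mu x : 0 < x -> nonpole (mu + 1) ->
  Kh (mu + 1) x = (mu + 1) * (2 * (mu + 1) / x * Kh mu x - Jh mu x).
Proof.
intros Hx H.
pose proof (nonpole_neq0 _ H) as H0.
assert (D1 := is_derive_Jh (mu + 1) x Hx (nonpole_succ _ H)).
assert (D2 : is_derive (Jh (mu + 1)) x ((mu + 1) * (Jh mu x - (mu + 1) / x * Kh mu x))).
{ apply is_derive_ext with (fun x => (mu + 1) * Kh mu x).
  - intros t; rewrite Kh_Jh; eqR; field; auto.
  - apply is_derive_scal, is_derive_Kh; auto. }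
pose proof (is_derive_unique _ _ _ D1) as E1; rewrite (is_derive_unique _ _ _ D2) in E1.
rewrite !Kh_Jh in *.
replace (Jh (mu + 1 + 1) x / (mu + 1 + 1)) with ((mu + 1) / x * Jh (mu + 1) x -
  (mu + 1) * (Jh mu x - (mu + 1) / x * (Jh (mu + 1) x / (mu + 1)))) by (rewrite E1; ring).
field; split; lra.
Qed.

(** * Products of two Bessel functions *)

Definition pcoef (mu la : R) : nat -> R := PS_mult (bcoef mu) (bcoef la).

(** By [bcoef_rec] both sums, once their vanishing end term is removed, equal minus the coefficient
    of index k - 1 of the product. *)
Lemma pcoef_rec mu la k : nonpole (mu + 1) -> nonpole (la + 1) ->
  sum_f_R0 (fun j => INR j * (mu + INR j) * bcoef mu j * bcoef la (k - j)) k =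
  sum_f_R0 (fun j => bcoef mu j * (INR (k - j) * (la + INR (k - j)) * bcoef la (k - j))) k.
Proof.
intros H1 H2; destruct k as [|n]; [simpl; ring|].
rewrite decomp_sum by lia; simpl pred.
rewrite tech5, Nat.sub_diag; simpl INR at 1 2.
transitivity (- sum_f_R0 (fun j => bcoef mu j * bcoef la (n - j)) n).
- rewrite <- (Rmult_1_l (sum_f_R0 (fun j => bcoef mu j * bcoef la (n - j)) n)).
  rewrite Ropp_mult_distr_l, scal_sum, !Rmult_0_l, Rplus_0_l.
  apply sum_eq; intros j Hj; rewrite Nat.sub_succ.
  rewrite bcoef_rec by auto; ring.
- rewrite <- (Rmult_1_l (sum_f_R0 (fun j => bcoef mu j * bcoef la (n - j)) n)).
  rewrite Ropp_mult_distr_l, scal_sum.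
  change (INR 0) with 0; rewrite !Rmult_0_l, Rmult_0_r, Rplus_0_r.
  apply sum_eq; intros j Hj; rewrite Nat.sub_succ_l by auto.
  rewrite bcoef_rec by auto; ring.
Qed.

Lemma sum_f_R0_linear (f g h u v : nat -> R) a b c d s n :
  (forall j, (j <= n)%nat -> s * (a * f j + b * (g j - h j)) = c * f j + d * (u j - v j)) ->
  s * (a * sum_f_R0 f n + b * (sum_f_R0 g n - sum_f_R0 h n)) =
  c * sum_f_R0 f n + d * (sum_f_R0 u n - sum_f_R0 v n).
Proof.
induction n as [|n IH]; intros H; [apply (H 0%nat); lia|].
rewrite !tech5.
pose proof (IH (fun j Hj => H j ltac:(lia))); pose proof (H (S n) ltac:(lia)); lra.
Qed.

(** Termwise this is a difference of squares: with p = mu + 2j and q = la + 2(k - j), the left side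
    carries (p + q)(p - q) = p^2 - q^2, which is mu^2 - la^2 plus four times the difference of the
    weights in [pcoef_rec]; the extra terms cancel in the sum. *)
Lemma wronskian_coef mu la k : nonpole (mu + 1) -> nonpole (la + 1) ->
  (mu + la + 2 * INR k) *
  ((mu - la) * pcoef mu la k +
   2 * (PS_mult (fun j => INR j * bcoef mu j) (bcoef la) k -
        PS_mult (bcoef mu) (fun j => INR j * bcoef la j) k)) =
  (mu ^ 2 - la ^ 2) * pcoef mu la k.
Proof.
intros H1 H2; pose proof (pcoef_rec mu la k H1 H2) as E.
set (S1 := sum_f_R0 _ k) in E; set (S2 := sum_f_R0 _ k) in E.
transitivity ((mu ^ 2 - la ^ 2) * pcoef mu la k + 4 * (S1 - S2)); [|rewrite E; ring].
unfold S1, S2, pcoef, PS_mult.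
apply sum_f_R0_linear.
intros j Hj; rewrite minus_INR by auto; ring.
Qed.

Lemma exp_type_pcoef mu la A A' B B' : exp_type (bcoef mu) A B -> exp_type (bcoef la) A' B' ->
  exp_type (pcoef mu la) (A * A') (B + B').
Proof. apply exp_type_mult. Qed.

Lemma x_Kh mu x : 0 < x -> nonpole (mu + 1) ->
  x * Kh mu x = - 2 * (Rpower (x / 2) mu * PSeries (fun k => INR k * bcoef mu k) (x ^ 2 / 4)).
Proof.
intros Hx H; destruct (bcoef_exp_type mu H) as [M HM].
rewrite <- (PSeries_mulk _ M 1) by auto.
assert (E : PSeries (PS_derive (bcoef mu)) (x ^ 2 / 4) = - / (mu + 1) * bser (mu + 1) (x ^ 2 / 4)).
{ unfold bser; rewrite <- PSeries_scal_fun; apply PSeries_ext; intros; apply bcoef_derive, H. }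
rewrite E; unfold Kh; rewrite Rpower_plus, Rpower_1 by lra.
field; apply nonpole_neq0, H.
Qed.

(** This is x (J_mu' J_la - J_mu J_la') for the functions [Jh], the derivatives being expressed
    through [Kh] so that the bounds on [Jh] and [Kh] apply directly. *)
Definition Wr (mu la x : R) : R :=
  x * (Jh mu x * Kh la x - Kh mu x * Jh la x) + (mu - la) * Jh mu x * Jh la x.

Definition pint_coef (mu la : R) (k : nat) : R := pcoef mu la k / (mu + la + 2 * INR k).

(* The primitive of [Jh mu x * Jh la x / x] without constant term. *)
Definition Gf (mu la x : R) : R :=
  Rpower (x / 2) (mu + la) * PSeries (pint_coef mu la) (x ^ 2 / 4).

Lemma PSeries_pcoef mu la y : nonpole (mu + 1) -> nonpole (la + 1) ->
  PSeries (pcoef mu la) y = bser mu y * bser la y.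
Proof.
intros H1 H2.
destruct (bcoef_exp_type mu H1) as [M HM]; destruct (bcoef_exp_type la H2) as [N HN].
apply PSeries_mult; eapply exp_type_lt; eauto.
Qed.

(** Away from resonance the first condition determines [c k] by [wronskian_coef]. At an index with
    mu + la + 2k = 0 it says nothing about [c k], which the second condition therefore prescribes.
    Both the primitive [Gf] and the constant Wronskian of opposite orders are instances. *)
Lemma Gf_Wr_coef mu la x (c : nat -> R) : 0 < x -> nonpole (mu + 1) -> nonpole (la + 1) ->
  (forall k, (mu ^ 2 - la ^ 2) * pcoef mu la k = (mu + la + 2 * INR k) * c k) ->
  (forall k, mu + la + 2 * INR k = 0 -> c k = (mu - la) * pcoef mu la k +
   2 * (PS_mult (fun j => INR j * bcoef mu j) (bcoef la) k -
        PS_mult (bcoef mu) (fun j => INR j * bcoef la j) k)) ->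
  Rpower (x / 2) (mu + la) * PSeries c (x ^ 2 / 4) = Wr mu la x.
Proof.
intros Hx H1 H2 Hc Hc0.
destruct (bcoef_exp_type mu H1) as [M HM]; destruct (bcoef_exp_type la H2) as [N HN].
assert (HM' := exp_type_mulk _ _ _ HM); assert (HN' := exp_type_mulk _ _ _ HN).
rewrite (PSeries_ext c (fun k => (mu - la) * pcoef mu la k +
   (2 * PS_mult (fun j => INR j * bcoef mu j) (bcoef la) k +
        (-2) * PS_mult (bcoef mu) (fun j => INR j * bcoef la j) k))).
- assert (P1 := exp_type_mult _ _ _ _ _ _ HM' HN).
  assert (P2 := exp_type_mult _ _ _ _ _ _ HM HN').
  assert (P3 := exp_type_pcoef _ _ _ _ _ _ HM HN).
  erewrite PSeries_plus_exp_type; [|apply exp_type_scal, P3|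
    apply exp_type_plus; apply exp_type_scal; [exact P1|exact P2]].
  erewrite PSeries_plus_exp_type; [|apply exp_type_scal, P1|apply exp_type_scal, P2].
  rewrite !PSeries_scal_fun, PSeries_pcoef by auto.
  rewrite !PSeries_mult by (eapply exp_type_lt; eauto).
  unfold Wr.
  replace (x * (Jh mu x * Kh la x - Kh mu x * Jh la x)) with
    (Jh mu x * (x * Kh la x) - (x * Kh mu x) * Jh la x) by ring.
  rewrite !x_Kh by auto; unfold Jh, bser; rewrite Rpower_plus; ring.
- intros k.
  destruct (Req_dec (mu + la + 2 * INR k) 0) as [E|E]; [rewrite Hc0 by auto; ring|].
  apply Rmult_eq_reg_l with (mu + la + 2 * INR k); auto.
  rewrite <- Hc, <- wronskian_coef by auto; ring.
Qed.

Lemma Gf_Wr mu la x : 0 < x -> nonpole (mu + 1) -> nonpole (la + 1) ->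
  (forall k, mu + la + 2 * INR k <> 0) ->
  (mu ^ 2 - la ^ 2) * Gf mu la x = Wr mu la x.
Proof.
intros Hx H1 H2 H.
rewrite <- (Gf_Wr_coef mu la x (fun k => (mu ^ 2 - la ^ 2) * pint_coef mu la k)); auto.
- rewrite PSeries_scal_fun; unfold Gf; ring.
- intros k; unfold pint_coef; field; auto.
- intros k Hk; destruct (H k Hk).
Qed.

Lemma pcoef_0 mu la : pcoef mu la 0 = 1.
Proof. unfold pcoef, PS_mult, bcoef; simpl; field. Qed.

Lemma PSeries_const_term (c : nat -> R) y : (forall k, c (S k) = 0) -> PSeries c y = c 0%nat.
Proof.
intros H.
assert (Hc : exp_type c (Rabs (c 0%nat)) 1).
{ split; [apply Rabs_pos|split; [lra|]].
  intros [|k]; [simpl; lra|].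
  rewrite H, Rabs_R0; apply Rmult_le_pos; [apply Rmult_le_pos; [apply Rabs_pos|rewrite pow1; lra]|].
  left; apply Rinv_0_lt_compat, INR_fact_pos. }
rewrite PSeries_decr_1 by (eapply ex_pseries_exp_type, Hc).
rewrite (PSeries_ext _ (fun _ => 0)) by (intros k; apply H).
rewrite PSeries_const_0; ring.
Qed.

(** For la = - mu the factor mu^2 - la^2 vanishes, which kills every coefficient with k >= 1; the
    constant one is mu - la. *)
Lemma Wr_opp mu x : 0 < x -> nonpole (mu + 1) -> nonpole (- mu + 1) ->
  Wr mu (- mu) x = 2 * mu.
Proof.
intros Hx H1 H2.
set (c := fun k : nat => match k with O => 2 * mu | S _ => 0 end).
rewrite <- (Gf_Wr_coef mu (- mu) x c); auto.
- rewrite PSeries_const_term by reflexivity.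
  rewrite Rplus_opp_r, Rpower_O by lra; unfold c; ring.
- intros [|k]; [simpl; ring|unfold c; ring].
- intros [|k] Hk; [unfold c; rewrite pcoef_0; unfold PS_mult; simpl; ring|].
  pose proof (pos_INR k); rewrite S_INR in Hk; lra.
Qed.

Lemma is_derive_Wr mu la x : 0 < x -> nonpole (mu + 1) -> nonpole (la + 1) ->
  is_derive (Wr mu la) x ((mu ^ 2 - la ^ 2) * (Jh mu x * Jh la x / x)).
Proof.
intros Hx H1 H2; unfold Wr.
assert (D1 := is_derive_Jh mu x Hx H1); assert (D2 := is_derive_Jh la x Hx H2).
assert (D3 := is_derive_Kh mu x Hx H1); assert (D4 := is_derive_Kh la x Hx H2).
auto_derive; [repeat split; auto; eexists; eauto|].
subst_Derive.
field; lra.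
Qed.

(** * Bounds at infinity *)

(** The derivative of x (J^2 + K^2) is (2 mu + 1)(J^2 - K^2), and that of J K is J^2 - K^2 - J K /
    x. The cross term is chosen so that only (2 mu + 1) J K / x survives, which is of the size of
    the energy divided by x^2. *)
Definition energy (mu x : R) : R :=
  x * (Jh mu x ^ 2 + Kh mu x ^ 2) - (2 * mu + 1) * Jh mu x * Kh mu x.

Lemma is_derive_energy mu x : 0 < x -> nonpole (mu + 1) ->
  is_derive (energy mu) x ((2 * mu + 1) * Jh mu x * Kh mu x / x).
Proof.
intros Hx H1; unfold energy.
assert (D1 := is_derive_Jh mu x Hx H1); assert (D3 := is_derive_Kh mu x Hx H1).
auto_derive; [repeat split; auto; eexists; eauto|].
subst_Derive.
field; lra.
Qed.

Lemma decreasing_derive (F dF : R -> R) a b : a <= b ->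
  (forall x, a <= x <= b -> is_derive F x (dF x)) ->
  (forall x, a <= x <= b -> dF x <= 0) -> F b <= F a.
Proof.
intros Hab HF Hd.
destruct (MVT_gen F a b dF) as [c [Hc E]].
- intros x; rewrite Rmin_left, Rmax_right by auto; intros; apply HF; lra.
- intros x; rewrite Rmin_left, Rmax_right by auto; intros.
  apply derivable_continuous_pt; exists (dF x); apply is_derive_Reals, HF; auto.
- rewrite Rmin_left, Rmax_right in Hc by auto.
  pose proof (Hd c Hc); nra.
Qed.

(** With m = |2 mu + 1|, the energy E satisfies E' <= (m / x^2) E, so that E exp(m / x) decreases.
    On x >= X >= 2m the energy lies between one half and twice x (J^2 + K^2), whence the factor
    4. *)
Lemma energy_bound mu X x : nonpole (mu + 1) -> 1 <= X -> 2 * Rabs (2 * mu + 1) <= X -> X <= x ->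
  x * (Jh mu x ^ 2 + Kh mu x ^ 2) <= 4 * exp (X / 2) * (X * (Jh mu X ^ 2 + Kh mu X ^ 2)).
Proof.
intros H HX Hm Hx.
set (m := Rabs (2 * mu + 1)) in *.
assert (Hm0 : 0 <= m) by apply Rabs_pos.
assert (Hcross : forall y, X <= y ->
  Rabs ((2 * mu + 1) * Jh mu y * Kh mu y) <= m * (Jh mu y ^ 2 + Kh mu y ^ 2) / 2).
{ intros y Hy; rewrite Rmult_assoc, Rabs_mult; fold m.
  assert (Rabs (Jh mu y * Kh mu y) <= (Jh mu y ^ 2 + Kh mu y ^ 2) / 2).
  { pose proof (pow2_ge_0 (Jh mu y - Kh mu y)); pose proof (pow2_ge_0 (Jh mu y + Kh mu y)).
    apply Rabs_le; split; lra. }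
  nra. }
assert (Hlow : forall y, X <= y ->
  y * (Jh mu y ^ 2 + Kh mu y ^ 2) / 2 <= energy mu y <= 2 * (y * (Jh mu y ^ 2 + Kh mu y ^ 2))).
{ intros y Hy; pose proof (Hcross y Hy) as Hc; unfold energy.
  apply Rabs_le_between in Hc.
  set (s := Jh mu y ^ 2 + Kh mu y ^ 2) in *.
  assert (0 <= s) by (unfold s; nra). assert (m * s <= y * s / 2) by nra. nra. }
set (F := fun y => energy mu y * exp (m / y)).
assert (HF : F x <= F X).
{ apply decreasing_derive with (fun y => exp (m / y) *
    ((2 * mu + 1) * Jh mu y * Kh mu y / y - m / y ^ 2 * energy mu y)); auto.
  - intros y Hy; unfold F.
    assert (D := is_derive_energy mu y ltac:(lra) H).
    auto_derive; [repeat split; [eexists; eauto|lra]|].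
    subst_Derive; unfold Rdiv; field; lra.
  - intros y Hy; pose proof (Hcross y ltac:(lra)) as Hc; pose proof (Hlow y ltac:(lra)) as Hl.
    pose proof (exp_pos (m / y)).
    apply Rabs_le_between in Hc.
    set (s := Jh mu y ^ 2 + Kh mu y ^ 2) in *.
    assert ((2 * mu + 1) * Jh mu y * Kh mu y / y <= m * s / 2 / y).
    { apply Rmult_le_compat_r; [left; apply Rinv_0_lt_compat; lra|lra]. }
    assert (m / y ^ 2 * (y * s / 2) <= m / y ^ 2 * energy mu y).
    { apply Rmult_le_compat_l; [|lra].
      apply Rmult_le_pos; auto; left; apply Rinv_0_lt_compat; nra. }
    replace (m / y ^ 2 * (y * s / 2)) with (m * s / 2 / y) in * by (field; lra).
    nra. }
unfold F in HF.
pose proof (Hlow x Hx) as [L1 _]; pose proof (Hlow X (Rle_refl X)) as [L2 L3].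
assert (1 <= exp (m / x)).
{ pose proof (exp_ineq1_le (m / x)).
  assert (0 <= m / x) by (apply Rmult_le_pos; auto; left; apply Rinv_0_lt_compat; lra). lra. }
assert (exp (m / X) <= exp (X / 2)).
{ assert (E : m / X <= X / 2); [|destruct E as [E|E]; [left; apply exp_increasing, E|rewrite E; lra]].
  apply Rmult_le_reg_r with X; [lra|].
  replace (m / X * X) with m by (field; lra); nra. }
pose proof (exp_pos (m / X)).
assert (0 <= Jh mu x ^ 2 + Kh mu x ^ 2) by nra.
assert (0 <= Jh mu X ^ 2 + Kh mu X ^ 2) by nra.
set (sx := Jh mu x ^ 2 + Kh mu x ^ 2) in *.
set (sX := Jh mu X ^ 2 + Kh mu X ^ 2) in *.
assert (0 <= x * sx) by nra. assert (0 <= X * sX) by nra.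
assert (energy mu x <= energy mu x * exp (m / x)) by nra.
assert (energy mu X * exp (m / X) <= 2 * (X * sX) * exp (X / 2)).
{ apply Rmult_le_compat; lra. }
lra.
Qed.

Lemma JK_series_bound mu M x : exp_type (bcoef mu) M 1 -> nonpole (mu + 1) -> 0 < x ->
  Rabs (Jh mu x) <= Rpower (x / 2) mu * (M * exp (x ^ 2 / 4)) /\
  x * Rabs (Kh mu x) <= 2 * (Rpower (x / 2) mu * (M * exp (2 * (x ^ 2 / 4)))).
Proof.
intros HM H Hx.
pose proof (Rpower_pos (x / 2) mu) as Hp.
assert (Hy : 0 <= x ^ 2 / 4) by nra.
split.
- unfold Jh; rewrite Rabs_mult, (Rabs_pos_eq (Rpower _ _)) by lra.
  apply Rmult_le_compat_l; [lra|].
  pose proof (exp_type_PSeries _ _ _ (x ^ 2 / 4) HM) as B.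
  rewrite (Rabs_pos_eq (x ^ 2 / 4)), Rmult_1_l in B by auto; exact B.
- rewrite <- (Rabs_pos_eq x) at 1 by lra; rewrite <- Rabs_mult, x_Kh by auto.
  rewrite Rabs_mult, Rabs_left by lra; replace (- -2) with 2 by ring.
  rewrite Rabs_mult, (Rabs_pos_eq (Rpower _ _)) by lra.
  apply Rmult_le_compat_l; [lra|]; apply Rmult_le_compat_l; [lra|].
  pose proof (exp_type_PSeries _ _ _ (x ^ 2 / 4) (exp_type_mulk _ _ _ HM)) as B.
  rewrite (Rabs_pos_eq (x ^ 2 / 4)), Rmult_1_r in B by auto; exact B.
Qed.

(** The energy estimate transports to all x >= X a bound at the single abscissa X, where the power
    series give one that is uniform for mu near mu0. *)
Lemma JK_bound mu0 : nonpole (mu0 + 1) -> exists eta X C, 0 < eta /\ 1 <= X /\ 0 <= C /\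
  forall mu, Rabs (mu - mu0) < eta -> nonpole (mu + 1) /\
    forall x, X <= x -> x * (Jh mu x ^ 2 + Kh mu x ^ 2) <= C.
Proof.
intros H; destruct (bcoef_unif mu0 H) as [e [M [He HM]]].
(* For mu within 1 of mu0, |2 mu + 1| <= 2 |mu0| + 3. Moreover X / 2 >= 1, so that the powers of X /
   2 increase with the order. *)
set (eta := Rmin e 1); set (X := 2 * (2 * Rabs mu0 + 3) + 2).
assert (Heta : 0 < eta <= 1) by (split; [apply Rmin_glb_lt; lra|apply Rmin_r]).
pose proof (Rmin_l e 1) as Hle; fold eta in Hle.
pose proof (Rabs_pos mu0).
set (B := Rpower (X / 2) (mu0 + 1) * (M * exp (2 * (X ^ 2 / 4)))).
exists eta, X, (4 * exp (X / 2) * (X * (B ^ 2 + (2 * B) ^ 2))).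
assert (HX : 2 <= X) by (unfold X; lra).
split; [lra|split; [lra|split]].
- pose proof (exp_pos (X / 2)); apply Rmult_le_pos; nra.
- intros mu Hmu; destruct (HM mu ltac:(lra)) as [Hn Ht]; split; auto.
  intros x Hx.
  assert (Hmm : 2 * Rabs (2 * mu + 1) <= X).
  { replace (2 * mu + 1) with (2 * (mu - mu0) + (2 * mu0 + 1)) by ring.
    pose proof (Rabs_triang (2 * (mu - mu0)) (2 * mu0 + 1)).
    pose proof (Rabs_triang (2 * mu0) 1).
    rewrite !Rabs_mult, !(Rabs_pos_eq 2), ?Rabs_R1 in * by lra; unfold X; lra. }
  apply Rle_trans with (1 := energy_bound mu X x Hn ltac:(lra) Hmm Hx).
  pose proof (exp_pos (X / 2)).
  apply Rmult_le_compat_l; [lra|]; apply Rmult_le_compat_l; [lra|].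
  destruct (JK_series_bound mu M X Ht Hn ltac:(lra)) as [B1 B2].
  assert (HMp : 0 <= M) by apply Ht.
  assert (Hpow : Rpower (X / 2) mu <= Rpower (X / 2) (mu0 + 1)).
  { apply Rle_Rpower; [lra|apply Rabs_def2 in Hmu; lra]. }
  pose proof (Rpower_pos (X / 2) mu).
  assert (C1 : Rabs (Jh mu X) <= B).
  { apply Rle_trans with (1 := B1); unfold B.
    assert (exp (X ^ 2 / 4) <= exp (2 * (X ^ 2 / 4))) by (left; apply exp_increasing; nra).
    pose proof (exp_pos (X ^ 2 / 4)).
    apply Rmult_le_compat; auto; [lra| |].
    - apply Rmult_le_pos; lra.
    - apply Rmult_le_compat_l; lra. }
  assert (C2 : Rabs (Kh mu X) <= 2 * B).
  { pose proof (Rabs_pos (Kh mu X)).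
    apply Rle_trans with (X * Rabs (Kh mu X)); [nra|].
    apply Rle_trans with (1 := B2); unfold B.
    apply Rmult_le_compat_l; [lra|]; apply Rmult_le_compat_r; auto.
    apply Rmult_le_pos; [auto|left; apply exp_pos]. }
  rewrite <- (pow2_abs (Jh mu X)), <- (pow2_abs (Kh mu X)).
  pose proof (Rabs_pos (Jh mu X)); pose proof (Rabs_pos (Kh mu X)); nra.
Qed.

Lemma continuous_Jh mu t : 0 < t -> nonpole (mu + 1) -> continuous (Jh mu) t.
Proof.
intros Ht H; apply (ex_derive_continuous (Jh mu)); eexists; apply is_derive_Jh; auto.
Qed.

(** The series controls (0, 1], the energy bound controls x >= X, and on [1, X] a crude form of the
    series bound is enough; C adds up the three constants. *)
Lemma Jh_dom mu : 0 < mu -> exists C, 0 <= C /\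
  (forall x, 0 < x <= 1 -> Rabs (Jh mu x) <= C * Rpower x mu) /\
  (forall x, 1 <= x -> Rabs (Jh mu x) <= C * Rpower x (- (1 / 2))).
Proof.
intros Hmu; assert (H : nonpole (mu + 1)) by (apply nonpole_pos; lra).
destruct (bcoef_exp_type mu H) as [M HM].
destruct (JK_bound mu H) as [eta [X [D [He [HX [HD HB]]]]]].
destruct (HB mu) as [_ HB']; [rewrite Rminus_diag, Rabs_R0; auto|clear HB].
assert (HM0 : 0 <= M) by apply HM.
set (C1 := M * exp 1).
set (C2 := Rpower X mu * (M * exp (X ^ 2)) * Rpower X (1 / 2)).
assert (0 <= C1) by (apply Rmult_le_pos; [auto|left; apply exp_pos]).
assert (0 <= C2).
{ apply Rmult_le_pos; [|left; apply Rpower_pos].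
  apply Rmult_le_pos; [left; apply Rpower_pos|apply Rmult_le_pos; [auto|left; apply exp_pos]]. }
exists (C1 + C2 + sqrt D); pose proof (sqrt_pos D).
split; [lra|split].
- intros x Hx; destruct (JK_series_bound mu M x HM H ltac:(lra)) as [B _].
  apply Rle_trans with (1 := B); rewrite Rmult_comm.
  pose proof (Rpower_pos (x / 2) mu).
  apply Rmult_le_compat; try lra.
  + apply Rmult_le_pos; [auto|left; apply exp_pos].
  + apply Rle_trans with C1; [|lra].
    apply Rmult_le_compat_l; auto.
    left; apply exp_increasing; nra.
  + apply Rle_Rpower_l; lra.
- intros x Hx; rewrite Rpower_Ropp.
  pose proof (Rpower_pos x (1 / 2)) as Hp.
  apply Rmult_le_reg_r with (Rpower x (1 / 2)); auto.
  rewrite Rmult_assoc, Rinv_l, Rmult_1_r by lra.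
  destruct (Rle_dec X x) as [HXx|HXx].
  + specialize (HB' x HXx).
    apply Rle_trans with (sqrt D); [|lra].
    replace (1 / 2) with (/ 2) by field; rewrite Rpower_sqrt by lra.
    rewrite <- sqrt_Rsqr_abs, <- sqrt_mult by (try lra; apply Rle_0_sqr).
    apply sqrt_le_1_alt; unfold Rsqr; nra.
  + destruct (JK_series_bound mu M x HM H ltac:(lra)) as [B _].
    apply Rle_trans with C2; [|lra].
    apply Rmult_le_compat; try lra; try apply Rabs_pos.
    * apply Rle_trans with (1 := B).
      assert (0 <= M * exp (x ^ 2 / 4)) by (apply Rmult_le_pos; [auto|left; apply exp_pos]).
      pose proof (Rpower_pos (x / 2) mu).
      apply Rmult_le_compat; try lra.
      -- apply Rle_Rpower_l; lra.
      -- apply Rmult_le_compat_l; auto; left; apply exp_increasing; nra.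
    * apply Rle_Rpower_l; lra.
Qed.

(** * Laplace transforms *)

(** A growth condition that survives multiplication by t, which is what differentiating the
    transform does. *)
Definition lap_class (f : R -> R) (a : R) (n : nat) (C : R) : Prop :=
  0 < a /\ 0 <= C /\ (forall t, 0 < t -> continuous f t) /\
  (forall t, 0 < t <= 1 -> Rabs (f t) <= C * Rpower t (a - 1)) /\
  (forall t, 1 <= t -> Rabs (f t) <= C * t ^ n).

Definition lkern (phi : R) (f : R -> R) (a b t : R) : R :=
  exp (- (a * t)) * cos (b * t + phi) * f t.

(* With [phi = 0] and [phi = PI / 2], the real and imaginary parts of the
   Laplace transform of [f] at [a + i b]. *)
Definition Lap (phi : R) (f : R -> R) (a b : R) : R :=
  RInt_gen (V := R_CompleteNormedModule) (lkern phi f a b) (at_right 0) (Rbar_locally p_infty).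

Lemma lap_class_tmul f a n C : lap_class f a n C -> lap_class (fun t => t * f t) a (S n) C.
Proof.
intros [Ha [HC [Hc [H0 H1]]]]; repeat split; auto.
- intros t Ht; apply (continuous_mult (fun t => t) f); auto; apply continuous_id.
- intros t Ht; rewrite Rabs_mult, (Rabs_pos_eq t) by lra.
  pose proof (H0 t Ht); pose proof (Rabs_pos (f t)); nra.
- intros t Ht; rewrite Rabs_mult, (Rabs_pos_eq t) by lra; simpl pow.
  pose proof (H1 t Ht); nra.
Qed.

Lemma lap_class_abs_dom f e n C s : lap_class f e n C -> 0 < s ->
  exists D, 0 <= D /\ dom (fun t => exp (- (s * t)) * Rabs (f t)) e D.
Proof.
intros [Ha [HC [Hc [H0 H1]]]] Hs.
destruct (Rpower_exp_bound (INR n + (e + 1)) s Hs) as [B [HB HB']].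
exists (C * (1 + B)); split; [apply Rmult_le_pos; lra|].
assert (Hexp : forall t, 0 < t -> 0 < exp (- (s * t)) <= 1).
{ intros t Ht; split; [apply exp_pos|]; rewrite <- exp_0; left; apply exp_increasing; nra. }
split; [|split].
- intros t Ht; apply (continuous_mult (fun t => exp (- (s * t))) (fun t => Rabs (f t))).
  + apply (ex_derive_continuous (fun t => exp (- (s * t)))); auto_derive; auto.
  + apply continuous_Rabs_comp; auto.
- intros t Ht; pose proof (Hexp t ltac:(lra)); pose proof (H0 t Ht).
  pose proof (Rabs_pos (f t)); pose proof (Rpower_pos t (e - 1)).
  rewrite Rabs_mult, Rabs_Rabsolu, (Rabs_pos_eq (exp _)) by lra.
  assert (0 <= C * B * Rpower t (e - 1)) by (repeat apply Rmult_le_pos; lra).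
  nra.
- intros t Ht; pose proof (Hexp t ltac:(lra)); pose proof (H1 t Ht).
  pose proof (Rabs_pos (f t)).
  rewrite Rabs_mult, Rabs_Rabsolu, (Rabs_pos_eq (exp _)) by lra.
  specialize (HB' t Ht); rewrite Rpower_plus, Rpower_pow in HB' by lra.
  replace (- e - 1) with (- (e + 1)) by ring; rewrite Rpower_Ropp.
  pose proof (Rpower_pos t (e + 1)) as Hp.
  apply Rmult_le_reg_r with (Rpower t (e + 1)); auto.
  rewrite (Rmult_assoc _ (/ _)), Rinv_l, Rmult_1_r by lra.
  apply Rle_trans with (C * (t ^ n * Rpower t (e + 1) * exp (- (s * t)))).
  + set (x := exp (- (s * t))) in *; set (p := Rpower t (e + 1)) in *.
    replace (C * (t ^ n * p * x)) with (x * (C * t ^ n) * p) by ring.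
    apply Rmult_le_compat_r; [lra|]; apply Rmult_le_compat_l; lra.
  + apply Rmult_le_compat_l; lra.
Qed.

Lemma lap_class_dom f e n C phi a b : lap_class f e n C -> 0 < a ->
  exists D, 0 <= D /\ dom (lkern phi f a b) e D.
Proof.
intros Hf Ha; destruct (lap_class_abs_dom f e n C a Hf Ha) as [D [HD [_ [D0 D1]]]].
exists D; split; auto.
assert (Hle : forall t, Rabs (lkern phi f a b t) <= Rabs (exp (- (a * t)) * Rabs (f t))).
{ intros t; unfold lkern; rewrite !Rabs_mult, Rabs_Rabsolu.
  pose proof (Rabs_pos (exp (- (a * t)))); pose proof (Rabs_pos (f t)).
  assert (Rabs (cos (b * t + phi)) <= 1) by (apply Rabs_le; apply COS_bound).
  apply Rmult_le_compat_r; auto; nra. }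
split; [|split].
- intros t Ht; unfold lkern.
  apply (continuous_mult (fun t => exp (- (a * t)) * cos (b * t + phi)) f); [|apply Hf, Ht].
  apply (ex_derive_continuous (fun t => exp (- (a * t)) * cos (b * t + phi))); auto_derive; auto.
- intros t Ht; apply Rle_trans with (1 := Hle t), D0, Ht.
- intros t Ht; apply Rle_trans with (1 := Hle t), D1, Ht.
Qed.

Lemma RInt_gen_II f l : II f l ->
  RInt_gen (V := R_CompleteNormedModule) f (at_right 0) (Rbar_locally p_infty) = l.
Proof. intros H; exact (is_RInt_gen_unique (V := R_CompleteNormedModule) f l H). Qed.

Lemma Lap_II f e n C phi a b : lap_class f e n C -> 0 < a ->
  II (lkern phi f a b) (Lap phi f a b).
Proof.
intros Hf Ha; destruct (lap_class_dom f e n C phi a b Hf Ha) as [D [HD Hd]].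
destruct (dom_II _ e D ltac:(apply Hf) HD Hd) as [l Hl].
unfold Lap; rewrite (RInt_gen_II _ _ Hl); exact Hl.
Qed.

(** Two applications of the mean value theorem; the factor 1/2 of Taylor's formula is given up. *)
Lemma taylor2_bound (G G1 G2 : R -> R) M :
  (forall s, 0 <= s <= 1 -> is_derive G s (G1 s)) ->
  (forall s, 0 <= s <= 1 -> is_derive G1 s (G2 s)) ->
  (forall s, 0 <= s <= 1 -> Rabs (G2 s) <= M) ->
  Rabs (G 1 - G 0 - G1 0) <= M.
Proof.
intros HG HG1 HM.
assert (HM0 : 0 <= M) by (apply Rle_trans with (2 := HM 0 ltac:(lra)), Rabs_pos).
assert (Hc : forall F dF b, 0 <= b <= 1 ->
  (forall s, 0 <= s <= 1 -> is_derive F s (dF s)) ->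
  exists c, 0 <= c <= b /\ F b - F 0 = dF c * b).
{ intros F dF b Hb HF; destruct (MVT_gen F 0 b dF) as [c [Hc E]].
  - intros x; rewrite Rmin_left, Rmax_right by lra; intros; apply HF; lra.
  - intros x; rewrite Rmin_left, Rmax_right by lra; intros.
    apply derivable_continuous_pt; exists (dF x); apply is_derive_Reals, HF; lra.
  - rewrite Rmin_left, Rmax_right in Hc by lra; exists c; split; auto; rewrite E; ring. }
destruct (Hc (fun s => G s - s * G1 0) (fun s => G1 s - G1 0) 1 ltac:(lra)) as [c [Hc1 E]].
- intros s Hs; pose proof (HG s Hs) as D; auto_derive; [eexists; eauto|subst_Derive; ring].
- destruct (Hc G1 G2 c ltac:(lra) HG1) as [c' [Hc' E']].
  replace (G 1 - G 0 - G1 0) with (G2 c' * c) by lra.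
  rewrite Rabs_mult, (Rabs_pos_eq c) by lra.
  pose proof (HM c' ltac:(lra)); pose proof (Rabs_pos (G2 c')); nra.
Qed.

Lemma cos_add_half_PI x : cos (x + PI / 2) = - sin x.
Proof. rewrite cos_plus, cos_PI2, sin_PI2; ring. Qed.

(** Second-order expansion along the segment from (a, b) to (a + h, b + k), on which |h| <= a / 2
    preserves a decay rate a / 2. Differentiation in b advances the phase by a quarter turn. *)
Lemma lkern_taylor phi a b h k t : 0 < t -> Rabs h <= a / 2 ->
  Rabs (exp (- ((a + h) * t)) * cos ((b + k) * t + phi) - exp (- (a * t)) * cos (b * t + phi)
    + h * (exp (- (a * t)) * cos (b * t + phi) * t)
    - k * (exp (- (a * t)) * cos (b * t + (phi + PI / 2)) * t)) <=
  2 * (h ^ 2 + k ^ 2) * (t * (t * exp (- (a / 2 * t)))).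
Proof.
intros Ht Hh.
set (G := fun s => exp (- ((a + s * h) * t)) * cos ((b + s * k) * t + phi)).
set (G1 := fun s => exp (- ((a + s * h) * t)) *
  (- h * t * cos ((b + s * k) * t + phi) - k * t * sin ((b + s * k) * t + phi))).
set (G2 := fun s => exp (- ((a + s * h) * t)) *
  ((h ^ 2 - k ^ 2) * t ^ 2 * cos ((b + s * k) * t + phi) + 2 * h * k * t ^ 2 * sin ((b + s * k) * t + phi))).
assert (B := taylor2_bound G G1 G2 (2 * (h ^ 2 + k ^ 2) * (t * (t * exp (- (a / 2 * t)))))).
match goal with |- Rabs ?e <= _ => replace e with (G 1 - G 0 - G1 0) end.
- apply B.
  + intros s _; unfold G, G1; auto_derive; auto; ring.
  + intros s _; unfold G1, G2; auto_derive; auto; ring.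
  + intros s Hs; unfold G2; rewrite Rabs_mult, Rabs_pos_eq by (left; apply exp_pos).
    set (c := cos _); set (sn := sin _).
    assert (Hc : -1 <= c <= 1) by apply COS_bound.
    assert (Hsn : -1 <= sn <= 1) by apply SIN_bound.
    assert (E : exp (- ((a + s * h) * t)) <= exp (- (a / 2 * t))).
    { assert (a / 2 * t <= (a + s * h) * t).
      { apply Rmult_le_compat_r; [lra|]; apply Rabs_le_between in Hh; nra. }
      destruct H as [H|H]; [left; apply exp_increasing; lra|rewrite H; lra]. }
    pose proof (exp_pos (- ((a + s * h) * t))).
    apply Rle_trans with (exp (- (a / 2 * t)) * (2 * (h ^ 2 + k ^ 2) * t ^ 2)); [|right; ring].
    apply Rmult_le_compat; auto; [lra|apply Rabs_pos|].
    apply Rle_trans with (1 := Rabs_triang _ _).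
    rewrite !Rabs_mult, (Rabs_pos_eq (t ^ 2)), (Rabs_pos_eq 2) by nra.
    assert (A1 : Rabs c <= 1) by (apply Rabs_le; lra).
    assert (A2 : Rabs sn <= 1) by (apply Rabs_le; lra).
    assert (A3 : Rabs (h ^ 2 - k ^ 2) <= h ^ 2 + k ^ 2) by (apply Rabs_le; nra).
    assert (A4 : 2 * Rabs h * Rabs k <= h ^ 2 + k ^ 2).
    { rewrite <- (pow2_abs h), <- (pow2_abs k); pose proof (pow2_ge_0 (Rabs h - Rabs k)); nra. }
    pose proof (pow2_ge_0 t); pose proof (Rabs_pos c); pose proof (Rabs_pos sn).
    pose proof (Rabs_pos (h ^ 2 - k ^ 2)).
    assert (0 <= 2 * Rabs h * Rabs k) by (pose proof (Rabs_pos h); pose proof (Rabs_pos k); nra).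
    assert (Rabs (h ^ 2 - k ^ 2) * t ^ 2 * Rabs c <= (h ^ 2 + k ^ 2) * t ^ 2).
    { apply Rle_trans with (Rabs (h ^ 2 - k ^ 2) * t ^ 2); [|apply Rmult_le_compat_r; auto].
      rewrite <- (Rmult_1_r (_ * t ^ 2)) at 2; apply Rmult_le_compat_l; auto; apply Rmult_le_pos; auto. }
    assert (2 * Rabs h * Rabs k * t ^ 2 * Rabs sn <= (h ^ 2 + k ^ 2) * t ^ 2).
    { apply Rle_trans with (2 * Rabs h * Rabs k * t ^ 2); [|apply Rmult_le_compat_r; auto].
      rewrite <- (Rmult_1_r (_ * t ^ 2)) at 2; apply Rmult_le_compat_l; auto; apply Rmult_le_pos; auto. }
    lra.
- unfold G, G1; rewrite !Rmult_1_l, !Rmult_0_l, !Rplus_0_r.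
  rewrite <- Rplus_assoc, cos_add_half_PI; ring.
Qed.

(** Integrating [lkern_taylor] against |f| leaves a remainder of at most 2 (h^2 + k^2) L, with L the
    integral of exp(- a t / 2) t^2 |f|. This quantitative form gives joint differentiability in one
    stroke. *)
Lemma Lap_differentiable f e n C phi a b : lap_class f e n C -> 0 < a ->
  differentiable_pt_lim (Lap phi f) a b
    (- Lap phi (fun t => t * f t) a b) (Lap (phi + PI / 2) (fun t => t * f t) a b).
Proof.
intros Hf Ha.
assert (Hf1 := lap_class_tmul _ _ _ _ Hf); assert (Hf2 := lap_class_tmul _ _ _ _ Hf1).
destruct (lap_class_abs_dom _ _ _ _ (a / 2) Hf2 ltac:(lra)) as [D [HD Hd]].
assert (He : 0 < e) by apply Hf.
destruct (dom_II _ e D He HD Hd) as [L HL].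
assert (HL0 : 0 <= L).
{ refine (II_ge0 _ _ _ HL); intros t Ht.
  apply Rmult_le_pos; [left; apply exp_pos|apply Rabs_pos]. }
assert (Hq : forall h k, Rabs h <= a / 2 ->
  Rabs (Lap phi f (a + h) (b + k) - Lap phi f a b
   - (- Lap phi (fun t => t * f t) a b * h + Lap (phi + PI / 2) (fun t => t * f t) a b * k))
  <= 2 * (h ^ 2 + k ^ 2) * L).
{ intros h k Hh.
  assert (Hah : 0 < a + h) by (apply Rabs_le_between in Hh; lra).
  assert (I1 := Lap_II f e n C phi (a + h) (b + k) Hf Hah).
  assert (I2 := Lap_II f e n C phi a b Hf Ha).
  assert (I3 := Lap_II _ e _ C phi a b Hf1 Ha).
  assert (I4 := Lap_II _ e _ C (phi + PI / 2) a b Hf1 Ha).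
  assert (I := II_plus _ _ _ _ (II_plus _ _ _ _ I1 (II_scal _ (-1) _ I2))
    (II_plus _ _ _ _ (II_scal _ h _ I3) (II_scal _ (- k) _ I4))).
  match type of I with II _ ?l => match goal with |- Rabs ?r <= _ => replace r with l by ring end end.
  refine (II_le _ _ _ _ _ I (II_scal _ (2 * (h ^ 2 + k ^ 2)) _ HL)).
  intros t Ht; unfold lkern.
  match goal with |- Rabs ?r <= _ => replace r with
    ((exp (- ((a + h) * t)) * cos ((b + k) * t + phi) - exp (- (a * t)) * cos (b * t + phi)
    + h * (exp (- (a * t)) * cos (b * t + phi) * t)
    - k * (exp (- (a * t)) * cos (b * t + (phi + PI / 2)) * t)) * f t) by ring end.
  rewrite !Rabs_mult, (Rabs_pos_eq t) by lra.
  apply Rle_trans with (2 * (h ^ 2 + k ^ 2) * (t * (t * exp (- (a / 2 * t)))) * Rabs (f t)).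
  - apply Rmult_le_compat_r; [apply Rabs_pos|apply lkern_taylor; auto].
  - right; ring. }
intros eps.
(* With m the larger of the two increments the remainder is at most 4 L m^2, and the second bound
   makes 4 L m at most eps. *)
assert (Hd0 : 0 < Rmin (a / 2) (eps / (4 * L + 1))).
{ pose proof (cond_pos eps); apply Rmin_glb_lt; [lra|apply Rdiv_lt_0_compat; lra]. }
exists (mkposreal _ Hd0); simpl; intros u v Hu Hv.
pose proof (Rmin_l (a / 2) (eps / (4 * L + 1))); pose proof (Rmin_r (a / 2) (eps / (4 * L + 1))).
replace (Lap phi f u v) with (Lap phi f (a + (u - a)) (b + (v - b))) by (f_equal; ring).
apply Rle_trans with (1 := Hq (u - a) (v - b) ltac:(lra)).
rewrite <- (pow2_abs (u - a)), <- (pow2_abs (v - b)).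
set (x := Rabs (u - a)) in *; set (y := Rabs (v - b)) in *.
assert (0 <= x) by apply Rabs_pos; assert (0 <= y) by apply Rabs_pos.
pose proof (Rmax_l x y); pose proof (Rmax_r x y).
set (m := Rmax x y) in *.
assert (m <= eps / (4 * L + 1)) by (apply Rmax_lub; lra).
assert (x ^ 2 <= m * m) by nra; assert (y ^ 2 <= m * m) by nra.
apply Rle_trans with ((4 * L) * m * m).
{ replace (4 * L * m * m) with (2 * (m * m + m * m) * L) by ring.
  apply Rmult_le_compat_r; lra. }
apply Rmult_le_compat_r; [lra|].
apply Rle_trans with ((4 * L) * (eps / (4 * L + 1))); [apply Rmult_le_compat_l; lra|].
pose proof (cond_pos eps).
apply Rmult_le_reg_r with (4 * L + 1); [lra|].
replace (4 * L * (eps / (4 * L + 1)) * (4 * L + 1)) with (4 * L * eps) by (field; lra).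
nra.
Qed.

(** Real and imaginary parts of the complex chain rule along a curve p = a + i b: the derivative of
    the transform of f is minus the transform of t f. Two quarter turns of the phase account for the
    sign in the second formula. *)
Lemma Lap_path f e n C (a b : R -> R) x a' b' : lap_class f e n C -> 0 < a x ->
  is_derive a x a' -> is_derive b x b' ->
  is_derive (fun t => Lap 0 f (a t) (b t)) x
    (- a' * Lap 0 (fun t => t * f t) (a x) (b x) + b' * Lap (PI / 2) (fun t => t * f t) (a x) (b x)) /\
  is_derive (fun t => Lap (PI / 2) f (a t) (b t)) x
    (- a' * Lap (PI / 2) (fun t => t * f t) (a x) (b x) - b' * Lap 0 (fun t => t * f t) (a x) (b x)).
Proof.
intros Hf Ha Da Db.
apply is_derive_Reals in Da; apply is_derive_Reals in Db.
assert (H := fun phi => derivable_pt_lim_comp_2d _ a b x _ _ a' b'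
  (Lap_differentiable f e n C phi (a x) (b x) Hf Ha) Da Db).
split; apply is_derive_Reals.
- specialize (H 0); rewrite Rplus_0_l in H.
  evar_last; [exact H|ring].
- specialize (H (PI / 2)).
  replace (Lap (PI / 2 + PI / 2) (fun t => t * f t) (a x) (b x))
    with (- Lap 0 (fun t => t * f t) (a x) (b x)) in H.
  + evar_last; [exact H|ring].
  + symmetry; apply RInt_gen_II.
    replace (- Lap 0 (fun t => t * f t) (a x) (b x)) with (-1 * Lap 0 (fun t => t * f t) (a x) (b x)) by ring.
    assert (Hf1 := lap_class_tmul _ _ _ _ Hf).
    refine (II_ext _ _ _ _ (II_scal _ (-1) _ (Lap_II _ _ _ _ 0 (a x) (b x) Hf1 Ha))).
    intros t _; unfold lkern.
    rewrite <- Rplus_assoc, !cos_add_half_PI, Rplus_0_r, sin_plus, sin_PI2, cos_PI2; ring.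
Qed.

(** * The Laplace transform of a Bessel function divided by its argument *)

Lemma tKh_dom mu : 0 < mu -> exists C, 0 <= C /\
  (forall x, 0 < x <= 1 -> Rabs (x * Kh mu x) <= C * Rpower x mu) /\
  (forall x, 1 <= x -> Rabs (x * Kh mu x) <= C * x).
Proof.
intros Hmu; assert (H : nonpole (mu + 1)) by (apply nonpole_pos; lra).
destruct (bcoef_exp_type mu H) as [M HM].
destruct (JK_bound mu H) as [eta [X [D [He [HX [HD HB]]]]]].
destruct (HB mu) as [_ HB']; [rewrite Rminus_diag, Rabs_R0; auto|clear HB].
assert (HM0 : 0 <= M) by apply HM.
set (C1 := 2 * (M * exp 1)).
set (C2 := 2 * (Rpower X mu * (M * exp (X ^ 2)))).
assert (0 <= C1) by (apply Rmult_le_pos; [lra|apply Rmult_le_pos; [auto|left; apply exp_pos]]).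
assert (0 <= C2).
{ apply Rmult_le_pos; [lra|].
  apply Rmult_le_pos; [left; apply Rpower_pos|apply Rmult_le_pos; [auto|left; apply exp_pos]]. }
exists (C1 + C2 + D + 1).
split; [lra|split].
- intros x Hx; destruct (JK_series_bound mu M x HM H ltac:(lra)) as [_ B].
  rewrite Rabs_mult, (Rabs_pos_eq x) by lra.
  apply Rle_trans with (1 := B); rewrite (Rmult_comm (Rpower _ _)), <- Rmult_assoc.
  pose proof (Rpower_pos (x / 2) mu).
  apply Rmult_le_compat; try lra.
  + apply Rmult_le_pos; [lra|apply Rmult_le_pos; [auto|left; apply exp_pos]].
  + apply Rle_trans with C1; [|lra].
    apply Rmult_le_compat_l; [lra|]; apply Rmult_le_compat_l; auto.
    left; apply exp_increasing; nra.
  + apply Rle_Rpower_l; lra.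
- intros x Hx; rewrite Rabs_mult, (Rabs_pos_eq x) by lra.
  destruct (Rle_dec X x) as [HXx|HXx].
  + specialize (HB' x HXx).
    rewrite Rmult_comm; apply Rmult_le_compat_r; [lra|].
    assert (Kh mu x ^ 2 <= D) by nra.
    apply Rle_trans with (D + 1); [|lra]; apply Rabs_le; nra.
  + destruct (JK_series_bound mu M x HM H ltac:(lra)) as [_ B].
    apply Rle_trans with C2; [|nra].
    apply Rle_trans with (1 := B).
    apply Rmult_le_compat_l; [lra|].
    assert (0 <= M * exp (2 * (x ^ 2 / 4))) by (apply Rmult_le_pos; [auto|left; apply exp_pos]).
    pose proof (Rpower_pos (x / 2) mu).
    apply Rmult_le_compat; try lra.
    * apply Rle_Rpower_l; lra.
    * apply Rmult_le_compat_l; auto; left; apply exp_increasing; nra.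
Qed.

Lemma Rinv_le_1 x : 1 <= x -> / x <= 1.
Proof.
intros H; apply Rle_trans with (/ 1); [apply Rinv_le_contravar; lra|rewrite Rinv_1; lra].
Qed.

Lemma Jh_div_class mu : 0 < mu -> exists C, lap_class (fun t => Jh mu t / t) mu 1 C.
Proof.
intros Hmu; assert (H : nonpole (mu + 1)) by (apply nonpole_pos; lra).
destruct (Jh_dom mu Hmu) as [C [HC [H0 H1]]].
exists C; repeat split; auto.
- intros t Ht; apply (continuous_mult (Jh mu) (fun t => / t)).
  + apply continuous_Jh; auto.
  + apply continuous_Rinv; lra.
- intros t Ht; unfold Rdiv; rewrite Rabs_mult, Rabs_inv, (Rabs_pos_eq t) by lra.
  unfold Rminus; rewrite Rpower_plus, Rpower_Ropp, Rpower_1 by lra.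
  rewrite <- Rmult_assoc; apply Rmult_le_compat_r; auto.
  left; apply Rinv_0_lt_compat; lra.
- intros t Ht; unfold Rdiv; rewrite Rabs_mult, Rabs_inv, (Rabs_pos_eq t) by lra.
  apply Rmult_le_reg_r with t; [lra|].
  rewrite Rmult_assoc, Rinv_l, Rmult_1_r, pow_1 by lra.
  apply Rle_trans with (1 := H1 t Ht).
  rewrite Rpower_Ropp; pose proof (Rpower_ge_1 t (1 / 2) Ht ltac:(lra)) as Hp.
  assert (/ Rpower t (1 / 2) <= 1) by (apply Rinv_le_1, Hp).
  assert (C * / Rpower t (1 / 2) <= C * 1) by (apply Rmult_le_compat_l; lra).
  assert (C * 1 <= C * (t * t)) by (apply Rmult_le_compat_l; nra).
  lra.
Qed.

(** If V(p) is the Laplace transform of [Vf mu], those of [Uf mu] and [Tf mu] are - V'(p) and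
    V''(p). *)
Definition Vf (mu : R) : R -> R := fun t => Jh mu t / t.
Definition Uf (mu : R) : R -> R := fun t => t * Vf mu t.
Definition Tf (mu : R) : R -> R := fun t => t * Uf mu t.

(** Bessel's equation under the Laplace transform: (1 + p^2) V'' + p V' = mu^2 V with p = a + i b.
    The corresponding combination of integrands is an exact derivative whose primitive vanishes at
    both ends. *)
Lemma Lap_Bessel_rel mu phi a b : 0 < mu -> 0 < a ->
  mu ^ 2 * Lap phi (Vf mu) a b + a * Lap phi (Uf mu) a b - b * Lap (phi + PI / 2) (Uf mu) a b
  = (1 + a ^ 2 - b ^ 2) * Lap phi (Tf mu) a b - 2 * a * b * Lap (phi + PI / 2) (Tf mu) a b.
Proof.
intros Hmu Ha; assert (H : nonpole (mu + 1)) by (apply nonpole_pos; lra).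
destruct (Jh_div_class mu Hmu) as [C Hf]; fold (Vf mu) in Hf.
assert (Hf1 := lap_class_tmul _ _ _ _ Hf); fold (Uf mu) in Hf1.
assert (Hf2 := lap_class_tmul _ _ _ _ Hf1); fold (Tf mu) in Hf2.
assert (I0 := Lap_II _ _ _ _ phi a b Hf Ha).
assert (I1 := Lap_II _ _ _ _ phi a b Hf1 Ha).
assert (I1' := Lap_II _ _ _ _ (phi + PI / 2) a b Hf1 Ha).
assert (I2 := Lap_II _ _ _ _ phi a b Hf2 Ha).
assert (I2' := Lap_II _ _ _ _ (phi + PI / 2) a b Hf2 Ha).
assert (I := II_plus _ _ _ _ (II_plus _ _ _ _ (II_scal _ (mu ^ 2) _ I0)
  (II_plus _ _ _ _ (II_scal _ a _ I1) (II_scal _ (- b) _ I1')))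
  (II_plus _ _ _ _ (II_scal _ (- (1 + a ^ 2 - b ^ 2)) _ I2) (II_scal _ (2 * a * b) _ I2'))).
(* The real part, with phase phi, of exp(- p t) (t J' + p t J), where t J' is written as mu J - t
   K. *)
set (F := fun t => exp (- (a * t)) * (cos (b * t + phi) * (mu * Jh mu t - t * Kh mu t + a * (t * Jh mu t))
  + b * (sin (b * t + phi) * (t * Jh mu t)))).
match type of I with II ?f ?l => assert (I' : II f (0 - 0)) end.
{ apply II_derive with F.
  - intros t Ht; unfold F.
    assert (D1 := is_derive_Jh mu t Ht H); assert (D3 := is_derive_Kh mu t Ht H).
    auto_derive; [repeat split; auto; eexists; eauto|].
    subst_Derive; unfold lkern, Tf, Uf, Vf.
    rewrite <- (Rplus_assoc (b * t)), cos_add_half_PI.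
    field; lra.
  - intros t Ht.
    destruct (lap_class_dom _ _ _ _ phi a b Hf Ha) as [? [_ [c0 _]]].
    destruct (lap_class_dom _ _ _ _ phi a b Hf1 Ha) as [? [_ [c1 _]]].
    destruct (lap_class_dom _ _ _ _ (phi + PI / 2) a b Hf1 Ha) as [? [_ [c1' _]]].
    destruct (lap_class_dom _ _ _ _ phi a b Hf2 Ha) as [? [_ [c2 _]]].
    destruct (lap_class_dom _ _ _ _ (phi + PI / 2) a b Hf2 Ha) as [? [_ [c2' _]]].
    assert (Hs : forall k (f : R -> R), continuous f t -> continuous (fun x => k * f x) t).
    { intros k f Hk; apply (continuous_mult (fun _ => k) f); auto; apply continuous_const. }
    assert (Hp : forall f g : R -> R, continuous f t -> continuous g t -> continuous (fun x => f x + g x) t).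
    { intros f g; apply (continuous_plus f g). }
    exact (Hp _ _ (Hp _ _ (Hs _ _ (c0 t Ht)) (Hp _ _ (Hs _ _ (c1 t Ht)) (Hs _ _ (c1' t Ht))))
      (Hp _ _ (Hs _ _ (c2 t Ht)) (Hs _ _ (c2' t Ht)))).
  - destruct (Jh_dom mu Hmu) as [CJ [HCJ [J0 _]]].
    destruct (tKh_dom mu Hmu) as [CK [HCK [K0 _]]].
    set (B := (mu * CJ + CK + a * CJ) + Rabs b * CJ + 1).
    assert (HB : 0 < B).
    { unfold B; pose proof (Rabs_pos b); assert (0 <= Rabs b * CJ) by nra; nra. }
    apply filterlim_at_right_0; intros eps He.
    destruct (Rpower_small mu (eps / B) Hmu (Rdiv_lt_0_compat _ _ He HB)) as [d [Hd Hd']].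
    exists (Rmin d 1); split; [apply Rmin_glb_lt; lra|].
    intros t Ht; pose proof (Rmin_l d 1); pose proof (Rmin_r d 1).
    rewrite Rminus_0_r; unfold F; rewrite Rabs_mult, Rabs_pos_eq by (left; apply exp_pos).
    assert (Ex : exp (- (a * t)) <= 1) by (rewrite <- exp_0; left; apply exp_increasing; nra).
    pose proof (exp_pos (- (a * t))).
    specialize (J0 t ltac:(lra)); specialize (K0 t ltac:(lra)); specialize (Hd' t ltac:(lra)).
    pose proof (Rpower_pos t mu) as Hp.
    assert (HJt : Rabs (t * Jh mu t) <= CJ * Rpower t mu).
    { rewrite Rabs_mult, (Rabs_pos_eq t) by lra; pose proof (Rabs_pos (Jh mu t)); nra. }
    assert (Hco : Rabs (cos (b * t + phi)) <= 1) by (apply Rabs_le, COS_bound).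
    assert (Hsi : Rabs (sin (b * t + phi)) <= 1) by (apply Rabs_le, SIN_bound).
    match goal with |- _ * Rabs ?r < _ => set (Q := Rabs r); assert (HQ : Q <= B * Rpower t mu) end.
    { unfold Q; apply Rle_trans with (1 := Rabs_triang _ _); rewrite !Rabs_mult.
      assert (Rabs (mu * Jh mu t - t * Kh mu t + a * (t * Jh mu t)) <= (mu * CJ + CK + a * CJ) * Rpower t mu).
      { apply Rle_trans with (1 := Rabs_triang _ _).
        assert (Rabs (mu * Jh mu t - t * Kh mu t) <= (mu * CJ + CK) * Rpower t mu).
        { unfold Rminus; apply Rle_trans with (1 := Rabs_triang _ _).
          rewrite Rabs_Ropp, Rabs_mult, (Rabs_pos_eq mu) by lra; nra. }
        rewrite (Rabs_mult a), (Rabs_pos_eq a) by lra; nra. }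
      rewrite Rabs_mult in HJt.
      assert (Rabs (sin (b * t + phi)) * (Rabs t * Rabs (Jh mu t)) <= CJ * Rpower t mu).
      { pose proof (Rabs_pos t); pose proof (Rabs_pos (Jh mu t)).
        assert (0 <= Rabs t * Rabs (Jh mu t)) by nra. nra. }
      assert (Rabs b * (Rabs (sin (b * t + phi)) * (Rabs t * Rabs (Jh mu t))) <= Rabs b * (CJ * Rpower t mu)).
      { apply Rmult_le_compat_l; [apply Rabs_pos|auto]. }
      pose proof (Rabs_pos (mu * Jh mu t - t * Kh mu t + a * (t * Jh mu t))).
      unfold B; nra. }
    assert (0 <= Q) by apply Rabs_pos.
    apply Rle_lt_trans with (B * Rpower t mu); [nra|].
    apply Rlt_le_trans with (B * (eps / B)); [apply Rmult_lt_compat_l; lra|right; field; lra].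
  - destruct (Jh_dom mu Hmu) as [CJ [HCJ [_ J1]]].
    destruct (tKh_dom mu Hmu) as [CK [HCK [_ K1]]].
    destruct (Rpower_exp_bound (INR 2) a Ha) as [E [HE HE']].
    set (B := (mu * CJ + CK + a * CJ) + Rabs b * CJ + 1).
    assert (HB : 0 < B).
    { unfold B; pose proof (Rabs_pos b); assert (0 <= Rabs b * CJ) by nra; nra. }
    apply filterlim_p_infty_R; intros eps He.
    exists (Rmax 1 (B * E / eps)).
    intros t Ht; pose proof (Rmax_l 1 (B * E / eps)); pose proof (Rmax_r 1 (B * E / eps)).
    rewrite Rminus_0_r; unfold F; rewrite Rabs_mult, Rabs_pos_eq by (left; apply exp_pos).
    pose proof (exp_pos (- (a * t))).
    specialize (J1 t ltac:(lra)); specialize (K1 t ltac:(lra)); specialize (HE' t ltac:(lra)).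
    rewrite (Rpower_pow 2 t) in HE' by lra.
    assert (HJ : Rabs (Jh mu t) <= CJ).
    { apply Rle_trans with (1 := J1); rewrite Rpower_Ropp.
      pose proof (Rpower_ge_1 t (1 / 2) ltac:(lra) ltac:(lra)) as Hp.
      assert (/ Rpower t (1 / 2) <= 1) by (apply Rinv_le_1, Hp).
      nra. }
    assert (HJt : Rabs (t * Jh mu t) <= CJ * t).
    { rewrite Rabs_mult, (Rabs_pos_eq t) by lra; pose proof (Rabs_pos (Jh mu t)); nra. }
    assert (Hco : Rabs (cos (b * t + phi)) <= 1) by (apply Rabs_le, COS_bound).
    assert (Hsi : Rabs (sin (b * t + phi)) <= 1) by (apply Rabs_le, SIN_bound).
    match goal with |- _ * Rabs ?r < _ => set (Q := Rabs r); assert (HQ : Q <= B * t) end.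
    { unfold Q; apply Rle_trans with (1 := Rabs_triang _ _); rewrite !Rabs_mult.
      assert (Rabs (mu * Jh mu t - t * Kh mu t + a * (t * Jh mu t)) <= (mu * CJ + CK + a * CJ) * t).
      { apply Rle_trans with (1 := Rabs_triang _ _).
        assert (Rabs (mu * Jh mu t - t * Kh mu t) <= (mu * CJ + CK) * t).
        { unfold Rminus; apply Rle_trans with (1 := Rabs_triang _ _).
          rewrite Rabs_Ropp, Rabs_mult, (Rabs_pos_eq mu) by lra.
          assert (Rabs (Jh mu t) <= CJ * t) by nra.
          assert (mu * Rabs (Jh mu t) <= mu * (CJ * t)) by (apply Rmult_le_compat_l; lra). lra. }
        rewrite (Rabs_mult a), (Rabs_pos_eq a) by lra; nra. }
      rewrite Rabs_mult in HJt.
      assert (Rabs (sin (b * t + phi)) * (Rabs t * Rabs (Jh mu t)) <= CJ * t).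
      { pose proof (Rabs_pos t); pose proof (Rabs_pos (Jh mu t)).
        assert (0 <= Rabs t * Rabs (Jh mu t)) by nra. nra. }
      assert (Rabs b * (Rabs (sin (b * t + phi)) * (Rabs t * Rabs (Jh mu t))) <= Rabs b * (CJ * t)).
      { apply Rmult_le_compat_l; [apply Rabs_pos|auto]. }
      pose proof (Rabs_pos (mu * Jh mu t - t * Kh mu t + a * (t * Jh mu t))).
      unfold B; nra. }
    apply Rle_lt_trans with (B * (exp (- (a * t)) * t)); [nra|].
    assert (B * E < eps * t).
    { apply Rmult_lt_reg_r with (/ eps); [apply Rinv_0_lt_compat; lra|].
      replace (eps * t * / eps) with t by (field; lra). unfold Rdiv in *; lra. }
    apply Rmult_lt_reg_r with t; [lra|].
    apply Rle_lt_trans with (B * E); [|lra].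
    replace (B * (exp (- (a * t)) * t) * t) with (B * (t ^ 2 * exp (- (a * t)))) by ring.
    apply Rmult_le_compat_l; lra. }
pose proof (II_unique _ _ _ I I'); lra.
Qed.

Lemma Lap_PI f e n C a b : lap_class f e n C -> 0 < a ->
  Lap (PI / 2 + PI / 2) f a b = - Lap 0 f a b.
Proof.
intros Hf Ha; apply RInt_gen_II.
replace (- Lap 0 f a b) with (-1 * Lap 0 f a b) by ring.
refine (II_ext _ _ _ _ (II_scal _ (-1) _ (Lap_II _ _ _ _ 0 a b Hf Ha))).
intros t _; unfold lkern.
rewrite <- Rplus_assoc, !cos_add_half_PI, Rplus_0_r, sin_plus, sin_PI2, cos_PI2; ring.
Qed.

Lemma is_derive_sinh x : is_derive sinh x (cosh x).
Proof. apply is_derive_Reals, derivable_pt_lim_sinh. Qed.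

Lemma is_derive_cosh x : is_derive cosh x (sinh x).
Proof. apply is_derive_Reals, derivable_pt_lim_cosh. Qed.

Lemma cosh_sqr x : cosh x ^ 2 = 1 + sinh x ^ 2.
Proof.
unfold cosh, sinh.
assert (E : exp x * exp (- x) = 1) by (rewrite <- exp_plus, Rplus_opp_r; apply exp_0).
replace (((exp x + exp (- x)) / 2) ^ 2) with ((exp x ^ 2 + exp (- x) ^ 2 + 2 * (exp x * exp (- x))) / 4) by field.
replace (((exp x - exp (- x)) / 2) ^ 2) with ((exp x ^ 2 + exp (- x) ^ 2 - 2 * (exp x * exp (- x))) / 4) by field.
rewrite E; field.
Qed.

Lemma cos_sqr x : cos x ^ 2 = 1 - sin x ^ 2.
Proof. pose proof (sin2_cos2 x) as H; unfold Rsqr in H; lra. Qed.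

Lemma sinh_lower x : 0 <= x -> x / 2 <= sinh x.
Proof.
intros Hx; unfold sinh; pose proof (exp_ineq1_le x).
assert (exp (- x) <= 1) by (rewrite <- exp_0; destruct Hx; [left; apply exp_increasing; lra|subst; rewrite Ropp_0; lra]).
lra.
Qed.

Lemma cosh_upper x : 1 <= x -> cosh x <= 2 * sinh x.
Proof.
intros Hx; unfold cosh, sinh.
assert (3 * exp (- x) <= exp x); [|lra].
assert (E : exp x = exp (2 * x) * exp (- x)) by (rewrite <- exp_plus; f_equal; ring).
rewrite E; apply Rmult_le_compat_r; [left; apply exp_pos|].
pose proof (exp_ineq1_le (2 * x)); lra.
Qed.

(* The real and imaginary parts of [mu V - q U], where [V] and [U] are the
   Laplace transforms of [Jh mu t / t] and [Jh mu t] at [a + i b], and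
   [q = q1 + i q2] stands for [sqrt (1 + (a + i b) ^ 2)]. *)
Definition lapN0 mu a b q1 q2 : R :=
  mu * Lap 0 (Vf mu) a b - (q1 * Lap 0 (Uf mu) a b - q2 * Lap (PI / 2) (Uf mu) a b).
Definition lapN1 mu a b q1 q2 : R :=
  mu * Lap (PI / 2) (Vf mu) a b - (q1 * Lap (PI / 2) (Uf mu) a b + q2 * Lap 0 (Uf mu) a b).

(** The gain 2 / a comes from t exp(- a t / 2) <= 2 / a. It compensates the growth of q in [lapN0]
    and [lapN1], where q is comparable to a. *)
Lemma Lap_Bessel_bound mu : 0 < mu -> exists B, 0 <= B /\ forall phi a b, 2 <= a ->
  Rabs (Lap phi (Vf mu) a b) <= B /\ Rabs (Lap phi (Uf mu) a b) <= 2 / a * B.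
Proof.
intros Hmu.
destruct (Jh_div_class mu Hmu) as [C Hf]; fold (Vf mu) in Hf.
assert (Hf1 := lap_class_tmul _ _ _ _ Hf); fold (Uf mu) in Hf1.
destruct (lap_class_abs_dom _ _ _ _ 1 Hf ltac:(lra)) as [D [HD Hd]].
destruct (dom_II _ mu D Hmu HD Hd) as [B HB].
assert (HB0 : 0 <= B).
{ refine (II_ge0 _ _ _ HB); intros t Ht.
  apply Rmult_le_pos; [left; apply exp_pos|apply Rabs_pos]. }
exists B; split; auto; intros phi a b Ha.
assert (Hc : forall x, Rabs (cos x) <= 1) by (intros; apply Rabs_le, COS_bound).
split.
- refine (II_le _ _ _ _ _ (Lap_II _ _ _ _ phi a b Hf ltac:(lra)) HB).
  intros t Ht; unfold lkern; rewrite !Rabs_mult, (Rabs_pos_eq (exp _)) by (left; apply exp_pos).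
  apply Rmult_le_compat_r; [apply Rabs_pos|].
  rewrite <- (Rmult_1_r (exp (- (1 * t)))).
  apply Rmult_le_compat; [left; apply exp_pos|apply Rabs_pos| |auto].
  left; apply exp_increasing; nra.
- refine (II_le _ _ _ _ _ (Lap_II _ _ _ _ phi a b Hf1 ltac:(lra)) (II_scal _ (2 / a) _ HB)).
  intros t Ht; unfold lkern, Uf; rewrite !Rabs_mult, (Rabs_pos_eq (exp _)), (Rabs_pos_eq t) by (try lra; left; apply exp_pos).
  rewrite <- !Rmult_assoc; apply Rmult_le_compat_r; [apply Rabs_pos|].
  assert (E : exp (- (a * t)) = exp (- (a / 2 * t)) * exp (- (a / 2 * t)))
    by (rewrite <- exp_plus; f_equal; field).
  assert (E1 : exp (- (a / 2 * t)) <= exp (- (1 * t))).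
  { destruct (Req_dec a 2) as [->|]; [right; do 2 f_equal; field|left; apply exp_increasing; nra]. }
  assert (E2 : t * exp (- (a / 2 * t)) <= 2 / a).
  { assert (P : exp (a / 2 * t) * exp (- (a / 2 * t)) = 1) by (rewrite <- exp_plus, Rplus_opp_r; apply exp_0).
    pose proof (exp_ineq1_le (a / 2 * t)); pose proof (exp_pos (- (a / 2 * t))).
    apply Rmult_le_reg_l with (a / 2); [lra|].
    replace (a / 2 * (2 / a)) with 1 by (field; lra). nra. }
  pose proof (exp_pos (- (a / 2 * t))).
  rewrite E; specialize (Hc (b * t + phi)); pose proof (Rabs_pos (cos (b * t + phi))).
  set (x := exp (- (a / 2 * t))) in *; set (y := exp (- (1 * t))) in *.
  apply Rle_trans with (x * (t * x)); [|].
  + rewrite <- (Rmult_1_r (x * (t * x))).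
    replace (x * x * Rabs (cos (b * t + phi)) * t) with (x * (t * x) * Rabs (cos (b * t + phi))) by ring.
    apply Rmult_le_compat_l; auto; repeat apply Rmult_le_pos; lra.
  + rewrite Rmult_comm; apply Rmult_le_compat; try lra.
    apply Rmult_le_pos; lra.
Qed.

(** In complex notation, with p = sinh w and q = cosh w, one has V' = - q U and U' = - q T, hence
    (mu V - q U)' = - mu q U - p U + q^2 T, which is mu (mu V - q U) by [Lap_Bessel_rel]. *)
Lemma N_ode mu (v0 v1 u0 u1 q1 q2 : R -> R) a b t0 t1 x :
  is_derive v0 x (- q1 x * u0 x + q2 x * u1 x) ->
  is_derive v1 x (- q1 x * u1 x - q2 x * u0 x) ->
  is_derive u0 x (- q1 x * t0 + q2 x * t1) ->
  is_derive u1 x (- q1 x * t1 - q2 x * t0) ->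
  is_derive q1 x a -> is_derive q2 x b ->
  mu ^ 2 * v0 x + a * u0 x - b * u1 x = (q1 x ^ 2 - q2 x ^ 2) * t0 - 2 * (q1 x * q2 x) * t1 ->
  mu ^ 2 * v1 x + a * u1 x - b * - u0 x = (q1 x ^ 2 - q2 x ^ 2) * t1 - 2 * (q1 x * q2 x) * - t0 ->
  is_derive (fun x => mu * v0 x - (q1 x * u0 x - q2 x * u1 x)) x
    (mu * (mu * v0 x - (q1 x * u0 x - q2 x * u1 x))) /\
  is_derive (fun x => mu * v1 x - (q1 x * u1 x + q2 x * u0 x)) x
    (mu * (mu * v1 x - (q1 x * u1 x + q2 x * u0 x))).
Proof.
intros D1 D2 D3 D4 D5 D6 E0 E1.
split; (auto_derive; [repeat split; auto; eexists; eauto|]); subst_Derive; lra.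
Qed.

(** Here p = sinh(s + i th) and q = cosh(s + i th). Along s the quantity mu V - q U is a multiple of
    exp(mu s) by [N_ode], yet it stays bounded as s grows; hence it is zero. *)
Lemma N_zero mu th s : 0 < mu -> 0 < cos th -> 0 < s ->
  let a := sinh s * cos th in let b := cosh s * sin th in
  let q1 := cosh s * cos th in let q2 := sinh s * sin th in
  lapN0 mu a b q1 q2 = 0 /\ lapN1 mu a b q1 q2 = 0.
Proof.
intros Hmu Hth Hs.
destruct (Jh_div_class mu Hmu) as [C Hf]; fold (Vf mu) in Hf.
assert (Hf1 := lap_class_tmul _ _ _ _ Hf); fold (Uf mu) in Hf1.
assert (Hf2 := lap_class_tmul _ _ _ _ Hf1); fold (Tf mu) in Hf2.
set (a := fun s => sinh s * cos th); set (b := fun s => cosh s * sin th).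
set (q1 := fun s => cosh s * cos th); set (q2 := fun s => sinh s * sin th).
assert (Hsh : forall x, 0 < x -> 0 < sinh x).
{ intros x Hx; pose proof (sinh_lower x ltac:(lra)); lra. }
assert (Ha : forall x, 0 < x -> 0 < a x) by (intros; apply Rmult_lt_0_compat; auto).
assert (Da : forall x, is_derive a x (q1 x)).
{ intros x; unfold a, q1; pose proof (is_derive_sinh x) as D; auto_derive; [eexists; eauto|subst_Derive; ring]. }
assert (Db : forall x, is_derive b x (q2 x)).
{ intros x; unfold b, q2; pose proof (is_derive_cosh x) as D; auto_derive; [eexists; eauto|subst_Derive; ring]. }
assert (Dq1 : forall x, is_derive q1 x (a x)).
{ intros x; unfold a, q1; pose proof (is_derive_cosh x) as D; auto_derive; [eexists; eauto|subst_Derive; ring]. }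
assert (Dq2 : forall x, is_derive q2 x (b x)).
{ intros x; unfold b, q2; pose proof (is_derive_sinh x) as D; auto_derive; [eexists; eauto|subst_Derive; ring]. }
assert (R1 : forall x, q1 x ^ 2 - q2 x ^ 2 = 1 + a x ^ 2 - b x ^ 2).
{ intros x; unfold a, b, q1, q2; rewrite !Rpow_mult_distr, cosh_sqr, cos_sqr; ring. }
assert (R2 : forall x, q1 x * q2 x = a x * b x) by (intros; unfold a, b, q1, q2; ring).
set (F0 := fun x => lapN0 mu (a x) (b x) (q1 x) (q2 x)).
set (F1 := fun x => lapN1 mu (a x) (b x) (q1 x) (q2 x)).
assert (DF : forall x, 0 < x -> is_derive F0 x (mu * F0 x) /\ is_derive F1 x (mu * F1 x)).
{ intros x Hx.
  destruct (Lap_path _ _ _ _ a b x _ _ Hf (Ha x Hx) (Da x) (Db x)) as [DV0 DV1].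
  destruct (Lap_path _ _ _ _ a b x _ _ Hf1 (Ha x Hx) (Da x) (Db x)) as [DU0 DU1].
  fold (Uf mu) in DV0, DV1; fold (Tf mu) in DU0, DU1.
  assert (E0 := Lap_Bessel_rel mu 0 (a x) (b x) Hmu (Ha x Hx)).
  assert (E1 := Lap_Bessel_rel mu (PI / 2) (a x) (b x) Hmu (Ha x Hx)).
  rewrite Rplus_0_l in E0.
  rewrite (Lap_PI _ _ _ _ _ _ Hf1), (Lap_PI _ _ _ _ _ _ Hf2) in E1 by auto.
  replace (2 * a x * b x) with (2 * (q1 x * q2 x)) in E0, E1 by (rewrite R2; ring).
  rewrite <- R1 in E0, E1.
  exact (N_ode mu (fun x => Lap 0 (Vf mu) (a x) (b x)) (fun x => Lap (PI / 2) (Vf mu) (a x) (b x))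
    (fun x => Lap 0 (Uf mu) (a x) (b x)) (fun x => Lap (PI / 2) (Uf mu) (a x) (b x))
    q1 q2 _ _ _ _ x DV0 DV1 DU0 DU1 (Dq1 x) (Dq2 x) E0 E1). }
assert (HG : forall F : R -> R, (forall x, 0 < x -> is_derive F x (mu * F x)) ->
  (exists B, forall x, 4 / cos th + 4 <= x -> Rabs (F x) <= B) -> F s = 0).
{ intros F HF [B HB].
  assert (Hconst : forall x, s < x -> F s = F x * exp (- (mu * (x - s)))).
  { intros x Hx.
    transitivity (F s * exp (- (mu * (s - s)))).
    { replace (- (mu * (s - s))) with 0 by ring; rewrite exp_0; ring. }
    apply (eq_is_derive (V := R_NormedModule) (fun x => F x * exp (- (mu * (x - s))))); auto.
    intros t Ht; pose proof (HF t ltac:(lra)) as D.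
    evar_last; [auto_derive; [eexists; eauto|reflexivity]|].
    subst_Derive; unfold zero; simpl; ring. }
  apply Rabs_eq_0.
  assert (H0 : 0 < 4 / cos th) by (apply Rdiv_lt_0_compat; lra).
  destruct (Rle_lt_dec (Rabs (F s)) 0) as [Hle|Hlt]; [pose proof (Rabs_pos (F s)); lra|exfalso].
  (* The last summand makes mu (x - s) |F s| at least |B|; since exp y >= 1 + y, the bound B is then
     exceeded at x. *)
  set (x := 4 / cos th + 4 + s + Rabs B / Rabs (F s) / mu).
  assert (HBp : 0 <= Rabs B / Rabs (F s) / mu).
  { unfold Rdiv; repeat apply Rmult_le_pos; try (left; apply Rinv_0_lt_compat; lra); apply Rabs_pos. }
  pose proof (Hconst x ltac:(unfold x; lra)) as E.
  pose proof (HB x ltac:(unfold x; lra)) as HBx.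
  rewrite exp_Ropp in E.
  pose proof (exp_ineq1_le (mu * (x - s))) as He.
  pose proof (exp_pos (mu * (x - s))) as Hep.
  assert (E' : Rabs (F s) * exp (mu * (x - s)) = Rabs (F x)).
  { rewrite <- (Rabs_pos_eq (exp _)), <- Rabs_mult by lra; f_equal; rewrite E; field; lra. }
  assert (Rabs B < Rabs (F s) * exp (mu * (x - s))).
  { apply Rlt_le_trans with (Rabs (F s) * (1 + mu * (x - s))); [|apply Rmult_le_compat_l; lra].
    assert (mu * (Rabs B / Rabs (F s) / mu) <= mu * (x - s)) by (apply Rmult_le_compat_l; unfold x; lra).
    replace (mu * (Rabs B / Rabs (F s) / mu)) with (Rabs B / Rabs (F s)) in * by (field; lra).
    replace (Rabs B) with (Rabs (F s) * (Rabs B / Rabs (F s))) at 1 by (field; lra).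
    apply Rmult_lt_compat_l; lra. }
  pose proof (Rle_abs B); lra. }
destruct (Lap_Bessel_bound mu Hmu) as [B [HB0 HB]].
(* As sinh x >= x / 2, the threshold yields a >= 2. As cosh x <= 2 sinh x, both parts of q are at
   most 2 sinh x, and the factor sinh x cancels against a = sinh x cos th. *)
assert (Hbd : forall x, 4 / cos th + 4 <= x -> 2 <= a x /\
  Rabs (q1 x) * (2 / a x) <= 4 / cos th /\ Rabs (q2 x) * (2 / a x) <= 4 / cos th).
{ intros x Hx.
  assert (H0 : 0 < 4 / cos th) by (apply Rdiv_lt_0_compat; lra).
  assert (Hax : 2 <= a x).
  { unfold a; pose proof (sinh_lower x ltac:(lra)).
    apply Rle_trans with (4 / cos th / 2 * cos th); [right; field; lra|].
    apply Rmult_le_compat_r; lra. }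
  pose proof (cosh_upper x ltac:(lra)); pose proof (Hsh x ltac:(lra)).
  assert (HX : forall y, Rabs y <= 2 * sinh x -> Rabs y * (2 / a x) <= 4 / cos th).
  { intros y Hy; apply Rle_trans with (2 * sinh x * (2 / a x)).
    - apply Rmult_le_compat_r; auto; left; apply Rdiv_lt_0_compat; lra.
    - right; unfold a; field; lra. }
  assert (0 < cosh x) by (unfold cosh; pose proof (exp_pos x); pose proof (exp_pos (- x)); lra).
  split; [auto|split]; apply HX.
  - unfold q1; rewrite Rabs_mult, (Rabs_pos_eq (cosh x)), (Rabs_pos_eq (cos th)) by lra.
    pose proof (COS_bound th); nra.
  - unfold q2; rewrite Rabs_mult, (Rabs_pos_eq (sinh x)) by lra.
    assert (Rabs (sin th) <= 1) by (apply Rabs_le, SIN_bound); pose proof (Rabs_pos (sin th)); nra. }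
assert (Hprod : forall p phi x, 4 / cos th + 4 <= x -> Rabs p * (2 / a x) <= 4 / cos th ->
  Rabs (p * Lap phi (Uf mu) (a x) (b x)) <= 4 / cos th * B).
{ intros p phi x Hx Hp; destruct (Hbd x Hx) as [Hax _]; destruct (HB phi (a x) (b x) Hax) as [HV HU].
  rewrite Rabs_mult; apply Rle_trans with (Rabs p * (2 / a x * B)).
  - apply Rmult_le_compat_l; [apply Rabs_pos|auto].
  - rewrite <- Rmult_assoc; apply Rmult_le_compat_r; auto. }
assert (HF : F0 s = 0 /\ F1 s = 0); [|exact HF].
split; [apply (HG F0 (fun x Hx => proj1 (DF x Hx)))|apply (HG F1 (fun x Hx => proj2 (DF x Hx)))];
  exists (mu * B + (4 / cos th * B + 4 / cos th * B)); intros x Hx;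
  destruct (Hbd x Hx) as [Hax [Hq1 Hq2]]; unfold F0, F1, lapN0, lapN1.
- destruct (HB 0 (a x) (b x) Hax) as [HV _].
  pose proof (Hprod _ 0 x Hx Hq1); pose proof (Hprod _ (PI / 2) x Hx Hq2).
  unfold Rminus; apply Rle_trans with (1 := Rabs_triang _ _); rewrite Rabs_Ropp, Rabs_mult, (Rabs_pos_eq mu) by lra.
  apply Rplus_le_compat; [nra|].
  apply Rle_trans with (1 := Rabs_triang _ _); rewrite Rabs_Ropp; lra.
- destruct (HB (PI / 2) (a x) (b x) Hax) as [HV _].
  pose proof (Hprod _ (PI / 2) x Hx Hq1); pose proof (Hprod _ 0 x Hx Hq2).
  unfold Rminus; apply Rle_trans with (1 := Rabs_triang _ _); rewrite Rabs_Ropp, Rabs_mult, (Rabs_pos_eq mu) by lra.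
  apply Rplus_le_compat; [nra|].
  apply Rle_trans with (1 := Rabs_triang _ _); lra.
Qed.

Lemma II_rescale a f l : 0 < a -> II f l -> II (fun t => a * f (a * t)) l.
Proof.
intros Ha H P HP; destruct (H P HP) as [Q1 Q2 H1 H2 HQ].
apply Filter_prod with (fun x => Q1 (a * x)) (fun y => Q2 (a * y)).
- destruct (at_right_0_inv _ H1) as [d [Hd Hd']].
  apply at_right_0_intro with (d / a); [apply Rdiv_lt_0_compat; lra|].
  intros x Hx; apply Hd'; split; [apply Rmult_lt_0_compat; lra|].
  apply Rmult_lt_reg_l with (/ a); [apply Rinv_0_lt_compat, Ha|].
  replace (/ a * (a * x)) with x by (field; lra).
  replace (/ a * d) with (d / a) by (unfold Rdiv; ring); lra.
- destruct H2 as [T HT]; exists (T / a); intros y Hy; apply HT.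
  apply Rmult_lt_reg_l with (/ a); [apply Rinv_0_lt_compat, Ha|].
  replace (/ a * (a * y)) with y by (field; lra).
  replace (/ a * T) with (T / a) by (unfold Rdiv; ring); lra.
- intros x y Hx Hy; destruct (HQ _ _ Hx Hy) as [z [Hz HPz]]; exists z; split; auto.
  simpl in *.
  assert (Hz' : is_RInt f (a * x + 0) (a * y + 0) z) by (rewrite !Rplus_0_r; exact Hz).
  pose proof (is_RInt_comp_lin (V := R_NormedModule) f a 0 x y z Hz') as HI.
  refine (is_RInt_ext (V := R_NormedModule) _ _ x y z _ HI).
  intros t _; unfold scal; simpl; unfold mult; simpl; rewrite Rplus_0_r; reflexivity.
Qed.

Lemma Gamma_laplace s a : 0 < s -> 0 < a ->
  II (fun t => exp (- (a * t)) * Rpower t (s - 1)) (Gamma_pos s * Rpower a (- s)).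
Proof.
intros Hs Ha.
rewrite Rmult_comm.
refine (II_ext _ _ _ _ (II_scal _ (Rpower a (- s)) _ (II_rescale a _ _ Ha (Gamma_pos_II s Hs)))).
intros t Ht.
replace (Rpower a (- s) * (a * (Rpower (a * t) (s - 1) * exp (- (a * t)))))
  with (Rpower a (- s) * a * (Rpower (a * t) (s - 1) * exp (- (a * t)))) by ring.
rewrite <- Rpower_mult_distr by auto.
rewrite <- (Rpower_1 a) at 2 by auto.
replace (Rpower a (- s) * Rpower a 1 * (Rpower a (s - 1) * Rpower t (s - 1) * exp (- (a * t))))
  with (Rpower a (- s) * Rpower a 1 * Rpower a (s - 1) * (exp (- (a * t)) * Rpower t (s - 1))) by ring.
rewrite <- !Rpower_plus.
replace (- s + 1 + (s - 1)) with 0 by ring; rewrite Rpower_O by auto; ring.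
Qed.

Lemma bser_near_1 mu M y : exp_type (bcoef mu) M 1 -> 0 <= y <= 1 ->
  Rabs (bser mu y - 1) <= y * (M * exp 1).
Proof.
intros HM Hy; unfold bser.
rewrite PSeries_decr_1 by (eapply ex_pseries_exp_type, HM).
replace (bcoef mu 0) with 1 by (unfold bcoef; simpl; field).
replace (1 + y * PSeries (PS_decr_1 (bcoef mu)) y - 1) with (y * PSeries (PS_decr_1 (bcoef mu)) y) by ring.
rewrite Rabs_mult, (Rabs_pos_eq y) by lra; apply Rmult_le_compat_l; [lra|].
destruct HM as [HM0 [_ HM]].
assert (Hd : exp_type (PS_decr_1 (bcoef mu)) M 1).
{ split; [auto|split; [lra|]]; intros k; unfold PS_decr_1.
  apply Rle_trans with (1 := HM (S k)); rewrite !pow1, Rmult_1_r.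
  apply Rmult_le_compat_l; auto; apply Rinv_le_contravar; [apply INR_fact_pos|].
  rewrite fact_simpl, mult_INR, S_INR; pose proof (pos_INR k); pose proof (INR_fact_pos k); nra. }
apply Rle_trans with (1 := exp_type_PSeries _ _ _ y Hd).
apply Rmult_le_compat_l; auto.
rewrite Rabs_pos_eq, Rmult_1_l by lra.
destruct (Req_dec y 1) as [->|]; [lra|left; apply exp_increasing; lra].
Qed.

(** Near 0 the series is used; for t > 1 the two terms are bounded separately, each by a multiple of
    t^(mu + 1). *)
Lemma Jh_leading mu : 0 < mu -> exists C, 0 <= C /\
  forall t, 0 < t -> Rabs (Jh mu t - Rpower (t / 2) mu) <= C * Rpower t (mu + 1).
Proof.
intros Hmu; assert (H : nonpole (mu + 1)) by (apply nonpole_pos; lra).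
destruct (bcoef_exp_type mu H) as [M HM].
destruct (Jh_dom mu Hmu) as [C [HC [_ H1]]].
assert (HM0 : 0 <= M) by apply HM.
assert (0 <= M * exp 1) by (apply Rmult_le_pos; [auto|left; apply exp_pos]).
exists (M * exp 1 + C + 1); split; [lra|].
intros t Ht; rewrite Rpower_plus, Rpower_1 by auto.
pose proof (Rpower_pos t mu) as Hp; pose proof (Rpower_pos (t / 2) mu) as Hp2.
assert (Hle : Rpower (t / 2) mu <= Rpower t mu) by (apply Rle_Rpower_l; lra).
destruct (Rle_dec t 1) as [Ht1|Ht1].
- unfold Jh.
  replace (Rpower (t / 2) mu * bser mu (t ^ 2 / 4) - Rpower (t / 2) mu)
    with (Rpower (t / 2) mu * (bser mu (t ^ 2 / 4) - 1)) by ring.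
  rewrite Rabs_mult, (Rabs_pos_eq (Rpower _ _)) by lra.
  pose proof (bser_near_1 mu M (t ^ 2 / 4) HM ltac:(nra)) as B.
  assert (B' : t ^ 2 / 4 * (M * exp 1) <= t * (M * exp 1 + C + 1)).
  { apply Rmult_le_compat; try lra; nra. }
  pose proof (Rabs_pos (bser mu (t ^ 2 / 4) - 1)).
  replace ((M * exp 1 + C + 1) * (Rpower t mu * t)) with (Rpower t mu * (t * (M * exp 1 + C + 1))) by ring.
  apply Rmult_le_compat; lra.
- specialize (H1 t ltac:(lra)).
  assert (HJ : Rabs (Jh mu t) <= C).
  { apply Rle_trans with (1 := H1); rewrite Rpower_Ropp.
    pose proof (Rpower_ge_1 t (1 / 2) ltac:(lra) ltac:(lra)) as Hq.
    pose proof (Rinv_le_1 _ Hq). nra. }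
  unfold Rminus; apply Rle_trans with (1 := Rabs_triang _ _).
  rewrite Rabs_Ropp, (Rabs_pos_eq (Rpower _ _)) by lra.
  pose proof (Rpower_ge_1 t mu ltac:(lra) ltac:(lra)).
  assert (1 <= Rpower t mu * t) by nra.
  assert (Rpower t mu <= Rpower t mu * t) by nra.
  set (z := Rpower t mu * t) in *. nra.
Qed.

(** The first step of Watson's lemma. This is where [Gamma] enters: the transform of the leading
    term of [Vf mu] is an Euler integral. *)
Lemma Lap_Vf_leading mu : 0 < mu -> exists C, 0 <= C /\ forall a, 0 < a ->
  Rabs (Lap 0 (Vf mu) a 0 - Gamma_pos mu * Rpower (2 * a) (- mu)) <= C * Rpower a (- (mu + 1)).
Proof.
intros Hmu.
destruct (Jh_leading mu Hmu) as [C [HC HJ]].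
destruct (Jh_div_class mu Hmu) as [C' Hf]; fold (Vf mu) in Hf.
exists (C * Gamma_pos (mu + 1)).
pose proof (Gamma_pos_gt0 (mu + 1) ltac:(lra)).
split; [apply Rmult_le_pos; lra|].
intros a Ha.
assert (I := II_plus _ _ _ _ (Lap_II _ _ _ _ 0 a 0 Hf Ha)
  (II_scal _ (- Rpower 2 (- mu)) _ (Gamma_laplace mu a Hmu Ha))).
assert (B := II_scal _ C _ (Gamma_laplace (mu + 1) a ltac:(lra) Ha)).
rewrite <- Rpower_mult_distr, Rmult_assoc by lra.
replace (Lap 0 (Vf mu) a 0 - Gamma_pos mu * (Rpower 2 (- mu) * Rpower a (- mu)))
  with (Lap 0 (Vf mu) a 0 + - Rpower 2 (- mu) * (Gamma_pos mu * Rpower a (- mu))) by ring.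
refine (II_le _ _ _ _ _ I B).
intros t Ht; unfold lkern, Vf.
replace (0 * t + 0) with 0 by ring; rewrite cos_0.
replace (exp (- (a * t)) * 1 * (Jh mu t / t) + - Rpower 2 (- mu) * (exp (- (a * t)) * Rpower t (mu - 1)))
  with (exp (- (a * t)) * / t * (Jh mu t - Rpower (t / 2) mu)).
- rewrite !Rabs_mult, Rabs_inv, (Rabs_pos_eq t), (Rabs_pos_eq (exp _)) by (try lra; left; apply exp_pos).
  pose proof (HJ t Ht) as HJt.
  replace (C * (exp (- (a * t)) * Rpower t (mu + 1 - 1))) with (exp (- (a * t)) * / t * (C * Rpower t (mu + 1))).
  + apply Rmult_le_compat_l; auto; apply Rmult_le_pos; [left; apply exp_pos|left; apply Rinv_0_lt_compat, Ht].
  + replace (mu + 1 - 1) with mu by ring; rewrite Rpower_plus, Rpower_1 by auto; field; lra.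
- unfold Rdiv at 1; rewrite <- Rpower_mult_distr by lra.
  unfold Rminus at 2; rewrite Rpower_plus, (Rpower_Ropp t 1), Rpower_1, (Rpower_Ropp 2) by auto.
  assert (E : Rpower (/ 2) mu = / Rpower 2 mu).
  { unfold Rpower; rewrite ln_Rinv, <- exp_Ropp by lra; f_equal; ring. }
  rewrite E; field; split; [lra|]; pose proof (Rpower_pos 2 mu); lra.
Qed.

Lemma is_derive_mult_exp_const (F : R -> R) k a b : a < b ->
  (forall t, a <= t <= b -> is_derive F t (k * F t)) ->
  F a * exp (- (k * a)) = F b * exp (- (k * b)).
Proof.
intros Hab HF.
apply (eq_is_derive (V := R_NormedModule) (fun t => F t * exp (- (k * t)))); auto.
intros t Ht; pose proof (HF t Ht) as D.
evar_last; [auto_derive; [eexists; eauto|reflexivity]|].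
subst_Derive; unfold zero; simpl; ring.
Qed.

Lemma filterlim_eq_of_bound (g h : R -> R) x l :
  filterlim g (at_right 0) (locally l) -> filterlim h (at_right 0) (locally 0) ->
  (forall s, 0 < s < 1 -> Rabs (x - g s) <= h s) -> x = l.
Proof.
intros Hg Hh H.
destruct (Req_dec x l) as [|Hne]; auto; exfalso.
assert (He : 0 < Rabs (x - l) / 4) by (apply Rdiv_lt_0_compat; [apply Rabs_pos_lt; lra|lra]).
assert (A1 : at_right 0 (fun s => Rabs (g s - l) < Rabs (x - l) / 4)) by exact (Hg _ (locally_Rabs _ _ He)).
assert (A2 : at_right 0 (fun s => Rabs (h s - 0) < Rabs (x - l) / 4)) by exact (Hh _ (locally_Rabs _ _ He)).
destruct (at_right_0_inv _ A1) as [d1 [Hd1 B1]]; destruct (at_right_0_inv _ A2) as [d2 [Hd2 B2]].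
set (s := Rmin (Rmin d1 d2) 1 / 2).
assert (0 < Rmin (Rmin d1 d2) 1) by (repeat apply Rmin_glb_lt; lra).
pose proof (Rmin_l (Rmin d1 d2) 1); pose proof (Rmin_r (Rmin d1 d2) 1).
pose proof (Rmin_l d1 d2); pose proof (Rmin_r d1 d2).
specialize (B1 s ltac:(unfold s; lra)); specialize (B2 s ltac:(unfold s; lra)).
specialize (H s ltac:(unfold s; lra)).
replace (x - l) with ((x - g s) + (g s - l)) in * by ring.
pose proof (Rabs_triang (x - g s) (g s - l)).
rewrite Rminus_0_r in B2; pose proof (Rle_abs (h s)); lra.
Qed.

Lemma filterlim_at_right_continuous (g : R -> R) : continuous g 0 ->
  filterlim g (at_right 0) (locally (g 0)).
Proof.
intros Hg P HP; destruct (Hg P HP) as [e He]; exists e; intros y Hy _; exact (He y Hy).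
Qed.

(** Since mu V = q U, V satisfies V' = - mu V in s, so that V exp(mu s) is constant. The constant is
    found at infinity, where V is close to [Gamma_pos mu] times (2 sinh s)^(- mu). *)
Lemma V_real mu s : 0 < mu -> 0 < s ->
  Lap 0 (Vf mu) (sinh s) 0 = Gamma_pos mu * exp (- (mu * s)).
Proof.
intros Hmu Hs.
destruct (Jh_div_class mu Hmu) as [C Hf]; fold (Vf mu) in Hf.
set (F := fun s => Lap 0 (Vf mu) (sinh s) 0).
assert (Hsh : forall x, 0 < x -> 0 < sinh x).
{ intros x Hx; pose proof (sinh_lower x ltac:(lra)); lra. }
assert (HF : forall x, 0 < x -> is_derive F x (- mu * F x)).
{ intros x Hx.
  destruct (Lap_path _ _ _ _ sinh (fun _ => 0) x (cosh x) 0 Hf (Hsh x Hx) (is_derive_sinh x)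
    (is_derive_const (K := R_AbsRing) (V := R_NormedModule) 0 x)) as [D _].
  destruct (N_zero mu 0 x Hmu ltac:(rewrite cos_0; lra) Hx) as [E _].
  unfold lapN0 in E; rewrite cos_0, sin_0, !Rmult_0_r, !Rmult_1_r, Rmult_0_l in E.
  unfold F; evar_last; [exact D|]; fold (Uf mu); eqR; lra. }
assert (Hc : forall x, s < x -> F s * exp (mu * s) = F x * exp (mu * x)).
{ intros x Hx.
  pose proof (is_derive_mult_exp_const F (- mu) s x Hx (fun t Ht => HF t ltac:(lra))) as E.
  replace (- (- mu * s)) with (mu * s) in E by ring; replace (- (- mu * x)) with (mu * x) in E by ring; exact E. }
destruct (Lap_Vf_leading mu Hmu) as [D [HD HL]].
(* Infinity is brought to 0 by w = exp(- x), for which 2 sinh x = (1 - w^2) / w: [g] is then the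
   leading term times exp(mu x), and [h] bounds the error. *)
set (g := fun u => Gamma_pos mu * Rpower (1 - u ^ 2) (- mu)).
set (h := fun u => D * (Rpower (1 / 4) (- (mu + 1)) * u)).
assert (Key : F s * exp (mu * s) = Gamma_pos mu).
{ replace (Gamma_pos mu) with (g 0).
  2: { unfold g; replace (1 - 0 ^ 2) with 1 by ring; unfold Rpower; rewrite ln_1, Rmult_0_r, exp_0; ring. }
  (* With w below this value x exceeds s + 1, so that the constancy between s and x applies; w <=
     1/2 also gives sinh x >= 1 / (4 w). *)
  set (s0 := exp (- (s + 1))).
  assert (Hs0 : 0 < s0 <= / 2).
  { split; [apply exp_pos|]; unfold s0; rewrite exp_Ropp; apply Rinv_le_contravar; [lra|].
    pose proof (exp_ineq1_le (s + 1)); lra. }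
  apply (filterlim_eq_of_bound (fun u => g (u * s0)) (fun u => h (u * s0))).
  - rewrite <- (Rmult_0_l s0) at 2.
    apply (filterlim_at_right_continuous (fun u => g (u * s0))).
    apply (ex_derive_continuous (fun u => g (u * s0))); unfold g, Rpower; auto_derive; lra.
  - assert (Hh0 : h (0 * s0) = 0) by (unfold h; ring); rewrite <- Hh0 at 2.
    apply (filterlim_at_right_continuous (fun u => h (u * s0))).
    apply (ex_derive_continuous (fun u => h (u * s0))); unfold h; auto_derive; auto.
  - intros u Hu; set (w := u * s0); assert (Hw : 0 < w < s0) by (unfold w; split; nra).
    set (x := - ln w).
    assert (Ew : exp (- x) = w) by (unfold x; rewrite Ropp_involutive; apply exp_ln; lra).
    assert (Hx : s + 1 < x).
    { apply Ropp_lt_cancel, exp_lt_inv; rewrite Ew; apply Hw. }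
    rewrite (Hc x ltac:(lra)).
    assert (Ex : exp x = / w) by (rewrite <- Ew, exp_Ropp, Rinv_inv; reflexivity).
    assert (E2 : 2 * sinh x = / w * (1 - w ^ 2)).
    { unfold sinh; rewrite Ew, Ex; field; lra. }
    assert (Hmx : exp (mu * x) = Rpower w (- mu)).
    { unfold Rpower, x; f_equal; ring. }
    pose proof (HL (sinh x) (Hsh x ltac:(lra))) as B.
    assert (Ew' : forall k, Rpower (/ w) k = Rpower w (- k)).
    { intros k; unfold Rpower; rewrite ln_Rinv by lra; f_equal; ring. }
    assert (0 < / w) by (apply Rinv_0_lt_compat; lra).
    rewrite E2, <- Rpower_mult_distr, Ew', Ropp_involutive in B by nra.
    unfold g, h; fold w.
    replace (F x * exp (mu * x) - Gamma_pos mu * Rpower (1 - w ^ 2) (- mu)) with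
      ((F x - Gamma_pos mu * (Rpower w mu * Rpower (1 - w ^ 2) (- mu))) * Rpower w (- mu)).
    2: { rewrite Hmx, (Rpower_Ropp w mu); field; pose proof (Rpower_pos w mu); lra. }
    rewrite Rabs_mult, (Rabs_pos_eq (Rpower _ _)) by (left; apply Rpower_pos).
    apply Rle_trans with (D * Rpower (sinh x) (- (mu + 1)) * Rpower w (- mu)).
    + apply Rmult_le_compat_r; [left; apply Rpower_pos|exact B].
    + rewrite Rmult_assoc; apply Rmult_le_compat_l; auto.
      replace (Rpower (1 / 4) (- (mu + 1)) * w) with (Rpower (/ w * (1 / 4)) (- (mu + 1)) * Rpower w (- mu)).
      2: { rewrite <- Rpower_mult_distr, Ew', Ropp_involutive, Rpower_plus, Rpower_1, (Rpower_Ropp w) by lra.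
           field; pose proof (Rpower_pos w mu); lra. }
      apply Rmult_le_compat_r; [left; apply Rpower_pos|].
      rewrite !Rpower_Ropp; apply Rinv_le_contravar; [apply Rpower_pos|].
      apply Rle_Rpower_l; [lra|split; [nra|]].
      assert (/ w * (1 / 2) <= / w * (1 - w ^ 2)) by (apply Rmult_le_compat_l; nra); lra. }
unfold F in Key; rewrite <- Key, exp_Ropp; field; pose proof (exp_pos (mu * s)); lra.
Qed.

(** At fixed s the relation mu V = q U reads dV / dth = - i mu V, so that V turns at constant speed
    from its real value at th = 0. *)
Lemma V_cplx mu s th : 0 < mu -> 0 < s -> 0 <= th < PI / 2 ->
  Lap 0 (Vf mu) (sinh s * cos th) (cosh s * sin th) = Gamma_pos mu * exp (- (mu * s)) * cos (mu * th) /\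
  Lap (PI / 2) (Vf mu) (sinh s * cos th) (cosh s * sin th) = - (Gamma_pos mu * exp (- (mu * s)) * sin (mu * th)).
Proof.
intros Hmu Hs Hth.
destruct (Jh_div_class mu Hmu) as [C Hf]; fold (Vf mu) in Hf.
pose proof PI_RGT_0 as HPI.
assert (Hsh : 0 < sinh s) by (pose proof (sinh_lower s ltac:(lra)); lra).
set (a := fun t => sinh s * cos t); set (b := fun t => cosh s * sin t).
set (F0 := fun t => Lap 0 (Vf mu) (a t) (b t)); set (F1 := fun t => Lap (PI / 2) (Vf mu) (a t) (b t)).
assert (HF : forall t, 0 <= t < PI / 2 -> is_derive F0 t (mu * F1 t) /\ is_derive F1 t (- mu * F0 t)).
{ intros t Ht.
  assert (Hcos : 0 < cos t) by (apply cos_gt_0; lra).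
  assert (Da : is_derive a t (- (sinh s * sin t))) by (unfold a; auto_derive; auto; ring).
  assert (Db : is_derive b t (cosh s * cos t)) by (unfold b; auto_derive; auto; ring).
  destruct (Lap_path _ _ _ _ a b t _ _ Hf (Rmult_lt_0_compat _ _ Hsh Hcos) Da Db) as [D0 D1].
  destruct (N_zero mu t s Hmu Hcos Hs) as [E0 E1]; unfold lapN0, lapN1 in E0, E1.
  split; [evar_last; [exact D0|]|evar_last; [exact D1|]]; fold (Uf mu); unfold F0, F1, a, b; eqR; lra. }
assert (HV0 : F0 0 = Gamma_pos mu * exp (- (mu * s))).
{ unfold F0, a, b; rewrite cos_0, sin_0, Rmult_1_r, Rmult_0_r; apply V_real; auto. }
assert (HV1 : F1 0 = 0).
{ unfold F1, a, b; rewrite cos_0, sin_0, Rmult_1_r, Rmult_0_r; apply RInt_gen_II.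
  replace 0 with (0 * Lap 0 (Vf mu) (sinh s) 0) at 2 by ring.
  refine (II_ext _ _ _ _ (II_scal _ 0 _ (Lap_II _ _ _ _ 0 (sinh s) 0 Hf Hsh))).
  intros t _; unfold lkern; replace (0 * t + PI / 2) with (PI / 2) by ring; rewrite cos_PI2; ring. }
set (c := cos (mu * th)); set (sn := sin (mu * th)).
(* [G k] is the real part of exp(i (mu t + k)) V, a constant; k = 0 and k = PI / 2 recover both
   components. *)
set (G := fun k : R => fun t => F0 t * cos (mu * t + k) - F1 t * sin (mu * t + k)).
assert (HG : forall k, G k th = G k 0).
{ intros k; destruct (Req_dec th 0) as [->|Hn]; auto.
  symmetry; apply (eq_is_derive (V := R_NormedModule) (G k)); [|lra].
  intros t Ht; destruct (HF t ltac:(lra)) as [D0 D1].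
  assert (Z : is_derive (G k) t (mu * F1 t * cos (mu * t + k) - F0 t * (mu * sin (mu * t + k))
    - (- mu * F0 t * sin (mu * t + k) + F1 t * (mu * cos (mu * t + k))))).
  { unfold G; clearbody F0 F1; auto_derive; [repeat split; eexists; eauto|]; subst_Derive; ring. }
  evar_last; [exact Z|]; unfold zero; simpl; ring. }
assert (G0 := HG 0); assert (G1 := HG (PI / 2)); unfold G in G0, G1.
rewrite !Rmult_0_r, !Rplus_0_r, !Rplus_0_l, cos_0, sin_0, HV0, HV1 in *.
rewrite cos_add_half_PI, cos_PI2, sin_PI2 in G1.
replace (sin (mu * th + PI / 2)) with (cos (mu * th)) in G1 by (rewrite sin_plus, cos_PI2, sin_PI2; ring).
fold c sn in G0, G1.
assert (Hcs : c ^ 2 + sn ^ 2 = 1) by (unfold c, sn; rewrite cos_sqr; ring).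
change (F0 th = Gamma_pos mu * exp (- (mu * s)) * c /\ F1 th = - (Gamma_pos mu * exp (- (mu * s)) * sn)).
set (W := Gamma_pos mu * exp (- (mu * s))) in *.
set (x := F0 th) in *; set (y := F1 th) in *; clearbody x y c sn W.
split.
- transitivity ((c ^ 2 + sn ^ 2) * x); [rewrite Hcs; ring|].
  transitivity (c * (x * c - y * sn) - sn * (x * - sn - y * c)); [ring|rewrite G0, G1; ring].
- transitivity ((c ^ 2 + sn ^ 2) * y); [rewrite Hcs; ring|].
  transitivity (- sn * (x * c - y * sn) - c * (x * - sn - y * c)); [ring|rewrite G0, G1; ring].
Qed.

(** * Passage to the imaginary axis *)

Lemma Vf_bounds mu : 0 < mu -> exists C, 0 <= C /\
  (forall t, 0 < t -> continuous (Vf mu) t) /\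
  (forall t, 0 < t <= 1 -> Rabs (Vf mu t) <= C * Rpower t (mu - 1)) /\
  (forall t, 1 <= t -> Rabs (Vf mu t) <= C * Rpower t (- (3 / 2))).
Proof.
intros Hmu; destruct (Jh_div_class mu Hmu) as [_ [_ [_ [Hc _]]]].
destruct (Jh_dom mu Hmu) as [C [HC [H0 H1]]].
exists C; split; [auto|split; [exact Hc|split]]; intros t Ht; unfold Vf, Rdiv;
  rewrite Rabs_mult, Rabs_inv, (Rabs_pos_eq t) by lra.
- unfold Rminus; rewrite Rpower_plus, Rpower_Ropp, Rpower_1 by lra.
  rewrite <- Rmult_assoc; apply Rmult_le_compat_r; auto.
  left; apply Rinv_0_lt_compat; lra.
- replace (- (3 * / 2)) with (- (1 / 2) + - (1)) by field.
  rewrite Rpower_plus, (Rpower_Ropp t 1), Rpower_1 by lra.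
  rewrite <- Rmult_assoc; apply Rmult_le_compat_r; auto.
  left; apply Rinv_0_lt_compat; lra.
Qed.

(* The weight [Rpower (1 + t) (1 / 4)] leaves room for Hoelder estimates. *)
Lemma Vf_dom mu g : 0 < mu -> (forall t, 0 < t -> continuous g t) ->
  (forall t, 0 < t -> Rabs (g t) <= 2 * Rpower (1 + t) (1 / 4)) ->
  exists e C, 0 < e /\ 0 <= C /\ dom (fun t => g t * Vf mu t) e C.
Proof.
intros Hmu Hg Hb; destruct (Vf_bounds mu Hmu) as [C [HC [Hc [H0 H1]]]].
set (e := Rmin mu (1 / 4)).
assert (He : 0 < e) by (apply Rmin_glb_lt; lra).
pose proof (Rmin_l mu (1 / 4)) as Hm; pose proof (Rmin_r mu (1 / 4)) as Hm'; fold e in Hm, Hm'.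
exists e, (4 * C); split; [auto|split; [lra|split; [|split]]].
- intros t Ht; apply (continuous_mult g (Vf mu)); auto.
- intros t Ht; rewrite Rabs_mult.
  assert (G : Rabs (g t) <= 4).
  { apply Rle_trans with (1 := Hb t ltac:(lra)).
    apply Rle_trans with (2 * Rpower 2 1); [|rewrite Rpower_1; lra].
    apply Rmult_le_compat_l; [lra|].
    apply Rle_trans with (Rpower 2 (1 / 4)); [apply Rle_Rpower_l; lra|apply Rle_Rpower; lra]. }
  rewrite Rmult_assoc; apply Rmult_le_compat; auto; try apply Rabs_pos.
  apply Rle_trans with (1 := H0 t Ht); apply Rmult_le_compat_l; auto.
  replace (mu - 1) with (e - 1 + (mu - e)) by ring; rewrite Rpower_plus.
  rewrite <- (Rmult_1_r (Rpower t (e - 1))) at 2.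
  apply Rmult_le_compat_l; [left; apply Rpower_pos|apply Rpower_le_1; lra].
- intros t Ht; rewrite Rabs_mult.
  assert (G : Rabs (g t) <= 4 * Rpower t (1 / 4)).
  { apply Rle_trans with (1 := Hb t ltac:(lra)).
    apply Rle_trans with (2 * (Rpower 2 1 * Rpower t (1 / 4))); [|rewrite Rpower_1 by lra; right; ring].
    apply Rmult_le_compat_l; [lra|].
    apply Rle_trans with (Rpower (2 * t) (1 / 4)); [apply Rle_Rpower_l; lra|].
    rewrite <- Rpower_mult_distr by lra; apply Rmult_le_compat_r; [left; apply Rpower_pos|].
    apply Rle_Rpower; lra. }
  apply Rle_trans with (4 * Rpower t (1 / 4) * (C * Rpower t (- (3 / 2)))).
  + apply Rmult_le_compat; auto; apply Rabs_pos.
  + replace (4 * Rpower t (1 / 4) * (C * Rpower t (- (3 / 2)))) with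
      (4 * C * (Rpower t (1 / 4) * Rpower t (- (3 / 2)))) by ring.
    rewrite <- Rpower_plus; apply Rmult_le_compat_l; [lra|]; apply Rle_Rpower; lra.
Qed.

Lemma Rabs_lipschitz (F dF : R -> R) M x y :
  (forall t, is_derive F t (dF t)) -> (forall t, Rabs (dF t) <= M) ->
  Rabs (F x - F y) <= M * Rabs (x - y).
Proof.
intros HF HM; destruct (MVT_gen F y x dF) as [c [_ E]].
- intros; apply HF.
- intros; apply derivable_continuous_pt; eexists; apply is_derive_Reals, HF.
- rewrite E, Rabs_mult; apply Rmult_le_compat_r; [apply Rabs_pos|auto].
Qed.

Lemma cos_lipschitz x y : Rabs (cos x - cos y) <= Rabs (x - y).
Proof.
rewrite <- (Rmult_1_l (Rabs (x - y))).
apply (Rabs_lipschitz cos (fun t => - sin t)); [apply is_derive_cos|].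
intros; rewrite Rabs_Ropp; apply Rabs_le, SIN_bound.
Qed.

Lemma sin_lipschitz x y : Rabs (sin x - sin y) <= Rabs (x - y).
Proof.
rewrite <- (Rmult_1_l (Rabs (x - y))).
apply (Rabs_lipschitz sin cos); [apply is_derive_sin|].
intros; apply Rabs_le, COS_bound.
Qed.

(** Interpolates between a trivial bound and a Lipschitz bound. The exponent 1/4 is small enough for
    t^(1/4) t^(-3/2) to remain integrable at infinity. *)
Lemma holder_quarter z y : 0 < y -> z <= 2 -> z <= y -> z <= 2 * Rpower y (1 / 4).
Proof.
intros Hy H2 H; destruct (Rle_dec y 1) as [H1|H1].
- assert (y <= Rpower y (1 / 4)).
  { rewrite <- (Rpower_1 y) at 1 by auto.
    replace 1 with (1 / 4 + 3 / 4) at 1 by field; rewrite Rpower_plus.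
    rewrite <- (Rmult_1_r (Rpower y (1 / 4))) at 2.
    apply Rmult_le_compat_l; [left; apply Rpower_pos|apply Rpower_le_1; lra]. }
  lra.
- pose proof (Rpower_ge_1 y (1 / 4) ltac:(lra) ltac:(lra)); lra.
Qed.

Lemma weighted_Vf mu : 0 < mu -> exists L, 0 <= L /\
  II (fun t => Rpower (1 + t) (1 / 4) * Rabs (Vf mu t)) L.
Proof.
intros Hmu.
destruct (Vf_dom mu (fun t => Rpower (1 + t) (1 / 4)) Hmu) as [e [C [He [HC [D1 [D2 D3]]]]]].
- intros t Ht; apply (ex_derive_continuous (fun t => Rpower (1 + t) (1 / 4))).
  unfold Rpower; auto_derive; lra.
- intros t Ht; pose proof (Rpower_pos (1 + t) (1 / 4)); rewrite Rabs_pos_eq; lra.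
- destruct (dom_II (fun t => Rpower (1 + t) (1 / 4) * Rabs (Vf mu t)) e C He HC) as [L HL].
  + split; [|split].
    * intros t Ht; apply continuous_ext with (fun t => Rabs (Rpower (1 + t) (1 / 4) * Vf mu t)).
      { intros x; rewrite Rabs_mult, (Rabs_pos_eq (Rpower _ _)); [reflexivity|left; apply Rpower_pos]. }
      apply continuous_Rabs_comp, D1, Ht.
    * intros t Ht; rewrite Rabs_mult, Rabs_Rabsolu, <- Rabs_mult; auto.
    * intros t Ht; rewrite Rabs_mult, Rabs_Rabsolu, <- Rabs_mult; auto.
  + exists L; split; auto; refine (II_ge0 _ _ _ HL); intros t Ht.
    apply Rmult_le_pos; [left; apply Rpower_pos|apply Rabs_pos].
Qed.

Lemma weight_ge_1 t : 0 < t -> 1 <= Rpower (1 + t) (1 / 4).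
Proof. intros; apply Rpower_ge_1; lra. Qed.

Lemma V_imag_aux mu phi b : 0 < mu -> exists l, II (fun t => cos (b * t + phi) * Vf mu t) l.
Proof.
intros Hmu; destruct (Vf_dom mu (fun t => cos (b * t + phi)) Hmu) as [e [C [He [HC D]]]].
- intros t Ht; apply (ex_derive_continuous (fun t => cos (b * t + phi))); auto_derive; auto.
- intros t Ht; pose proof (weight_ge_1 t Ht).
  assert (Rabs (cos (b * t + phi)) <= 1) by (apply Rabs_le, COS_bound); lra.
- apply (dom_II _ e C); auto.
Qed.

(** The two kernels differ by at most 2, and also by at most (exp s - 1) t: the frequency moves by
    at most cosh s - 1 and the damping rate is at most sinh s, and sinh s + cosh s = exp s. *)
Lemma V_imag_approx mu phi th s l : 0 < mu -> 0 < s -> 0 <= th < PI / 2 ->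
  forall L, II (fun t => Rpower (1 + t) (1 / 4) * Rabs (Vf mu t)) L ->
  II (fun t => cos (sin th * t + phi) * Vf mu t) l ->
  Rabs (l - Lap phi (Vf mu) (sinh s * cos th) (cosh s * sin th)) <= 2 * Rpower (exp s - 1) (1 / 4) * L.
Proof.
intros Hmu Hs Hth L HL Hl.
destruct (Jh_div_class mu Hmu) as [C Hf]; fold (Vf mu) in Hf.
pose proof PI_RGT_0.
assert (Hsh : 0 < sinh s) by (pose proof (sinh_lower s ltac:(lra)); lra).
assert (Hcos : 0 < cos th) by (apply cos_gt_0; lra).
assert (Hsin : 0 <= sin th) by (apply sin_ge_0; lra).
pose proof (COS_bound th); pose proof (SIN_bound th).
assert (Hch : 1 <= cosh s).
{ assert (cosh s ^ 2 = 1 + sinh s ^ 2) by apply cosh_sqr.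
  assert (0 < cosh s) by (unfold cosh; pose proof (exp_pos s); pose proof (exp_pos (- s)); lra). nra. }
assert (Hes : exp s = sinh s + cosh s) by (unfold sinh, cosh; field).
set (a := sinh s * cos th); set (b := cosh s * sin th).
assert (Ha : 0 < a) by (apply Rmult_lt_0_compat; auto).
set (D := exp s - 1).
assert (HD : 0 < D) by (unfold D; lra).
assert (I := II_plus _ _ _ _ Hl (II_scal _ (-1) _ (Lap_II _ _ _ _ phi a b Hf Ha))).
replace (l - Lap phi (Vf mu) a b) with (l + -1 * Lap phi (Vf mu) a b) by ring.
refine (II_le _ _ _ _ _ I (II_scal _ (2 * Rpower D (1 / 4)) _ HL)).
intros t Ht; unfold lkern.
replace (cos (sin th * t + phi) * Vf mu t + -1 * (exp (- (a * t)) * cos (b * t + phi) * Vf mu t))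
  with ((cos (sin th * t + phi) - exp (- (a * t)) * cos (b * t + phi)) * Vf mu t) by ring.
rewrite Rabs_mult.
replace (2 * Rpower D (1 / 4) * (Rpower (1 + t) (1 / 4) * Rabs (Vf mu t))) with
  (2 * (Rpower D (1 / 4) * Rpower (1 + t) (1 / 4)) * Rabs (Vf mu t)) by ring.
apply Rmult_le_compat_r; [apply Rabs_pos|].
rewrite Rpower_mult_distr by lra.
assert (Hc1 : Rabs (cos (sin th * t + phi)) <= 1) by (apply Rabs_le, COS_bound).
assert (Hc2 : Rabs (cos (b * t + phi)) <= 1) by (apply Rabs_le, COS_bound).
pose proof (exp_pos (- (a * t))) as Hep.
assert (He1 : 1 - exp (- (a * t)) <= a * t) by (pose proof (exp_ineq1_le (- (a * t))); lra).
assert (He2 : exp (- (a * t)) <= 1) by (rewrite <- exp_0; left; apply exp_increasing; nra).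
apply holder_quarter.
- apply Rmult_lt_0_compat; lra.
- unfold Rminus; apply Rle_trans with (1 := Rabs_triang _ _).
  rewrite Rabs_Ropp, Rabs_mult, (Rabs_pos_eq (exp _)) by lra.
  pose proof (Rabs_pos (cos (b * t + phi))); nra.
- replace (cos (sin th * t + phi) - exp (- (a * t)) * cos (b * t + phi)) with
    ((cos (sin th * t + phi) - cos (b * t + phi)) + (1 - exp (- (a * t))) * cos (b * t + phi)) by ring.
  apply Rle_trans with (1 := Rabs_triang _ _).
  rewrite (Rabs_mult (1 - _)), (Rabs_pos_eq (1 - _)) by lra.
  pose proof (cos_lipschitz (sin th * t + phi) (b * t + phi)) as Hl1.
  replace (sin th * t + phi - (b * t + phi)) with (- ((cosh s - 1) * sin th * t)) in Hl1 by (unfold b; ring).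
  rewrite Rabs_Ropp, (Rabs_pos_eq ((cosh s - 1) * sin th * t)) in Hl1 by (repeat apply Rmult_le_pos; lra).
  pose proof (Rabs_pos (cos (b * t + phi))).
  apply Rle_trans with (D * t); [|nra].
  assert ((cosh s - 1) * sin th <= cosh s - 1) by nra.
  assert (a <= sinh s) by (unfold a; nra).
  unfold D; rewrite Hes.
  assert ((cosh s - 1) * sin th * t <= (cosh s - 1) * t) by (apply Rmult_le_compat_r; lra).
  assert (a * t <= sinh s * t) by (apply Rmult_le_compat_r; lra).
  nra.
Qed.

Lemma exp_small_holder L : 0 <= L ->
  filterlim (fun s => 2 * Rpower (exp s - 1) (1 / 4) * L) (at_right 0) (locally 0).
Proof.
intros HL; apply filterlim_at_right_0; intros eps He.
destruct (Rpower_small (1 / 4) (eps / (2 * L + 1)) ltac:(lra)) as [d [Hd Hd']].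
{ apply Rdiv_lt_0_compat; lra. }
exists (ln (1 + d)); split.
- rewrite <- ln_1; apply ln_increasing; lra.
- intros s Hs.
  assert (Hes : 0 < exp s - 1 < d).
  { split; [pose proof (exp_ineq1 s ltac:(lra)); lra|].
    assert (exp s < 1 + d); [|lra].
    rewrite <- (exp_ln (1 + d)) by lra; apply exp_increasing, Hs. }
  pose proof (Hd' _ Hes); pose proof (Rpower_pos (exp s - 1) (1 / 4)).
  rewrite Rminus_0_r, Rabs_pos_eq by (repeat apply Rmult_le_pos; lra).
  apply Rle_lt_trans with ((2 * L) * (eps / (2 * L + 1))).
  + replace (2 * Rpower (exp s - 1) (1 / 4) * L) with ((2 * L) * Rpower (exp s - 1) (1 / 4)) by ring.
    apply Rmult_le_compat_l; lra.
  + apply Rmult_lt_reg_r with (2 * L + 1); [lra|].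
    replace (2 * L * (eps / (2 * L + 1)) * (2 * L + 1)) with (2 * L * eps) by (field; lra). nra.
Qed.

(** Let s tend to 0 at fixed th, so that p tends to i sin th. The closed form is available only for
    positive real part of p; on the axis itself the integral exists because [Vf] decays like
    t^(-3/2). *)
Lemma V_imag mu th : 0 < mu -> 0 <= th < PI / 2 ->
  II (fun t => cos (sin th * t) * Vf mu t) (Gamma_pos mu * cos (mu * th)) /\
  II (fun t => sin (sin th * t) * Vf mu t) (Gamma_pos mu * sin (mu * th)).
Proof.
intros Hmu Hth.
destruct (weighted_Vf mu Hmu) as [L [HL0 HL]].
assert (Hlim : forall k, filterlim (fun s => Gamma_pos mu * exp (- (mu * s)) * k) (at_right 0)
  (locally (Gamma_pos mu * k))).
{ intros k; replace (Gamma_pos mu * k) with (Gamma_pos mu * exp (- (mu * 0)) * k)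
    by (rewrite Rmult_0_r, Ropp_0, exp_0; ring).
  apply (filterlim_at_right_continuous (fun s => Gamma_pos mu * exp (- (mu * s)) * k)).
  apply (ex_derive_continuous (fun s => Gamma_pos mu * exp (- (mu * s)) * k)); auto_derive; auto. }
assert (Hmain : forall phi k, (forall s, 0 < s -> Lap phi (Vf mu) (sinh s * cos th) (cosh s * sin th)
   = Gamma_pos mu * exp (- (mu * s)) * k) ->
   II (fun t => cos (sin th * t + phi) * Vf mu t) (Gamma_pos mu * k)).
{ intros phi k Hk; destruct (V_imag_aux mu phi (sin th) Hmu) as [l Hl].
  rewrite <- (filterlim_eq_of_bound (fun s => Gamma_pos mu * exp (- (mu * s)) * k)
    (fun s => 2 * Rpower (exp s - 1) (1 / 4) * L) l (Gamma_pos mu * k) (Hlim k) (exp_small_holder L HL0)); auto.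
  intros s Hs; rewrite <- Hk by lra; apply V_imag_approx; auto; lra. }
split.
- refine (II_ext _ _ _ _ (Hmain 0 (cos (mu * th)) _)).
  + intros t _; rewrite Rplus_0_r; auto.
  + intros s Hs; exact (proj1 (V_cplx mu s th Hmu Hs Hth)).
- assert (H := Hmain (PI / 2) (- sin (mu * th))).
  replace (Gamma_pos mu * sin (mu * th)) with (-1 * (Gamma_pos mu * - sin (mu * th))) by ring.
  refine (II_ext _ _ _ _ (II_scal _ (-1) _ (H _))).
  + intros t _; rewrite cos_add_half_PI; ring.
  + intros s Hs; rewrite (proj2 (V_cplx mu s th Hmu Hs Hth)); ring.
Qed.

(** * Averaging over the angle *)

Lemma continuous_lipschitz (F : R -> R) M x : 0 <= M ->
  (forall y, Rabs (F y - F x) <= M * Rabs (y - x)) -> continuous F x.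
Proof.
intros HM H P [eps HP].
assert (Hd : 0 < eps / (M + 1)) by (pose proof (cond_pos eps); apply Rdiv_lt_0_compat; lra).
exists (mkposreal _ Hd); intros y Hy; apply HP.
change (Rabs (F y - F x) < eps).
assert (Hy' : Rabs (y - x) < eps / (M + 1)) by exact Hy.
apply Rle_lt_trans with (1 := H y).
apply Rle_lt_trans with (M * (eps / (M + 1))); [apply Rmult_le_compat_l; lra|].
pose proof (cond_pos eps); apply Rmult_lt_reg_r with (M + 1); [lra|].
replace (M * (eps / (M + 1)) * (M + 1)) with (M * eps) by (field; lra); nra.
Qed.

Lemma RInt_bound (f : R -> R) a b M : (forall x, continuous f x) ->
  (forall x, Rmin a b <= x <= Rmax a b -> Rabs (f x) <= M) -> Rabs (RInt f a b) <= M * Rabs (b - a).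
Proof.
intros Hc HM.
assert (Hex : forall u v, ex_RInt f u v)
  by (intros; apply (ex_RInt_continuous (V := R_CompleteNormedModule)); auto).
assert (H : forall u v, u <= v -> (forall x, u <= x <= v -> Rabs (f x) <= M) ->
  Rabs (RInt f u v) <= M * (v - u)).
{ intros u v Huv HM'; rewrite Rmult_comm.
  apply (norm_RInt_le_const (V := R_NormedModule) f u v (RInt f u v) M Huv HM').
  apply (RInt_correct (V := R_CompleteNormedModule)), Hex. }
destruct (Rle_dec a b) as [Hab|Hab].
- rewrite Rmin_left, Rmax_right in HM by auto.
  rewrite (Rabs_pos_eq (b - a)) by lra; apply H; auto.
- rewrite Rmin_right, Rmax_left in HM by lra.
  rewrite <- (opp_RInt_swap (V := R_CompleteNormedModule)) by apply Hex.
  change (opp (RInt f b a)) with (- RInt f b a).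
  rewrite Rabs_Ropp, Rabs_minus_sym, (Rabs_pos_eq (a - b)) by lra; apply H; auto; lra.
Qed.

(** The order of the two integrations is exchanged by varying the upper end p of the angular
    integral: the resulting function P of p has derivative K, with an error controlled by
    [holder_quarter]. The constant c stays on the left because it is mu^2 - 1 in one application and
    vanishes there for mu = 1. *)
Lemma II_average mu (k : R -> R -> R) (K Q : R -> R) c : 0 < mu ->
  (forall th t, Rabs (k th t) <= 1) ->
  (forall th th' t, 0 < t -> Rabs (k th t - k th' t) <= (1 + t) * Rabs (th - th')) ->
  (forall th t t', Rabs (k th t - k th t') <= Rabs (t - t')) ->
  (forall th, 0 <= th < PI / 2 -> II (fun t => k th t * Vf mu t) (K th)) ->
  (forall th, 0 < th < PI / 2 -> is_derive Q th (c * K th)) ->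
  (forall th, continuous Q th) ->
  exists P, II (fun t => RInt (fun th => k th t) 0 (PI / 2) * Vf mu t) P /\ c * P = Q (PI / 2) - Q 0.
Proof.
intros Hmu H1 Hth Ht HK HQ HQc.
pose proof PI_RGT_0 as HPI; pose proof PI_4 as HPI4.
destruct (weighted_Vf mu Hmu) as [L [HL0 HL]].
assert (kc : forall t, 0 < t -> forall th, continuous (fun th => k th t) th).
{ intros t Htt th; apply continuous_lipschitz with (1 + t); [lra|]; intros; apply Hth, Htt. }
assert (kex : forall t, 0 < t -> forall a b, ex_RInt (fun th => k th t) a b).
{ intros t Htt a b; apply (ex_RInt_continuous (V := R_CompleteNormedModule)); intros; apply kc, Htt. }
set (B := fun p t : R => RInt (fun th => k th t) 0 p).
assert (Bb : forall p t, 0 <= p <= PI / 2 -> 0 < t -> Rabs (B p t) <= 2).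
{ intros p t Hp Htt; apply Rle_trans with (1 * Rabs (p - 0)).
  - apply RInt_bound; [apply kc, Htt|intros; apply H1].
  - rewrite Rabs_pos_eq; lra. }
assert (Bc : forall p t, 0 <= p <= PI / 2 -> 0 < t -> continuous (B p) t).
{ intros p t Hp Htt P [eps HP].
  assert (Hd : 0 < Rmin t (eps / 3)) by (pose proof (cond_pos eps); apply Rmin_glb_lt; lra).
  exists (mkposreal _ Hd); intros u Hu; apply HP; change (Rabs (B p u - B p t) < eps).
  assert (Hu' : Rabs (u - t) < Rmin t (eps / 3)) by exact Hu.
  pose proof (Rmin_l t (eps / 3)); pose proof (Rmin_r t (eps / 3)).
  assert (Hu0 : 0 < u) by (apply Rabs_def2 in Hu'; lra).
  assert (E : B p u - B p t = RInt (fun th => k th u - k th t) 0 p).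
  { unfold B; symmetry; apply (RInt_minus (V := R_CompleteNormedModule) (fun th => k th u) (fun th => k th t)); auto. }
  rewrite E; apply Rle_lt_trans with (Rabs (u - t) * Rabs (p - 0)).
  - apply RInt_bound; [|intros; apply Ht].
    intros x; apply (continuous_minus (V := R_NormedModule) (fun th => k th u) (fun th => k th t)); apply kc; auto.
  - rewrite (Rabs_pos_eq (p - 0)) by lra; pose proof (Rabs_pos (u - t)); pose proof (cond_pos eps); nra. }
assert (Pex : forall p, 0 <= p <= PI / 2 -> exists l, II (fun t => B p t * Vf mu t) l).
{ intros p Hp; destruct (Vf_dom mu (B p) Hmu) as [e [C [He [HC D]]]].
  - intros t Htt; apply Bc; auto.
  - intros t Htt; pose proof (weight_ge_1 t Htt); pose proof (Bb p t Hp Htt); lra.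
  - apply (dom_II _ e C); auto. }
set (P := fun p => RInt_gen (V := R_CompleteNormedModule) (fun t => B p t * Vf mu t) (at_right 0) (Rbar_locally p_infty)).
assert (HP : forall p, 0 <= p <= PI / 2 -> II (fun t => B p t * Vf mu t) (P p)).
{ intros p Hp; destruct (Pex p Hp) as [l Hl]; unfold P; rewrite (RInt_gen_II _ _ Hl); exact Hl. }
assert (Bdiff : forall p q t, 0 < t -> B q t - B p t = RInt (fun th => k th t) p q).
{ intros p q t Htt; unfold B; rewrite <- (RInt_Chasles (fun th => k th t) 0 p q) by (apply kex, Htt).
  unfold plus; simpl; ring. }
assert (Plip : forall p q, 0 <= p <= PI / 2 -> 0 <= q <= PI / 2 -> Rabs (P q - P p) <= L * Rabs (q - p)).
{ intros p q Hp Hq.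
  assert (I := II_plus _ _ _ _ (HP q Hq) (II_scal _ (-1) _ (HP p Hp))).
  replace (P q - P p) with (P q + -1 * P p) by ring.
  replace (L * Rabs (q - p)) with (Rabs (q - p) * L) by ring.
  refine (II_le _ _ _ _ _ I (II_scal _ (Rabs (q - p)) _ HL)).
  intros t Htt.
  replace (B q t * Vf mu t + -1 * (B p t * Vf mu t)) with ((B q t - B p t) * Vf mu t) by ring.
  rewrite Bdiff, Rabs_mult by auto.
  rewrite <- Rmult_assoc; apply Rmult_le_compat_r; [apply Rabs_pos|].
  apply Rle_trans with (1 * Rabs (q - p)).
  - apply RInt_bound; [apply kc, Htt|intros; apply H1].
  - rewrite Rmult_comm; apply Rmult_le_compat_l; [apply Rabs_pos|apply weight_ge_1, Htt]. }
assert (Pder : forall p, 0 < p < PI / 2 -> is_derive P p (K p)).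
{ intros p Hp; apply is_derive_Reals; intros eps Heps.
  destruct (Rpower_small (1 / 4) (eps / (2 * L + 1)) ltac:(lra)) as [d [Hd Hd']].
  { apply Rdiv_lt_0_compat; lra. }
  assert (Hd0 : 0 < Rmin d (Rmin p (PI / 2 - p))) by (repeat apply Rmin_glb_lt; lra).
  exists (mkposreal _ Hd0); intros h Hh0 Hh; simpl in Hh.
  pose proof (Rmin_l d (Rmin p (PI / 2 - p))); pose proof (Rmin_r d (Rmin p (PI / 2 - p))).
  pose proof (Rmin_l p (PI / 2 - p)); pose proof (Rmin_r p (PI / 2 - p)).
  assert (Hh' : 0 < Rabs h) by (apply Rabs_pos_lt; auto).
  assert (Hq : 0 <= p + h <= PI / 2) by (apply Rabs_def2 in Hh; lra).
  assert (Hest : Rabs (P (p + h) - P p - h * K p) <= Rabs h * (2 * Rpower (Rabs h) (1 / 4)) * L).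
  { assert (I := II_plus _ _ _ _ (II_plus _ _ _ _ (HP (p + h) Hq) (II_scal _ (-1) _ (HP p ltac:(lra))))
      (II_scal _ (- h) _ (HK p ltac:(lra)))).
    replace (P (p + h) - P p - h * K p) with (P (p + h) + -1 * P p + - h * K p) by ring.
    refine (II_le _ _ _ _ _ I (II_scal _ (Rabs h * (2 * Rpower (Rabs h) (1 / 4))) _ HL)).
    intros t Htt.
    replace (B (p + h) t * Vf mu t + -1 * (B p t * Vf mu t) + - h * (k p t * Vf mu t))
      with ((B (p + h) t - B p t - h * k p t) * Vf mu t) by ring.
    rewrite Bdiff by auto.
    assert (E : RInt (fun th => k th t) p (p + h) - h * k p t = RInt (fun th => k th t - k p t) p (p + h)).
    { assert (E := RInt_minus (V := R_CompleteNormedModule) (fun th => k th t) (fun _ => k p t) p (p + h)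
        (kex t Htt _ _) (ex_RInt_const _ _ _)).
      rewrite RInt_const in E.
      transitivity (minus (RInt (fun th => k th t) p (p + h)) (scal (p + h - p) (k p t)) : R).
      - unfold minus, plus, opp, scal; simpl; unfold mult; simpl; ring.
      - symmetry; exact E. }
    rewrite E, Rabs_mult.
    replace (Rabs h * (2 * Rpower (Rabs h) (1 / 4)) * (Rpower (1 + t) (1 / 4) * Rabs (Vf mu t)))
      with (2 * (Rpower (Rabs h) (1 / 4) * Rpower (1 + t) (1 / 4)) * Rabs h * Rabs (Vf mu t)) by ring.
    apply Rmult_le_compat_r; [apply Rabs_pos|].
    rewrite Rpower_mult_distr by lra.
    apply Rle_trans with (2 * Rpower (Rabs h * (1 + t)) (1 / 4) * Rabs (p + h - p)).
    2: { right; f_equal; f_equal; ring. }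
    apply RInt_bound.
    - intros x; apply (continuous_minus (V := R_NormedModule) (fun th => k th t) (fun _ => k p t));
        [apply kc, Htt|apply continuous_const].
    - intros x Hx; apply holder_quarter; [apply Rmult_lt_0_compat; lra| |].
      + unfold Rminus; apply Rle_trans with (1 := Rabs_triang _ _); rewrite Rabs_Ropp.
        pose proof (H1 x t); pose proof (H1 p t); lra.
      + apply Rle_trans with (1 := Hth x p t Htt); rewrite Rmult_comm.
        apply Rmult_le_compat_r; [lra|].
        revert Hx; unfold Rmin, Rmax; destruct (Rle_dec p (p + h)); intros Hx;
          [rewrite !Rabs_pos_eq by lra|rewrite !Rabs_left1 by lra]; lra. }
  replace ((P (p + h) - P p) / h - K p) with ((P (p + h) - P p - h * K p) / h) by (field; auto).
  unfold Rdiv; rewrite Rabs_mult, Rabs_inv.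
  apply Rmult_lt_reg_r with (Rabs h); auto.
  rewrite Rmult_assoc, Rinv_l, Rmult_1_r by lra.
  apply Rle_lt_trans with (1 := Hest).
  specialize (Hd' (Rabs h) ltac:(lra)).
  replace (Rabs h * (2 * Rpower (Rabs h) (1 / 4)) * L) with ((2 * L) * Rpower (Rabs h) (1 / 4) * Rabs h) by ring.
  apply Rmult_lt_compat_r; auto.
  apply Rle_lt_trans with ((2 * L) * (eps / (2 * L + 1))); [apply Rmult_le_compat_l; lra|].
  apply Rmult_lt_reg_r with (2 * L + 1); [lra|].
  replace (2 * L * (eps / (2 * L + 1)) * (2 * L + 1)) with (2 * L * eps) by (field; lra). nra. }
exists (P (PI / 2)); split; [apply (HP (PI / 2)); lra|].
assert (HP0 : P 0 = 0).
{ refine (RInt_gen_II (fun t => B 0 t * Vf mu t) 0 _); destruct (V_imag_aux mu 0 0 Hmu) as [l Hl].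
  assert (H0 : II (fun t => B 0 t * Vf mu t) (0 * l)); [|rewrite Rmult_0_l in H0; exact H0].
  refine (II_ext _ _ _ _ (II_scal _ 0 _ Hl)).
  intros t _; unfold B; rewrite RInt_point; unfold zero; simpl; ring. }
(* P is controlled on [0, PI / 2] only. Clipping its argument makes it Lipschitz on the whole line,
   so that the mean value theorem can be applied up to the end points. *)
set (clip := fun x => Rmax 0 (Rmin x (PI / 2))).
assert (Hclip : forall x, 0 <= clip x <= PI / 2).
{ intros x; unfold clip; split; [apply Rmax_l|apply Rmax_lub; [lra|apply Rmin_r]]. }
assert (Hclip' : forall x, 0 <= x <= PI / 2 -> clip x = x).
{ intros x Hx; unfold clip; rewrite Rmin_left, Rmax_right; lra. }
assert (Hcliplip : forall x y, Rabs (clip x - clip y) <= Rabs (x - y)).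
{ intros x y; unfold clip, Rmin, Rmax.
  repeat destruct Rle_dec; apply Rabs_le; unfold Rabs; destruct (Rcase_abs _); lra. }
destruct (MVT_gen (fun x => c * P (clip x) - Q x) 0 (PI / 2) (fun _ => 0)) as [x [_ E]].
- intros x; rewrite Rmin_left, Rmax_right by lra; intros Hx.
  assert (D : is_derive (fun x => c * P x - Q x) x 0).
  { pose proof (Pder x Hx) as D1; pose proof (HQ x Hx) as D2.
    auto_derive; [repeat split; eexists; eauto|subst_Derive; ring]. }
  apply is_derive_ext_loc with (fun x => c * P x - Q x); auto.
  assert (Hd : 0 < Rmin x (PI / 2 - x)) by (apply Rmin_glb_lt; lra).
  exists (mkposreal _ Hd); intros y Hy; rewrite Hclip'; auto.
  assert (Hy' : Rabs (y - x) < Rmin x (PI / 2 - x)) by exact Hy.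
  pose proof (Rmin_l x (PI / 2 - x)); pose proof (Rmin_r x (PI / 2 - x)); apply Rabs_def2 in Hy'; lra.
- intros x _; apply continuity_pt_filterlim.
  apply (continuous_minus (V := R_NormedModule) (fun x => c * P (clip x)) Q); [|apply HQc].
  apply (continuous_mult (fun _ => c) (fun x => P (clip x))); [apply continuous_const|].
  apply continuous_lipschitz with L; auto; intros y.
  apply Rle_trans with (1 := Plip _ _ (Hclip x) (Hclip y)); apply Rmult_le_compat_l; auto.
- rewrite !Hclip', HP0 in E by lra; lra.
Qed.

(** Bessel's integrals: PI / 2 times J_0 here and PI / 2 times J_1 for [sinavg]. *)
Definition cosavg (t : R) : R := RInt (fun th => cos (sin th * t)) 0 (PI / 2).
Definition sinavg (t : R) : R := RInt (fun th => sin th * sin (sin th * t)) 0 (PI / 2).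

Lemma ex_RInt_smooth (f : R -> R) a b : (forall x, ex_derive f x) -> ex_RInt f a b.
Proof.
intros H; apply (ex_RInt_continuous (V := R_CompleteNormedModule)); intros x _.
apply (ex_derive_continuous f), H.
Qed.

Lemma is_derive_cosavg t : is_derive cosavg t (- sinavg t).
Proof.
unfold cosavg, sinavg.
replace (- RInt (fun th => sin th * sin (sin th * t)) 0 (PI / 2)) with
  (RInt (fun th => Derive (fun u => cos (sin th * u)) t) 0 (PI / 2)).
- apply (is_derive_RInt_param (fun u th => cos (sin th * u))).
  + apply filter_forall; intros u th _; auto_derive; auto.
  + intros th _.
    apply continuity_2d_pt_ext with (fun u v => - (sin v * sin (sin v * u))).
    { intros u v; symmetry; apply is_derive_unique; auto_derive; auto; ring. }
    apply continuity_2d_pt_opp, continuity_2d_pt_mult.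
    * apply (continuity_1d_2d_pt_comp sin (fun _ v => v)); [apply continuity_sin|apply continuity_2d_pt_id2].
    * apply (continuity_1d_2d_pt_comp sin (fun u v => sin v * u)); [apply continuity_sin|].
      apply continuity_2d_pt_mult; [|apply continuity_2d_pt_id1].
      apply (continuity_1d_2d_pt_comp sin (fun _ v => v)); [apply continuity_sin|apply continuity_2d_pt_id2].
  + apply filter_forall; intros u; apply ex_RInt_smooth; intros; auto_derive; auto.
- rewrite (RInt_ext _ (fun th => opp (sin th * sin (sin th * t)))).
  + rewrite (RInt_opp (V := R_CompleteNormedModule)); [reflexivity|].
    apply ex_RInt_smooth; intros; auto_derive; auto.
  + intros th _; apply is_derive_unique; auto_derive; auto; unfold opp; simpl; ring.
Qed.

(** Differentiation under the integral gives the average of sin^2 th cos(t sin th). Integrating the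
    th-derivative of cos th sin(t sin th), which vanishes at both ends, converts it. *)
Lemma is_derive_sinavg t : 0 < t -> is_derive sinavg t (cosavg t - sinavg t / t).
Proof.
intros Ht; unfold sinavg at 1.
assert (E : cosavg t - sinavg t / t = RInt (fun th => sin th ^ 2 * cos (sin th * t)) 0 (PI / 2)).
{ assert (I1 : is_RInt (fun th => - (sin th * sin (sin th * t)) + t * (cos th ^ 2 * cos (sin th * t))) 0 (PI / 2) 0).
  { assert (E0 : minus (cos (PI / 2) * sin (sin (PI / 2) * t)) (cos 0 * sin (sin 0 * t)) = 0).
    { unfold minus, plus, opp; simpl; rewrite cos_PI2, sin_0, !Rmult_0_l, sin_0; ring. }
    rewrite <- E0 at 2.
    apply (is_RInt_derive (fun th => cos th * sin (sin th * t))).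
    - intros; auto_derive; auto; ring.
    - intros x _; apply (ex_derive_continuous (fun th => - (sin th * sin (sin th * t)) + t * (cos th ^ 2 * cos (sin th * t)))).
      auto_derive; auto. }
  set (I3 := RInt (fun th => sin th ^ 2 * cos (sin th * t)) 0 (PI / 2)).
  assert (J0 : is_RInt (fun th => cos (sin th * t)) 0 (PI / 2) (cosavg t)).
  { apply (RInt_correct (V := R_CompleteNormedModule)), ex_RInt_smooth; intros; auto_derive; auto. }
  assert (J1 : is_RInt (fun th => sin th * sin (sin th * t)) 0 (PI / 2) (sinavg t)).
  { apply (RInt_correct (V := R_CompleteNormedModule)), ex_RInt_smooth; intros; auto_derive; auto. }
  assert (J3 : is_RInt (fun th => sin th ^ 2 * cos (sin th * t)) 0 (PI / 2) I3).
  { apply (RInt_correct (V := R_CompleteNormedModule)), ex_RInt_smooth; intros; auto_derive; auto. }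
  assert (J : is_RInt (fun th => - (sin th * sin (sin th * t)) + t * (cos th ^ 2 * cos (sin th * t))) 0 (PI / 2)
    (- sinavg t + t * (cosavg t - I3))).
  { refine (is_RInt_ext (V := R_NormedModule) _ _ _ _ _ _ (is_RInt_plus (V := R_NormedModule) _ _ _ _ _ _
      (is_RInt_opp (V := R_NormedModule) _ _ _ _ J1)
      (is_RInt_scal (V := R_NormedModule) _ _ _ t _ (is_RInt_minus (V := R_NormedModule) _ _ _ _ _ _ J0 J3)))).
    intros x _; unfold plus, opp, minus, scal, plus, opp; simpl; unfold mult; simpl.
    rewrite <- (Rmult_1_l (cos (sin x * t))) at 1.
    replace (cos x * (cos x * 1)) with (1 - sin x * (sin x * 1)) by (pose proof (cos_sqr x) as E; simpl in E; lra).
    ring. }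
  assert (E : 0 = - sinavg t + t * (cosavg t - I3)).
  { rewrite <- (is_RInt_unique _ _ _ _ I1); apply is_RInt_unique, J. }
  apply Rmult_eq_reg_l with t; [|lra].
  replace (t * (cosavg t - sinavg t / t)) with (t * cosavg t - sinavg t) by (field; lra); lra. }
rewrite E.
replace (RInt (fun th => sin th ^ 2 * cos (sin th * t)) 0 (PI / 2)) with
  (RInt (fun th => Derive (fun u => sin th * sin (sin th * u)) t) 0 (PI / 2)).
- apply (is_derive_RInt_param (fun u th => sin th * sin (sin th * u))).
  + apply filter_forall; intros u th _; auto_derive; auto.
  + intros th _.
    assert (Hs : continuity_2d_pt (fun u v => sin v) t th)
      by (apply (continuity_1d_2d_pt_comp sin (fun _ v => v)); [apply continuity_sin|apply continuity_2d_pt_id2]).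
    apply continuity_2d_pt_ext with (fun u v => (sin v * sin v) * cos (sin v * u)).
    { intros u v; symmetry; apply is_derive_unique; auto_derive; auto; ring. }
    apply continuity_2d_pt_mult; [apply continuity_2d_pt_mult; auto|].
    apply (continuity_1d_2d_pt_comp cos (fun u v => sin v * u)); [apply continuity_cos|].
    apply continuity_2d_pt_mult; [auto|apply continuity_2d_pt_id1].
  + apply filter_forall; intros u; apply ex_RInt_smooth; intros; auto_derive; auto.
- apply RInt_ext; intros th _; apply is_derive_unique; auto_derive; auto; ring.
Qed.

(** Both pairs solve the same linear system. For their difference (e, d), the sum e^2 + d^2 has
    derivative - 2 d^2 / t, so it decreases; as it tends to 0 at the origin, it is zero. *)
Lemma cosavg_Jh t : 0 < t -> cosavg t = PI / 2 * Jh 0 t /\ sinavg t = PI / 2 * Kh 0 t.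
Proof.
intros Ht; pose proof PI_RGT_0 as HPI; pose proof PI_4.
assert (H0 : nonpole (0 + 1)) by (apply nonpole_pos; lra).
set (e := fun t => cosavg t - PI / 2 * Jh 0 t); set (d := fun t => sinavg t - PI / 2 * Kh 0 t).
assert (De : forall t, 0 < t -> is_derive e t (- d t)).
{ intros u Hu; unfold e, d; pose proof (is_derive_cosavg u) as D1; pose proof (is_derive_Jh 0 u Hu H0) as D2.
  auto_derive; [repeat split; eexists; eauto|subst_Derive; field; lra]. }
assert (Dd : forall t, 0 < t -> is_derive d t (e t - d t / t)).
{ intros u Hu; unfold e, d; pose proof (is_derive_sinavg u Hu) as D1; pose proof (is_derive_Kh 0 u Hu H0) as D2.
  auto_derive; [repeat split; eexists; eauto|subst_Derive; field; lra]. }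
set (E := fun t => e t ^ 2 + d t ^ 2).
assert (HE : forall s, 0 < s <= t -> E t <= E s).
{ intros s Hs; apply decreasing_derive with (fun u => - 2 * d u ^ 2 / u); [lra| |].
  - intros x Hx; pose proof (De x ltac:(lra)) as D1; pose proof (Dd x ltac:(lra)) as D2; unfold E.
    clearbody e d; auto_derive; [repeat split; eexists; eauto|subst_Derive; field; lra].
  - intros x Hx; replace (- 2 * d x ^ 2 / x) with (- (2 * d x ^ 2 * / x)) by (unfold Rdiv; ring).
    assert (0 < / x) by (apply Rinv_0_lt_compat; lra).
    assert (0 <= 2 * d x ^ 2 * / x) by (apply Rmult_le_pos; nra); lra. }
destruct (bcoef_exp_type 0 H0) as [M0 HM0].
destruct (bcoef_exp_type (0 + 1) (nonpole_succ _ H0)) as [M1 HM1].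
assert (HM0p : 0 <= M0) by apply HM0; assert (HM1p : 0 <= M1) by apply HM1.
pose proof (exp_pos 1) as Hexp.
set (A := 4 + 2 * (M0 * exp 1) + 2 * (M1 * exp 1)).
assert (HA : 0 <= A) by (unfold A; assert (0 <= M0 * exp 1) by nra; assert (0 <= M1 * exp 1) by nra; lra).
assert (Hsmall : forall s, 0 < s <= 1 -> Rabs (e s) <= A * s /\ Rabs (d s) <= A * s).
{ intros s Hs.
  assert (HB0 : Rabs (cosavg s - PI / 2) <= 2 * s).
  { assert (EB : cosavg s - PI / 2 = RInt (fun th => cos (sin th * s) - cos 0) 0 (PI / 2)).
    { assert (Hex : ex_RInt (fun th => cos (sin th * s)) 0 (PI / 2))
        by (apply ex_RInt_smooth; intros; auto_derive; auto).
      assert (Q := RInt_minus (V := R_CompleteNormedModule) (fun th => cos (sin th * s)) (fun _ => cos 0) 0 (PI / 2)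
        Hex (ex_RInt_const _ _ _)).
      rewrite RInt_const in Q.
      transitivity (minus (RInt (fun th => cos (sin th * s)) 0 (PI / 2)) (scal (PI / 2 - 0) (cos 0)) : R).
      - unfold minus, plus, opp, scal; simpl; unfold mult; simpl; rewrite cos_0; unfold cosavg; ring.
      - symmetry; exact Q. }
    rewrite EB; apply Rle_trans with (s * Rabs (PI / 2 - 0)).
    - apply RInt_bound.
      + intros x; apply (ex_derive_continuous (fun th => cos (sin th * s) - cos 0)); auto_derive; auto.
      + intros x _; apply Rle_trans with (1 := cos_lipschitz _ _).
        rewrite Rminus_0_r, Rabs_mult, (Rabs_pos_eq s) by lra.
        assert (Rabs (sin x) <= 1) by (apply Rabs_le, SIN_bound); nra.
    - rewrite Rabs_pos_eq by lra; nra. }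
  assert (HB1 : Rabs (sinavg s) <= 2 * s).
  { apply Rle_trans with (s * Rabs (PI / 2 - 0)).
    - apply RInt_bound.
      + intros x; apply (ex_derive_continuous (fun th => sin th * sin (sin th * s))); auto_derive; auto.
      + intros x _; rewrite Rabs_mult.
        pose proof (sin_lipschitz (sin x * s) 0) as L; rewrite sin_0, !Rminus_0_r, Rabs_mult, (Rabs_pos_eq s) in L by lra.
        assert (Rabs (sin x) <= 1) by (apply Rabs_le, SIN_bound).
        pose proof (Rabs_pos (sin x)); pose proof (Rabs_pos (sin (sin x * s))); nra.
    - rewrite Rabs_pos_eq by lra; nra. }
  assert (HJ : Rabs (Jh 0 s - 1) <= s * (M0 * exp 1)).
  { unfold Jh; rewrite Rpower_O, Rmult_1_l by lra.
    apply Rle_trans with (1 := bser_near_1 0 M0 (s ^ 2 / 4) HM0 ltac:(nra)).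
    apply Rmult_le_compat_r; nra. }
  assert (HK : Rabs (Kh 0 s) <= s * (M1 * exp 1)).
  { unfold Kh; rewrite Rplus_0_l, Rpower_1 by lra.
    replace (s / 2 * bser 1 (s ^ 2 / 4) / 1) with (s * (bser (0 + 1) (s ^ 2 / 4) / 2))
      by (rewrite Rplus_0_l; field).
    rewrite Rabs_mult, (Rabs_pos_eq s) by lra; apply Rmult_le_compat_l; [lra|].
    pose proof (exp_type_PSeries _ _ _ (s ^ 2 / 4) HM1) as Q.
    rewrite (Rabs_pos_eq (s ^ 2 / 4)) in Q by nra.
    assert (exp (1 * (s ^ 2 / 4)) <= exp 1) by (left; apply exp_increasing; nra).
    unfold Rdiv; rewrite Rabs_mult, (Rabs_pos_eq (/ 2)) by lra; fold (bser (0 + 1) (s ^ 2 / 4)) in Q.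
    pose proof (Rabs_pos (bser (0 + 1) (s ^ 2 * / 4))); unfold Rdiv in Q.
    assert (M1 * exp (1 * (s ^ 2 * / 4)) <= M1 * exp 1) by (apply Rmult_le_compat_l; auto). lra. }
  assert (0 <= s * (M0 * exp 1)) by (repeat apply Rmult_le_pos; lra).
  assert (0 <= s * (M1 * exp 1)) by (repeat apply Rmult_le_pos; lra).
  split.
  - unfold e; replace (cosavg s - PI / 2 * Jh 0 s) with ((cosavg s - PI / 2) - PI / 2 * (Jh 0 s - 1)) by ring.
    unfold Rminus at 1; apply Rle_trans with (1 := Rabs_triang _ _); rewrite Rabs_Ropp, Rabs_mult, (Rabs_pos_eq (PI / 2)) by lra.
    pose proof (Rabs_pos (Jh 0 s - 1)); unfold A; nra.
  - unfold d, Rminus; apply Rle_trans with (1 := Rabs_triang _ _); rewrite Rabs_Ropp, Rabs_mult, (Rabs_pos_eq (PI / 2)) by lra.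
    pose proof (Rabs_pos (Kh 0 s)); unfold A; nra. }
assert (HE0 : E t <= 0).
{ apply le_epsilon; intros eps Heps; rewrite Rplus_0_l.
  set (s := Rmin (Rmin t 1) (eps / (2 * A ^ 2 + 1))).
  assert (Hs : 0 < s).
  { repeat apply Rmin_glb_lt; try lra; apply Rdiv_lt_0_compat; nra. }
  pose proof (Rmin_l (Rmin t 1) (eps / (2 * A ^ 2 + 1))) as S1; pose proof (Rmin_r (Rmin t 1) (eps / (2 * A ^ 2 + 1))) as S2.
  pose proof (Rmin_l t 1); pose proof (Rmin_r t 1); fold s in S1, S2.
  apply Rle_trans with (1 := HE s ltac:(lra)).
  destruct (Hsmall s ltac:(lra)) as [Q1 Q2]; unfold E.
  rewrite <- (pow2_abs (e s)), <- (pow2_abs (d s)).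
  pose proof (Rabs_pos (e s)); pose proof (Rabs_pos (d s)).
  assert (Rabs (e s) ^ 2 <= (A * s) ^ 2) by (apply pow_incr; auto).
  assert (Rabs (d s) ^ 2 <= (A * s) ^ 2) by (apply pow_incr; auto).
  assert ((2 * A ^ 2 + 1) * s <= eps).
  { apply Rmult_le_reg_r with (/ (2 * A ^ 2 + 1)); [apply Rinv_0_lt_compat; nra|].
    replace ((2 * A ^ 2 + 1) * s * / (2 * A ^ 2 + 1)) with s by (field; nra). exact S2. }
  assert ((A * s) ^ 2 <= A ^ 2 * s) by (replace ((A * s) ^ 2) with (A ^ 2 * s * s) by ring; assert (0 <= A ^ 2 * s) by nra; nra).
  nra. }
unfold E in HE0; pose proof (pow2_ge_0 (e t)); pose proof (pow2_ge_0 (d t)).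
assert (e t = 0) by nra; assert (d t = 0) by nra; unfold e, d in *; split; lra.
Qed.

(** * Limits of the Wronskians at infinity *)

Lemma lim_of_II F f l : (forall t, 0 < t -> is_derive F t (f t)) ->
  (forall t, 0 < t -> continuous f t) -> filterlim F (at_right 0) (locally 0) ->
  II f l -> filterlim F (Rbar_locally p_infty) (locally l).
Proof.
intros HF Hf H0 HI; apply filterlim_p_infty_R; intros eps He.
destruct (II_limits f l HI Hf (eps / 2) ltac:(lra)) as [d [T [Hd [HT H]]]].
assert (A : at_right 0 (fun x => Rabs (F x - 0) < eps / 2)) by exact (H0 _ (locally_Rabs 0 (eps / 2) ltac:(lra))).
destruct (at_right_0_inv _ A) as [d' [Hd' H']].
exists T; intros y Hy.
set (x := Rmin d d' / 2).
assert (0 < Rmin d d') by (apply Rmin_glb_lt; auto).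
pose proof (Rmin_l d d'); pose proof (Rmin_r d d').
specialize (H x y ltac:(unfold x; lra) Hy); specialize (H' x ltac:(unfold x; lra)).
assert (E : RInt f x y = F y - F x).
{ apply is_RInt_unique, (is_RInt_derive F); intros t Ht; [apply HF|apply Hf];
  destruct Ht as [Ht _]; revert Ht; unfold Rmin, x; destruct Rle_dec; lra. }
rewrite E in H; replace (F y - l) with ((F y - F x - l) + (F x - 0)) by ring.
apply Rle_lt_trans with (1 := Rabs_triang _ _); lra.
Qed.

(** As mu is positive, [Jh mu] and x [Kh mu] are both O(x^mu), while the factors of order la >= 0
    stay bounded. *)
Lemma Wr_at_0 mu la : 0 < mu -> 0 <= la -> filterlim (Wr mu la) (at_right 0) (locally 0).
Proof.
intros Hmu Hla.
assert (H : nonpole (la + 1)) by (apply nonpole_pos; lra).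
destruct (Jh_dom mu Hmu) as [CJ [HCJ [J0 _]]]; destruct (tKh_dom mu Hmu) as [CK [HCK [K0 _]]].
destruct (bcoef_exp_type la H) as [M HM].
assert (HMp : 0 <= M) by apply HM.
set (E := M * exp 1).
assert (HE : 0 <= E) by (apply Rmult_le_pos; [auto|left; apply exp_pos]).
assert (Hl : forall x, 0 < x <= 1 -> Rabs (Jh la x) <= E /\ Rabs (x * Kh la x) <= 2 * E).
{ intros x Hx; destruct (JK_series_bound la M x HM H ltac:(lra)) as [Q1 Q2].
  assert (Hp : Rpower (x / 2) la <= 1) by (apply Rpower_le_1; lra).
  pose proof (Rpower_pos (x / 2) la).
  assert (E1 : exp (x ^ 2 / 4) <= exp 1) by (left; apply exp_increasing; nra).
  assert (E2 : exp (2 * (x ^ 2 / 4)) <= exp 1) by (left; apply exp_increasing; nra).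
  pose proof (exp_pos (x ^ 2 / 4)); pose proof (exp_pos (2 * (x ^ 2 / 4))).
  split.
  - apply Rle_trans with (1 := Q1); apply Rle_trans with (1 * (M * exp 1)); [|unfold E; lra].
    apply Rmult_le_compat; try lra; [apply Rmult_le_pos; lra|apply Rmult_le_compat_l; auto].
  - rewrite Rabs_mult, (Rabs_pos_eq x) by lra.
    apply Rle_trans with (1 := Q2); apply Rmult_le_compat_l; [lra|].
    apply Rle_trans with (1 * (M * exp 1)); [|unfold E; lra].
    apply Rmult_le_compat; try lra; [apply Rmult_le_pos; lra|apply Rmult_le_compat_l; auto]. }
set (B := CJ * (2 * E) + CK * E + Rabs (mu - la) * CJ * E + 1).
assert (HB : 0 < B).
{ unfold B; pose proof (Rabs_pos (mu - la)).
  assert (0 <= CJ * (2 * E)) by nra; assert (0 <= CK * E) by nra.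
  assert (0 <= CJ * E) by nra.
  assert (0 <= Rabs (mu - la) * CJ * E) by (rewrite Rmult_assoc; apply Rmult_le_pos; auto); lra. }
apply filterlim_at_right_0; intros eps Heps.
destruct (Rpower_small mu (eps / B) Hmu (Rdiv_lt_0_compat _ _ Heps HB)) as [d [Hd Hd']].
exists (Rmin d 1); split; [apply Rmin_glb_lt; lra|].
intros x Hx; pose proof (Rmin_l d 1); pose proof (Rmin_r d 1).
specialize (J0 x ltac:(lra)); specialize (K0 x ltac:(lra)); specialize (Hd' x ltac:(lra)).
destruct (Hl x ltac:(lra)) as [Q1 Q2].
rewrite Rminus_0_r; unfold Wr.
replace (x * (Jh mu x * Kh la x - Kh mu x * Jh la x) + (mu - la) * Jh mu x * Jh la x)
  with (Jh mu x * (x * Kh la x) - (x * Kh mu x) * Jh la x + (mu - la) * Jh mu x * Jh la x) by ring.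
apply Rle_lt_trans with (B * Rpower x mu).
- pose proof (Rpower_pos x mu) as Hp; set (p := Rpower x mu) in *.
  apply Rle_trans with (1 := Rabs_triang _ _); unfold Rminus at 1.
  apply Rle_trans with ((Rabs (Jh mu x * (x * Kh la x)) + Rabs (x * Kh mu x * Jh la x)) + Rabs ((mu - la) * Jh mu x * Jh la x)).
  + apply Rplus_le_compat_r; apply Rle_trans with (1 := Rabs_triang _ _); rewrite Rabs_Ropp; lra.
  + rewrite (Rabs_mult (Jh mu x)), (Rabs_mult (x * Kh mu x)), (Rabs_mult ((mu - la) * Jh mu x)), (Rabs_mult (mu - la)).
    assert (Rabs (Jh mu x) * Rabs (x * Kh la x) <= CJ * p * (2 * E)) by (apply Rmult_le_compat; auto; apply Rabs_pos).
    assert (Rabs (x * Kh mu x) * Rabs (Jh la x) <= CK * p * E) by (apply Rmult_le_compat; auto; apply Rabs_pos).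
    assert (Rabs (mu - la) * Rabs (Jh mu x) * Rabs (Jh la x) <= Rabs (mu - la) * (CJ * p) * E).
    { apply Rmult_le_compat; auto; try apply Rabs_pos; [apply Rmult_le_pos; apply Rabs_pos|].
      apply Rmult_le_compat_l; auto; apply Rabs_pos. }
    unfold B; nra.
- apply Rlt_le_trans with (B * (eps / B)); [apply Rmult_lt_compat_l; lra|right; field; lra].
Qed.

Lemma continuous_Wr_derive mu la t : 0 < t -> nonpole (mu + 1) -> nonpole (la + 1) ->
  continuous (fun t => (mu ^ 2 - la ^ 2) * (Jh mu t * Jh la t / t)) t.
Proof.
intros Ht H1 H2; apply (ex_derive_continuous (fun t => (mu ^ 2 - la ^ 2) * (Jh mu t * Jh la t / t))).
pose proof (is_derive_Jh mu t Ht H1); pose proof (is_derive_Jh la t Ht H2).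
auto_derive; repeat split; try lra; eexists; eauto.
Qed.

Lemma lim_Wr_0 mu : 0 < mu ->
  filterlim (Wr mu 0) (Rbar_locally p_infty) (locally (2 / PI * (Gamma (mu + 1) * sin (mu * (PI / 2))))).
Proof.
intros Hmu; pose proof PI_RGT_0.
assert (H1 : nonpole (mu + 1)) by (apply nonpole_pos; lra).
assert (H0 : nonpole (0 + 1)) by (apply nonpole_pos; lra).
apply lim_of_II with (fun t => (mu ^ 2 - 0 ^ 2) * (Jh mu t * Jh 0 t / t)).
- intros; apply is_derive_Wr; auto.
- intros; apply continuous_Wr_derive; auto.
- apply Wr_at_0; lra.
- destruct (II_average mu (fun th t => cos (sin th * t)) (fun th => Gamma_pos mu * cos (mu * th))
    (fun th => mu * Gamma_pos mu * sin (mu * th)) (mu ^ 2) Hmu) as [P [HP E]].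
  + intros; apply Rabs_le, COS_bound.
  + intros th th' t Ht; apply Rle_trans with (1 := cos_lipschitz _ _).
    replace (sin th * t - sin th' * t) with ((sin th - sin th') * t) by ring.
    rewrite Rabs_mult, (Rabs_pos_eq t) by lra; pose proof (sin_lipschitz th th'); pose proof (Rabs_pos (th - th')); nra.
  + intros th t t'; apply Rle_trans with (1 := cos_lipschitz _ _).
    replace (sin th * t - sin th * t') with (sin th * (t - t')) by ring.
    rewrite Rabs_mult; assert (Rabs (sin th) <= 1) by (apply Rabs_le, SIN_bound); pose proof (Rabs_pos (t - t')); nra.
  + intros th Hth; exact (proj1 (V_imag mu th Hmu Hth)).
  + intros th _; auto_derive; auto; ring.
  + intros th; apply (ex_derive_continuous (fun th => mu * Gamma_pos mu * sin (mu * th))); auto_derive; auto.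
  + replace (2 / PI * (Gamma (mu + 1) * sin (mu * (PI / 2)))) with ((mu ^ 2 * (2 / PI)) * P).
    * refine (II_ext _ _ _ _ (II_scal _ (mu ^ 2 * (2 / PI)) _ HP)).
      intros t Ht; change (RInt (fun th => cos (sin th * t)) 0 (PI / 2)) with (cosavg t).
      rewrite (proj1 (cosavg_Jh t Ht)); unfold Vf; field; lra.
    * rewrite Rmult_0_r, sin_0 in E.
      rewrite Gamma_pos_eq, Gamma_pos_succ by lra.
      replace (mu ^ 2 * (2 / PI) * P) with (2 / PI * (mu ^ 2 * P)) by ring; rewrite E; ring.
Qed.

Lemma lim_Wr_1 mu : 0 < mu ->
  filterlim (Wr mu 1) (Rbar_locally p_infty) (locally (- (2 / PI * (Gamma (mu + 1) * cos (mu * (PI / 2)))))).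
Proof.
intros Hmu; pose proof PI_RGT_0.
assert (H1 : nonpole (mu + 1)) by (apply nonpole_pos; lra).
assert (H0 : nonpole (1 + 1)) by (apply nonpole_pos; lra).
apply lim_of_II with (fun t => (mu ^ 2 - 1 ^ 2) * (Jh mu t * Jh 1 t / t)).
- intros; apply is_derive_Wr; auto.
- intros; apply continuous_Wr_derive; auto.
- apply Wr_at_0; lra.
(* The third function is an elementary primitive of (mu^2 - 1) sin th sin(mu th), up to the factor
   [Gamma_pos mu]. *)
- destruct (II_average mu (fun th t => sin th * sin (sin th * t)) (fun th => sin th * (Gamma_pos mu * sin (mu * th)))
    (fun th => Gamma_pos mu * (cos th * sin (mu * th) - mu * (sin th * cos (mu * th)))) (mu ^ 2 - 1 ^ 2) Hmu) as [P [HP E]].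
  + intros th t; rewrite Rabs_mult.
    assert (Rabs (sin th) <= 1) by (apply Rabs_le, SIN_bound).
    assert (Rabs (sin (sin th * t)) <= 1) by (apply Rabs_le, SIN_bound).
    pose proof (Rabs_pos (sin th)); nra.
  + intros th th' t Ht.
    replace (sin th * sin (sin th * t) - sin th' * sin (sin th' * t)) with
      ((sin th - sin th') * sin (sin th * t) + sin th' * (sin (sin th * t) - sin (sin th' * t))) by ring.
    apply Rle_trans with (1 := Rabs_triang _ _); rewrite !Rabs_mult.
    pose proof (sin_lipschitz th th'); pose proof (sin_lipschitz (sin th * t) (sin th' * t)) as L.
    replace (sin th * t - sin th' * t) with ((sin th - sin th') * t) in L by ring.
    rewrite Rabs_mult, (Rabs_pos_eq t) in L by lra.
    assert (Rabs (sin (sin th * t)) <= 1) by (apply Rabs_le, SIN_bound).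
    assert (Rabs (sin th') <= 1) by (apply Rabs_le, SIN_bound).
    pose proof (Rabs_pos (th - th')); pose proof (Rabs_pos (sin th')); pose proof (Rabs_pos (sin th - sin th')).
    pose proof (Rabs_pos (sin (sin th * t) - sin (sin th' * t))); pose proof (Rabs_pos (sin (sin th * t))).
    assert (Rabs (sin th - sin th') * Rabs (sin (sin th * t)) <= Rabs (th - th')) by nra.
    assert (Rabs (sin th - sin th') * t <= Rabs (th - th') * t) by nra.
    assert (Rabs (sin th') * Rabs (sin (sin th * t) - sin (sin th' * t)) <= Rabs (th - th') * t) by nra.
    lra.
  + intros th t t'.
    replace (sin th * sin (sin th * t) - sin th * sin (sin th * t')) with
      (sin th * (sin (sin th * t) - sin (sin th * t'))) by ring.
    pose proof (sin_lipschitz (sin th * t) (sin th * t')) as L.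
    replace (sin th * t - sin th * t') with (sin th * (t - t')) in L by ring.
    rewrite Rabs_mult in *; assert (Rabs (sin th) <= 1) by (apply Rabs_le, SIN_bound).
    pose proof (Rabs_pos (t - t')); pose proof (Rabs_pos (sin th)).
    pose proof (Rabs_pos (sin (sin th * t) - sin (sin th * t'))); nra.
  + intros th Hth.
    refine (II_ext _ _ _ _ (II_scal _ (sin th) _ (proj2 (V_imag mu th Hmu Hth)))); intros; ring.
  + intros th _; auto_derive; auto; ring.
  + intros th; apply (ex_derive_continuous (fun th => Gamma_pos mu * (cos th * sin (mu * th) - mu * (sin th * cos (mu * th))))); auto_derive; auto.
  + replace (- (2 / PI * (Gamma (mu + 1) * cos (mu * (PI / 2))))) with (((mu ^ 2 - 1 ^ 2) * (2 / PI)) * P).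
    * refine (II_ext _ _ _ _ (II_scal _ ((mu ^ 2 - 1 ^ 2) * (2 / PI)) _ HP)).
      intros t Ht; change (RInt (fun th => sin th * sin (sin th * t)) 0 (PI / 2)) with (sinavg t).
      rewrite (proj2 (cosavg_Jh t Ht)), Kh_Jh, Rplus_0_l; unfold Vf; field; lra.
    * rewrite Rmult_0_r, !sin_0, cos_PI2, sin_PI2 in E.
      rewrite Gamma_pos_eq, Gamma_pos_succ by lra.
      replace ((mu ^ 2 - 1 ^ 2) * (2 / PI) * P) with (2 / PI * ((mu ^ 2 - 1 ^ 2) * P)) by ring; rewrite E; ring.
Qed.

Definition decays (a : R -> R) : Prop :=
  exists X C, forall x, X <= x -> x * a x ^ 2 <= C.

Lemma decays_Jh mu : nonpole (mu + 1) -> decays (Jh mu).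
Proof.
intros H; destruct (JK_bound mu H) as [eta [X [C [He [HX [HC HB]]]]]].
destruct (HB mu) as [_ HB']; [rewrite Rminus_diag, Rabs_R0; auto|].
exists X, C; intros x Hx; specialize (HB' x Hx); nra.
Qed.

Lemma decays_Kh mu : nonpole (mu + 1) -> decays (Kh mu).
Proof.
intros H; destruct (JK_bound mu H) as [eta [X [C [He [HX [HC HB]]]]]].
destruct (HB mu) as [_ HB']; [rewrite Rminus_diag, Rabs_R0; auto|].
exists X, C; intros x Hx; specialize (HB' x Hx); nra.
Qed.

Lemma decays_mult a b : decays a -> decays b -> is_lim (fun x => a x * b x) p_infty 0.
Proof.
intros [X [C H]] [X' [C' H']].
apply filterlim_p_infty_R; intros eps He.
exists (Rmax (Rmax X X') (Rmax 1 ((Rabs C + Rabs C' + 1) / eps))).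
intros x Hx.
pose proof (Rmax_l (Rmax X X') (Rmax 1 ((Rabs C + Rabs C' + 1) / eps))).
pose proof (Rmax_r (Rmax X X') (Rmax 1 ((Rabs C + Rabs C' + 1) / eps))).
pose proof (Rmax_l X X'); pose proof (Rmax_r X X').
pose proof (Rmax_l 1 ((Rabs C + Rabs C' + 1) / eps)).
pose proof (Rmax_r 1 ((Rabs C + Rabs C' + 1) / eps)).
specialize (H x ltac:(lra)); specialize (H' x ltac:(lra)).
pose proof (Rle_abs C); pose proof (Rle_abs C'); pose proof (Rabs_pos C); pose proof (Rabs_pos C').
assert (Hlt : Rabs C + Rabs C' + 1 < eps * x).
{ apply Rmult_lt_reg_r with (/ eps); [apply Rinv_0_lt_compat; lra|].
  replace (eps * x * / eps) with x by (field; lra). unfold Rdiv in *; lra. }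
rewrite Rminus_0_r.
assert (Hab : Rabs (a x * b x) <= (a x ^ 2 + b x ^ 2) / 2).
{ pose proof (pow2_ge_0 (a x - b x)); pose proof (pow2_ge_0 (a x + b x)).
  apply Rabs_le; split; lra. }
apply Rle_lt_trans with (1 := Hab).
apply Rmult_lt_reg_r with x; [lra|]; lra.
Qed.

(** The determinant part of [Wr]. The remaining term (mu - la) J J tends to 0, so both have the same
    limit, and a determinant lends itself to a Pluecker relation. *)
Definition Br (mu la x : R) : R := x * (Jh mu x * Kh la x - Kh mu x * Jh la x).

Lemma lim_Wr_Br mu la l : nonpole (mu + 1) -> nonpole (la + 1) ->
  is_lim (Wr mu la) p_infty l <-> is_lim (Br mu la) p_infty l.
Proof.
intros H1 H2.
assert (Z : is_lim (fun x => (mu - la) * (Jh mu x * Jh la x)) p_infty 0).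
{ replace (Finite 0) with (Rbar_mult (mu - la) 0) by (simpl; f_equal; ring).
  apply is_lim_scal_l, decays_mult; apply decays_Jh; auto. }
assert (F : forall f g (k l : Rbar), is_lim f p_infty l -> is_lim (fun x => k * (Jh mu x * Jh la x)) p_infty 0 ->
  (forall x, g x = f x + k * (Jh mu x * Jh la x)) -> is_lim g p_infty l).
{ intros f g k l0 Hf Hk E; apply is_lim_ext with (fun x => f x + k * (Jh mu x * Jh la x)); [intros; symmetry; apply E|].
  replace l0 with (Rbar_plus l0 0) by (destruct l0; simpl; auto; f_equal; ring).
  apply is_lim_plus with l0 0; auto. destruct l0; simpl; exact I || reflexivity. }
split; intros H.
- apply (F (Wr mu la) _ (Finite (- (mu - la))) l H).
  + replace (Finite 0) with (Rbar_opp 0) by (simpl; f_equal; ring).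
    apply is_lim_ext with (fun x => - ((mu - la) * (Jh mu x * Jh la x))); [intros; simpl; ring|].
    apply is_lim_opp, Z.
  + intros x; unfold Wr, Br; simpl; ring.
- apply (F (Br mu la) _ (Finite (mu - la)) l H); auto.
  intros x; unfold Wr, Br; simpl; ring.
Qed.

Definition wlim (mu la : R) : R :=
  2 / PI * (Gamma (mu + 1) * Gamma (la + 1) * sin ((mu - la) * (PI / 2))).

Lemma is_lim_plus_R f g (lf lg : R) : is_lim f p_infty lf -> is_lim g p_infty lg ->
  is_lim (fun x => f x + g x) p_infty (lf + lg).
Proof. intros; apply is_lim_plus'; auto. Qed.

Lemma is_lim_mult_R f g (lf lg : R) : is_lim f p_infty lf -> is_lim g p_infty lg ->
  is_lim (fun x => f x * g x) p_infty (lf * lg).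
Proof. intros Hf Hg; apply (is_lim_mult f g p_infty lf lg Hf Hg); exact I. Qed.

Lemma is_lim_ext_pos f g (l : Rbar) : (forall x, 0 < x -> f x = g x) -> is_lim f p_infty l -> is_lim g p_infty l.
Proof. intros E; apply is_lim_ext_loc; exists 0; auto. Qed.

(** In the plane, det(u, v) |e|^2 = det(u, e) (v . e) - det(v, e) (u . e). Here e is the vector
    ([Jh 0], [Kh 0]), [dot] is the scalar product with e and [n2] its squared length, all scaled by
    x. Since [n2] has a nonzero limit it can be divided out. *)
Lemma lim_Br_pos mu la : 0 < mu -> 0 < la -> is_lim (Br mu la) p_infty (wlim mu la).
Proof.
intros Hmu Hla; pose proof PI_RGT_0.
assert (H0 : nonpole (0 + 1)) by (apply nonpole_pos; lra).
set (dot := fun m x => x * (Jh m x * Jh 0 x + Kh m x * Kh 0 x)).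
set (n2 := fun x => x * (Jh 0 x ^ 2 + Kh 0 x ^ 2)).
assert (HB : forall m, 0 < m -> is_lim (Br m 0) p_infty (2 / PI * (Gamma (m + 1) * sin (m * (PI / 2))))).
{ intros m Hm; apply lim_Wr_Br; auto; [apply nonpole_pos; lra|apply lim_Wr_0, Hm]. }
assert (HD : forall m, 0 < m -> is_lim (dot m) p_infty (2 / PI * (Gamma (m + 1) * cos (m * (PI / 2))))).
{ intros m Hm; assert (Hm1 : nonpole (m + 1)) by (apply nonpole_pos; lra).
  replace (2 / PI * (Gamma (m + 1) * cos (m * (PI / 2)))) with
    ((m + 1) * 0 + -1 * - (2 / PI * (Gamma (m + 1) * cos (m * (PI / 2))))) by ring.
  apply is_lim_ext_pos with (fun x => (m + 1) * (Jh m x * Kh 0 x) + -1 * Wr m 1 x).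
  - intros x Hx; unfold Wr, dot.
    assert (E1 : Jh 1 x = Kh 0 x) by (rewrite Kh_Jh, Rplus_0_l; field).
    assert (E2 : Kh 1 x = 2 / x * Kh 0 x - Jh 0 x).
    { replace 1 with (0 + 1) at 1 by ring; rewrite Kh_succ by auto; field; lra. }
    rewrite E1, E2; field; lra.
  - apply is_lim_plus_R.
    + apply (is_lim_scal_l (fun x => Jh m x * Kh 0 x) (m + 1) p_infty 0), decays_mult; [apply decays_Jh|apply decays_Kh]; auto.
    + apply (is_lim_scal_l (Wr m 1) (-1) p_infty (- (2 / PI * (Gamma (m + 1) * cos (m * (PI / 2)))))), lim_Wr_1, Hm. }
assert (HN : is_lim n2 p_infty (2 / PI)).
{ replace (2 / PI) with (2 / PI * (Gamma (1 + 1) * sin (1 * (PI / 2))) + 2 * 0).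
  - apply is_lim_ext_pos with (fun x => Br 1 0 x + 2 * (Kh 0 x * Jh 0 x)).
    + intros x Hx; unfold Br, n2.
      assert (E1 : Jh 1 x = Kh 0 x) by (rewrite Kh_Jh, Rplus_0_l; field).
      assert (E2 : Kh 1 x = 2 / x * Kh 0 x - Jh 0 x).
      { replace 1 with (0 + 1) at 1 by ring; rewrite Kh_succ by auto; field; lra. }
      rewrite E1, E2; field; lra.
    + apply is_lim_plus_R; [apply HB; lra|].
      apply (is_lim_scal_l (fun x => Kh 0 x * Jh 0 x) 2 p_infty 0), decays_mult; [apply decays_Kh|apply decays_Jh]; auto.
  - assert (HG1 : Gamma 1 = 1).
    { rewrite Gamma_pos_eq by lra.
      assert (I1 : II (fun t => Rpower t (1 - 1) * exp (- t)) (0 - -1));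
        [|rewrite (II_unique _ _ _ (Gamma_pos_II 1 ltac:(lra)) I1); ring].
      apply II_derive with (fun t => - exp (- t)).
      - intros t Ht; replace (1 - 1) with 0 by ring; rewrite Rpower_O by auto; auto_derive; auto; ring.
      - intros t Ht; destruct (dom_Gamma 1 ltac:(lra)) as [? [_ [c _]]]; apply c, Ht.
      - replace (-1) with (- exp (- 0)) by (rewrite Ropp_0, exp_0; ring).
        apply (filterlim_at_right_continuous (fun t => - exp (- t))).
        apply (ex_derive_continuous (fun t => - exp (- t))); auto_derive; auto.
      - apply filterlim_p_infty_R; intros eps He; exists (- ln eps); intros x Hx.
        rewrite Rminus_0_r, Rabs_Ropp, Rabs_pos_eq by (left; apply exp_pos).
        rewrite <- (exp_ln eps) by auto; apply exp_increasing; lra. }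
    rewrite Gamma_succ, HG1, (Rmult_1_l (PI / 2)), sin_PI2 by (apply nonpole_pos; lra); field; lra. }
assert (HP : is_lim (fun x => Br mu la x * n2 x) p_infty (wlim mu la * (2 / PI))).
{ replace (wlim mu la * (2 / PI)) with
    (2 / PI * (Gamma (mu + 1) * sin (mu * (PI / 2))) * (2 / PI * (Gamma (la + 1) * cos (la * (PI / 2))))
     + -1 * (2 / PI * (Gamma (la + 1) * sin (la * (PI / 2))) * (2 / PI * (Gamma (mu + 1) * cos (mu * (PI / 2)))))).
  - apply is_lim_ext with (fun x => Br mu 0 x * dot la x + -1 * (Br la 0 x * dot mu x)).
    + intros x; unfold Br, dot, n2; ring.
    + apply is_lim_plus_R; [apply is_lim_mult_R; auto|].
      apply (is_lim_scal_l (fun x => Br la 0 x * dot mu x) (-1) p_infty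
        (2 / PI * (Gamma (la + 1) * sin (la * (PI / 2))) * (2 / PI * (Gamma (mu + 1) * cos (mu * (PI / 2)))))).
      apply is_lim_mult_R; auto.
  - unfold wlim; rewrite Rmult_minus_distr_r, sin_minus; ring. }
assert (Hp : 0 < 2 / PI) by (apply Rdiv_lt_0_compat; lra).
replace (wlim mu la) with (wlim mu la * (2 / PI) * / (2 / PI)) by (field; lra).
apply is_lim_ext_loc with (fun x => Br mu la x * n2 x * / n2 x).
- assert (A : Rbar_locally p_infty (fun x => Rabs (n2 x - 2 / PI) < 2 / PI))
    by exact (HN _ (locally_Rabs (2 / PI) (2 / PI) Hp)).
  revert A; apply filter_imp; intros x Hx; field.
  intros E; rewrite E in Hx; replace (0 - 2 / PI) with (- (2 / PI)) in Hx by ring.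
  rewrite Rabs_Ropp, Rabs_pos_eq in Hx; lra.
- apply is_lim_mult_R; auto.
  apply (is_lim_inv n2 p_infty (2 / PI)); auto.
  intros E; injection E; lra.
Qed.

(** Both orders are raised by 1 at a time until they are positive. By [Kh_succ] the determinant
    changes only by a constant factor and a decaying product; mu - la is preserved, and the factor
    matches the functional equation of [Gamma]. *)
Lemma lim_Br mu la : nonpole (mu + 1) -> nonpole (la + 1) -> is_lim (Br mu la) p_infty (wlim mu la).
Proof.
intros H1 H2.
assert (Hn : forall n mu la, nonpole (mu + 1) -> nonpole (la + 1) -> - INR n < mu -> - INR n < la ->
  is_lim (Br mu la) p_infty (wlim mu la)).
{ clear; induction n as [|n IH]; intros mu la H1 H2 Hmu Hla.
  - simpl in *; apply lim_Br_pos; lra.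
  - rewrite S_INR in *.
    assert (Z1 := nonpole_neq0 _ H1); assert (Z2 := nonpole_neq0 _ H2).
    assert (IH' := IH (mu + 1) (la + 1) (nonpole_succ _ H1) (nonpole_succ _ H2) ltac:(lra) ltac:(lra)).
    apply is_lim_ext_pos with (fun x => / ((mu + 1) * (la + 1)) * Br (mu + 1) (la + 1) x + (2 * (mu - la)) * (Kh mu x * Kh la x)).
    + intros x Hx; unfold Br; rewrite !Kh_succ by auto.
      assert (E1 : Jh (mu + 1) x = (mu + 1) * Kh mu x) by (rewrite Kh_Jh; field; auto).
      assert (E2 : Jh (la + 1) x = (la + 1) * Kh la x) by (rewrite Kh_Jh; field; auto).
      rewrite E1, E2; field; repeat split; lra.
    + replace (wlim mu la) with (/ ((mu + 1) * (la + 1)) * wlim (mu + 1) (la + 1) + (2 * (mu - la)) * 0).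
      * apply is_lim_plus_R.
        -- apply (is_lim_scal_l (Br (mu + 1) (la + 1)) (/ ((mu + 1) * (la + 1))) p_infty (wlim (mu + 1) (la + 1))), IH'.
        -- apply (is_lim_scal_l (fun x => Kh mu x * Kh la x) (2 * (mu - la)) p_infty 0), decays_mult; apply decays_Kh; auto.
      * unfold wlim; rewrite (Gamma_succ (mu + 1)), (Gamma_succ (la + 1)) by auto.
        replace (mu + 1 - (la + 1)) with (mu - la) by ring; field; pose proof PI_RGT_0; repeat split; lra. }
destruct (INR_unbounded (Rmax (- mu) (- la))) as [n Hn'].
pose proof (Rmax_l (- mu) (- la)); pose proof (Rmax_r (- mu) (- la)).
apply (Hn n); auto; lra.
Qed.

Lemma lim_Wr mu la : nonpole (mu + 1) -> nonpole (la + 1) -> is_lim (Wr mu la) p_infty (wlim mu la).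
Proof. intros; apply lim_Wr_Br; auto; apply lim_Br; auto. Qed.

(** * Reflection formula and speed of convergence *)

Definition nonint (nu : R) : Prop := forall n : Z, nu <> IZR n.

Lemma nonint_nonpole nu k : nonint nu -> nonpole (nu + IZR k).
Proof.
intros H n E; apply (H (- Z.of_nat n - k)%Z).
rewrite minus_IZR, opp_IZR, <- INR_IZR_INZ; lra.
Qed.

Lemma nonint_opp nu : nonint nu -> nonint (- nu).
Proof. intros H n E; apply (H (- n)%Z); rewrite opp_IZR; lra. Qed.

(* The Wronskian of the orders [nu] and [- nu] is constant, equal both to its
   leading coefficient and to its limit at infinity. *)
Lemma Gamma_reflection nu : nonint nu ->
  Gamma (nu + 1) * Gamma (- nu + 1) * sin (PI * nu) = PI * nu.
Proof.
intros H.
assert (H1 : nonpole (nu + 1)) by apply (nonint_nonpole nu 1 H).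
assert (H2 : nonpole (- nu + 1)) by apply (nonint_nonpole _ 1 (nonint_opp _ H)).
assert (L := lim_Wr nu (- nu) H1 H2).
assert (L' : is_lim (Wr nu (- nu)) p_infty (2 * nu)).
{ apply is_lim_ext_pos with (fun _ => 2 * nu); [intros; symmetry; apply Wr_opp; auto|apply is_lim_const]. }
apply is_lim_unique in L; apply is_lim_unique in L'; rewrite L in L'.
injection L'; unfold wlim; intros E; pose proof PI_RGT_0.
replace ((nu - - nu) * (PI / 2)) with (PI * nu) in E by field.
replace (PI * nu) with (PI / 2 * (2 * nu)) at 2 by field; rewrite <- E; field; lra.
Qed.

Lemma Rabs_lim_le f (l y K : R) X : is_lim f p_infty l -> (forall x, X <= x -> Rabs (f x - y) <= K) -> Rabs (l - y) <= K.
Proof.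
intros H HK; apply le_epsilon; intros eps He.
assert (A : Rbar_locally p_infty (fun x => Rabs (f x - l) < eps)) by exact (H _ (locally_Rabs l eps He)).
destruct A as [T HT].
set (x := Rmax T X + 1); pose proof (Rmax_l T X); pose proof (Rmax_r T X).
specialize (HT x ltac:(unfold x; lra)); specialize (HK x ltac:(unfold x; lra)).
replace (l - y) with (- (f x - l) + (f x - y)) by ring.
apply Rle_trans with (1 := Rabs_triang _ _); rewrite Rabs_Ropp; lra.
Qed.

(** Beyond x the derivative of the Wronskian is at most K / t^2, so that [Wr] + K / t and - [Wr] + K
    / t both decrease; the other end then goes to infinity. The factor mu^2 - la0^2 is kept explicit
    because it is divided out afterwards. *)
Lemma Wr_tail mu0 la0 : nonpole (mu0 + 1) -> nonpole (la0 + 1) -> exists eta X C, 0 < eta /\ 1 <= X /\ 0 <= C /\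
  forall mu, Rabs (mu - mu0) < eta -> nonpole (mu + 1) /\
    forall x, X <= x -> Rabs (Wr mu la0 x - wlim mu la0) <= Rabs (mu ^ 2 - la0 ^ 2) * C / x.
Proof.
intros H1 H2.
destruct (JK_bound mu0 H1) as [eta [X1 [C1 [He [HX1 [HC1 B1]]]]]].
destruct (JK_bound la0 H2) as [eta2 [X2 [C2 [He2 [HX2 [HC2 B2]]]]]].
destruct (B2 la0) as [_ B2']; [rewrite Rminus_diag, Rabs_R0; auto|clear B2].
exists eta, (Rmax X1 X2), (C1 + C2).
pose proof (Rmax_l X1 X2); pose proof (Rmax_r X1 X2).
split; [auto|split; [lra|split; [lra|]]].
intros mu Hmu; destruct (B1 mu Hmu) as [Hn B1']; split; auto.
intros x Hx.
set (K := Rabs (mu ^ 2 - la0 ^ 2) * (C1 + C2)).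
assert (HK : 0 <= K) by (apply Rmult_le_pos; [apply Rabs_pos|lra]).
rewrite Rabs_minus_sym.
apply (Rabs_lim_le (Wr mu la0) _ _ _ x (lim_Wr mu la0 Hn H2)).
intros y Hy.
assert (Hd : forall t, x <= t <= y -> Rabs ((mu ^ 2 - la0 ^ 2) * (Jh mu t * Jh la0 t / t)) <= K / t ^ 2).
{ intros t Ht; specialize (B1' t ltac:(lra)); specialize (B2' t ltac:(lra)).
  unfold Rdiv; rewrite !Rabs_mult, Rabs_inv, (Rabs_pos_eq t) by lra; unfold K.
  apply Rmult_le_reg_r with (t ^ 2); [nra|].
  replace (Rabs (mu ^ 2 - la0 ^ 2) * (Rabs (Jh mu t) * Rabs (Jh la0 t) * / t) * t ^ 2)
    with (Rabs (mu ^ 2 - la0 ^ 2) * (t * (Rabs (Jh mu t) * Rabs (Jh la0 t)))) by (field; lra).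
  replace (Rabs (mu ^ 2 - la0 ^ 2) * (C1 + C2) * / t ^ 2 * t ^ 2) with (Rabs (mu ^ 2 - la0 ^ 2) * (C1 + C2)) by (field; lra).
  apply Rmult_le_compat_l; [apply Rabs_pos|].
  rewrite <- (pow2_abs (Jh mu t)) in B1'; rewrite <- (pow2_abs (Jh la0 t)) in B2'.
  pose proof (pow2_ge_0 (Rabs (Jh mu t) - Rabs (Jh la0 t))).
  pose proof (pow2_ge_0 (Kh mu t)); pose proof (pow2_ge_0 (Kh la0 t)).
  assert (t * (2 * (Rabs (Jh mu t) * Rabs (Jh la0 t))) <= t * (Rabs (Jh mu t) ^ 2 + Rabs (Jh la0 t) ^ 2)) by (apply Rmult_le_compat_l; lra).
  nra. }
assert (D : forall t, x <= t <= y -> is_derive (Wr mu la0) t ((mu ^ 2 - la0 ^ 2) * (Jh mu t * Jh la0 t / t))).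
{ intros t Ht; apply is_derive_Wr; auto; lra. }
assert (P1 : Wr mu la0 y + K / y <= Wr mu la0 x + K / x).
{ apply (decreasing_derive (fun t => Wr mu la0 t + K / t)
    (fun t => (mu ^ 2 - la0 ^ 2) * (Jh mu t * Jh la0 t / t) - K / t ^ 2)); auto.
  - intros t Ht; pose proof (D t Ht) as Dt; auto_derive; [repeat split; [eexists; eauto|lra]|].
    subst_Derive; field; lra.
  - intros t Ht; pose proof (Hd t Ht) as Hb; apply Rabs_le_between in Hb; lra. }
assert (P2 : - Wr mu la0 y + K / y <= - Wr mu la0 x + K / x).
{ apply (decreasing_derive (fun t => - Wr mu la0 t + K / t)
    (fun t => - ((mu ^ 2 - la0 ^ 2) * (Jh mu t * Jh la0 t / t)) - K / t ^ 2)); auto.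
  - intros t Ht; pose proof (D t Ht) as Dt; auto_derive; [repeat split; [eexists; eauto|lra]|].
    subst_Derive; field; lra.
  - intros t Ht; pose proof (Hd t Ht) as Hb; apply Rabs_le_between in Hb; lra. }
assert (0 <= K / y) by (apply Rmult_le_pos; auto; left; apply Rinv_0_lt_compat; lra).
apply Rabs_le; lra.
Qed.

(** * Continuity in the order *)

Lemma continuous_rf (f : R -> R) t0 k : continuous f t0 -> continuous (fun t => rf (f t + 1) k) t0.
Proof.
intros Hf; induction k as [|k IH]; simpl; [apply continuous_const|].
apply (continuous_mult (fun t => rf (f t + 1) k) (fun t => f t + 1 + INR k)); auto.
apply (continuous_plus (fun t => f t + 1) (fun _ => INR k)); [|apply continuous_const].
apply (continuous_plus f (fun _ => 1)); [auto|apply continuous_const].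
Qed.

Lemma continuous_bcoef (f : R -> R) t0 k : continuous f t0 -> nonpole (f t0 + 1) ->
  continuous (fun t => bcoef (f t) k) t0.
Proof.
intros Hf H; unfold bcoef, Rdiv.
apply (continuous_mult (fun _ => (-1) ^ k) (fun t => / (INR (fact k) * rf (f t + 1) k))); [apply continuous_const|].
apply continuous_Rinv_comp.
- apply (continuous_mult (fun _ => INR (fact k)) (fun t => rf (f t + 1) k)); [apply continuous_const|apply continuous_rf, Hf].
- apply Rmult_integral_contrapositive_currified; [apply INR_fact_neq_0|apply rf_neq0, H].
Qed.

Lemma continuous_sum (u : R -> nat -> R) t0 n : (forall j, (j <= n)%nat -> continuous (fun t => u t j) t0) ->
  continuous (fun t => sum_f_R0 (u t) n) t0.
Proof.
induction n as [|n IH]; intros H; simpl; [apply H; lia|].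
apply (continuous_plus (fun t => sum_f_R0 (u t) n) (fun t => u t (S n))); [apply IH; intros; apply H; lia|apply H; lia].
Qed.

Lemma continuous_pcoef (f g : R -> R) t0 k : continuous f t0 -> continuous g t0 ->
  nonpole (f t0 + 1) -> nonpole (g t0 + 1) -> continuous (fun t => pcoef (f t) (g t) k) t0.
Proof.
intros Hf Hg H1 H2; unfold pcoef, PS_mult.
apply (continuous_sum (fun t j => bcoef (f t) j * bcoef (g t) (k - j))); intros j _.
apply (continuous_mult (fun t => bcoef (f t) j) (fun t => bcoef (g t) (k - j)));
  apply continuous_bcoef; auto.
Qed.

Lemma locally_continuous_lt (f : R -> R) t0 e : continuous f t0 -> 0 < e -> locally t0 (fun t => Rabs (f t - f t0) < e).
Proof. intros Hf He; exact (Hf _ (locally_Rabs (f t0) e He)). Qed.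

Lemma pcoef_unif (f g : R -> R) t0 : continuous f t0 -> continuous g t0 ->
  nonpole (f t0 + 1) -> nonpole (g t0 + 1) ->
  exists A, locally t0 (fun t => nonpole (f t + 1) /\ nonpole (g t + 1) /\ exp_type (pcoef (f t) (g t)) A 2).
Proof.
intros Hf Hg H1 H2.
destruct (bcoef_unif _ H1) as [e1 [M1 [He1 B1]]]; destruct (bcoef_unif _ H2) as [e2 [M2 [He2 B2]]].
exists (M1 * M2).
generalize (filter_and _ _ (locally_continuous_lt f t0 e1 Hf He1) (locally_continuous_lt g t0 e2 Hg He2)).
apply filter_imp; intros t [L1 L2].
destruct (B1 _ L1) as [N1 E1]; destruct (B2 _ L2) as [N2 E2]; repeat split; auto; try apply N1; try apply N2.
all: replace 2 with (1 + 1) by ring; apply (exp_type_pcoef _ _ _ _ _ _ E1 E2).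
Qed.

(** Tannery's theorem with an exponential series as majorant. *)
Lemma Series_continuous_param (c : R -> nat -> R) t0 A B (x : nat -> R) r :
  (forall k, Rabs (x k) <= r ^ k) -> 0 <= r ->
  locally t0 (fun t => exp_type (c t) A B) -> (forall k, continuous (fun t => c t k) t0) ->
  continuous (fun t => Series (fun k => c t k * x k)) t0.
Proof.
intros Hx Hr Hc Hk.
assert (Hc0 : exp_type (c t0) A B) by exact (locally_singleton _ _ Hc).
apply (filterlim_Series (locally t0) (fun t k => c t k * x k) (fun k => c t0 k * x k)
  (fun k => A * (B * r) ^ k / INR (fact k))).
- eexists; apply is_series_exp.
- revert Hc; apply filter_imp; intros t Ht k; apply exp_type_term; auto.
- intros k; apply exp_type_term; auto.
- intros k; apply (continuous_mult (fun t => c t k) (fun _ => x k)); [apply Hk|apply continuous_const].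
Qed.

Lemma PSeries_continuous_param (c : R -> nat -> R) t0 A B y :
  locally t0 (fun t => exp_type (c t) A B) -> (forall k, continuous (fun t => c t k) t0) ->
  continuous (fun t => PSeries (c t) y) t0.
Proof.
apply (Series_continuous_param c t0 A B (fun k => y ^ k) (Rabs y)); [intros k; apply Rabs_pow_le|apply Rabs_pos].
Qed.

Lemma Rpower_continuous_exp b (f : R -> R) t0 : continuous f t0 -> continuous (fun t => Rpower b (f t)) t0.
Proof.
intros Hf; unfold Rpower; apply continuous_exp_comp.
apply (continuous_mult f (fun _ => ln b)); [auto|apply continuous_const].
Qed.

(* Coefficients of the power series part of a primitive of
   [Jh nu x * Jh (- nu) x / x]. *)
Definition kcoef (mu nu : R) (k : nat) : R :=
  match k with O => 0 | S _ => pcoef mu (- nu) k / (mu - nu + 2 * INR k) end.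

(** For mu within 1 of nu the denominators with k >= 1 exceed 1, so that the coefficients are
    dominated by those of the product. *)
Lemma kcoef_unif nu : nonpole (nu + 1) -> nonpole (- nu + 1) ->
  exists A, locally nu (fun mu => exp_type (kcoef mu nu) A 2).
Proof.
intros H1 H2.
destruct (pcoef_unif (fun mu => mu) (fun _ => - nu) nu (continuous_id nu) (continuous_const _ nu) H1 H2) as [A HA].
exists A; generalize (filter_and _ _ HA (locally_Rabs nu 1 Rlt_0_1)); apply filter_imp.
intros mu [[_ [_ E]] Hmu]; apply exp_type_le with (1 := E).
intros [|k]; unfold kcoef; [rewrite Rabs_R0; apply Rabs_pos|].
apply Rabs_def2 in Hmu; rewrite S_INR; pose proof (pos_INR k).
unfold Rdiv; rewrite Rabs_mult, Rabs_inv, (Rabs_pos_eq (mu - nu + _)) by lra.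
rewrite <- (Rmult_1_r (Rabs (pcoef mu (- nu) (S k)))) at 2.
apply Rmult_le_compat_l; [apply Rabs_pos|apply Rinv_le_1; lra].
Qed.

Lemma kcoef_continuous nu k : nonpole (nu + 1) -> nonpole (- nu + 1) -> continuous (fun mu => kcoef mu nu k) nu.
Proof.
intros H1 H2; destruct k as [|k]; unfold kcoef; [apply continuous_const|].
pose proof (pos_INR k).
apply (continuous_mult (fun mu => pcoef mu (- nu) (S k)) (fun mu => / (mu - nu + 2 * INR (S k)))).
- apply (continuous_pcoef (fun mu => mu) (fun _ => - nu)); auto; [apply continuous_id|apply continuous_const].
- assert (0 < 2 * INR (S k)) by (rewrite S_INR; lra).
  set (c := 2 * INR (S k)) in *; clearbody c.
  apply (ex_derive_continuous (fun mu => / (mu - nu + c))); auto_derive; lra.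
Qed.

(** The finite part of [Gf mu (- nu)] as mu tends to nu: its constant term 1 / (mu - nu) is removed,
    and the logarithm is the derivative of (x / 2)^(mu - nu) at mu = nu. *)
Definition Kf (nu x : R) : R := ln (x / 2) + PSeries (kcoef nu nu) (x ^ 2 / 4).

(** Chosen so that the limit of [Gf mu (- nu)] at infinity is [Gamma (mu + 1)] [Gamma (- nu + 1)]
    [sinq nu mu] / (mu - nu). *)
Definition sinq (nu mu : R) : R := 2 / PI * sin ((mu + nu) * (PI / 2)) / (mu + nu).

Lemma sin_nonint nu : nonint nu -> sin (PI * nu) <> 0.
Proof.
intros H E; apply sin_eq_0_0 in E; destruct E as [k Hk]; apply (H k).
pose proof PI_RGT_0; apply Rmult_eq_reg_r with PI; lra.
Qed.

Lemma Gf_split mu nu x : 0 < x -> mu <> nu -> nonpole (mu + 1) -> nonpole (- nu + 1) -> Rabs (mu - nu) < 1 ->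
  Gf mu (- nu) x = Rpower (x / 2) (mu - nu) * (/ (mu - nu) + PSeries (kcoef mu nu) (x ^ 2 / 4)).
Proof.
intros Hx Hne H1 H2 Hd; unfold Gf.
destruct (bcoef_exp_type _ H1) as [M1 E1]; destruct (bcoef_exp_type _ H2) as [M2 E2].
assert (E := exp_type_pcoef _ _ _ _ _ _ E1 E2).
change (mu + - nu) with (mu - nu); f_equal.
set (c0 := fun k : nat => match k with O => / (mu - nu) | S _ => 0 end).
assert (Hk : exp_type (kcoef mu nu) (M1 * M2) (1 + 1)).
{ apply exp_type_le with (1 := E).
  intros [|k]; unfold kcoef; [rewrite Rabs_R0; apply Rabs_pos|].
  apply Rabs_def2 in Hd; rewrite S_INR; pose proof (pos_INR k).
  unfold Rdiv; rewrite Rabs_mult, Rabs_inv, (Rabs_pos_eq (mu - nu + _)) by lra.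
  rewrite <- (Rmult_1_r (Rabs (pcoef mu (- nu) (S k)))) at 2.
  apply Rmult_le_compat_l; [apply Rabs_pos|apply Rinv_le_1; lra]. }
assert (Hc0 : exp_type c0 (Rabs (/ (mu - nu))) 1).
{ split; [apply Rabs_pos|split; [lra|]]; intros [|k]; unfold c0; simpl.
  - lra.
  - rewrite Rabs_R0, pow1; apply Rmult_le_pos; [pose proof (Rabs_pos (/ (mu - nu))); lra|].
    left; apply Rinv_0_lt_compat; change (0 < INR (fact (S k))); apply INR_fact_pos. }
replace (/ (mu - nu)) with (PSeries c0 (x ^ 2 / 4)) by (apply PSeries_const_term; reflexivity).
rewrite <- (PSeries_plus_exp_type _ _ _ _ _ _ _ Hc0 Hk).
apply PSeries_ext; intros [|k]; unfold c0, kcoef, pint_coef.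
- rewrite pcoef_0; simpl; field; lra.
- change (mu + - nu) with (mu - nu); ring.
Qed.

(** The same pole 1 / (mu - nu) is subtracted from [Gf mu (- nu)] and from its limit at infinity.
    Their difference is the Wronskian error divided by mu^2 - nu^2, hence at most C / x uniformly in
    mu. *)
Lemma kf_approx nu : nonint nu -> exists eta X C, 0 < eta <= 1 /\ 1 <= X /\ 0 <= C /\
  forall mu, 0 < Rabs (mu - nu) < eta -> forall x, X <= x ->
  Rabs ((Rpower (x / 2) (mu - nu) - 1) / (mu - nu) + Rpower (x / 2) (mu - nu) * PSeries (kcoef mu nu) (x ^ 2 / 4)
    - (Gamma (mu + 1) * Gamma (- nu + 1) * sinq nu mu - 1) / (mu - nu)) <= C / x.
Proof.
intros H.
assert (H1 : nonpole (nu + 1)) by apply (nonint_nonpole nu 1 H).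
assert (H2 : nonpole (- nu + 1)) by apply (nonint_nonpole _ 1 (nonint_opp _ H)).
assert (Hnu : nu <> 0) by apply (H 0%Z).
destruct (Wr_tail nu (- nu) H1 H2) as [eta [X [C [He [HX [HC HW]]]]]].
(* A radius at most |nu| excludes mu = - nu, which is at distance 2 |nu|; a radius at most 1 keeps
   mu - nu + 2k away from 0 for k >= 1. *)
exists (Rmin eta (Rmin 1 (Rabs nu))), X, C.
assert (0 < Rabs nu) by (apply Rabs_pos_lt; auto).
assert (0 < Rmin eta (Rmin 1 (Rabs nu))) by (repeat apply Rmin_glb_lt; lra).
pose proof (Rmin_l eta (Rmin 1 (Rabs nu))); pose proof (Rmin_r eta (Rmin 1 (Rabs nu))).
pose proof (Rmin_l 1 (Rabs nu)); pose proof (Rmin_r 1 (Rabs nu)).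
split; [lra|split; [auto|split; [auto|]]].
intros mu Hmu x Hx; destruct (HW mu ltac:(lra)) as [Hn HW'].
assert (Hne : mu - nu <> 0) by (intros E; rewrite E, Rabs_R0 in Hmu; lra).
assert (Hs : mu + nu <> 0).
{ intros E; replace (mu - nu) with (- 2 * nu) in Hmu by lra.
  rewrite Rabs_mult, Rabs_left in Hmu by lra; lra. }
assert (Hsq : 0 < Rabs (mu ^ 2 - (- nu) ^ 2)).
{ apply Rabs_pos_lt; replace (mu ^ 2 - (- nu) ^ 2) with ((mu - nu) * (mu + nu)) by ring.
  apply Rmult_integral_contrapositive_currified; auto. }
pose proof (Gf_Wr mu (- nu) x ltac:(lra) Hn H2) as E.
rewrite (Gf_split mu nu x) in E by (auto; lra).
match goal with |- Rabs ?r <= _ => replace r with ((Wr mu (- nu) x - wlim mu (- nu)) / (mu ^ 2 - (- nu) ^ 2)) end.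
- unfold Rdiv at 1; rewrite Rabs_mult, Rabs_inv.
  apply Rmult_le_reg_l with (Rabs (mu ^ 2 - (- nu) ^ 2)); auto.
  replace (Rabs (mu ^ 2 - (- nu) ^ 2) * (Rabs (Wr mu (- nu) x - wlim mu (- nu)) * / Rabs (mu ^ 2 - (- nu) ^ 2)))
    with (Rabs (Wr mu (- nu) x - wlim mu (- nu))) by (field; lra).
  apply Rle_trans with (1 := HW' x Hx); right; unfold Rdiv; ring.
- rewrite <- E.
  + unfold wlim, sinq; pose proof PI_RGT_0.
    replace (mu ^ 2 - (- nu) ^ 2) with ((mu - nu) * (mu + nu)) by ring.
    replace (mu - - nu) with (mu + nu) by ring; field; repeat split; auto; lra.
  + intros [|k] E'; [simpl in E'; lra|].
    rewrite S_INR in E'; pose proof (pos_INR k).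
    assert (Rabs (mu - nu) < 1) as Hlt by lra; apply Rabs_def2 in Hlt; lra.
Qed.

Lemma Rpower_quotient_lim b : is_lim (fun d => (Rpower b d - 1) / d) 0 (ln b).
Proof.
assert (D : is_derive (fun d => Rpower b d) 0 (ln b)).
{ unfold Rpower; auto_derive; auto; rewrite Rmult_0_l, exp_0; ring. }
apply is_derive_Reals in D.
intros P [eps HP]; destruct (D eps (cond_pos eps)) as [d Hd].
exists d; intros h Hh Hh0; apply HP.
assert (Hh' : Rabs h < d) by (replace h with (h - 0) by ring; exact Hh).
specialize (Hd h Hh0 Hh'); rewrite Rplus_0_l in Hd.
assert (E : Rpower b 0 = 1) by (unfold Rpower; rewrite Rmult_0_l; apply exp_0).
rewrite E in Hd; exact Hd.
Qed.

Lemma kf_main_lim nu x : nonint nu -> is_lim (fun mu =>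
  (Rpower (x / 2) (mu - nu) - 1) / (mu - nu) + Rpower (x / 2) (mu - nu) * PSeries (kcoef mu nu) (x ^ 2 / 4))
  nu (Kf nu x).
Proof.
intros H.
assert (H1 : nonpole (nu + 1)) by apply (nonint_nonpole nu 1 H).
assert (H2 : nonpole (- nu + 1)) by apply (nonint_nonpole _ 1 (nonint_opp _ H)).
apply is_lim_plus'.
- apply (is_lim_comp (fun d => (Rpower (x / 2) d - 1) / d) (fun mu => mu - nu) nu (ln (x / 2)) 0).
  + apply Rpower_quotient_lim.
  + replace (Finite 0) with (Finite (nu - nu)) by (f_equal; ring).
    apply (is_lim_continuity (fun mu => mu - nu)), continuity_pt_minus; [apply continuity_pt_id|apply continuity_pt_const; intros ? ?; auto].
  + exists (mkposreal 1 Rlt_0_1); intros y _ Hy E; injection E; lra.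
- assert (C1 : continuous (fun mu => Rpower (x / 2) (mu - nu) * PSeries (kcoef mu nu) (x ^ 2 / 4)) nu).
  { apply (continuous_mult (fun mu => Rpower (x / 2) (mu - nu)) (fun mu => PSeries (kcoef mu nu) (x ^ 2 / 4))).
    - apply Rpower_continuous_exp, (ex_derive_continuous (fun t => t - nu)); auto_derive; auto.
    - destruct (kcoef_unif nu H1 H2) as [A HA].
      apply (PSeries_continuous_param (fun mu => kcoef mu nu) nu A 2); auto.
      intros; apply kcoef_continuous; auto. }
  assert (L := is_lim_continuity _ nu (proj2 (continuity_pt_filterlim _ _) C1)).
  replace (PSeries (kcoef nu nu) (x ^ 2 / 4)) with
    (Rpower (x / 2) (nu - nu) * PSeries (kcoef nu nu) (x ^ 2 / 4)); [exact L|].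
  rewrite Rminus_diag; unfold Rpower; rewrite Rmult_0_l, exp_0; ring.
Qed.

(** [D] is the difference quotient at nu, because the product equals 1 there by the reflection
    formula. Near nu it is within C / x plus any eps of [Kf nu x]; so it is Cauchy as mu tends to
    nu, and its limit is also that of [Kf nu] at infinity. *)
Lemma kf_derivative nu : nonint nu -> exists L,
  is_derive (fun mu => Gamma (mu + 1) * Gamma (- nu + 1) * sinq nu mu) nu L /\ is_lim (Kf nu) p_infty L.
Proof.
intros H; destruct (kf_approx nu H) as [eta [X [C [He [HX [HC HB]]]]]].
set (D := fun mu => (Gamma (mu + 1) * Gamma (- nu + 1) * sinq nu mu - 1) / (mu - nu)).
assert (HD : forall x eps, X <= x -> 0 < eps -> exists d, 0 < d /\ forall mu, 0 < Rabs (mu - nu) < d ->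
  Rabs (D mu - Kf nu x) <= C / x + eps).
{ intros x eps Hx Heps.
  destruct (kf_main_lim nu x H _ (locally_Rabs _ _ Heps)) as [d Hd].
  exists (Rmin d eta); split; [apply Rmin_glb_lt; [apply cond_pos|lra]|].
  intros mu Hmu; pose proof (Rmin_l d eta); pose proof (Rmin_r d eta).
  assert (Hne : mu <> nu) by (intros E; rewrite E, Rminus_diag, Rabs_R0 in Hmu; lra).
  assert (Hmud : Rabs (mu - nu) < d) by lra.
  specialize (Hd mu Hmud Hne); specialize (HB mu ltac:(lra) x Hx); simpl in Hd; fold (D mu) in HB.
  set (Q := _ + _ * PSeries _ _) in Hd, HB.
  replace (D mu - Kf nu x) with (- (Q - D mu) + (Q - Kf nu x)) by ring.
  apply Rle_trans with (1 := Rabs_triang _ _); rewrite Rabs_Ropp; lra. }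
assert (HL : exists L : R, filterlim D (Rbar_locally' nu) (locally L)).
{ apply (filterlim_locally_cauchy (U := R_CompleteSpace) (F := Rbar_locally' nu)).
  intros eps; pose proof (cond_pos eps) as Heps.
  (* This x makes C / x <= eps / 8. Each comparison of [D] with [Kf nu x] then costs at most eps /
     4, so that two values of [D] differ by at most eps / 2. *)
  set (x := Rmax X (8 * C / eps + 1)); pose proof (Rmax_l X (8 * C / eps + 1)); pose proof (Rmax_r X (8 * C / eps + 1)).
  assert (HCx : C / x <= eps / 8).
  { assert (0 <= 8 * C / eps) by (apply Rmult_le_pos; [lra|left; apply Rinv_0_lt_compat; lra]).
    apply Rmult_le_reg_r with (8 * x / eps).
    - apply Rdiv_lt_0_compat; unfold x; lra.
    - replace (C / x * (8 * x / eps)) with (8 * C / eps) by (field; unfold x; lra).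
      replace (eps / 8 * (8 * x / eps)) with x by (field; lra); unfold x; lra. }
  destruct (HD x (eps / 8) ltac:(unfold x; lra) ltac:(lra)) as [d [Hd0 Hd]].
  exists (fun mu => 0 < Rabs (mu - nu) < d); split.
  - exists (mkposreal d Hd0); intros y Hy Hne; split; [apply Rabs_pos_lt; lra|exact Hy].
  - intros u v Hu Hv; change (Rabs (D v - D u) < eps).
    pose proof (Hd u Hu); pose proof (Hd v Hv).
    replace (D v - D u) with ((D v - Kf nu x) + - (D u - Kf nu x)) by ring.
    apply Rle_lt_trans with (1 := Rabs_triang _ _); rewrite Rabs_Ropp; lra. }
destruct HL as [L HL]; exists L.
assert (H1 : Gamma (nu + 1) * Gamma (- nu + 1) * sinq nu nu = 1).
{ pose proof (Gamma_reflection nu H) as E; pose proof PI_RGT_0.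
  assert (Hnu : nu <> 0) by apply (H 0%Z).
  unfold sinq; replace ((nu + nu) * (PI / 2)) with (PI * nu) by field.
  replace (Gamma (nu + 1) * Gamma (- nu + 1) * (2 / PI * sin (PI * nu) / (nu + nu))) with
    (Gamma (nu + 1) * Gamma (- nu + 1) * sin (PI * nu) * (2 / PI / (nu + nu))) by (field; lra).
  rewrite E; field; lra. }
split.
- apply is_derive_Reals; intros eps Heps.
  destruct (HL _ (locally_Rabs L eps Heps)) as [d Hd].
  exists d; intros h Hh0 Hh; rewrite H1.
  assert (Hh' : Rabs (nu + h - nu) < d) by (replace (nu + h - nu) with h by ring; auto).
  specialize (Hd (nu + h) Hh' ltac:(lra)); unfold D in Hd.
  replace (nu + h - nu) with h in Hd by ring; exact Hd.
- apply filterlim_p_infty_R; intros eps Heps.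
  exists (Rmax X (2 * C / eps + 1)); intros x Hx.
  pose proof (Rmax_l X (2 * C / eps + 1)); pose proof (Rmax_r X (2 * C / eps + 1)).
  assert (HCx : C / x < eps / 2).
  { assert (0 <= 2 * C / eps) by (apply Rmult_le_pos; [lra|left; apply Rinv_0_lt_compat; lra]).
    apply Rmult_lt_reg_r with (2 * x / eps); [apply Rdiv_lt_0_compat; lra|].
    replace (C / x * (2 * x / eps)) with (2 * C / eps) by (field; lra).
    replace (eps / 2 * (2 * x / eps)) with x by (field; lra); lra. }
  destruct (HD x (eps / 8) ltac:(lra) ltac:(lra)) as [d [Hd0 Hd]].
  destruct (HL _ (locally_Rabs L (eps / 8) ltac:(lra))) as [d' Hd'].
  set (mu := nu + Rmin d d' / 2).
  assert (Hm : 0 < Rmin d d') by (apply Rmin_glb_lt; [auto|apply cond_pos]).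
  pose proof (Rmin_l d d'); pose proof (Rmin_r d d').
  assert (E : Rabs (mu - nu) = Rmin d d' / 2) by (unfold mu; rewrite Rabs_pos_eq; lra).
  specialize (Hd mu ltac:(lra)).
  assert (Hm' : Rabs (mu - nu) < d') by lra.
  specialize (Hd' mu Hm' ltac:(unfold mu; lra)); simpl in Hd'.
  replace (Kf nu x - L) with (- (D mu - Kf nu x) + (D mu - L)) by ring.
  apply Rle_lt_trans with (1 := Rabs_triang _ _); rewrite Rabs_Ropp; lra.
Qed.

Lemma is_derive_sinq nu : nonint nu ->
  is_derive (sinq nu) nu (cos (PI * nu) / (2 * nu) - sin (PI * nu) / (2 * PI * nu ^ 2)).
Proof.
intros H; assert (Hnu : nu <> 0) by apply (H 0%Z); pose proof PI_RGT_0.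
unfold sinq; auto_derive; [lra|].
replace ((nu + nu) * (PI / 2)) with (PI * nu) by field.
field; lra.
Qed.

Lemma sinq_neq0 nu : nonint nu -> sinq nu nu = sin (PI * nu) / (PI * nu) /\ sinq nu nu <> 0.
Proof.
intros H; assert (Hnu : nu <> 0) by apply (H 0%Z); pose proof PI_RGT_0; pose proof (sin_nonint nu H).
assert (E : sinq nu nu = sin (PI * nu) / (PI * nu)).
{ unfold sinq; replace ((nu + nu) * (PI / 2)) with (PI * nu) by field; field; lra. }
split; auto; rewrite E; apply Rmult_integral_contrapositive_currified; auto.
apply Rinv_neq_0_compat, Rmult_integral_contrapositive_currified; lra.
Qed.

(** The product in [kf_derivative] is solved for [Gamma (mu + 1)]: the other factors are
    differentiable and nonzero at nu. *)
Lemma Gamma_derivable nu : nonint nu -> ex_derive (fun mu => Gamma (mu + 1)) nu.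
Proof.
intros H; destruct (kf_derivative nu H) as [L [D _]].
destruct (sinq_neq0 nu H) as [_ S0].
assert (H2 : nonpole (- nu + 1)) by apply (nonint_nonpole _ 1 (nonint_opp _ H)).
pose proof (Gamma_neq0 _ H2) as G0.
pose proof (is_derive_sinq nu H) as DS.
set (h := fun mu => Gamma (mu + 1) * Gamma (- nu + 1) * sinq nu mu).
assert (Dh : is_derive h nu L) by exact D; clear D.
apply ex_derive_ext_loc with (fun mu => h mu / (Gamma (- nu + 1) * sinq nu mu)).
- assert (Cs : continuous (sinq nu) nu) by (apply (ex_derive_continuous (sinq nu)); eexists; eauto).
  generalize (locally_continuous_lt _ _ (Rabs (sinq nu nu)) Cs (Rabs_pos_lt _ S0)); apply filter_imp.
  intros mu Hmu.
  assert (sinq nu mu <> 0).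
  { intros E; rewrite E in Hmu; replace (0 - sinq nu nu) with (- sinq nu nu) in Hmu by ring.
    rewrite Rabs_Ropp in Hmu; lra. }
  unfold h; eqR; field; auto.
- clearbody h; auto_derive; repeat split; try (eexists; eassumption).
  apply Rmult_integral_contrapositive_currified; auto.
Qed.

Lemma Gamma_continuous nu : nonint nu -> continuous (fun mu => Gamma (mu + 1)) nu.
Proof. intros H; apply (ex_derive_continuous (fun mu => Gamma (mu + 1))), Gamma_derivable, H. Qed.

(** The product equals 1 at nu, so its derivative is a logarithmic derivative: digamma(nu) + 1 / nu
    from [Gamma (mu + 1)], and (PI / 2) cot(PI nu) - 1 / (2 nu) from [sinq]. *)
Lemma Kf_lim nu : 0 < nu -> nonint nu ->
  is_lim (Kf nu) p_infty (digamma nu + / (2 * nu) + PI / 2 * cot (PI * nu)).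
Proof.
intros Hnu H; destruct (kf_derivative nu H) as [L [D HL]].
replace (digamma nu + / (2 * nu) + PI / 2 * cot (PI * nu)) with L; auto.
destruct (sinq_neq0 nu H) as [S1 S0]; pose proof (is_derive_sinq nu H) as DS.
pose proof (Gamma_reflection nu H) as E; pose proof PI_RGT_0 as HPI; pose proof (sin_nonint nu H) as Hsin.
destruct (Gamma_derivable nu H) as [g Dg].
assert (DG : is_derive Gamma nu ((g - Gamma nu) / nu)).
{ assert (D2 : is_derive (fun mu => Gamma (mu + 1) / mu) nu ((g - Gamma nu) / nu)).
  { set (G := fun mu => Gamma (mu + 1)) in *.
    assert (EG : G nu = nu * Gamma nu) by (unfold G; apply Gamma_succ, nonpole_pos, Hnu).
    evar_last; [apply (is_derive_div G (fun x => x) nu g 1); [exact Dg|apply (is_derive_id (K := R_AbsRing))|lra]|].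
    rewrite EG; field; lra. }
  apply is_derive_ext_loc with (2 := D2).
  exists (mkposreal nu Hnu); intros y Hy.
  assert (Hy' : Rabs (y - nu) < nu) by exact Hy; apply Rabs_def2 in Hy'.
  eqR; rewrite Gamma_succ by (apply nonpole_pos; lra); field; lra. }
unfold digamma; rewrite (is_derive_unique _ _ _ DG).
assert (D3 : is_derive (fun mu => Gamma (mu + 1) * Gamma (- nu + 1) * sinq nu mu) nu
  (g * Gamma (- nu + 1) * sinq nu nu + Gamma (nu + 1) * Gamma (- nu + 1) *
   (cos (PI * nu) / (2 * nu) - sin (PI * nu) / (2 * PI * nu ^ 2)))).
{ set (G := fun mu => Gamma (mu + 1)); set (S := sinq nu) in *.
  assert (DG' : is_derive G nu g) by exact Dg.
  change (Gamma (nu + 1)) with (G nu).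
  change (is_derive (fun mu => G mu * Gamma (- nu + 1) * S mu) nu
   (g * Gamma (- nu + 1) * S nu + G nu * Gamma (- nu + 1) *
   (cos (PI * nu) / (2 * nu) - sin (PI * nu) / (2 * PI * nu ^ 2)))).
  clear Dg D; clearbody G S; auto_derive; [repeat split; eexists; eassumption|subst_Derive; ring]. }
rewrite <- (is_derive_unique _ _ _ D), (is_derive_unique _ _ _ D3), S1; clear D D3.
assert (HG0 : Gamma nu <> 0) by (apply Gamma_neq0, nonpole_pos, Hnu).
rewrite (Gamma_succ nu) in E |- * by (apply nonpole_pos, Hnu).
assert (Eg : Gamma (- nu + 1) = PI / (Gamma nu * sin (PI * nu))).
{ apply Rmult_eq_reg_l with (nu * Gamma nu * sin (PI * nu)).
  - transitivity (nu * Gamma nu * Gamma (- nu + 1) * sin (PI * nu)); [ring|rewrite E; field; auto].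
  - repeat apply Rmult_integral_contrapositive_currified; lra. }
rewrite Eg; unfold cot; eqR; field; repeat split; lra.
Qed.

(** * Limits of the primitives of the squares *)

Lemma nonint_double_unif al : nonint al -> exists eta m, 0 < eta /\ 0 < m /\
  forall s, Rabs (s - 2 * al) < eta -> forall k, m <= Rabs (s + 2 * INR k).
Proof.
intros H.
assert (Hp : nonpole al) by (intros n E; apply (H (- Z.of_nat n)%Z); rewrite opp_IZR, <- INR_IZR_INZ; auto).
destruct (rf_unif al Hp) as [eta [m [He [Hm HB]]]].
exists eta, m; split; [auto|split; auto]; intros s Hs k.
destruct (HB (s / 2)) as [_ HB'].
- replace (s / 2 - al) with ((s - 2 * al) / 2) by field; unfold Rdiv; rewrite Rabs_mult, (Rabs_pos_eq (/ 2)) by lra.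
  pose proof (Rabs_pos (s - 2 * al)); lra.
- destruct (HB' k) as [_ B]; replace (s + 2 * INR k) with (2 * (s / 2 + INR k)) by field.
  rewrite Rabs_mult, (Rabs_pos_eq 2) by lra; lra.
Qed.

(** Two moving orders are allowed because one use fixes the second order while another moves both
    together. *)
Lemma pint_coef_unif (f g : R -> R) t0 al : nonint al -> continuous f t0 -> continuous g t0 ->
  f t0 = al -> g t0 = al -> exists A,
  locally t0 (fun t => exp_type (pint_coef (f t) (g t)) A 2) /\
  forall k, continuous (fun t => pint_coef (f t) (g t) k) t0.
Proof.
intros H Cf Cg Ef Eg; assert (H1 : nonpole (al + 1)) by apply (nonint_nonpole al 1 H).
destruct (nonint_double_unif al H) as [eta [m [He [Hm HB]]]].
assert (Hf1 : nonpole (f t0 + 1)) by (rewrite Ef; auto); assert (Hg1 : nonpole (g t0 + 1)) by (rewrite Eg; auto).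
destruct (pcoef_unif f g t0 Cf Cg Hf1 Hg1) as [A HA].
assert (Cs : continuous (fun t => f t + g t) t0) by exact (continuous_plus f g t0 Cf Cg).
assert (Es : f t0 + g t0 = 2 * al) by lra.
exists (/ m * A); split.
- generalize (filter_and _ _ HA (locally_continuous_lt _ t0 eta Cs He)); apply filter_imp.
  intros t [[_ [_ E]] Ht]; rewrite Es in Ht.
  assert (E' := exp_type_bmul (pcoef (f t) (g t)) (fun k => / (f t + g t + 2 * INR k)) (/ m) A 2 E).
  apply exp_type_le with (fun k => / (f t + g t + 2 * INR k) * pcoef (f t) (g t) k).
  + apply E'; intros k; rewrite Rabs_inv; apply Rinv_le_contravar; auto.
  + intros k; unfold pint_coef, Rdiv; rewrite Rmult_comm; lra.
- intros k; unfold pint_coef, Rdiv.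
  apply (continuous_mult (fun t => pcoef (f t) (g t) k) (fun t => / (f t + g t + 2 * INR k))).
  + apply (continuous_pcoef f g); auto.
  + apply continuous_comp with (f := fun t => f t + g t + 2 * INR k) (g := Rinv).
    * apply (continuous_plus (fun t => f t + g t) (fun _ => 2 * INR k)); [exact Cs|apply continuous_const].
    * apply continuous_Rinv; rewrite Es; intros E.
      specialize (HB (2 * al) ltac:(rewrite Rminus_diag, Rabs_R0; auto) k); rewrite E, Rabs_R0 in HB; lra.
Qed.

(** For mu near al, [Gf mu al] is within C / x of its limit [v mu], with C independent of mu. As mu
    tends to al, sin((mu - al) PI / 2) / (mu - al) tends to PI / 2. Negative al is included, for
    which [Gf al al] is not an integral starting at 0. *)
Lemma Gf_diag_lim al : nonint al -> is_lim (Gf al al) p_infty (Gamma (al + 1) ^ 2 / (2 * al)).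
Proof.
intros H; assert (H1 : nonpole (al + 1)) by apply (nonint_nonpole al 1 H).
assert (Hal : al <> 0) by apply (H 0%Z).
destruct (Wr_tail al al H1 H1) as [eta [X [C [He [HX [HC HW]]]]]].
destruct (nonint_double_unif al H) as [eta2 [m [He2 [Hm HB]]]].
destruct (pint_coef_unif (fun mu => mu) (fun _ => al) al al H (continuous_id al) (continuous_const _ al) eq_refl eq_refl) as [A [HA HAc]].
set (v := fun mu => Gamma (mu + 1) * Gamma (al + 1) * (2 / PI * (sin ((mu - al) * (PI / 2)) / (mu - al)) / (mu + al))).
pose proof PI_RGT_0 as HPI.
assert (Hv : is_lim v al (Gamma (al + 1) ^ 2 / (2 * al))).
{ replace (Gamma (al + 1) ^ 2 / (2 * al)) with (Gamma (al + 1) * Gamma (al + 1) * (2 / PI * (PI / 2) * / (al + al)))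
    by (field; lra).
  apply (is_lim_mult (fun mu => Gamma (mu + 1) * Gamma (al + 1))
    (fun mu => 2 / PI * (sin ((mu - al) * (PI / 2)) / (mu - al)) / (mu + al)) al
    (Gamma (al + 1) * Gamma (al + 1)) (2 / PI * (PI / 2) * / (al + al))); [| |exact I].
  - apply (is_lim_continuity (fun mu => Gamma (mu + 1) * Gamma (al + 1))), continuity_pt_filterlim.
    apply (continuous_mult (fun mu => Gamma (mu + 1)) (fun _ => Gamma (al + 1))); [apply Gamma_continuous, H|apply continuous_const].
  - apply (is_lim_mult (fun mu => 2 / PI * (sin ((mu - al) * (PI / 2)) / (mu - al))) (fun mu => / (mu + al)) al
      (2 / PI * (PI / 2)) (/ (al + al))); [| |exact I].
    + apply (is_lim_scal_l (fun mu => sin ((mu - al) * (PI / 2)) / (mu - al)) (2 / PI) al (PI / 2)).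
      assert (D : is_derive (fun mu => sin ((mu - al) * (PI / 2))) al (PI / 2)).
      { auto_derive; auto; unfold Rminus; rewrite Rplus_opp_r, Rmult_0_l, cos_0; field. }
      apply is_derive_Reals in D.
      intros P [eps HP]; destruct (D eps (cond_pos eps)) as [d Hd].
      exists d; change (forall mu : R, Rabs (mu - al) < d -> mu <> al -> P (sin ((mu - al) * (PI / 2)) / (mu - al))).
      intros mu Hmu Hne; apply HP.
      assert (Hh' : Rabs (mu - al) < d) by exact Hmu.
      specialize (Hd (mu - al) ltac:(lra) Hh').
      replace (al + (mu - al)) with mu in Hd by ring.
      rewrite (Rminus_diag al), Rmult_0_l, sin_0, Rminus_0_r in Hd; exact Hd.
    + apply (is_lim_continuity (fun mu => / (mu + al))), continuity_pt_filterlim.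
      apply (ex_derive_continuous (fun mu => / (mu + al))); auto_derive; lra. }
assert (HG : forall x, 0 < x -> continuous (fun mu => Gf mu al x) al).
{ intros x Hx; unfold Gf.
  apply (continuous_mult (fun mu => Rpower (x / 2) (mu + al)) (fun mu => PSeries (pint_coef mu al) (x ^ 2 / 4))).
  - apply Rpower_continuous_exp, (ex_derive_continuous (fun t => t + al)); auto_derive; auto.
  - apply (PSeries_continuous_param (fun mu => pint_coef mu al) al (A) 2); auto. }
assert (Hb : forall x, X <= x -> Rabs (Gf al al x - Gamma (al + 1) ^ 2 / (2 * al)) <= C / x).
{ intros x Hx; apply le_epsilon; intros eps Heps.
  destruct (Hv _ (locally_Rabs _ (eps / 2) ltac:(lra))) as [d1 Hd1].
  destruct (locally_continuous_lt _ _ (eps / 2) (HG x ltac:(lra)) ltac:(lra)) as [d2 Hd2].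
  set (r := Rmin (Rmin d1 d2) (Rmin (Rmin eta eta2) (Rabs al))).
  assert (0 < Rabs al) by (apply Rabs_pos_lt; auto).
  assert (Hr : 0 < r) by (repeat apply Rmin_glb_lt; auto; apply cond_pos).
  assert (Hr' : r <= d1 /\ r <= d2 /\ r <= eta /\ r <= eta2 /\ r <= Rabs al).
  { unfold r; pose proof (Rmin_l (Rmin d1 d2) (Rmin (Rmin eta eta2) (Rabs al))).
    pose proof (Rmin_r (Rmin d1 d2) (Rmin (Rmin eta eta2) (Rabs al))).
    pose proof (Rmin_l d1 d2); pose proof (Rmin_r d1 d2).
    pose proof (Rmin_l (Rmin eta eta2) (Rabs al)); pose proof (Rmin_r (Rmin eta eta2) (Rabs al)).
    pose proof (Rmin_l eta eta2); pose proof (Rmin_r eta eta2); lra. }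
  set (mu := al + r / 2).
  assert (Emu : Rabs (mu - al) = r / 2) by (unfold mu; rewrite Rabs_pos_eq; lra).
  assert (B1 : Rabs (mu - al) < d1) by lra; assert (B2 : Rabs (mu - al) < d2) by lra.
  specialize (Hd1 mu B1 ltac:(unfold mu; lra)); specialize (Hd2 mu B2); cbv beta in Hd1, Hd2.
  destruct (HW mu ltac:(lra)) as [Hn HW']; specialize (HW' x Hx).
  specialize (HB (mu + al) ltac:(replace (mu + al - 2 * al) with (mu - al) by ring; lra)).
  assert (Hs0 : mu + al <> 0).
  { intros E; specialize (HB 0%nat); simpl in HB; rewrite Rmult_0_r, Rplus_0_r, E, Rabs_R0 in HB; lra. }
  assert (Hd0 : mu - al <> 0) by (unfold mu; lra).
  assert (Hsq : 0 < Rabs (mu ^ 2 - al ^ 2)).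
  { apply Rabs_pos_lt; replace (mu ^ 2 - al ^ 2) with ((mu - al) * (mu + al)) by ring.
    apply Rmult_integral_contrapositive_currified; auto. }
  assert (E : Gf mu al x - v mu = (Wr mu al x - wlim mu al) / (mu ^ 2 - al ^ 2)).
  { rewrite <- Gf_Wr; auto; [|lra|].
    - unfold v, wlim; replace (mu ^ 2 - al ^ 2) with ((mu - al) * (mu + al)) by ring; field; repeat split; auto; lra.
    - intros k Ek; specialize (HB k); rewrite Ek, Rabs_R0 in HB; lra. }
  assert (Hmain : Rabs (Gf mu al x - v mu) <= C / x).
  { rewrite E; unfold Rdiv at 1; rewrite Rabs_mult, Rabs_inv.
    apply Rmult_le_reg_l with (Rabs (mu ^ 2 - al ^ 2)); auto.
    replace (Rabs (mu ^ 2 - al ^ 2) * (Rabs (Wr mu al x - wlim mu al) * / Rabs (mu ^ 2 - al ^ 2)))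
      with (Rabs (Wr mu al x - wlim mu al)) by (field; lra).
    apply Rle_trans with (1 := HW'); right; unfold Rdiv; ring. }
  set (c := Gamma (al + 1) ^ 2 / (2 * al)) in *.
  replace (Gf al al x - c) with (- (Gf mu al x - Gf al al x) + (Gf mu al x - v mu) + (v mu - c)) by ring.
  apply Rle_trans with (1 := Rabs_triang _ _).
  pose proof (Rabs_triang (- (Gf mu al x - Gf al al x)) (Gf mu al x - v mu)) as T; rewrite Rabs_Ropp in T; lra. }
apply filterlim_p_infty_R; intros eps Heps.
exists (Rmax X (C / eps)); intros x Hx.
pose proof (Rmax_l X (C / eps)); pose proof (Rmax_r X (C / eps)).
apply Rle_lt_trans with (1 := Hb x ltac:(lra)).
apply Rmult_lt_reg_r with (x / eps); [apply Rdiv_lt_0_compat; lra|].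
replace (C / x * (x / eps)) with (C / eps) by (field; lra).
replace (eps * (x / eps)) with x by (field; lra); lra.
Qed.

(** * Derivatives along paths *)

Definition Cder (g : R -> C) (t : R) (l : C) : Prop := is_derive (V := C_R_NormedModule) g t l.

Lemma Cnorm_Cmod (z : C) : norm (V := C_R_NormedModule) z = Cmod z.
Proof.
unfold norm; simpl; unfold prod_norm, Cmod, norm; simpl; unfold abs; simpl.
f_equal; rewrite <- !Rsqr_pow2 || idtac; pose proof (pow2_abs (fst z)); pose proof (pow2_abs (snd z)); simpl in *; lra.
Qed.

Lemma Cder_eps (g : R -> C) t l : Cder g t l <->
  forall eps, 0 < eps -> exists d, 0 < d /\ forall s, Rabs (s - t) < d ->
    Cmod (g s - g t - RtoC (s - t) * l) <= eps * Rabs (s - t).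
Proof.
assert (E : forall s, minus (G := C_R_NormedModule) (minus (g s) (g t)) (scal (minus (s : R) t) l)
  = (g s - g t - RtoC (s - t) * l)%C).
{ intros s; unfold minus, plus, opp, scal, Cminus, Cplus, Copp, Cmult, RtoC; simpl.
  unfold prod_plus, prod_opp, prod_scal, scal, plus, opp; simpl; unfold mult; simpl.
  apply injective_projections; simpl; ring. }
split.
- intros [_ H] eps He.
  destruct (H t (fun P HP => HP) (mkposreal eps He)) as [d Hd].
  exists d; split; [apply cond_pos|]; intros s Hs.
  assert (Hd' : norm (V := C_R_NormedModule) (minus (G := C_R_NormedModule) (minus (g s) (g t)) (scal (minus (s : R) t) l))
    <= eps * Rabs (s - t)) by exact (Hd s Hs).
  rewrite E, Cnorm_Cmod in Hd'; exact Hd'.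
- intros H; split; [apply is_linear_scal_l|].
  intros x Hx eps.
  assert (Ex : t = x) by (apply (is_filter_lim_locally_unique (K := R_AbsRing) (V := R_NormedModule)); exact Hx).
  rewrite <- Ex.
  destruct (H eps (cond_pos eps)) as [d [Hd0 Hd]].
  exists (mkposreal d Hd0); intros s Hs.
  assert (Hd' := Hd s Hs); rewrite <- Cnorm_Cmod, <- E in Hd'; exact Hd'.
Qed.

Lemma Cder_components (g : R -> C) t l : Cder g t l <->
  is_derive (fun s => Re (g s)) t (Re l) /\ is_derive (fun s => Im (g s)) t (Im l).
Proof.
split.
- intros H; rewrite Cder_eps in H.
  assert (Hc : forall z : C, Rabs (Re z) <= Cmod z /\ Rabs (Im z) <= Cmod z).
  { intros z; pose proof (Rmax_Cmod z); pose proof (Rmax_l (Rabs (fst z)) (Rabs (snd z)));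
    pose proof (Rmax_r (Rabs (fst z)) (Rabs (snd z))); unfold Re, Im; lra. }
  assert (Hd : forall (p : C -> R), (forall s, p (g s - g t - RtoC (s - t) * l)%C = p (g s) - p (g t) - (s - t) * p l) ->
    (forall z, Rabs (p z) <= Cmod z) -> is_derive (fun s => p (g s)) t (p l)).
  { intros p Hp Hb; apply is_derive_Reals; intros eps He.
    destruct (H (eps / 2) ltac:(lra)) as [d [Hd0 Hd]].
    exists (mkposreal d Hd0); intros h Hh0 Hh; simpl in Hh.
    specialize (Hd (t + h)); replace (t + h - t) with h in Hd by ring; specialize (Hd Hh).
    pose proof (Hb (g (t + h)%R - g t - RtoC h * l)%C) as B.
    replace (RtoC h) with (RtoC (t + h - t)) in B at 1 by (f_equal; ring).
    rewrite Hp in B; replace (t + h - t) with h in B by ring.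
    assert (0 < Rabs h) by (apply Rabs_pos_lt; auto).
    replace ((p (g (t + h)) - p (g t)) / h - p l) with ((p (g (t + h)) - p (g t) - h * p l) / h) by (field; auto).
    unfold Rdiv; rewrite Rabs_mult, Rabs_inv; apply Rmult_lt_reg_r with (Rabs h); auto.
    rewrite Rmult_assoc, Rinv_l by lra.
    replace (t + h - t) with h in B by ring. nra. }
  split; apply Hd; try (intros; apply Hc); intros s; unfold Re, Im; simpl; ring.
- intros [H1 H2].
  assert (D := is_derive_plus (V := C_R_NormedModule) _ _ _ _ _
    (is_derive_scal_l (K := R_AbsRing) (V := C_R_NormedModule) _ _ _ ((1, 0) : C) H1)
    (is_derive_scal_l (K := R_AbsRing) (V := C_R_NormedModule) _ _ _ ((0, 1) : C) H2)).
  unfold Cder; replace l with (plus (G := C_R_NormedModule) (scal (Re l) ((1, 0) : C)) (scal (Im l) ((0, 1) : C))).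
  + apply is_derive_ext with (2 := D).
    intros s; unfold plus, scal; simpl; unfold prod_plus, prod_scal, plus, scal; simpl; unfold mult; simpl.
    apply injective_projections; unfold Re, Im; simpl; ring.
  + unfold plus, scal; simpl; unfold prod_plus, prod_scal, plus, scal; simpl; unfold mult; simpl.
    apply injective_projections; unfold Re, Im; simpl; ring.
Qed.

(* [F] has the complex derivative [d] at [w], as seen along real paths. *)
Definition pder (F : C -> C) (w d : C) : Prop :=
  forall g g' t, g t = w -> Cder g t g' -> Cder (fun s => F (g s)) t (d * g')%C.

Lemma pder_const (c w : C) : pder (fun _ => c) w 0.
Proof.
intros g g' t _ _; apply Cder_components; unfold Re, Im; simpl.
replace (0 * fst g' - 0 * snd g') with 0 by ring; replace (0 * snd g' + 0 * fst g') with 0 by ring.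
split; apply (is_derive_const (K := R_AbsRing) (V := R_NormedModule)).
Qed.

Lemma pder_id w : pder (fun z => z) w 1.
Proof. intros g g' t _ H; rewrite Cmult_1_l; exact H. Qed.

Lemma pder_plus F G w a b : pder F w a -> pder G w b -> pder (fun z => F z + G z)%C w (a + b).
Proof.
intros HF HG g g' t E H; rewrite Cmult_plus_distr_r.
exact (is_derive_plus (V := C_R_NormedModule) _ _ _ _ _ (HF g g' t E H) (HG g g' t E H)).
Qed.

Lemma is_derive_Cmult_parts (a b c d : R -> R) t a' b' c' d' :
  is_derive a t a' -> is_derive b t b' -> is_derive c t c' -> is_derive d t d' ->
  is_derive (fun s => a s * c s - b s * d s) t (a' * c t + a t * c' - b' * d t - b t * d') /\
  is_derive (fun s => a s * d s + b s * c s) t (a' * d t + a t * d' + b' * c t + b t * c').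
Proof.
intros H1 H2 H3 H4; split; (auto_derive; [repeat split; eexists; eassumption|subst_Derive; ring]).
Qed.

Lemma Cder_mult f g t a b : Cder f t a -> Cder g t b -> Cder (fun s => f s * g s)%C t (a * g t + f t * b)%C.
Proof.
intros Hf Hg; apply Cder_components in Hf; apply Cder_components in Hg; apply Cder_components.
destruct Hf as [F1 F2]; destruct Hg as [G1 G2].
destruct (is_derive_Cmult_parts _ _ _ _ t _ _ _ _ F1 F2 G1 G2) as [D1 D2].
split; [evar_last; [exact D1|]|evar_last; [exact D2|]]; unfold Re, Im; simpl; eqR; ring.
Qed.

Lemma pder_mult F G w a b : pder F w a -> pder G w b -> pder (fun z => F z * G z)%C w (a * G w + F w * b).
Proof.
intros HF HG g g' t E H.
replace ((a * G w + F w * b) * g')%C with ((a * g') * G (g t) + F (g t) * (b * g'))%C by (rewrite E; ring).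
apply (Cder_mult (fun s => F (g s)) (fun s => G (g s))); auto.
Qed.

Lemma pder_comp F G w a b : pder F w a -> pder G (F w) b -> pder (fun z => G (F z)) w (b * a).
Proof.
intros HF HG g g' t E H; rewrite <- Cmult_assoc.
apply (HG (fun s => F (g s))); [rewrite E; auto|auto].
Qed.

Lemma pder_scal c F w a : pder F w a -> pder (fun z => c * F z)%C w (c * a).
Proof.
intros H; replace (c * a)%C with (0 * F w + c * a)%C by ring.
apply (pder_mult (fun _ => c) F); [apply pder_const|auto].
Qed.

Lemma pder_eq F w a b : pder F w a -> a = b -> pder F w b.
Proof. intros H <-; exact H. Qed.

Lemma pder_ext F G w a : (forall z, F z = G z) -> pder F w a -> pder G w a.
Proof.
intros E H g g' t Et D; apply is_derive_ext with (fun s => F (g s)); auto; apply H; auto.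
Qed.

Lemma is_derive_Cexp_parts (a b : R -> R) t a' b' : is_derive a t a' -> is_derive b t b' ->
  is_derive (fun s => exp (a s) * cos (b s)) t (exp (a t) * (a' * cos (b t) - b' * sin (b t))) /\
  is_derive (fun s => exp (a s) * sin (b s)) t (exp (a t) * (a' * sin (b t) + b' * cos (b t))).
Proof.
intros H1 H2; split; (auto_derive; [repeat split; eexists; eassumption|subst_Derive; ring]).
Qed.

Lemma pder_Cexp w : pder Cexp w (Cexp w).
Proof.
intros g g' t E H; apply Cder_components in H; apply Cder_components.
destruct H as [H1 H2]; rewrite <- E; unfold Cexp.
destruct (is_derive_Cexp_parts _ _ t _ _ H1 H2) as [D1 D2].
split; [evar_last; [exact D1|]|evar_last; [exact D2|]]; unfold Re, Im; simpl; eqR; ring.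
Qed.

Lemma Cexp_plus a b : Cexp (a + b) = (Cexp a * Cexp b)%C.
Proof.
unfold Cexp, Re, Im; simpl; rewrite exp_plus, cos_plus, sin_plus.
apply injective_projections; simpl; ring.
Qed.

(** * The complex logarithm and powers *)

Lemma Cmod_sqr (z : C) : Cmod z ^ 2 = Re z ^ 2 + Im z ^ 2.
Proof.
unfold Cmod, Re, Im; rewrite pow2_sqrt; auto.
pose proof (pow2_ge_0 (fst z)); pose proof (pow2_ge_0 (snd z)); lra.
Qed.

(** Describes the cut plane by a strict inequality between continuous functions, which makes it
    visibly open and provides the denominator of the half-angle formula. *)
Lemma cut_plane_pos z : cut_plane z <-> 0 < Cmod z + Re z.
Proof.
pose proof (Cmod_sqr z) as E; pose proof (Cmod_ge_0 z).
unfold cut_plane; split.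
- intros Hc; destruct (Rlt_dec 0 (Cmod z + Re z)) as [Hp|Hn]; auto; exfalso; apply Hc.
  assert (Re z <= 0) by lra; split; auto.
  assert (Cmod z ^ 2 <= Re z ^ 2) by nra; nra.
- intros Hp [Hi Hr]; rewrite Hi in E; assert (Cmod z = - Re z) by nra; lra.
Qed.

(** The half-angle formula tan(arg / 2) = Im z / (|z| + Re z). It replaces the two acos branches by
    a single smooth expression, valid across the positive real axis. *)
Lemma Carg_atan z : cut_plane z -> Carg z = 2 * atan (Im z / (Cmod z + Re z)).
Proof.
intros Hc; assert (Hp := proj1 (cut_plane_pos z) Hc).
pose proof (Cmod_sqr z) as E; pose proof (Cmod_ge_0 z) as H0.
assert (Hm : 0 < Cmod z).
{ destruct H0 as [H0|H0]; auto; rewrite <- H0 in *; nra. }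
set (u := Im z / (Cmod z + Re z)).
assert (Hcos : cos (2 * atan u) = Re z / Cmod z).
{ rewrite cos_2a_cos, cos_atan.
  assert (Hu : 0 < 1 + Rsqr u) by (pose proof (Rle_0_sqr u); lra).
  replace (2 * (1 / sqrt (1 + Rsqr u)) * (1 / sqrt (1 + Rsqr u)) - 1) with (2 / (sqrt (1 + Rsqr u) * sqrt (1 + Rsqr u)) - 1)
    by (field; pose proof (sqrt_lt_R0 _ Hu); lra).
  rewrite sqrt_sqrt by lra; unfold Rsqr, u.
  assert (E2 : 1 + Im z / (Cmod z + Re z) * (Im z / (Cmod z + Re z)) = 2 * Cmod z / (Cmod z + Re z)).
  { replace (Im z / (Cmod z + Re z) * (Im z / (Cmod z + Re z))) with ((Cmod z ^ 2 - Re z ^ 2) / (Cmod z + Re z) ^ 2)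
      by (rewrite E; field; lra).
    field; lra. }
  rewrite E2; field; lra. }
pose proof (atan_bound u) as Hb; pose proof PI_RGT_0.
unfold Carg; rewrite <- Hcos.
destruct (Rle_dec 0 (Im z)) as [Hi|Hi].
- assert (0 <= u) by (apply Rmult_le_pos; [auto|left; apply Rinv_0_lt_compat; auto]).
  assert (0 <= atan u).
  { rewrite <- atan_0; destruct H1 as [H1|H1]; [left; apply atan_increasing, H1|rewrite <- H1; lra]. }
  apply acos_cos; lra.
- assert (u < 0).
  { unfold u, Rdiv; pose proof (Rinv_0_lt_compat _ Hp); nra. }
  assert (atan u < 0) by (rewrite <- atan_0; apply atan_increasing; auto).
  replace (2 * atan u) with (- (2 * (- atan u))) at 1 by ring.
  rewrite cos_neg, acos_cos by lra; ring.
Qed.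

Lemma is_derive_sqrt_sum (a b : R -> R) t a' b' : is_derive a t a' -> is_derive b t b' ->
  0 < a t ^ 2 + b t ^ 2 ->
  is_derive (fun s => sqrt (a s ^ 2 + b s ^ 2)) t ((a t * a' + b t * b') / sqrt (a t ^ 2 + b t ^ 2)).
Proof.
intros H1 H2 Hp; auto_derive; [repeat split; try (eexists; eassumption); simpl in Hp; exact Hp|].
subst_Derive; simpl; field; simpl in Hp; pose proof (sqrt_lt_R0 _ Hp); lra.
Qed.

Lemma Cder_Cmod_pos (g : R -> C) t l : Cder g t l -> 0 < Cmod (g t) ->
  is_derive (fun s => Cmod (g s)) t ((Re (g t) * Re l + Im (g t) * Im l) / Cmod (g t)).
Proof.
intros H Hm; apply Cder_components in H; destruct H as [H1 H2].
pose proof (Cmod_sqr (g t)) as E.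
assert (Hs : 0 < Re (g t) ^ 2 + Im (g t) ^ 2) by nra.
evar_last; [exact (is_derive_sqrt_sum _ _ t _ _ H1 H2 Hs)|].
change (sqrt (Re (g t) ^ 2 + Im (g t) ^ 2)) with (Cmod (g t)); reflexivity.
Qed.

(** The modulus part is differentiated directly, the argument through [Carg_atan], which holds at
    all nearby points of the path because the cut plane is open. *)
Lemma pder_Clog w : cut_plane w -> pder Clog w (/ w).
Proof.
intros Hc g g' t E H.
assert (Hp := proj1 (cut_plane_pos w) Hc); pose proof (Cmod_sqr w) as Em; pose proof (Cmod_ge_0 w) as Hm0.
assert (Hm : 0 < Cmod w) by (destruct Hm0 as [Hm0|Hm0]; auto; rewrite <- Hm0 in *; nra).
assert (DM : is_derive (fun s => Cmod (g s)) t ((Re w * Re g' + Im w * Im g') / Cmod w)).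
{ rewrite <- E; apply Cder_Cmod_pos; auto; rewrite E; auto. }
destruct (proj1 (Cder_components _ _ _) H) as [H1 H2].
set (m := fun s => Cmod (g s)); set (x := fun s => Re (g s)); set (y := fun s => Im (g s)).
assert (Dm : is_derive m t ((Re w * Re g' + Im w * Im g') / Cmod w)) by exact DM.
assert (Dx : is_derive x t (Re g')) by exact H1.
assert (Dy : is_derive y t (Im g')) by exact H2.
clear DM H1 H2.
assert (Em' : m t = Cmod w) by (unfold m; rewrite E; auto).
assert (Ex' : x t = Re w) by (unfold x; rewrite E; auto).
assert (Ey' : y t = Im w) by (unfold y; rewrite E; auto).
assert (Einv : (/ w * g')%C = ((Re w * Re g' + Im w * Im g') / Cmod w ^ 2, (Re w * Im g' - Im w * Re g') / Cmod w ^ 2)).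
{ rewrite Em; unfold Re, Im in *; apply injective_projections; simpl; field; nra. }
rewrite Einv; apply Cder_components; unfold Clog; simpl.
split.
- change (is_derive (fun s => ln (m s)) t ((Re w * Re g' + Im w * Im g') / (Cmod w * (Cmod w * 1)))).
  clearbody m; auto_derive; [rewrite Em'; repeat split; [eexists; eassumption|auto]|].
  subst_Derive; rewrite Em'; field; lra.
- apply is_derive_ext_loc with (fun s => 2 * atan (y s / (m s + x s))).
  + assert (Cs : continuous (fun s => m s + x s) t).
    { apply (continuous_plus m x); [apply (ex_derive_continuous m)|apply (ex_derive_continuous x)]; eexists; eassumption. }
    assert (Hpos : 0 < m t + x t) by (rewrite Em', Ex'; auto).
    generalize (locally_continuous_lt _ _ _ Cs Hpos); apply filter_imp.
    intros s Hs; apply Rabs_def2 in Hs; symmetry; apply Carg_atan, cut_plane_pos.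
    unfold m, x in Hs; lra.
  + clearbody m x y.
    auto_derive; [repeat split; try (eexists; eassumption); rewrite Em', Ex'; lra|].
    subst_Derive; rewrite Em', Ex', Ey'.
    assert (Eq : 1 + (Im w / (Cmod w + Re w)) ^ 2 = 2 * Cmod w / (Cmod w + Re w)).
    { replace ((Im w / (Cmod w + Re w)) ^ 2) with ((Cmod w ^ 2 - Re w ^ 2) / (Cmod w + Re w) ^ 2)
        by (rewrite Em; field; lra).
      field; lra. }
    set (M := Cmod w) in *; set (X := Re w) in *; set (Y := Im w) in *.
    assert (EY : Y * Y = M * M - X * X) by nra.
    replace (1 + Y * / (M + X) * (Y * / (M + X) * 1)) with (2 * M / (M + X))
      by (rewrite <- Eq; unfold Rdiv; simpl; reflexivity).
    apply Rmult_eq_reg_r with (M ^ 2 * (M + X)); [|apply Rmult_integral_contrapositive_currified; [apply pow_nonzero|]; lra].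
    transitivity (M * (M + X) * Im g' - Y * (M + X) * Re g' - Y * Y * Im g'); [field; lra|].
    rewrite EY; field; lra.
Qed.

Lemma pder_Cpower a w : cut_plane w -> pder (fun z => Cpower z a) w (RtoC a / w * Cpower w a)%C.
Proof.
intros Hc; unfold Cpower.
refine (pder_eq _ _ _ _ (pder_comp (fun z => RtoC a * Clog z)%C Cexp w _ _ (pder_scal (RtoC a) Clog w _ (pder_Clog w Hc)) (pder_Cexp _)) _).
unfold Cdiv; ring.
Qed.

Lemma Cpower_plus a b z : (Cpower z a * Cpower z b)%C = Cpower z (a + b).
Proof. unfold Cpower; rewrite <- Cexp_plus, RtoC_plus; f_equal; ring. Qed.

Lemma Cpower_0 z : Cpower z 0 = 1.
Proof.
unfold Cpower; rewrite Cmult_0_l; unfold Cexp, Re, Im; simpl.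
rewrite exp_0, cos_0, sin_0; apply injective_projections; simpl; ring.
Qed.

(** * Entire functions of a complex variable *)

Definition CPS (c : nat -> R) (w : C) : C := CSeries (fun k => RtoC (c k) * w ^ k)%C.

Lemma Re_le_Cmod z : Rabs (Re z) <= Cmod z.
Proof. pose proof (Rmax_Cmod z); pose proof (Rmax_l (Rabs (fst z)) (Rabs (snd z))); unfold Re; lra. Qed.

Lemma Im_le_Cmod z : Rabs (Im z) <= Cmod z.
Proof. pose proof (Rmax_Cmod z); pose proof (Rmax_r (Rabs (fst z)) (Rabs (snd z))); unfold Im; lra. Qed.

Lemma Re_RtoC_mult a z : Re (RtoC a * z) = a * Re z.
Proof. unfold Re, RtoC; simpl; ring. Qed.

Lemma Im_RtoC_mult a z : Im (RtoC a * z) = a * Im z.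
Proof. unfold Im, RtoC; simpl; ring. Qed.

Lemma CPS_parts c w : CPS c w =
  (Series (fun k => c k * Re (w ^ k)%C), Series (fun k => c k * Im (w ^ k)%C)).
Proof.
unfold CPS, CSeries; f_equal; apply Series_ext; intros k; [apply Re_RtoC_mult|apply Im_RtoC_mult].
Qed.

Lemma CPS_ext c c' w : (forall k, c k = c' k) -> CPS c w = CPS c' w.
Proof. intros E; rewrite !CPS_parts; f_equal; apply Series_ext; intros k; rewrite E; auto. Qed.

Lemma Re_pow_le w k : Rabs (Re (w ^ k)%C) <= Cmod w ^ k.
Proof. rewrite <- Cmod_pow; apply Re_le_Cmod. Qed.

Lemma Im_pow_le w k : Rabs (Im (w ^ k)%C) <= Cmod w ^ k.
Proof. rewrite <- Cmod_pow; apply Im_le_Cmod. Qed.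

Lemma CPS_ex c A B w : exp_type c A B ->
  ex_series (fun k => c k * Re (w ^ k)%C) /\ ex_series (fun k => c k * Im (w ^ k)%C).
Proof.
intros H; split; apply (exp_type_Series c A B _ (Cmod w)); auto using Cmod_ge_0, Re_pow_le, Im_pow_le.
Qed.

Lemma CPS_plus a b A B A' B' w : exp_type a A B -> exp_type b A' B' ->
  CPS (fun k => a k + b k) w = (CPS a w + CPS b w)%C.
Proof.
intros Ha Hb; destruct (CPS_ex a A B w Ha) as [A1 A2]; destruct (CPS_ex b A' B' w Hb) as [B1 B2].
rewrite !CPS_parts; apply injective_projections; simpl; rewrite <- Series_plus by auto;
  apply Series_ext; intros; ring.
Qed.

Lemma CPS_scal a m w : CPS (fun k => m * a k) w = (RtoC m * CPS a w)%C.
Proof.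
rewrite !CPS_parts; apply injective_projections; simpl; rewrite Rmult_0_l, ?Rminus_0_r, ?Rplus_0_r;
  rewrite <- Series_scal_l; apply Series_ext; intros; ring.
Qed.

Lemma Series_zero (a : nat -> R) : (forall k, a k = 0) -> Series a = 0.
Proof.
intros H; rewrite (Series_ext a (fun k => 0 * a k)) by (intros k; rewrite H; ring).
rewrite Series_scal_l; ring.
Qed.

Lemma CPS_RtoC c x : CPS c (RtoC x) = RtoC (PSeries c x).
Proof.
rewrite CPS_parts; unfold PSeries, RtoC; f_equal.
- apply Series_ext; intros k; fold (RtoC x); rewrite <- RtoC_pow; reflexivity.
- apply Series_zero; intros k; fold (RtoC x); rewrite <- RtoC_pow; unfold Im, RtoC; simpl; ring.
Qed.

Lemma CPS_mulk c A B w : exp_type c A B ->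
  (w * CPS (PS_derive c) w)%C = CPS (fun k => INR k * c k) w.
Proof.
intros H; destruct (CPS_ex _ _ _ w (exp_type_derive _ _ _ H)) as [D1 D2].
destruct (CPS_ex _ _ _ w (exp_type_mulk _ _ _ H)) as [K1 K2].
rewrite !CPS_parts.
rewrite (Series_incr_1 (fun k => INR k * c k * Re (w ^ k)%C)), (Series_incr_1 (fun k => INR k * c k * Im (w ^ k)%C)) by auto.
apply injective_projections; simpl fst; simpl snd; simpl INR at 1; rewrite !Rmult_0_l, Rplus_0_l.
- rewrite <- !Series_scal_l, <- Series_minus by (apply (ex_series_scal (K := R_AbsRing) (V := R_NormedModule)); auto).
  apply Series_ext; intros k; unfold PS_derive; rewrite ?Cpow_S; unfold Re, Im; simpl; ring.
- rewrite <- !Series_scal_l, <- Series_plus by (apply (ex_series_scal (K := R_AbsRing) (V := R_NormedModule)); auto).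
  apply Series_ext; intros k; unfold PS_derive; rewrite ?Cpow_S; unfold Re, Im; simpl; ring.
Qed.

Lemma exp_type_abs_series c A B (t : nat -> R) r : exp_type c A B ->
  (forall k, Rabs (t k) <= r ^ k) -> 0 <= r -> ex_series (fun k => Rabs (c k * t k)).
Proof.
intros Hc Ht Hr; apply (ex_series_le (V := R_CompleteNormedModule)) with (fun k => A * (B * r) ^ k / INR (fact k)).
- intros k; unfold norm; simpl; unfold abs; simpl; rewrite Rabs_Rabsolu; apply exp_type_term; auto.
- eexists; apply is_series_exp.
Qed.

Lemma Series_cauchy a b A B A' B' (s t : nat -> R) r : exp_type a A B -> exp_type b A' B' ->
  (forall k, Rabs (s k) <= r ^ k) -> (forall k, Rabs (t k) <= r ^ k) -> 0 <= r ->
  is_series (fun n => sum_f_R0 (fun k => (a k * s k) * (b (n - k)%nat * t (n - k)%nat)) n)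
    (Series (fun k => a k * s k) * Series (fun k => b k * t k)).
Proof.
intros Ha Hb Hs Ht Hr; apply (is_series_mult (fun k => a k * s k) (fun k => b k * t k)).
- apply Series_correct, (exp_type_Series a A B s r); auto.
- apply Series_correct, (exp_type_Series b A' B' t r); auto.
- apply (exp_type_abs_series a A B s r); auto.
- apply (exp_type_abs_series b A' B' t r); auto.
Qed.

(** [CSeries] sums real and imaginary parts separately, so that the complex Cauchy product is
    assembled from four real ones. *)
Lemma CPS_mult a b A B A' B' w : exp_type a A B -> exp_type b A' B' ->
  CPS (PS_mult a b) w = (CPS a w * CPS b w)%C.
Proof.
intros Ha Hb.
assert (HR := Re_pow_le w); assert (HI := Im_pow_le w); assert (H0 := Cmod_ge_0 w).
assert (S1 := Series_cauchy a b A B A' B' _ _ _ Ha Hb HR HR H0).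
assert (S2 := Series_cauchy a b A B A' B' _ _ _ Ha Hb HI HI H0).
assert (S3 := Series_cauchy a b A B A' B' _ _ _ Ha Hb HR HI H0).
assert (S4 := Series_cauchy a b A B A' B' _ _ _ Ha Hb HI HR H0).
rewrite !CPS_parts; apply injective_projections; simpl fst; simpl snd.
- rewrite <- (is_series_unique _ _ S1), <- (is_series_unique _ _ S2), <- Series_minus by (eexists; eauto).
  apply Series_ext; intros n; rewrite <- minus_sum; unfold PS_mult.
  rewrite Rmult_comm, scal_sum; apply sum_eq; intros k Hk.
  replace (w ^ n)%C with (w ^ k * w ^ (n - k))%C by (rewrite <- Cpow_add_r; f_equal; lia).
  unfold Re, Im; simpl; ring.
- rewrite <- (is_series_unique _ _ S3), <- (is_series_unique _ _ S4), <- Series_plus by (eexists; eauto).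
  apply Series_ext; intros n; rewrite <- plus_sum; unfold PS_mult.
  rewrite Rmult_comm, scal_sum; apply sum_eq; intros k Hk.
  replace (w ^ n)%C with (w ^ k * w ^ (n - k))%C by (rewrite <- Cpow_add_r; f_equal; lia).
  unfold Re, Im; simpl; ring.
Qed.

(** Induction: the remainder is multiplied by w + h and gains n w^k h^2, where n = k + 1; the
    constant grows from n^2 to n^2 + n, which is below (n + 1)^2. *)
Lemma Cpow_taylor (w h : C) M k : 1 <= M -> Cmod w <= M -> Cmod (w + h) <= M ->
  Cmod ((w + h) ^ S k - w ^ S k - RtoC (INR (S k)) * w ^ k * h) <= INR (S k) ^ 2 * M ^ S k * Cmod h ^ 2.
Proof.
intros HM Hw Hwh; pose proof (Cmod_ge_0 h) as Hh; pose proof (Cmod_ge_0 w) as Hw0.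
induction k as [|k IH].
- replace ((w + h) ^ 1 - w ^ 1 - RtoC (INR 1) * w ^ 0 * h)%C with (RtoC 0) by (simpl; ring).
  rewrite Cmod_0; simpl; nra.
- replace ((w + h) ^ S (S k) - w ^ S (S k) - RtoC (INR (S (S k))) * w ^ S k * h)%C with
    ((w + h) * ((w + h) ^ S k - w ^ S k - RtoC (INR (S k)) * w ^ k * h) + RtoC (INR (S k)) * w ^ k * (h * h))%C
    by (rewrite (S_INR (S k)), RtoC_plus, !Cpow_S; ring).
  apply Rle_trans with (1 := Cmod_triangle _ _).
  rewrite !Cmod_mult, Cmod_R, Cmod_pow, (Rabs_pos_eq (INR _)) by apply pos_INR.
  assert (HMk : Cmod w ^ k <= M ^ S (S k)).
  { apply Rle_trans with (M ^ k); [apply pow_incr; auto|apply Rle_pow; [auto|lia]]. }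
  assert (Hn : 0 <= INR (S k)) by apply pos_INR.
  assert (HMp : 0 <= M ^ S k) by (apply pow_le; lra).
  set (n := INR (S k)) in *.
  apply Rle_trans with (M * (n ^ 2 * M ^ S k * Cmod h ^ 2) + n * M ^ S (S k) * (Cmod h * Cmod h)).
  + apply Rplus_le_compat.
    * apply Rmult_le_compat; auto; apply Cmod_ge_0.
    * apply Rmult_le_compat_r; [nra|]; apply Rmult_le_compat_l; auto.
  + rewrite (S_INR (S k)); fold n.
    change (M ^ S (S k)) with (M * M ^ S k).
    replace (M * (n ^ 2 * M ^ S k * Cmod h ^ 2) + n * (M * M ^ S k) * (Cmod h * Cmod h))
      with ((n ^ 2 + n) * (M * M ^ S k * Cmod h ^ 2)) by ring.
    replace ((n + 1) ^ 2 * (M * M ^ S k) * Cmod h ^ 2) with ((n + 1) ^ 2 * (M * M ^ S k * Cmod h ^ 2)) by ring.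
    apply Rmult_le_compat_r; [|nra].
    apply Rmult_le_pos; [apply Rmult_le_pos; lra|nra].
Qed.

Lemma ex_series_plus_R (a b : nat -> R) : ex_series a -> ex_series b -> ex_series (fun n => a n + b n).
Proof. exact (ex_series_plus (V := R_NormedModule) a b). Qed.

Lemma ex_series_minus_R (a b : nat -> R) : ex_series a -> ex_series b -> ex_series (fun n => a n - b n).
Proof. exact (ex_series_minus (V := R_NormedModule) a b). Qed.

Lemma ex_series_scal_R k (a : nat -> R) : ex_series a -> ex_series (fun n => k * a n).
Proof. exact (ex_series_scal (K := R_AbsRing) (V := R_NormedModule) k a). Qed.

(** [Cpow_taylor] is summed term by term. Its factor k^2 is absorbed because k^2 c_k is still of
    exponential type, and the factor 2 in K pays for treating real and imaginary parts
    separately. *)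
Lemma CPS_taylor c A B w : exp_type c A B -> exists K, 0 <= K /\ forall h, Cmod h <= 1 ->
  Cmod (CPS c (w + h) - CPS c w - CPS (PS_derive c) w * h) <= K * Cmod h ^ 2.
Proof.
intros Hc.
set (M := Cmod w + 1); assert (HM : 1 <= M) by (unfold M; pose proof (Cmod_ge_0 w); lra).
assert (HB0 : 0 <= B) by apply Hc; assert (HA0 : 0 <= A) by apply Hc.
assert (Hck2 : exp_type (fun k => INR k * (INR k * c k)) (A * B * (B + 1)) (B + 1 + 1)).
{ apply exp_type_mulk, exp_type_mulk, Hc. }
set (D := fun k => A * B * (B + 1) * ((B + 1 + 1) * M) ^ k / INR (fact k)).
assert (HD : ex_series D) by (eexists; apply is_series_exp).
assert (HDpos : forall k, 0 <= D k).
{ intros k; unfold D, Rdiv; apply Rmult_le_pos; [|left; apply Rinv_0_lt_compat, INR_fact_pos].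
  apply Rmult_le_pos; [repeat apply Rmult_le_pos; lra|apply pow_le; nra]. }
exists (2 * Series D); split.
{ apply Rmult_le_pos; [lra|].
  assert (0 <= Series (fun _ : nat => 0)) by (rewrite Series_zero; [lra|auto]).
  apply Rle_trans with (1 := H); apply Series_le; auto; intros k; split; [lra|].
  apply HDpos. }
intros h Hh.
(* the derived series, shifted so that its terms match those of the others *)
set (dc := fun k : nat => match k with O => RtoC 0 | S j => (RtoC (INR k) * w ^ j)%C end).
set (r := fun k => ((w + h) ^ k - w ^ k - dc k * h)%C).
assert (Hr : forall k, Cmod (RtoC (c k) * r k) <= D k * Cmod h ^ 2).
{ intros [|k].
  - assert (E0 : r 0%nat = RtoC 0) by (unfold r, dc; simpl; ring).
    rewrite E0, Cmult_0_r, Cmod_0; apply Rmult_le_pos; [apply HDpos|nra].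
  - rewrite Cmod_mult, Cmod_R; unfold r.
    assert (B1 := Cpow_taylor w h M k HM ltac:(unfold M; lra)
      ltac:(unfold M; pose proof (Cmod_triangle w h); lra)).
    destruct Hck2 as [_ [_ H2]]; specialize (H2 (S k)).
    rewrite !Rabs_mult, (Rabs_pos_eq (INR _)) in H2 by apply pos_INR.
    apply Rle_trans with (Rabs (c (S k)) * (INR (S k) ^ 2 * M ^ S k * Cmod h ^ 2)).
    + apply Rmult_le_compat_l; [apply Rabs_pos|exact B1].
    + unfold D; rewrite Rpow_mult_distr.
      replace (Rabs (c (S k)) * (INR (S k) ^ 2 * M ^ S k * Cmod h ^ 2)) with
        (INR (S k) * (INR (S k) * Rabs (c (S k))) * (M ^ S k * Cmod h ^ 2)) by ring.
      replace (A * B * (B + 1) * ((B + 1 + 1) ^ S k * M ^ S k) / INR (fact (S k)) * Cmod h ^ 2) with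
        (A * B * (B + 1) * (B + 1 + 1) ^ S k / INR (fact (S k)) * (M ^ S k * Cmod h ^ 2)) by (unfold Rdiv; ring).
      apply Rmult_le_compat_r; auto; apply Rmult_le_pos; [apply pow_le; lra|nra]. }
destruct (CPS_ex c A B (w + h)%C Hc) as [E1 E2]; destruct (CPS_ex c A B w Hc) as [E3 E4].
destruct (CPS_ex _ _ _ w (exp_type_derive _ _ _ Hc)) as [E5 E6].
assert (HDh : ex_series (fun k => D k * Cmod h ^ 2)) by (apply (ex_series_scal_r (Cmod h ^ 2)), HD).
assert (Hsh : forall p : C -> R, (forall a z, p (RtoC a * z)%C = a * p z) ->
  ex_series (fun k => PS_derive c k * p (w ^ k)%C) ->
  ex_series (fun k => c k * p (dc k)) /\
  Series (fun k => c k * p (dc k)) = Series (fun k => PS_derive c k * p (w ^ k)%C)).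
{ intros p Hp Hex.
  assert (Es : forall k, c (S k) * p (dc (S k)) = PS_derive c k * p (w ^ k)%C).
  { intros k; unfold dc, PS_derive; rewrite Hp; ring. }
  assert (Hex' : ex_series (fun k => c k * p (dc k))).
  { apply ex_series_incr_1, (ex_series_ext (fun k => PS_derive c k * p (w ^ k)%C)); auto. }
  split; auto; rewrite (Series_incr_1 _ Hex').
  unfold dc at 1; replace (RtoC 0) with (RtoC 0 * 0)%C by ring; rewrite Hp, Rmult_0_l, Rmult_0_r, Rplus_0_l.
  apply Series_ext, Es. }
destruct (Hsh Re Re_RtoC_mult E5) as [X1 Y1]; destruct (Hsh Im Im_RtoC_mult E6) as [X2 Y2].
assert (Hpart : (CPS c (w + h) - CPS c w - CPS (PS_derive c) w * h)%C =
  (Series (fun k => Re (RtoC (c k) * r k)%C), Series (fun k => Im (RtoC (c k) * r k)%C))).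
{ rewrite !CPS_parts, <- Y1, <- Y2; apply injective_projections; simpl fst; simpl snd.
  - transitivity (Series (fun k => c k * Re ((w + h) ^ k)%C) - Series (fun k => c k * Re (w ^ k)%C)
      - (Series (fun k => fst h * (c k * Re (dc k))) - Series (fun k => snd h * (c k * Im (dc k))))).
    + rewrite !Series_scal_l; ring.
    + rewrite <- !Series_minus by repeat first [assumption | apply ex_series_minus_R | apply ex_series_scal_R].
      apply Series_ext; intros k; unfold r, Re, Im; generalize ((w + h) ^ k)%C (w ^ k)%C (dc k); intros; simpl; ring.
  - transitivity (Series (fun k => c k * Im ((w + h) ^ k)%C) - Series (fun k => c k * Im (w ^ k)%C)
      - (Series (fun k => snd h * (c k * Re (dc k))) + Series (fun k => fst h * (c k * Im (dc k))))).
    + rewrite !Series_scal_l; ring.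
    + rewrite <- Series_plus by (apply ex_series_scal_R; assumption).
      rewrite <- !Series_minus by
        repeat first [assumption | apply ex_series_minus_R | apply ex_series_plus_R | apply ex_series_scal_R].
      apply Series_ext; intros k; unfold r, Re, Im; generalize ((w + h) ^ k)%C (w ^ k)%C (dc k); intros; simpl; ring. }
rewrite Hpart.
destruct (Series_le_abs (fun k => Re (RtoC (c k) * r k)) _ (fun k => Rle_trans _ _ _ (Re_le_Cmod _) (Hr k)) HDh) as [_ B1].
destruct (Series_le_abs (fun k => Im (RtoC (c k) * r k)) _ (fun k => Rle_trans _ _ _ (Im_le_Cmod _) (Hr k)) HDh) as [_ B2].
rewrite Series_scal_r in B1, B2.
set (z := (Series _, Series _)).
assert (Hz : Cmod z <= Rabs (fst z) + Rabs (snd z)).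
{ pose proof (Cmod_sqr z) as Q; unfold Re, Im in Q; pose proof (Cmod_ge_0 z).
  rewrite <- (pow2_abs (fst z)), <- (pow2_abs (snd z)) in Q.
  pose proof (Rabs_pos (fst z)); pose proof (Rabs_pos (snd z)); nra. }
assert (F1 : Rabs (fst z) <= Series D * Cmod h ^ 2) by exact B1.
assert (F2 : Rabs (snd z) <= Series D * Cmod h ^ 2) by exact B2.
lra.
Qed.

Lemma pder_CPS c A B w : exp_type c A B -> pder (CPS c) w (CPS (PS_derive c) w).
Proof.
intros Hc g g' t E H; destruct (CPS_taylor c A B w Hc) as [K [HK HT]].
set (d := CPS (PS_derive c) w) in *.
rewrite Cder_eps in H; apply Cder_eps; intros eps He.
pose proof (Cmod_ge_0 d) as Hd0; pose proof (Cmod_ge_0 g') as Hg0.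
set (L := Cmod g' + 1).
assert (HL : 1 <= L) by (unfold L; lra).
destruct (H (Rmin 1 (eps / (2 * (Cmod d + 1))))) as [d1 [Hd1 H1]].
{ apply Rmin_glb_lt; [lra|apply Rdiv_lt_0_compat; lra]. }
(* The increment h of the path is at most L |s - t|. The radius q bounds the quadratic remainder by
   half of the allowed error, and the radius 1 / L keeps |h| <= 1 as [CPS_taylor] requires. *)
set (q := eps / (2 * (K + 1) * L ^ 2)).
assert (Hq : 0 < q) by (apply Rdiv_lt_0_compat; nra).
exists (Rmin d1 (Rmin (/ L) q)); split.
{ repeat apply Rmin_glb_lt; auto; apply Rinv_0_lt_compat; lra. }
intros s Hs.
pose proof (Rmin_l d1 (Rmin (/ L) q)); pose proof (Rmin_r d1 (Rmin (/ L) q)).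
pose proof (Rmin_l (/ L) q); pose proof (Rmin_r (/ L) q).
specialize (H1 s ltac:(lra)); rewrite E in *.
pose proof (Rmin_l 1 (eps / (2 * (Cmod d + 1)))) as M1; pose proof (Rmin_r 1 (eps / (2 * (Cmod d + 1)))) as M2.
set (m := Rmin 1 (eps / (2 * (Cmod d + 1)))) in *.
set (x := Rabs (s - t)) in *; assert (Hx : 0 <= x) by apply Rabs_pos.
set (h := (g s - w)%C).
assert (Hh : Cmod h <= L * x).
{ unfold h; replace (g s - w)%C with ((g s - w - RtoC (s - t) * g') + RtoC (s - t) * g')%C by ring.
  apply Rle_trans with (1 := Cmod_triangle _ _); rewrite (Cmod_mult (RtoC _)), Cmod_R; fold x; unfold L; nra. }
assert (Hh1 : Cmod h <= 1).
{ apply Rle_trans with (1 := Hh); apply Rmult_le_reg_l with (/ L); [apply Rinv_0_lt_compat; lra|].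
  rewrite <- Rmult_assoc, Rinv_l by lra; lra. }
specialize (HT h Hh1); replace (w + h)%C with (g s) in HT by (unfold h; ring).
replace (CPS c (g s) - CPS c w - RtoC (s - t) * (d * g'))%C with
  ((CPS c (g s) - CPS c w - d * h) + d * (g s - w - RtoC (s - t) * g'))%C by (unfold h; ring).
apply Rle_trans with (1 := Cmod_triangle _ _); rewrite (Cmod_mult d).
assert (P1 : K * Cmod h ^ 2 <= eps / 2 * x).
{ pose proof (Cmod_ge_0 h).
  assert (Cmod h ^ 2 <= (L * x) ^ 2) by (apply pow_incr; auto).
  assert (K * Cmod h ^ 2 <= K * (L * x) ^ 2) by (apply Rmult_le_compat_l; auto).
  apply Rle_trans with ((K + 1) * L ^ 2 * q * x).
  - replace (K * (L * x) ^ 2) with (K * L ^ 2 * x * x) in * by ring.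
    apply Rle_trans with (K * L ^ 2 * x * x); auto.
    apply Rmult_le_compat_r; auto; apply Rmult_le_compat; try lra; nra.
  - right; unfold q; field; lra. }
assert (P2 : Cmod d * Cmod (g s - w - RtoC (s - t) * g') <= eps / 2 * x).
{ apply Rle_trans with (Cmod d * (m * x)); [apply Rmult_le_compat_l; auto|].
  apply Rle_trans with ((Cmod d + 1) * (eps / (2 * (Cmod d + 1)) * x)).
  - apply Rmult_le_compat; try lra; try nra.
    apply Rmult_le_pos; auto; unfold m; apply Rmin_glb; [lra|left; apply Rdiv_lt_0_compat; lra].
  - right; field; lra. }
lra.
Qed.

(** * Continuity on the complex plane *)

Definition Ccont (F : C -> C) (w : C) : Prop :=
  forall eps, 0 < eps -> exists d, 0 < d /\ forall z, Cmod (z - w) < d -> Cmod (F z - F w) < eps.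

Lemma Cmod_parts (z : C) : Cmod z <= Rabs (Re z) + Rabs (Im z).
Proof.
pose proof (Cmod_sqr z) as Q; pose proof (Cmod_ge_0 z).
rewrite <- (pow2_abs (Re z)), <- (pow2_abs (Im z)) in Q.
pose proof (Rabs_pos (Re z)); pose proof (Rabs_pos (Im z)); nra.
Qed.

Definition Clim (T : Type) (Fil : (T -> Prop) -> Prop) (g : T -> C) (l : C) : Prop :=
  forall eps, 0 < eps -> Fil (fun t => Cmod (g t - l) < eps).

(** The neighbourhoods of the product space C are squares, those of [Cmod] are discs; each contains
    the other up to a factor 2. *)
Lemma Clim_filterlim (T : Type) (Fil : (T -> Prop) -> Prop) {FF : Filter Fil} (g : T -> C) (l : C) :
  Clim T Fil g l <-> filterlim g Fil (locally l).
Proof.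
split.
- intros H P [eps HP].
  change (Fil (fun t => P (g t))).
  generalize (H eps (cond_pos eps)); apply filter_imp; intros t Ht; apply HP.
  pose proof (Re_le_Cmod (g t - l)); pose proof (Im_le_Cmod (g t - l)).
  split; [change (Rabs (Re (g t - l)%C) < eps)|change (Rabs (Im (g t - l)%C) < eps)]; lra.
- intros H eps He.
  assert (He2 : 0 < eps / 2) by lra.
  apply (H (fun z => Cmod (z - l) < eps)).
  exists (mkposreal _ He2); intros z [H1 H2].
  assert (H1' : Rabs (Re (z - l)%C) < eps / 2) by exact H1.
  assert (H2' : Rabs (Im (z - l)%C) < eps / 2) by exact H2.
  pose proof (Cmod_parts (z - l)); lra.
Qed.

Lemma Clim_comp (T : Type) (Fil : (T -> Prop) -> Prop) {FF : Filter Fil} (g : T -> C) (l : C) (F : C -> C) :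
  Clim T Fil g l -> Ccont F l -> Clim T Fil (fun t => F (g t)) (F l).
Proof.
intros Hg HF eps He; destruct (HF eps He) as [d [Hd H]].
generalize (Hg d Hd); apply filter_imp; intros t; apply H.
Qed.

Lemma Clim_mult (T : Type) (Fil : (T -> Prop) -> Prop) {FF : Filter Fil} (f g : T -> C) (l m : C) :
  Clim T Fil f l -> Clim T Fil g m -> Clim T Fil (fun t => f t * g t)%C (l * m)%C.
Proof.
intros Hf Hg eps He.
set (M := Cmod l + Cmod m + 1); pose proof (Cmod_ge_0 l); pose proof (Cmod_ge_0 m).
set (e := Rmin 1 (eps / (2 * M))).
assert (HM : 1 <= M) by (unfold M; lra).
assert (He' : 0 < e) by (apply Rmin_glb_lt; [lra|apply Rdiv_lt_0_compat; lra]).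
pose proof (Rmin_l 1 (eps / (2 * M))) as E1; pose proof (Rmin_r 1 (eps / (2 * M))) as E2; fold e in E1, E2.
generalize (filter_and _ _ (Hf e He') (Hg e He')); apply filter_imp; intros t [F1 G1].
replace (f t * g t - l * m)%C with ((f t - l) * (g t - m) + ((f t - l) * m + l * (g t - m)))%C by ring.
apply Rle_lt_trans with (1 := Cmod_triangle _ _).
pose proof (Cmod_triangle ((f t - l) * m) (l * (g t - m))) as Tr.
rewrite !Cmod_mult in *.
pose proof (Cmod_ge_0 (f t - l)); pose proof (Cmod_ge_0 (g t - m)).
set (x := Cmod (f t - l)) in *; set (y := Cmod (g t - m)) in *.
assert (x * y + (x * Cmod m + Cmod l * y) <= e * M).
{ assert (x * y <= e * 1) by (apply Rmult_le_compat; lra).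
  assert (x * Cmod m <= e * Cmod m) by (apply Rmult_le_compat_r; lra).
  assert (Cmod l * y <= Cmod l * e) by (apply Rmult_le_compat_l; lra).
  unfold M; lra. }
assert (e * M <= eps / 2).
{ apply Rle_trans with (eps / (2 * M) * M); [apply Rmult_le_compat_r; lra|right; field; lra]. }
lra.
Qed.

Lemma Clim_plus (T : Type) (Fil : (T -> Prop) -> Prop) {FF : Filter Fil} (f g : T -> C) (l m : C) :
  Clim T Fil f l -> Clim T Fil g m -> Clim T Fil (fun t => f t + g t)%C (l + m)%C.
Proof.
intros Hf Hg eps He.
assert (He2 : 0 < eps / 2) by lra.
generalize (filter_and _ _ (Hf (eps / 2) He2) (Hg (eps / 2) He2)); apply filter_imp; intros t [F1 G1].
replace (f t + g t - (l + m))%C with ((f t - l) + (g t - m))%C by ring.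
apply Rle_lt_trans with (1 := Cmod_triangle _ _); lra.
Qed.

Lemma Ccont_Clim F w : Ccont F w <-> Clim C (locally w) F (F w).
Proof.
split.
- intros H; apply (Clim_comp C (locally w) (fun z => z) w F); auto.
  apply Clim_filterlim; [apply _|]; apply filterlim_id.
- intros H eps He; destruct (H eps He) as [d Hd].
  exists d; split; [apply cond_pos|]; intros z Hz; apply Hd.
  pose proof (Re_le_Cmod (z - w)); pose proof (Im_le_Cmod (z - w)).
  split; [change (Rabs (Re (z - w)%C) < d)|change (Rabs (Im (z - w)%C) < d)]; lra.
Qed.

Lemma Ccont_mult F G w : Ccont F w -> Ccont G w -> Ccont (fun z => F z * G z)%C w.
Proof. rewrite !Ccont_Clim; intros HF HG; apply (Clim_mult C (locally w) F G); auto. Qed.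

Lemma Ccont_plus F G w : Ccont F w -> Ccont G w -> Ccont (fun z => F z + G z)%C w.
Proof. rewrite !Ccont_Clim; intros HF HG; apply (Clim_plus C (locally w) F G); auto. Qed.

Lemma Ccont_comp F G w : Ccont F w -> Ccont G (F w) -> Ccont (fun z => G (F z)) w.
Proof. rewrite (Ccont_Clim F); intros HF HG; apply Ccont_Clim, (Clim_comp C (locally w) F); auto. Qed.

Lemma Ccont_const c w : Ccont (fun _ => c) w.
Proof.
intros eps He; exists 1; split; [lra|]; intros z _; replace (c - c)%C with (RtoC 0) by ring; rewrite Cmod_0; auto.
Qed.

Lemma Ccont_id w : Ccont (fun z => z) w.
Proof. intros eps He; exists eps; auto. Qed.

Lemma Ccont_pair (F : C -> C) w : continuous (fun z : C => Re (F z)) w -> continuous (fun z : C => Im (F z)) w -> Ccont F w.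
Proof.
intros H1 H2; apply Ccont_Clim; intros eps He; assert (He2 : 0 < eps / 2) by lra.
assert (A1 : locally w (fun z => Rabs (Re (F z) - Re (F w)) < eps / 2)) by exact (H1 _ (locally_Rabs _ (eps / 2) He2)).
assert (A2 : locally w (fun z => Rabs (Im (F z) - Im (F w)) < eps / 2)) by exact (H2 _ (locally_Rabs _ (eps / 2) He2)).
generalize (filter_and _ _ A1 A2); apply filter_imp; intros z [B1 B2].
apply Rle_lt_trans with (1 := Cmod_parts _).
change (Re (F z - F w)%C) with (Re (F z) - Re (F w)); change (Im (F z - F w)%C) with (Im (F z) - Im (F w)); lra.
Qed.

Lemma continuous_Re (w : C) : continuous (fun z : C => Re z) w.
Proof. exact (continuous_fst (U := R_UniformSpace) (V := R_UniformSpace) (fst w) (snd w)) || (destruct w; apply continuous_fst). Qed.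

Lemma continuous_Im (w : C) : continuous (fun z : C => Im z) w.
Proof. exact (continuous_snd (U := R_UniformSpace) (V := R_UniformSpace) (fst w) (snd w)) || (destruct w; apply continuous_snd). Qed.

Lemma Ccont_Cexp w : Ccont Cexp w.
Proof.
apply Ccont_pair; [change (continuous (fun z : C => exp (Re z) * cos (Im z)) w)|change (continuous (fun z : C => exp (Re z) * sin (Im z)) w)].
- apply (continuous_mult (fun z : C => exp (Re z)) (fun z : C => cos (Im z))).
  + apply continuous_comp with (f := fun z : C => Re z) (g := exp); [apply continuous_Re|apply continuous_exp].
  + apply continuous_comp with (f := fun z : C => Im z) (g := cos); [apply continuous_Im|apply continuous_cos].
- apply (continuous_mult (fun z : C => exp (Re z)) (fun z : C => sin (Im z))).
  + apply continuous_comp with (f := fun z : C => Re z) (g := exp); [apply continuous_Re|apply continuous_exp].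
  + apply continuous_comp with (f := fun z : C => Im z) (g := sin); [apply continuous_Im|apply continuous_sin].
Qed.

Lemma continuous_Cmod (w : C) : continuous (fun z : C => Cmod z) w.
Proof.
intros P [eps HP]; assert (He := cond_pos eps); assert (He2 : 0 < eps / 2) by lra.
exists (mkposreal (eps / 2) He2); intros z [H1 H2]; apply HP.
assert (H1' : Rabs (Re (z - w)%C) < eps / 2) by exact H1.
assert (H2' : Rabs (Im (z - w)%C) < eps / 2) by exact H2.
change (Rabs (Cmod z - Cmod w) < eps); change C in z.
pose proof (Cmod_parts (z - w)).
pose proof (Cmod_triangle (z - w) w) as T1; replace (z - w + w)%C with z in T1 by ring.
pose proof (Cmod_triangle (w - z) z) as T2; replace (w - z + z)%C with w in T2 by ring.
replace (w - z)%C with (- (z - w))%C in T2 by ring; rewrite Cmod_opp in T2.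
apply Rabs_def1; lra.
Qed.

Lemma cut_plane_Cmod w : cut_plane w -> 0 < Cmod w.
Proof.
intros H; apply cut_plane_pos in H; pose proof (Cmod_ge_0 w) as [H0|H0]; auto.
pose proof (Cmod_sqr w) as E; rewrite <- H0 in *; nra.
Qed.

Lemma Ccont_Clog w : cut_plane w -> Ccont Clog w.
Proof.
intros Hc; pose proof (proj1 (cut_plane_pos w) Hc) as Hp; pose proof (cut_plane_Cmod w Hc) as Hm.
assert (Cs : continuous (fun z : C => Cmod z + Re z) w).
{ apply (continuous_plus (fun z : C => Cmod z) (fun z : C => Re z)); [apply continuous_Cmod|apply continuous_Re]. }
apply Ccont_pair; [change (continuous (fun z : C => ln (Cmod z)) w)|change (continuous (fun z : C => Carg z) w)].
- apply continuous_comp with (f := fun z : C => Cmod z) (g := ln); [apply continuous_Cmod|apply continuous_ln, Hm].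
- apply continuous_ext_loc with (fun z : C => 2 * atan (Im z * / (Cmod z + Re z))).
  + assert (A : locally w (fun z => Rabs ((Cmod z + Re z) - (Cmod w + Re w)) < Cmod w + Re w)) by exact (Cs _ (locally_Rabs _ _ Hp)).
    revert A; apply filter_imp; intros z Hz; apply Rabs_def2 in Hz; symmetry; apply Carg_atan, cut_plane_pos; lra.
  + apply (continuous_mult (fun _ : C => 2) (fun z : C => atan (Im z * / (Cmod z + Re z)))); [apply continuous_const|].
    apply continuous_comp with (f := fun z : C => Im z * / (Cmod z + Re z)) (g := atan); [|apply continuous_atan].
    apply (continuous_mult (fun z : C => Im z) (fun z : C => / (Cmod z + Re z))); [apply continuous_Im|].
    apply continuous_comp with (f := fun z : C => Cmod z + Re z) (g := Rinv); auto.
    apply continuous_Rinv; lra.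
Qed.

Lemma Ccont_Cpower a w : cut_plane w -> Ccont (fun z => Cpower z a) w.
Proof.
intros Hc; unfold Cpower.
apply (Ccont_comp (fun z => RtoC a * Clog z)%C Cexp); [|apply Ccont_Cexp].
apply (Ccont_mult (fun _ => RtoC a) Clog); [apply Ccont_const|apply Ccont_Clog, Hc].
Qed.

Lemma Ccont_Cinv (w : C) : w <> RtoC 0 -> Ccont Cinv w.
Proof.
intros Hw eps He.
assert (Hm : 0 < Cmod w) by (apply Cmod_gt_0, Hw).
assert (Hd : 0 < Rmin (Cmod w / 2) (eps * (Cmod w * Cmod w) / 4)).
{ apply Rmin_glb_lt; [lra|]; apply Rdiv_lt_0_compat; [|lra]; repeat apply Rmult_lt_0_compat; auto. }
exists (Rmin (Cmod w / 2) (eps * (Cmod w * Cmod w) / 4)); split; auto.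
intros z Hz.
pose proof (Rmin_l (Cmod w / 2) (eps * (Cmod w * Cmod w) / 4)); pose proof (Rmin_r (Cmod w / 2) (eps * (Cmod w * Cmod w) / 4)).
assert (Hz2 : Cmod w / 2 <= Cmod z).
{ pose proof (Cmod_triangle (- (z - w)) z) as T; replace (- (z - w) + z)%C with w in T by ring.
  rewrite Cmod_opp in T; lra. }
assert (Hz0 : z <> RtoC 0) by (intros E; rewrite E, Cmod_0 in Hz2; lra).
replace (/ z - / w)%C with (- (z - w) * / (z * w))%C by (field; auto).
rewrite Cmod_mult, Cmod_opp, Cmod_inv by (apply Cmult_neq_0; auto).
rewrite Cmod_mult.
apply Rmult_lt_reg_r with (Cmod z * Cmod w); [apply Rmult_lt_0_compat; lra|].
rewrite Rmult_assoc, Rinv_l, Rmult_1_r by (apply Rmult_integral_contrapositive_currified; lra).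
apply Rlt_le_trans with (eps * (Cmod w / 2 * Cmod w)); [|apply Rmult_le_compat_l; [lra|apply Rmult_le_compat_r; lra]].
assert (0 < eps * (Cmod w * Cmod w)) by (repeat apply Rmult_lt_0_compat; auto).
replace (eps * (Cmod w / 2 * Cmod w)) with (eps * (Cmod w * Cmod w) / 2) by field; lra.
Qed.

Lemma Ccont_CPS c A B w : exp_type c A B -> Ccont (CPS c) w.
Proof.
intros Hc eps He; destruct (CPS_taylor c A B w Hc) as [K [HK HT]].
set (d := CPS (PS_derive c) w) in *; pose proof (Cmod_ge_0 d).
assert (Hr : 0 < Rmin 1 (eps / (K + Cmod d + 1))) by (apply Rmin_glb_lt; [lra|apply Rdiv_lt_0_compat; lra]).
exists (Rmin 1 (eps / (K + Cmod d + 1))); split; auto; intros z Hz.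
pose proof (Rmin_l 1 (eps / (K + Cmod d + 1))); pose proof (Rmin_r 1 (eps / (K + Cmod d + 1))).
specialize (HT (z - w)%C ltac:(lra)).
replace (w + (z - w))%C with z in HT by ring.
replace (CPS c z - CPS c w)%C with ((CPS c z - CPS c w - d * (z - w)) + d * (z - w))%C by ring.
apply Rle_lt_trans with (1 := Cmod_triangle _ _); rewrite Cmod_mult.
pose proof (Cmod_ge_0 (z - w)) as Hx; set (x := Cmod (z - w)) in *.
assert (K * x ^ 2 <= K * x) by (apply Rmult_le_compat_l; nra).
apply Rle_lt_trans with ((K + Cmod d) * x); [lra|].
apply Rle_lt_trans with ((K + Cmod d) * (eps / (K + Cmod d + 1))); [apply Rmult_le_compat_l; lra|].
apply Rmult_lt_reg_r with (K + Cmod d + 1); [lra|].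
replace ((K + Cmod d) * (eps / (K + Cmod d + 1)) * (K + Cmod d + 1)) with ((K + Cmod d) * eps) by (field; lra).
nra.
Qed.

(** * Integration along paths *)

(** At the ends the derivative has one-sided limits only, possibly different from its values there.
    Both functions are extended by constants beyond [a, b], which makes them continuous everywhere;
    the extended primitive minus the integral of the extended derivative is then constant. *)
Lemma ftc_one_sided (phi psi : R -> R) a b la lb : a < b ->
  filterlim phi (at_right a) (locally (phi a)) -> filterlim phi (at_left b) (locally (phi b)) ->
  (forall t, a < t < b -> is_derive phi t (psi t)) -> (forall t, a < t < b -> continuous psi t) ->
  filterlim psi (at_right a) (locally la) -> filterlim psi (at_left b) (locally lb) ->
  is_RInt psi a b (phi b - phi a).
Proof.
intros Hab Pa Pb HD Hc La Lb.
set (ext := fun (h : R -> R) (l m t : R) => if Rle_dec t a then l else if Rle_dec b t then m else h t).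
assert (Hin : forall h l m t, a < t < b -> ext h l m t = h t).
{ intros h l m t Ht; unfold ext; destruct (Rle_dec t a); [lra|]; destruct (Rle_dec b t); [lra|auto]. }
assert (Hlo : forall h l m t, t <= a -> ext h l m t = l).
{ intros h l m t Ht; unfold ext; destruct (Rle_dec t a); [auto|lra]. }
assert (Hhi : forall h l m t, b <= t -> ext h l m t = m).
{ intros h l m t Ht; unfold ext; destruct (Rle_dec t a); [lra|]; destruct (Rle_dec b t); [auto|lra]. }
assert (Hloc : forall t, a < t < b -> locally t (fun s => a < s < b)).
{ intros t Ht; assert (Hd : 0 < Rmin (t - a) (b - t)) by (apply Rmin_glb_lt; lra).
  exists (mkposreal _ Hd); intros s Hs.
  assert (Hs' : Rabs (s - t) < Rmin (t - a) (b - t)) by exact Hs.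
  pose proof (Rmin_l (t - a) (b - t)); pose proof (Rmin_r (t - a) (b - t)); apply Rabs_def2 in Hs'; lra. }
assert (Hext : forall h l m, filterlim h (at_right a) (locally l) -> filterlim h (at_left b) (locally m) ->
  (forall t, a < t < b -> continuous h t) -> forall t, continuous (ext h l m) t).
{ intros h l m Hl Hm Hh t P HP; change (locally t (fun s => P (ext h l m s))).
  destruct (Rle_lt_dec t a) as [Ha|Ha]; [|destruct (Rle_lt_dec b t) as [Hb|Hb]].
  - rewrite Hlo in HP by auto.
    destruct (Hl P HP) as [d Hd].
    assert (Hd' : 0 < Rmin d (b - a)) by (apply Rmin_glb_lt; [apply cond_pos|lra]).
    exists (mkposreal _ Hd'); intros s Hs.
    assert (Hs' : Rabs (s - t) < Rmin d (b - a)) by exact Hs.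
    pose proof (Rmin_l d (b - a)); pose proof (Rmin_r d (b - a)); apply Rabs_def2 in Hs'.
    destruct (Rle_lt_dec s a) as [Hsa|Hsa]; [rewrite Hlo by auto; exact (locally_singleton _ _ HP)|].
    rewrite Hin by lra; apply Hd; [change (Rabs (s - a) < d); apply Rabs_def1; lra|lra].
  - rewrite Hhi in HP by auto.
    destruct (Hm P HP) as [d Hd].
    assert (Hd' : 0 < Rmin d (b - a)) by (apply Rmin_glb_lt; [apply cond_pos|lra]).
    exists (mkposreal _ Hd'); intros s Hs.
    assert (Hs' : Rabs (s - t) < Rmin d (b - a)) by exact Hs.
    pose proof (Rmin_l d (b - a)); pose proof (Rmin_r d (b - a)); apply Rabs_def2 in Hs'.
    destruct (Rle_lt_dec b s) as [Hsb|Hsb]; [rewrite Hhi by auto; exact (locally_singleton _ _ HP)|].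
    rewrite Hin by lra; apply Hd; [change (Rabs (s - b) < d); apply Rabs_def1; lra|lra].
  - rewrite Hin in HP by auto.
    generalize (filter_and _ _ (Hloc t (conj Ha Hb)) (Hh t (conj Ha Hb) P HP)); apply filter_imp.
    intros s [Hs1 Hs2]; rewrite Hin; auto. }
set (p := ext phi (phi a) (phi b)); set (q := ext psi la lb).
assert (Cp : forall t, continuous p t).
{ apply Hext; auto; intros t Ht; apply (ex_derive_continuous phi); eexists; apply HD, Ht. }
assert (Cq : forall t, continuous q t) by (apply Hext; auto).
assert (exq : forall u v, ex_RInt q u v).
{ intros u v; apply (ex_RInt_continuous (V := R_CompleteNormedModule)); intros t _; apply Cq. }
assert (D2 : forall t, is_derive (fun s => RInt q a s) t (q t)).
{ intros t; apply (is_derive_RInt (V := R_NormedModule) q (fun s => RInt q a s) a t); [|apply Cq].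
  exists (mkposreal 1 Rlt_0_1); intros s _; apply (RInt_correct (V := R_CompleteNormedModule)), exq. }
assert (E : RInt q a b = phi b - phi a).
{ destruct (MVT_gen (fun t => p t - RInt q a t) a b (fun _ => 0)) as [x [_ Ex]].
  - intros t Ht; rewrite Rmin_left, Rmax_right in Ht by lra.
    assert (D1 : is_derive p t (q t)).
    { replace (q t) with (psi t) by (symmetry; apply Hin, Ht).
      apply is_derive_ext_loc with phi; [|apply HD, Ht].
      generalize (Hloc t Ht); apply filter_imp; intros s Hs; symmetry; apply Hin, Hs. }
    evar_last; [exact (is_derive_minus (V := R_NormedModule) p (fun s => RInt q a s) t _ _ D1 (D2 t))|].
    unfold minus, plus, opp; simpl; ring.
  - intros t _; apply continuity_pt_filterlim.
    apply (continuous_minus (V := R_NormedModule) p (fun s => RInt q a s)); [apply Cp|].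
    apply (ex_derive_continuous (fun s => RInt q a s)); eexists; apply D2.
  - rewrite RInt_point in Ex; unfold zero in Ex; simpl in Ex.
    assert (Ea : p a = phi a) by (apply Hlo; lra); assert (Eb : p b = phi b) by (apply Hhi; lra); lra. }
rewrite <- E.
apply is_RInt_ext with q.
- intros t Ht; rewrite Rmin_left, Rmax_right in Ht by lra; apply Hin, Ht.
- apply (RInt_correct (V := R_CompleteNormedModule)), exq.
Qed.

Lemma filterlim_C_parts (T : Type) (Fil : (T -> Prop) -> Prop) {FF : Filter Fil} (g : T -> C) (l : C) :
  filterlim g Fil (locally l) <->
  filterlim (fun t => Re (g t)) Fil (locally (Re l)) /\ filterlim (fun t => Im (g t)) Fil (locally (Im l)).
Proof.
split.
- intros H; split.
  + apply (filterlim_comp _ _ _ g (fun z : C => Re z) _ (locally l)); [exact H|apply continuous_Re].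
  + apply (filterlim_comp _ _ _ g (fun z : C => Im z) _ (locally l)); [exact H|apply continuous_Im].
- intros [H1 H2]; apply Clim_filterlim; [exact FF|]; intros eps He; assert (He2 : 0 < eps / 2) by lra.
    assert (A1 : Fil (fun t => Rabs (Re (g t) - Re l) < eps / 2)) by exact (H1 _ (locally_Rabs _ (eps / 2) He2)).
  assert (A2 : Fil (fun t => Rabs (Im (g t) - Im l) < eps / 2)) by exact (H2 _ (locally_Rabs _ (eps / 2) He2)).
  generalize (filter_and _ _ A1 A2); apply filter_imp; intros z [B1 B2].
  apply Rle_lt_trans with (1 := Cmod_parts _).
  change (Re (g z - l)%C) with (Re (g z) - Re l); change (Im (g z - l)%C) with (Im (g z) - Im l); lra.
Qed.

Lemma ftc_one_sided_C (phi psi : R -> C) a b la lb : a < b ->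
  filterlim phi (at_right a) (locally (phi a)) -> filterlim phi (at_left b) (locally (phi b)) ->
  (forall t, a < t < b -> Cder phi t (psi t)) -> (forall t, a < t < b -> filterlim psi (locally t) (locally (psi t))) ->
  filterlim psi (at_right a) (locally la) -> filterlim psi (at_left b) (locally lb) ->
  is_RInt (V := C_R_NormedModule) psi a b (phi b - phi a)%C.
Proof.
intros Hab Pa Pb HD Hc La Lb.
apply (filterlim_C_parts R _) in Pa; apply (filterlim_C_parts R _) in Pb;
apply (filterlim_C_parts R _) in La; apply (filterlim_C_parts R _) in Lb.
assert (Hc' : forall t, a < t < b -> continuous (fun t => Re (psi t)) t /\ continuous (fun t => Im (psi t)) t).
{ intros t Ht; exact (proj1 (filterlim_C_parts R _ _ _) (Hc t Ht)). }
apply (is_RInt_fct_extend_pair (U := R_NormedModule) (V := R_NormedModule)).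
- apply (ftc_one_sided (fun t => Re (phi t)) (fun t => Re (psi t)) a b (Re la) (Re lb)); try tauto.
  + intros t Ht; apply (Cder_components phi t (psi t)), HD, Ht.
  + intros t Ht; apply Hc', Ht.
- apply (ftc_one_sided (fun t => Im (phi t)) (fun t => Im (psi t)) a b (Im la) (Im lb)); try tauto.
  + intros t Ht; apply (Cder_components phi t (psi t)), HD, Ht.
  + intros t Ht; apply Hc', Ht.
Qed.

(** Induction on the list of break points: one lying strictly inside the interval splits it, any
    other is dropped. When none is left, [ftc_one_sided_C] applies with the one-sided limits of
    g'. *)
Lemma path_FTC (F f : C -> C) z g g' T :
  (forall w, cut_plane w -> pder F w (f w)) -> (forall w, cut_plane w -> Ccont F w) ->
  (forall w, cut_plane w -> Ccont f w) -> path_to_infty z g g' -> 0 <= T ->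
  is_RInt (V := C_R_NormedModule) (fun t => f (g t) * g' t)%C 0 T (F (g T) - F z)%C.
Proof.
intros HD HF Hf [G0 [[Gr [Gc [[l Hl] [Dr Dl]]]] [Gcut _]]] HT.
rewrite <- G0.
assert (GR : forall t, 0 <= t -> filterlim g (at_right t) (locally (g t))).
{ intros t [Ht|<-]; [|exact Gr].
  apply filterlim_filter_le_1 with (2 := Gc t Ht); intros P [d Hd]; exists d; auto. }
assert (GL : forall t, 0 < t -> filterlim g (at_left t) (locally (g t))).
{ intros t Ht; apply filterlim_filter_le_1 with (2 := Gc t Ht); intros P [d Hd]; exists d; auto. }
assert (comp : forall (Fil : (R -> Prop) -> Prop) (FF : Filter Fil) H t, 0 <= t -> Ccont H (g t) ->
  filterlim g Fil (locally (g t)) -> filterlim (fun s => H (g s)) Fil (locally (H (g t)))).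
{ intros Fil FF H t Ht HH Hg; apply Clim_filterlim; [exact FF|]; apply Clim_comp; auto.
  apply Clim_filterlim; auto. }
assert (compm : forall (Fil : (R -> Prop) -> Prop) (FF : Filter Fil) t d, 0 <= t ->
  filterlim g Fil (locally (g t)) -> filterlim g' Fil (locally d) ->
  filterlim (fun s => f (g s) * g' s)%C Fil (locally (f (g t) * d)%C)).
{ intros Fil FF t d Ht Hg Hg'; apply Clim_filterlim; [exact FF|]; apply Clim_mult; auto.
  - apply Clim_filterlim; [exact FF|]; apply comp; auto.
  - apply Clim_filterlim; auto. }
assert (claim : forall k a b, 0 <= a <= b -> (forall t, a < t < b -> ~ In t k ->
  is_derive (V := C_R_NormedModule) g t (g' t) /\ continuous g' t) ->
  is_RInt (V := C_R_NormedModule) (fun t => f (g t) * g' t)%C a b (F (g b) - F (g a))%C).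
{ induction k as [|c k IH]; intros a b Hab Hk.
  - destruct (Req_dec a b) as [->|Nab].
    { replace (F (g b) - F (g b))%C with (RtoC 0) by ring.
      exact (is_RInt_point (V := C_R_NormedModule) (fun t => f (g t) * g' t)%C b). }
    destruct (Dr a ltac:(lra)) as [da Hda]; destruct (Dl b ltac:(lra)) as [db Hdb].
    apply (ftc_one_sided_C (fun t => F (g t)) (fun t => f (g t) * g' t)%C a b (f (g a) * da)%C (f (g b) * db)%C);
      [lra| | | | | |].
    + apply (comp _ _ F a); [lra|apply HF, Gcut; lra|apply GR; lra].
    + apply (comp _ _ F b); [lra|apply HF, Gcut; lra|apply GL; lra].
    + intros t Ht; destruct (Hk t Ht (fun h => h)) as [D _].
      apply (HD (g t)); [apply Gcut; lra|auto|exact D].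
    + intros t Ht; destruct (Hk t Ht (fun h => h)) as [_ D].
      apply (compm _ _ t (g' t)); [lra|apply Gc; lra|exact D].
    + apply (compm _ _ a da); [lra|apply GR; lra|auto].
    + apply (compm _ _ b db); [lra|apply GL; lra|auto].
  - destruct (Rlt_dec a c) as [Hc1|Hc]; [destruct (Rlt_dec c b) as [Hc2|Hc]|].
    + replace (F (g b) - F (g a))%C with ((F (g c) - F (g a)) + (F (g b) - F (g c)))%C by ring.
      apply (is_RInt_Chasles (V := C_R_NormedModule) (fun t => f (g t) * g' t)%C a c b).
      * apply IH; [lra|]; intros t Ht Hn; apply Hk; [lra|]; intros [E|Hi]; [lra|auto].
      * apply IH; [lra|]; intros t Ht Hn; apply Hk; [lra|]; intros [E|Hi]; [lra|auto].
    + apply IH; auto; intros t Ht Hn; apply Hk; auto; intros [E|Hi]; [lra|auto].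
    + apply IH; auto; intros t Ht Hn; apply Hk; auto; intros [E|Hi]; [lra|auto]. }
apply (claim l 0 T); [lra|].
intros t Ht Hn; apply Hl; auto; lra.
Qed.

(** * Hypergeometric form of the coefficients *)

Lemma rf_add a j k : rf a (j + k) = rf a j * rf (a + INR j) k.
Proof.
induction k as [|k IH]; [rewrite Nat.add_0_r; simpl; ring|].
rewrite Nat.add_succ_r; simpl rf; rewrite IH, plus_INR; ring.
Qed.

(** Duplication formula: two consecutive factors 2a + 2k and 2a + 2k + 1 multiply to 4 (a + k)(a +
    1/2 + k). *)
Lemma rf_double a k : rf (2 * a) (2 * k) = 4 ^ k * rf a k * rf (a + 1 / 2) k.
Proof.
induction k as [|k IH]; [simpl; ring|].
assert (E : INR (2 * k) = 2 * INR k) by (rewrite mult_INR; reflexivity).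
replace (2 * S k)%nat with (S (S (2 * k))) by lia.
revert IH E; generalize (2 * k)%nat; intros n IH E.
change (rf (2 * a) (S (S n)) = 4 ^ S k * (rf a k * (a + INR k)) * (rf (a + 1 / 2) k * (a + 1 / 2 + INR k))).
change (rf (2 * a) (S (S n))) with (rf (2 * a) n * (2 * a + INR n) * (2 * a + INR (S n))).
rewrite IH, S_INR, E; simpl pow; field.
Qed.

Lemma rf_1 k : rf 1 k = INR (fact k).
Proof.
induction k as [|k IH]; [reflexivity|]; rewrite fact_simpl, mult_INR, S_INR; simpl rf; rewrite IH; ring.
Qed.

Lemma rf_2 k : rf 2 k = INR (fact (S k)).
Proof. rewrite <- rf_1, rf_first; replace (1 + 1) with 2 by ring; ring. Qed.

(* The generalized binomial coefficient of [x] over [j]. *)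
Fixpoint gbin (x : R) (j : nat) : R :=
  match j with O => 1 | S j => gbin x j * (x - INR j) / (INR j + 1) end.

(** Both sides are multiplied by k + 1 = j + (k + 1 - j). Each summand lowers one index through (j +
    1) binom(x, j + 1) = (x - j) binom(x, j), and the two weights a - j and b - (k - j) add up to a
    + b - k. *)
Lemma gbin_vandermonde a b k : PS_mult (gbin a) (gbin b) k = gbin (a + b) k.
Proof.
induction k as [|k IH]; [unfold PS_mult; simpl; ring|].
pose proof (pos_INR k) as Hk.
apply Rmult_eq_reg_l with (INR k + 1); [|lra].
transitivity ((a + b - INR k) * gbin (a + b) k); [|simpl gbin; field; lra].
rewrite <- IH.
assert (S1 : forall x j, (INR j + 1) * gbin x (S j) = (x - INR j) * gbin x j).
{ intros x j; pose proof (pos_INR j); simpl gbin; field; lra. }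
transitivity (sum_f_R0 (fun j => INR j * gbin a j * gbin b (S k - j)) (S k)
  + sum_f_R0 (fun j => gbin a j * (INR (S k - j) * gbin b (S k - j))) (S k)).
{ unfold PS_mult; rewrite scal_sum, <- plus_sum; apply sum_eq; intros j Hj.
  rewrite minus_INR, S_INR by auto; ring. }
rewrite (decomp_sum (fun j => INR j * gbin a j * gbin b (S k - j))) by lia.
rewrite (tech5 (fun j => gbin a j * (INR (S k - j) * gbin b (S k - j)))).
rewrite Nat.sub_diag; simpl (INR 0); simpl pred.
rewrite !Rmult_0_l, Rmult_0_r, Rplus_0_l, Rplus_0_r.
unfold PS_mult; rewrite scal_sum, <- plus_sum; apply sum_eq; intros j Hj.
replace (S k - S j)%nat with (k - j)%nat by lia; replace (S k - j)%nat with (S (k - j)) by lia.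
rewrite !S_INR, !S1, minus_INR by auto; ring.
Qed.

Lemma gbin_rf x k : gbin (x + INR k) k = rf (x + 1) k / INR (fact k).
Proof.
assert (H : forall j y, gbin y j = rf (y - INR j + 1) j / INR (fact j)).
{ induction j as [|j IH]; intros y; [simpl; field|].
  simpl gbin; rewrite IH, fact_simpl, mult_INR, rf_first, S_INR; pose proof (INR_fact_neq_0 j); pose proof (pos_INR j).
  replace (y - (INR j + 1) + 1 + 1) with (y - INR j + 1) by ring; field; split; lra. }
rewrite H; do 2 f_equal; ring.
Qed.

Lemma bcoef_gbin mu j i : nonpole (mu + 1) ->
  bcoef mu i * rf (mu + 1) (i + j) = (-1) ^ i / INR (fact i) * (gbin (mu + INR (i + j)) j * INR (fact j)).
Proof.
intros H; unfold bcoef; rewrite rf_add, plus_INR, <- Rplus_assoc, gbin_rf.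
replace (mu + INR i + 1) with (mu + 1 + INR i) by ring; field.
repeat split; try apply INR_fact_neq_0; apply rf_neq0, H.
Qed.

(** Multiplying by (mu + 1)_k (la + 1)_k turns each factor of the Cauchy product into a binomial
    coefficient of mu + k or la + k over the complementary index; the factorials cancel and
    Vandermonde's identity sums the rest. *)
Lemma pcoef_closed mu la k : nonpole (mu + 1) -> nonpole (la + 1) ->
  pcoef mu la k = (-1) ^ k * rf (mu + la + INR k + 1) k / (INR (fact k) * rf (mu + 1) k * rf (la + 1) k).
Proof.
intros H1 H2.
assert (N1 := rf_neq0 _ k H1); assert (N2 := rf_neq0 _ k H2).
apply Rmult_eq_reg_r with (rf (mu + 1) k * rf (la + 1) k); [|apply Rmult_integral_contrapositive_currified; auto].
transitivity ((-1) ^ k * gbin ((la + INR k) + (mu + INR k)) k).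
2: { replace (la + INR k + (mu + INR k)) with ((mu + la + INR k) + INR k) by ring; rewrite gbin_rf; field.
     repeat split; auto; apply INR_fact_neq_0. }
rewrite <- gbin_vandermonde; unfold pcoef, PS_mult; rewrite Rmult_comm, !scal_sum; apply sum_eq; intros j Hj.
assert (E1 := bcoef_gbin mu (k - j) j H1); assert (E2 := bcoef_gbin la j (k - j) H2).
replace (j + (k - j))%nat with k in E1 by lia; replace (k - j + j)%nat with k in E2 by lia.
transitivity ((bcoef mu j * rf (mu + 1) k) * (bcoef la (k - j) * rf (la + 1) k)); [ring|].
rewrite E1, E2.
replace ((-1) ^ k) with ((-1) ^ j * (-1) ^ (k - j)) by (rewrite <- pow_add; f_equal; lia).
field; split; apply INR_fact_neq_0.
Qed.

Lemma Copp_sqr_half (z : C) : (- z ^ 2)%C = (RtoC (- 4) * (z / 2) ^ 2)%C.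
Proof. simpl; field. Qed.

Lemma RtoC_pow_mult a (w : C) k : ((RtoC a * w) ^ k)%C = (RtoC (a ^ k) * w ^ k)%C.
Proof. rewrite Cpow_mult_l, RtoC_pow; auto. Qed.

Lemma pFq_CPS a b c (z : C) :
  (forall k, Rprod (map (fun x => poch x k) a) / Rprod (map (fun x => poch x k) b) * (-4) ^ k / INR (fact k) = c k) ->
  pFq a b (- z ^ 2) = CPS c ((z / 2) ^ 2).
Proof.
intros H; rewrite Copp_sqr_half; unfold pFq, CPS, CSeries.
assert (E : forall k, (RtoC (Rprod (map (fun x => poch x k) a) / Rprod (map (fun x => poch x k) b)) *
  ((RtoC (-4) * (z / 2) ^ 2) ^ k / RtoC (INR (fact k))) = RtoC (c k) * ((z / 2) ^ 2) ^ k)%C).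
{ intros k; pose proof (INR_fact_neq_0 k); rewrite RtoC_pow_mult, <- H.
  generalize (Rprod (map (fun x => poch x k) a) / Rprod (map (fun x => poch x k) b)); intros q; unfold Rdiv.
  rewrite !RtoC_mult, RtoC_inv by auto; unfold Cdiv; ring. }
f_equal; apply Series_ext; intros k; rewrite E; auto.
Qed.

(** (2 mu + 1)_(2k) is factored in two ways, by splitting it in the middle and by duplication, while
    (mu)_k / (mu + 1)_k = mu / (mu + k) produces the denominator of [pint_coef]. *)
Lemma pint_coef_closed mu k : nonpole mu -> nonpole (mu + 1 / 2) -> nonpole (2 * mu + 1) ->
  rf mu k * rf (mu + 1 / 2) k / (rf (mu + 1) k * rf (mu + 1) k * rf (2 * mu + 1) k) * (-4) ^ k / INR (fact k)
  = 2 * mu * pint_coef mu mu k.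
Proof.
intros H0 Hh H2; assert (H1 := nonpole_succ _ H0).
unfold pint_coef; rewrite pcoef_closed by auto.
assert (D := rf_double (mu + 1 / 2) k).
replace (2 * (mu + 1 / 2)) with (2 * mu + 1) in D by field; replace (mu + 1 / 2 + 1 / 2) with (mu + 1) in D by field.
replace (2 * k)%nat with (k + k)%nat in D by lia; rewrite rf_add in D.
replace (2 * mu + 1 + INR k) with (mu + mu + INR k + 1) in D by ring.
assert (F := rf_first mu k); simpl rf in F.
replace ((-4) ^ k) with ((-1) ^ k * 4 ^ k) by (rewrite <- Rpow_mult_distr; f_equal; ring).
assert (N0 := nonpole_add mu k H0); apply nonpole_neq0 in N0.
assert (N1 := rf_neq0 _ k H1); assert (N2 := rf_neq0 _ k H2); pose proof (INR_fact_neq_0 k).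
replace (mu + mu + 2 * INR k) with (2 * (mu + INR k)) by ring.
replace (rf (mu + mu + INR k + 1) k) with (4 ^ k * rf (mu + 1 / 2) k * rf (mu + 1) k / rf (2 * mu + 1) k) by (rewrite <- D; field; auto).
replace (rf mu k) with (mu * rf (mu + 1) k / (mu + INR k)) by (rewrite <- F; field; auto).
field; repeat split; auto.
Qed.

Lemma pFq_2F3 mu (z : C) a1 a2 b1 b2 : nonpole mu -> nonpole (mu + 1 / 2) -> nonpole (2 * mu + 1) ->
  a1 = mu -> a2 = mu + 1 / 2 -> b1 = mu + 1 -> b2 = 2 * mu + 1 ->
  pFq [a1; a2] [b1; b1; b2] (- z ^ 2) = (RtoC (2 * mu) * CPS (pint_coef mu mu) ((z / 2) ^ 2))%C.
Proof.
intros H0 Hh H2 -> -> -> ->; assert (H1 := nonpole_succ _ H0).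
rewrite <- CPS_scal; apply pFq_CPS; intros k.
unfold Rprod; simpl map; simpl fold_right; rewrite !poch_rf by auto.
rewrite <- pint_coef_closed by auto; f_equal; f_equal; f_equal; ring.
Qed.

Lemma exp_type_shift c A B : exp_type c A B -> exp_type (fun k => c (S k)) (A * B) B.
Proof.
intros H; apply exp_type_le with (1 := exp_type_derive c A B H); intros k.
unfold PS_derive; rewrite Rabs_mult, (Rabs_pos_eq (INR (S k))) by apply pos_INR.
rewrite S_INR; pose proof (pos_INR k); pose proof (Rabs_pos (c (S k))); nra.
Qed.

Lemma CPS_decr_1 c A B w : exp_type c A B -> CPS c w = (RtoC (c 0%nat) + w * CPS (fun k => c (S k)) w)%C.
Proof.
intros H; destruct (CPS_ex _ _ _ w H) as [D1 D2].
destruct (CPS_ex _ _ _ w (exp_type_shift _ _ _ H)) as [K1 K2].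
rewrite !CPS_parts.
rewrite (Series_incr_1 (fun k => c k * Re (w ^ k)%C)), (Series_incr_1 (fun k => c k * Im (w ^ k)%C)) by auto.
apply injective_projections; simpl fst; simpl snd.
- rewrite Rmult_1_r; f_equal; rewrite <- !Series_scal_l, <- Series_minus by (apply (ex_series_scal (K := R_AbsRing) (V := R_NormedModule)); auto).
  apply Series_ext; intros k; rewrite ?Cpow_S; unfold Re, Im; simpl; ring.
- rewrite Rmult_0_r; f_equal; rewrite <- !Series_scal_l, <- Series_plus by (apply (ex_series_scal (K := R_AbsRing) (V := R_NormedModule)); auto).
  apply Series_ext; intros k; rewrite ?Cpow_S; unfold Re, Im; simpl; ring.
Qed.

(** The series starts at k = 1 in [kcoef]. Shifting the index gives (2 + nu)_k = (1 + nu)_(k+1) / (1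
    + nu), likewise with - nu, whence the prefactor; the half-integer parameter comes from
    duplication at 1/2. *)
Lemma pFq_3F4 nu (z : C) : nonint nu -> (z ^ 2 / RtoC (4 * (1 - nu ^ 2)) *
  pFq [1; 1; 3 / 2]%R [2; 2; 2 - nu; 2 + nu]%R (- z ^ 2) = - CPS (kcoef nu nu) ((z / 2) ^ 2))%C.
Proof.
intros H.
assert (P1 : nonpole (nu + 1)) by apply (nonint_nonpole nu 1 H).
assert (P2 : nonpole (- nu + 1)) by apply (nonint_nonpole (- nu) 1 (nonint_opp _ H)).
assert (P3 := nonpole_succ _ P1); assert (P4 := nonpole_succ _ P2).
assert (E1 : 1 + nu <> 0) by (apply nonpole_neq0 in P1; lra).
assert (E2 : 1 - nu <> 0) by (apply nonpole_neq0 in P2; lra).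
assert (En : 1 - nu ^ 2 <> 0) by (replace (1 - nu ^ 2) with ((1 + nu) * (1 - nu)) by ring; apply Rmult_integral_contrapositive_currified; auto).
rewrite (pFq_CPS _ _ (fun k => - (1 - nu ^ 2) * kcoef nu nu (S k))).
2: { intros k; unfold Rprod; simpl map; simpl fold_right.
  assert (P5 : nonpole (2 + nu)) by (replace (2 + nu) with (nu + 1 + 1) by ring; auto).
  assert (P6 : nonpole (2 - nu)) by (replace (2 - nu) with (- nu + 1 + 1) by ring; auto).
  rewrite !poch_rf by first [assumption | apply nonpole_pos; lra].
  unfold kcoef; rewrite pcoef_closed by auto.
  replace (2 + nu) with (nu + 1 + 1) by ring; replace (2 - nu) with (- nu + 1 + 1) by ring.
  rewrite (rf_first (nu + 1)), (rf_first (- nu + 1)), rf_1, rf_2.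
  replace (nu + - nu + INR (S k) + 1) with (1 + INR (S k)) by ring.
  assert (D := rf_double (1 / 2) (S k)); replace (2 * (1 / 2)) with 1 in D by field.
  replace (1 / 2 + 1 / 2) with 1 in D by field; replace (2 * S k)%nat with (S k + S k)%nat in D by lia.
  rewrite rf_add, (rf_first (1 / 2)), rf_1 in D; replace (1 / 2 + 1) with (3 / 2) in D by field.
  pose proof (INR_fact_neq_0 k); pose proof (INR_fact_neq_0 (S k)).
  assert (D' : rf (1 + INR (S k)) (S k) = 4 ^ S k * (1 / 2 * rf (3 / 2) k)).
  { apply Rmult_eq_reg_l with (INR (fact (S k))); auto; rewrite D; ring. }
  rewrite D', fact_simpl, mult_INR, S_INR; pose proof (pos_INR k).
  assert (rf (nu + 1 + 1) k <> 0) by (apply rf_neq0; auto).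
  assert (rf (- nu + 1 + 1) k <> 0) by (apply rf_neq0; auto).
  replace ((-4) ^ k) with ((-1) ^ k * 4 ^ k) by (rewrite <- Rpow_mult_distr; f_equal; ring).
  simpl pow; field; repeat split; auto; lra. }
rewrite CPS_scal.
destruct (kcoef_unif nu P1 P2) as [A HA]; apply locally_singleton in HA.
rewrite (CPS_decr_1 (kcoef nu nu) A 2) by auto; simpl (kcoef nu nu 0).
rewrite RtoC_opp, !RtoC_mult.
assert (RtoC (1 - nu ^ 2) <> RtoC 0) by (intros E; apply RtoC_inj in E; auto).
assert (RtoC 4 <> RtoC 0) by (intros E; apply RtoC_inj in E; lra).
replace (RtoC 4) with (RtoC 2 * RtoC 2)%C in * by (rewrite <- RtoC_mult; f_equal; ring).
simpl Cpow; field; repeat split; auto; intros E; apply RtoC_inj in E; lra.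
Qed.

(** When 2 nu is not an integer this is [pFq_2F3]. When nu is a half-integer the left side is a
    limit: at nearby mu the formula holds, and its right side is continuous at nu because the
    denominators of [pint_coef] vanish only at integers. *)
Lemma pFq_ext_2F3 nu (z : C) : 0 < nu -> nonint nu ->
  pFq_ext (fun mu => [- mu; 1 / 2 - mu]%R) (fun mu => [1 - mu; 1 - mu; 1 - 2 * mu]%R) nu (- z ^ 2)
  = (RtoC (- 2 * nu) * CPS (pint_coef (- nu) (- nu)) ((z / 2) ^ 2))%C.
Proof.
intros Hnu H; assert (Hn := nonint_opp _ H).
assert (rl : forall f x (l : R), is_lim f x l -> real (Lim f x) = l)
  by (intros f x l Hl; rewrite (is_lim_unique f x l Hl); reflexivity).
assert (F : forall mu, nonint (2 * mu) -> pFq [- mu; 1 / 2 - mu]%R [1 - mu; 1 - mu; 1 - 2 * mu]%R (- z ^ 2)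
  = (RtoC (- 2 * mu) * CPS (pint_coef (- mu) (- mu)) ((z / 2) ^ 2))%C).
{ intros mu Hmu; rewrite (pFq_2F3 (- mu)); [do 2 f_equal; ring| | | |ring|ring|ring|ring].
  - intros n E; apply (Hmu (2 * Z.of_nat n)%Z); rewrite mult_IZR, <- INR_IZR_INZ; lra.
  - intros n E; apply (Hmu (2 * Z.of_nat n + 1)%Z); rewrite plus_IZR, mult_IZR, <- INR_IZR_INZ; lra.
  - intros n E; apply (Hmu (Z.of_nat n + 1)%Z); rewrite plus_IZR, <- INR_IZR_INZ; lra. }
unfold pFq_ext; destruct (excluded_middle_informative _) as [Hp|Hp].
(* The parameter 1 - nu cannot be a pole, nu not being an integer, so that 1 - 2 nu is. *)
- assert (Hhalf : exists n : nat, 2 * nu = INR n + 1).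
  { destruct Hp as [c [Hc [n Ec]]]; simpl in Hc; destruct Hc as [<-|[<-|[<-|[]]]].
    - exfalso; apply (H (1 + Z.of_nat n)%Z); rewrite plus_IZR, <- INR_IZR_INZ; lra.
    - exfalso; apply (H (1 + Z.of_nat n)%Z); rewrite plus_IZR, <- INR_IZR_INZ; lra.
    - exists n; lra. }
  destruct Hhalf as [n En].
  assert (Hnear : forall mu, Rabs (mu - nu) < 1 / 2 -> mu <> nu -> nonint (2 * mu)).
  { intros mu Hmu Hne m E; apply Rabs_def2 in Hmu.
    assert (A1 : INR n < IZR m) by lra; assert (A2 : IZR m < INR n + 2) by lra.
    rewrite INR_IZR_INZ in A1, A2, En; rewrite <- plus_IZR in A2.
    apply lt_IZR in A1; apply lt_IZR in A2; assert (m = (Z.of_nat n + 1)%Z) by lia; subst m.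
    rewrite plus_IZR in E; apply Hne; lra. }
  destruct (pint_coef_unif (fun mu => - mu) (fun mu => - mu) nu (- nu) Hn) as [A [HA HAc]]; auto.
  1,2: apply (ex_derive_continuous (fun mu => - mu)); auto_derive; auto.
  set (w := ((z / 2) ^ 2)%C) in *.
  assert (L : forall x : nat -> R, (forall k, Rabs (x k) <= Cmod w ^ k) ->
    is_lim (fun mu => - 2 * mu * Series (fun k => pint_coef (- mu) (- mu) k * x k)) nu
      (- 2 * nu * Series (fun k => pint_coef (- nu) (- nu) k * x k))).
  { intros x Hx; apply (is_lim_continuity (fun mu => - 2 * mu * Series (fun k => pint_coef (- mu) (- mu) k * x k))), continuity_pt_filterlim.
    apply (continuous_mult (fun mu => - 2 * mu) (fun mu => Series (fun k => pint_coef (- mu) (- mu) k * x k))).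
    - apply (ex_derive_continuous (fun mu => - 2 * mu)); auto_derive; auto.
    - apply (Series_continuous_param (fun mu => pint_coef (- mu) (- mu)) nu A 2 x (Cmod w)); auto; apply Cmod_ge_0. }
  rewrite CPS_parts; apply injective_projections.
  + transitivity (- 2 * nu * Series (fun k => pint_coef (- nu) (- nu) k * Re (w ^ k)%C)); [|symmetry; exact (Re_RtoC_mult _ _)].
    simpl fst.
    apply rl; eapply is_lim_ext_loc; [|apply (L _ (Re_pow_le w))].
    exists (mkposreal (1 / 2) ltac:(lra)).
    change (forall mu : R, Rabs (mu - nu) < 1 / 2 -> mu <> nu ->
      - 2 * mu * Series (fun k => pint_coef (- mu) (- mu) k * Re (w ^ k)%C) =
      Re (pFq [- mu; 1 / 2 - mu]%R [1 - mu; 1 - mu; 1 - 2 * mu]%R (- z ^ 2))).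
    intros mu Hmu Hne; rewrite F by auto; rewrite Re_RtoC_mult, CPS_parts; reflexivity.
  + transitivity (- 2 * nu * Series (fun k => pint_coef (- nu) (- nu) k * Im (w ^ k)%C)); [|symmetry; exact (Im_RtoC_mult _ _)].
    simpl snd.
    apply rl; eapply is_lim_ext_loc; [|apply (L _ (Im_pow_le w))].
    exists (mkposreal (1 / 2) ltac:(lra)).
    change (forall mu : R, Rabs (mu - nu) < 1 / 2 -> mu <> nu ->
      - 2 * mu * Series (fun k => pint_coef (- mu) (- mu) k * Im (w ^ k)%C) =
      Im (pFq [- mu; 1 / 2 - mu]%R [1 - mu; 1 - mu; 1 - 2 * mu]%R (- z ^ 2))).
    intros mu Hmu Hne; rewrite F by auto; rewrite Im_RtoC_mult, CPS_parts; reflexivity.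
- apply F; intros m E.
  destruct (Z_le_gt_dec m 0) as [Hm|Hm]; [apply IZR_le in Hm; lra|].
  apply Hp; exists (1 - 2 * nu); split; [simpl; auto|]; exists (Z.to_nat (m - 1)).
  rewrite INR_IZR_INZ, Z2Nat.id by lia; rewrite minus_IZR; lra.
Qed.

(** * The primitive and its value at infinity *)

Definition Jc (mu : R) (z : C) : C := (Cpower (z / 2) mu * CPS (bcoef mu) ((z / 2) ^ 2))%C.

Lemma BesselJ_Jc mu z : nonpole (mu + 1) -> BesselJ mu z = (RtoC (/ Gamma (mu + 1)) * Jc mu z)%C.
Proof.
intros H; unfold BesselJ, Jc.
assert (E : CSeries (fun k => (RtoC ((-1) ^ k / (INR (fact k) * Gamma (mu + INR k + 1))) * (z / 2) ^ (2 * k))%C)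
  = CPS (fun k => / Gamma (mu + 1) * bcoef mu k) ((z / 2) ^ 2)).
{ unfold CPS, CSeries.
  assert (E : forall k, (RtoC ((-1) ^ k / (INR (fact k) * Gamma (mu + INR k + 1))) * (z / 2) ^ (2 * k) =
    RtoC (/ Gamma (mu + 1) * bcoef mu k) * ((z / 2) ^ 2) ^ k)%C).
  { intros k; rewrite Cpow_mult_r; f_equal; f_equal; unfold bcoef.
    replace (mu + INR k + 1) with (mu + 1 + INR k) by ring; rewrite Gamma_add by auto; field.
    repeat split; first [apply INR_fact_neq_0 | apply rf_neq0, H | apply Gamma_neq0, H]. }
  f_equal; apply Series_ext; intros k; rewrite E; auto. }
rewrite E, CPS_scal; ring.
Qed.

Lemma cut_plane_neq0 z : cut_plane z -> z <> RtoC 0.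
Proof. intros H E; apply H; rewrite E; simpl; lra. Qed.

Lemma half_parts (z : C) : Re (z / 2)%C = Re z / 2 /\ Im (z / 2)%C = Im z / 2.
Proof. destruct z as [x y]; unfold Re, Im, Cdiv, Cinv, RtoC; simpl; split; field. Qed.

Lemma cut_plane_half z : cut_plane z -> cut_plane (z / 2).
Proof. intros H [E1 E2]; destruct (half_parts z) as [P1 P2]; apply H; lra. Qed.

Lemma pder_half z : pder (fun z => z / 2)%C z (/ 2)%C.
Proof.
apply pder_ext with (fun z => / 2 * z)%C; [intros w; unfold Cdiv; ring|].
apply pder_eq with (/ 2 * 1)%C; [apply pder_scal, pder_id|ring].
Qed.

Lemma pder_CPS_half c A B z : exp_type c A B -> z <> RtoC 0 ->
  pder (fun z => CPS c ((z / 2) ^ 2)%C) z (CPS (fun k => (2 * INR k * c k)%R) ((z / 2) ^ 2) / z)%C.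
Proof.
intros Hc Hz.
apply pder_eq with (CPS (PS_derive c) ((z / 2) ^ 2) * (z / 2))%C.
- apply (pder_comp (fun z => (z / 2) ^ 2)%C (CPS c)); [|apply (pder_CPS c A B), Hc].
  apply pder_ext with (fun z => (z / 2) * (z / 2))%C; [intros w; simpl; ring|].
  apply pder_eq with (/ 2 * (z / 2) + (z / 2) * / 2)%C; [apply (pder_mult (fun z => z / 2)%C (fun z => z / 2)%C); apply pder_half|field; intros E; apply RtoC_inj in E; lra].
- rewrite (CPS_ext (fun k => 2 * INR k * c k) (fun k => 2 * (INR k * c k))) by (intros k; ring).
  rewrite CPS_scal, <- (CPS_mulk c A B) by auto; simpl; field; repeat split; auto; intros E; apply RtoC_inj in E; lra.
Qed.

Lemma pder_Cpower_CPS c A B a z : exp_type c A B -> cut_plane z ->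
  pder (fun z => Cpower (z / 2) a * CPS c ((z / 2) ^ 2))%C z
    (Cpower (z / 2) a * CPS (fun k => ((a + 2 * INR k) * c k)%R) ((z / 2) ^ 2) / z)%C.
Proof.
intros Hc Hz; assert (Hz0 := cut_plane_neq0 z Hz).
assert (H2 := exp_type_scal _ 2 _ _ (exp_type_mulk c A B Hc)).
eapply pder_eq.
- apply (pder_mult (fun z => Cpower (z / 2) a) (fun z => CPS c ((z / 2) ^ 2)%C)).
  + apply (pder_comp (fun z => z / 2)%C (fun z => Cpower z a)); [apply pder_half|apply pder_Cpower, cut_plane_half, Hz].
  + apply (pder_CPS_half c A B); auto.
- rewrite (CPS_ext (fun k => (a + 2 * INR k) * c k) (fun k => a * c k + 2 * (INR k * c k))) by (intros k; ring).
  rewrite (CPS_plus _ _ _ _ _ _ _ (exp_type_scal c a A B Hc) H2), CPS_scal.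
  rewrite (CPS_ext (fun k => 2 * INR k * c k) (fun k => 2 * (INR k * c k))) by (intros k; ring).
  field; auto.
Qed.

(* A primitive of [(a1 * Jc nu z ^ 2 + a2 * Jc (- nu) z ^ 2 + a3 * Jc nu z * Jc (- nu) z) / z]. *)
Definition Jprim (nu a1 a2 a3 a4 : R) (z : C) : C :=
  (RtoC a1 * (Cpower (z / 2) (2 * nu) * CPS (pint_coef nu nu) ((z / 2) ^ 2))
   + RtoC a2 * (Cpower (z / 2) (- 2 * nu) * CPS (pint_coef (- nu) (- nu)) ((z / 2) ^ 2))
   + RtoC a3 * (CPS (kcoef nu nu) ((z / 2) ^ 2) + Clog (z / 2)) + RtoC a4)%C.

Lemma pint_coef_exp_type al : nonint al -> exists A, exp_type (pint_coef al al) A 2.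
Proof.
intros H; destruct (pint_coef_unif (fun mu => mu) (fun mu => mu) al al H (continuous_id al) (continuous_id al) eq_refl eq_refl) as [A [HA _]].
exists A; exact (locally_singleton _ _ HA).
Qed.

Lemma kcoef_exp_type nu : nonint nu -> exists A, exp_type (kcoef nu nu) A 2.
Proof.
intros H; destruct (kcoef_unif nu (nonint_nonpole nu 1 H) (nonint_nonpole (- nu) 1 (nonint_opp _ H))) as [A HA].
exists A; exact (locally_singleton _ _ HA).
Qed.

Lemma CPS_pcoef mu la w : nonpole (mu + 1) -> nonpole (la + 1) ->
  CPS (pcoef mu la) w = (CPS (bcoef mu) w * CPS (bcoef la) w)%C.
Proof.
intros H1 H2; destruct (bcoef_exp_type mu H1) as [M HM]; destruct (bcoef_exp_type la H2) as [N HN].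
apply (CPS_mult _ _ M 1 N 1); auto.
Qed.

Lemma nonint_double_neq al k : nonint al -> al + al + 2 * INR k <> 0.
Proof. intros H E; apply (H (- Z.of_nat k)%Z); rewrite opp_IZR, <- INR_IZR_INZ; lra. Qed.

(** Differentiation multiplies each coefficient by the denominator introduced in [pint_coef] or
    [kcoef], which restores the product series; the derivative of the logarithm supplies the
    constant coefficient 1 that [kcoef] leaves out. *)
Lemma pder_Jprim nu a1 a2 a3 a4 z : nonint nu -> cut_plane z -> pder (Jprim nu a1 a2 a3 a4) z
  ((RtoC a1 * (Jc nu z * Jc nu z) + RtoC a2 * (Jc (- nu) z * Jc (- nu) z) + RtoC a3 * (Jc nu z * Jc (- nu) z)) / z)%C.
Proof.
intros H Hz; assert (Hz0 := cut_plane_neq0 z Hz); assert (Hn := nonint_opp _ H).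
assert (P1 := nonint_nonpole nu 1 H); assert (P2 := nonint_nonpole (- nu) 1 Hn).
destruct (pint_coef_exp_type nu H) as [A HA]; destruct (pint_coef_exp_type (- nu) Hn) as [B HB].
destruct (kcoef_exp_type nu H) as [K HK].
assert (D1 := pder_Cpower_CPS _ _ _ (2 * nu) z HA Hz); assert (D2 := pder_Cpower_CPS _ _ _ (- 2 * nu) z HB Hz).
assert (D3 := pder_CPS_half _ _ _ z HK Hz0).
assert (D4 := pder_comp (fun z => z / 2)%C Clog z _ _ (pder_half z) (pder_Clog _ (cut_plane_half _ Hz))).
eapply pder_eq.
- unfold Jprim; apply pder_plus; [apply pder_plus; [apply pder_plus|]|apply pder_const]; apply pder_scal.
  + exact D1.
  + exact D2.
  + apply pder_plus; [exact D3|exact D4].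
- set (w := ((z / 2) ^ 2)%C).
  assert (E1 : CPS (fun k => ((2 * nu + 2 * INR k) * pint_coef nu nu k)%R) w = (CPS (bcoef nu) w * CPS (bcoef nu) w)%C).
  { rewrite <- CPS_pcoef by auto; apply CPS_ext; intros k; unfold pint_coef.
    pose proof (nonint_double_neq nu k H); field; auto. }
  assert (E2 : CPS (fun k => ((- 2 * nu + 2 * INR k) * pint_coef (- nu) (- nu) k)%R) w = (CPS (bcoef (- nu)) w * CPS (bcoef (- nu)) w)%C).
  { rewrite <- CPS_pcoef by auto; apply CPS_ext; intros k; unfold pint_coef.
    pose proof (nonint_double_neq (- nu) k Hn); field; auto. }
  assert (E3 : (CPS (fun k => (2 * INR k * kcoef nu nu k)%R) w + 1 = CPS (bcoef nu) w * CPS (bcoef (- nu)) w)%C).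
  { rewrite <- CPS_pcoef by auto.
    destruct (bcoef_exp_type nu P1) as [M HM]; destruct (bcoef_exp_type (- nu) P2) as [N HN].
    rewrite (CPS_decr_1 _ _ _ w (exp_type_pcoef _ _ _ _ _ _ HM HN)), pcoef_0.
    rewrite (CPS_ext (fun k => 2 * INR k * kcoef nu nu k) (fun k => 2 * (INR k * kcoef nu nu k))) by (intros k; ring).
    rewrite (CPS_decr_1 _ _ _ w (exp_type_scal _ 2 _ _ (exp_type_mulk _ _ _ HK))); simpl (INR 0).
    rewrite Rmult_0_l, Rmult_0_r, Cplus_0_l, Cplus_comm; f_equal; f_equal; apply CPS_ext; intros k.
    unfold kcoef; pose proof (pos_INR k); rewrite S_INR; field; lra. }
  rewrite E1, E2; unfold Jc; fold w.
  assert (Q1 : Cpower (z / 2) (2 * nu) = (Cpower (z / 2) nu * Cpower (z / 2) nu)%C) by (rewrite Cpower_plus; f_equal; ring).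
  assert (Q2 : Cpower (z / 2) (- 2 * nu) = (Cpower (z / 2) (- nu) * Cpower (z / 2) (- nu))%C) by (rewrite Cpower_plus; f_equal; ring).
  assert (Q3 : (Cpower (z / 2) nu * Cpower (z / 2) (- nu) = 1)%C) by (rewrite Cpower_plus, Rplus_opp_r; apply Cpower_0).
  rewrite Q1, Q2.
  transitivity ((RtoC a1 * (Cpower (z / 2) nu * Cpower (z / 2) nu * (CPS (bcoef nu) w * CPS (bcoef nu) w)) +
    RtoC a2 * (Cpower (z / 2) (- nu) * Cpower (z / 2) (- nu) * (CPS (bcoef (- nu)) w * CPS (bcoef (- nu)) w)) +
    RtoC a3 * (CPS (fun k => (2 * INR k * kcoef nu nu k)%R) w + 1)) / z)%C; [field; auto|].
  rewrite E3, <- (Cmult_1_l (CPS (bcoef nu) w * CPS (bcoef (- nu)) w)), <- Q3; field; auto.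
Qed.

Lemma Ccont_ext F G w : (forall z, F z = G z) -> Ccont F w -> Ccont G w.
Proof. intros E H eps He; destruct (H eps He) as [d [Hd HF]]; exists d; split; auto; intros z Hz; rewrite <- !E; auto. Qed.

Lemma Ccont_half w : Ccont (fun z => z / 2)%C w.
Proof. apply (Ccont_mult (fun z => z) (fun _ => / 2)%C); [apply Ccont_id|apply Ccont_const]. Qed.

Lemma Ccont_CPS_half c A B w : exp_type c A B -> Ccont (fun z => CPS c ((z / 2) ^ 2)%C) w.
Proof.
intros H; apply (Ccont_comp (fun z => (z / 2) ^ 2)%C (CPS c)); [|apply (Ccont_CPS c A B), H].
apply Ccont_ext with (fun z => (z / 2) * (z / 2))%C; [intros z; simpl; ring|].
apply Ccont_mult; apply Ccont_half.
Qed.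

Lemma Ccont_Cpower_CPS c A B a w : exp_type c A B -> cut_plane w ->
  Ccont (fun z => Cpower (z / 2) a * CPS c ((z / 2) ^ 2))%C w.
Proof.
intros H Hw; apply Ccont_mult; [|apply (Ccont_CPS_half c A B), H].
apply (Ccont_comp (fun z => z / 2)%C (fun z => Cpower z a)); [apply Ccont_half|apply Ccont_Cpower, cut_plane_half, Hw].
Qed.

Lemma Ccont_Jc mu w : nonpole (mu + 1) -> cut_plane w -> Ccont (Jc mu) w.
Proof.
intros H Hw; destruct (bcoef_exp_type mu H) as [M HM]; apply (Ccont_Cpower_CPS (bcoef mu) M 1); auto.
Qed.

Lemma Ccont_Jprim nu a1 a2 a3 a4 w : nonint nu -> cut_plane w -> Ccont (Jprim nu a1 a2 a3 a4) w.
Proof.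
intros H Hw; assert (Hn := nonint_opp _ H).
destruct (pint_coef_exp_type nu H) as [A HA]; destruct (pint_coef_exp_type (- nu) Hn) as [B HB].
destruct (kcoef_exp_type nu H) as [K HK].
unfold Jprim; repeat apply Ccont_plus; try apply Ccont_const; apply Ccont_mult; try apply Ccont_const.
- apply (Ccont_Cpower_CPS _ _ _ _ _ HA Hw).
- apply (Ccont_Cpower_CPS _ _ _ _ _ HB Hw).
- apply Ccont_plus; [apply (Ccont_CPS_half _ _ _ _ HK)|].
  apply (Ccont_comp (fun z => z / 2)%C Clog); [apply Ccont_half|apply Ccont_Clog, cut_plane_half, Hw].
Qed.

Lemma Clog_RtoC x : 0 < x -> Clog (RtoC x) = RtoC (ln x).
Proof.
intros Hx; unfold Clog, Carg; rewrite Cmod_R, Rabs_pos_eq by lra; unfold RtoC; simpl.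
destruct (Rle_dec 0 0) as [_|F]; [|exfalso; lra].
replace (x / x) with 1 by (field; lra); rewrite acos_1; auto.
Qed.

Lemma Cpower_RtoC x a : 0 < x -> Cpower (RtoC x) a = RtoC (Rpower x a).
Proof.
intros Hx; unfold Cpower; rewrite Clog_RtoC, <- RtoC_mult by auto; unfold Cexp, Rpower, RtoC; simpl.
rewrite cos_0, sin_0; f_equal; ring.
Qed.

Lemma Jprim_RtoC nu a1 a2 a3 a4 x : 0 < x ->
  Jprim nu a1 a2 a3 a4 (RtoC x) = RtoC (a1 * Gf nu nu x + a2 * Gf (- nu) (- nu) x + a3 * Kf nu x + a4).
Proof.
intros Hx; unfold Jprim, Gf, Kf.
replace (RtoC x / 2)%C with (RtoC (x / 2)) by (rewrite RtoC_div; auto; lra).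
rewrite !Cpower_RtoC, Clog_RtoC, <- RtoC_pow, !CPS_RtoC by lra.
replace ((x / 2) ^ 2) with (x ^ 2 / 4) by field.
replace (nu + nu) with (2 * nu) by ring; replace (- nu + - nu) with (- 2 * nu) by ring.
rewrite !RtoC_plus, !RtoC_mult, !RtoC_plus; ring.
Qed.

Lemma Clog_inv u : cut_plane u -> Clog (/ u)%C = (- Clog u)%C.
Proof.
intros H; assert (H0 := cut_plane_neq0 u H); assert (Hm := cut_plane_Cmod u H).
assert (Hp := proj1 (cut_plane_pos u) H); assert (Q := Cmod_sqr u).
assert (R1 : Re (/ u)%C = Re u / Cmod u ^ 2) by (rewrite Q; destruct u; reflexivity).
assert (R2 : Im (/ u)%C = - Im u / Cmod u ^ 2) by (rewrite Q; destruct u; reflexivity).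
assert (Ms : Cmod (/ u)%C = / Cmod u) by (rewrite Cmod_inv; auto).
assert (E : Cmod (/ u)%C + Re (/ u)%C = (Cmod u + Re u) / Cmod u ^ 2) by (rewrite Ms, R1; field; lra).
assert (Hi : cut_plane (/ u)%C).
{ apply cut_plane_pos; rewrite E; apply Rdiv_lt_0_compat; [lra|apply pow_lt; auto]. }
unfold Clog; apply injective_projections; simpl fst; simpl snd.
- rewrite Ms, ln_Rinv; auto.
- rewrite !Carg_atan, E, R2 by auto.
  replace (- Im u / Cmod u ^ 2 / ((Cmod u + Re u) / Cmod u ^ 2)) with (- (Im u / (Cmod u + Re u))) by (field; lra).
  rewrite atan_opp; ring.
Qed.

(** On the negative real axis [Carg] takes the value PI exactly. *)
Lemma Carg_cut_plane z : z <> RtoC 0 -> Rabs (Carg z) < PI -> cut_plane z.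
Proof.
intros Hz Ha [E1 E2]; destruct z as [x y]; simpl in E1, E2; subst y; fold (RtoC x) in *.
assert (Hx : x < 0) by (destruct E2 as [E2| -> ]; [auto|exfalso; auto]).
revert Ha; unfold Carg; rewrite Cmod_R, (Rabs_left x) by auto; unfold RtoC; simpl.
destruct (Rle_dec 0 0) as [_|F]; [|exfalso; lra].
replace (x / - x) with (- (1)) by (field; lra); rewrite acos_opp, acos_1.
pose proof PI_RGT_0; rewrite Rabs_pos_eq; lra.
Qed.

(** The path is eventually on the positive real axis, so that a limit along real x is enough; the
    constant a4 serves to make that limit 0. *)
Lemma Jprim_path nu a1 a2 a3 a4 z :
  nonint nu -> is_lim (fun x => a1 * Gf nu nu x + a2 * Gf (- nu) (- nu) x + a3 * Kf nu x + a4) p_infty 0 ->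
  is_CInt_to_infty (fun t => (RtoC a1 * (Jc nu t * Jc nu t) + RtoC a2 * (Jc (- nu) t * Jc (- nu) t)
    + RtoC a3 * (Jc nu t * Jc (- nu) t)) / t)%C z (- Jprim nu a1 a2 a3 a4 z)%C.
Proof.
intros H L g g' Hg.
assert (P1 := nonint_nonpole nu 1 H); assert (P2 := nonint_nonpole (- nu) 1 (nonint_opp _ H)).
set (F := Jprim nu a1 a2 a3 a4); set (f := fun t => ((RtoC a1 * (Jc nu t * Jc nu t) + RtoC a2 * (Jc (- nu) t * Jc (- nu) t)
    + RtoC a3 * (Jc nu t * Jc (- nu) t)) / t)%C).
assert (HT : forall T, 0 <= T -> is_RInt (V := C_R_NormedModule) (fun t => f (g t) * g' t)%C 0 T (F (g T) - F z)%C).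
{ intros T HT; apply (path_FTC F f z g g' T); auto.
  - intros w Hw; apply pder_Jprim; auto.
  - intros w Hw; apply Ccont_Jprim; auto.
  - intros w Hw; unfold f, Cdiv; apply Ccont_mult; [|apply Ccont_Cinv, cut_plane_neq0, Hw].
    repeat apply Ccont_plus; (apply Ccont_mult; [apply Ccont_const|apply Ccont_mult; apply Ccont_Jc; auto]). }
assert (LF : filterlim (fun T => F (g T) - F z)%C (Rbar_locally p_infty) (locally (- F z)%C)).
{ destruct Hg as [_ [_ [_ [[T0 HT0] HR]]]].
  apply Clim_filterlim; [apply _|]; intros eps He.
  set (h := fun x => a1 * Gf nu nu x + a2 * Gf (- nu) (- nu) x + a3 * Kf nu x + a4) in *.
  assert (A : Rbar_locally p_infty (fun T => Rabs (h (Re (g T)) - 0) < eps)) by exact (HR _ (L _ (locally_Rabs 0 eps He))).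
  assert (A' : Rbar_locally p_infty (fun T => T0 <= T)) by (exists T0; intros; lra).
  generalize (filter_and _ _ A A'); apply filter_imp; intros T [B1 B2].
  destruct (HT0 T B2) as [I0 R0].
  assert (Eg : g T = RtoC (Re (g T))) by (destruct (g T) as [u v]; simpl in *; subst v; reflexivity).
  replace (F (g T) - F z - - F z)%C with (F (g T)) by ring.
  rewrite Eg; unfold F; rewrite Jprim_RtoC, Cmod_R by auto.
  rewrite Rminus_0_r in B1; exact B1. }
intros P HP.
apply Filter_prod with (fun a => a = 0) (fun T => 0 <= T /\ P (F (g T) - F z)%C).
- reflexivity.
- apply (filter_and (F := Rbar_locally p_infty)); [exists 0; intros; lra|exact (LF P HP)].
- intros a T -> [HT1 HT2]; exists (F (g T) - F z)%C; split; [apply HT, HT1|exact HT2].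
Qed.

Theorem theorem2 (z : C) (nu : R)
  (hz : z <> RtoC 0) (harg : Rabs (Carg z) < PI)
  (hnu : 0 < nu) (hnuZ : forall n : Z, nu <> IZR n) :
  is_CInt_to_infty (fun t => ((BesselY nu t) ^ 2 / t)%C) z
    (RtoC (1 / (2 * PI ^ 2 * nu)) *
       (Cpower (z / 2) (- 2 * nu) * RtoC (Gamma nu ^ 2) *
          pFq_ext (fun mu => [- mu; 1 / 2 - mu]%R)
                  (fun mu => [1 - mu; 1 - mu; 1 - 2 * mu]%R) nu (- z ^ 2)
        - Cpower (z / 2) (2 * nu) *
          RtoC (Gamma (- nu) ^ 2 * cos (PI * nu) ^ 2) *
          pFq [nu; nu + 1 / 2]%R [nu + 1; nu + 1; 2 * nu + 1]%R (- z ^ 2))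
     - RtoC ((1 + 2 * cot (PI * nu) ^ 2) / (2 * nu))
     - RtoC (2 * cot (PI * nu) / (PI * nu)) *
       (z ^ 2 / RtoC (4 * (1 - nu ^ 2)) *
          pFq [1; 1; 3 / 2]%R [2; 2; 2 - nu; 2 + nu]%R (- z ^ 2)
        + Clog (2 / z)
        + RtoC (1 / (2 * nu))
        + RtoC (digamma nu)))%C.
Proof.
assert (Hc := Carg_cut_plane z hz harg).
assert (H : nonint nu) by exact hnuZ; assert (Hn := nonint_opp _ H).
assert (P1 := nonint_nonpole nu 1 H); assert (P2 := nonint_nonpole (- nu) 1 Hn).
assert (P0 := nonint_nonpole (- nu) 0 Hn); rewrite Rplus_0_r in P0.
assert (Hs := sin_nonint nu H); assert (HR := Gamma_reflection nu H).
assert (G1 := Gamma_neq0 _ P1); assert (G2 := Gamma_neq0 _ P2).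
pose proof PI_RGT_0 as HPI.
rewrite pFq_ext_2F3, pFq_3F4 by auto.
rewrite (pFq_2F3 nu) by first [apply nonpole_pos; lra | ring].
replace (2 / z)%C with (/ (z / 2))%C by (field; repeat split; first [exact hz | intros E; apply RtoC_inj in E; lra]).
rewrite Clog_inv by (apply cut_plane_half; auto).
set (s := sin (PI * nu)) in *; set (co := cos (PI * nu)).
set (gp := Gamma (nu + 1)) in *; set (gm := Gamma (- nu + 1)) in *.
(* The reflection formula expresses [Gamma] at nu and - nu through gp and gm, the two values that
   normalize the Bessel functions. *)
assert (Ep : Gamma (- nu) = - PI / (s * gp)).
{ assert (E : gm = - nu * Gamma (- nu)) by (apply Gamma_succ, P0).
  apply Rmult_eq_reg_l with (nu * (s * gp)); [|repeat apply Rmult_integral_contrapositive_currified; auto; lra].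
  transitivity (- (gp * gm * s)); [rewrite E; ring|rewrite HR; field; auto]. }
assert (Em : Gamma nu = PI / (s * gm)).
{ assert (E : gp = nu * Gamma nu) by (apply Gamma_succ, nonpole_pos; auto).
  apply Rmult_eq_reg_l with (nu * (s * gm)); [|repeat apply Rmult_integral_contrapositive_currified; auto; lra].
  transitivity (gp * gm * s); [rewrite E; ring|rewrite HR; field; auto]. }
assert (Egm : gm = PI * nu / (gp * s)) by (rewrite <- HR; field; auto).
(* a1, a2 and a3 come from expanding Y_nu^2 with J_nu = [Jc nu] / gp and J_(-nu) = [Jc (- nu)] / gm.
   a4 is minus the limit at infinity of the rest of the primitive. *)
set (a1 := co ^ 2 / (s ^ 2 * gp ^ 2)); set (a2 := 1 / (s ^ 2 * gm ^ 2)); set (a3 := - 2 * co / (s ^ 2 * gp * gm)).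
set (a4 := (1 + 2 * cot (PI * nu) ^ 2) / (2 * nu) + 2 * cot (PI * nu) / (PI * nu) * (1 / (2 * nu) + digamma nu)).
assert (L : is_lim (fun x => a1 * Gf nu nu x + a2 * Gf (- nu) (- nu) x + a3 * Kf nu x + a4) p_infty 0).
{ assert (L1 := Gf_diag_lim nu H); assert (L2 := Gf_diag_lim (- nu) Hn); assert (L3 := Kf_lim nu hnu H).
  fold gp in L1; fold gm in L2.
  evar_last.
  - apply is_lim_plus_R; [apply is_lim_plus_R; [apply is_lim_plus_R|]|apply (is_lim_const a4)];
    (apply is_lim_mult_R; [apply is_lim_const|eassumption]).
  (* The limits of the squares contribute cot^2 - 1 / sin^2 over 2 nu. Writing the numerator 1 as
     sin^2 + cos^2 makes the vanishing of the total a rational identity. *)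
  - assert (Ea2 : a2 = (s ^ 2 + co ^ 2) / (s ^ 2 * gm ^ 2)).
    { unfold a2; f_equal; rewrite <- (sin2_cos2 (PI * nu)); unfold Rsqr, s, co; ring. }
    f_equal; rewrite Ea2; unfold a1, a3, a4, cot; fold s; fold co; rewrite Egm; field; repeat split; auto; lra. }
assert (Hi : forall t, (BesselY nu t ^ 2 / t)%C = ((RtoC a1 * (Jc nu t * Jc nu t) + RtoC a2 * (Jc (- nu) t * Jc (- nu) t)
    + RtoC a3 * (Jc nu t * Jc (- nu) t)) / t)%C).
{ intros t; unfold BesselY; rewrite !BesselJ_Jc by auto; fold s; fold co; fold gp; fold gm.
  assert (E1 : a1 = co * / s * / gp * (co * / s * / gp)) by (unfold a1; field; auto).
  assert (E2 : a2 = / s * / gm * (/ s * / gm)) by (unfold a2; field; auto).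
  assert (E3 : a3 = - (2) * (co * / s * / gp) * (/ s * / gm)) by (unfold a3; field; auto).
  rewrite E1, E2, E3, !RtoC_mult, RtoC_opp; unfold Cdiv; rewrite <- (RtoC_inv s) by auto.
  simpl Cpow; ring. }
set (c1 := (1 + 2 * cot (PI * nu) ^ 2) / (2 * nu)); set (c2 := 2 * cot (PI * nu) / (PI * nu)).
assert (e1 : 1 / (2 * PI ^ 2 * nu) * Gamma nu ^ 2 * (- 2 * nu) = - a2).
{ rewrite Em; unfold a2; field; repeat split; auto; lra. }
assert (e2 : 1 / (2 * PI ^ 2 * nu) * (Gamma (- nu) ^ 2 * co ^ 2) * (2 * nu) = a1).
{ rewrite Ep; unfold a1; field; repeat split; auto; lra. }
assert (e3 : c2 = - a3) by (unfold c2, a3, cot; fold s; fold co; rewrite Egm; field; repeat split; auto; lra).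
assert (E : (RtoC (1 / (2 * PI ^ 2 * nu)) *
    (Cpower (z / 2) (- 2 * nu) * RtoC (Gamma nu ^ 2) * (RtoC (- 2 * nu) * CPS (pint_coef (- nu) (- nu)) ((z / 2) ^ 2))
     - Cpower (z / 2) (2 * nu) * RtoC (Gamma (- nu) ^ 2 * co ^ 2) * (RtoC (2 * nu) * CPS (pint_coef nu nu) ((z / 2) ^ 2)))
    - RtoC c1 - RtoC c2 * (- CPS (kcoef nu nu) ((z / 2) ^ 2) + - Clog (z / 2) + RtoC (1 / (2 * nu)) + RtoC (digamma nu))
    = - Jprim nu a1 a2 a3 a4 z)%C).
{ transitivity (RtoC (1 / (2 * PI ^ 2 * nu) * Gamma nu ^ 2 * (- 2 * nu)) * (Cpower (z / 2) (- 2 * nu) * CPS (pint_coef (- nu) (- nu)) ((z / 2) ^ 2))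
    - RtoC (1 / (2 * PI ^ 2 * nu) * (Gamma (- nu) ^ 2 * co ^ 2) * (2 * nu)) * (Cpower (z / 2) (2 * nu) * CPS (pint_coef nu nu) ((z / 2) ^ 2))
    - RtoC c1 - RtoC c2 * (- CPS (kcoef nu nu) ((z / 2) ^ 2) + - Clog (z / 2) + RtoC (1 / (2 * nu)) + RtoC (digamma nu)))%C;
    [rewrite !RtoC_mult; ring|].
  assert (E4 : a4 = c1 + c2 * (1 / (2 * nu) + digamma nu)) by reflexivity.
  rewrite e1, e2, e3 in *; unfold Jprim; rewrite E4, !RtoC_plus, !RtoC_mult, !RtoC_opp, RtoC_plus; ring. }
rewrite E; intros g g' Hg.
refine (is_RInt_gen_ext _ _ _ _ (Jprim_path nu a1 a2 a3 a4 z H L g g' Hg)).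
apply filter_forall; intros ab t _; rewrite Hi; reflexivity.
Qed.
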